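(* Let $K$ be a totally real number field, $G$ an extension of $K$ of degree $2$, $T$ a totally real cyclic extension of $\mathbb{Q}$ of odd prime degree $p$ with $p$ not dividing the degree over $\mathbb{Q}$ of the Galois closure of $K$ over $\mathbb{Q}$, $E=KT$, and $\mathcal{X}_G$ a set of primes of $G$ such that all but finitely many primes of $\mathcal{X}_G$ do not split in $GE/G$. Then there exists a set of $G$-primes $\mathcal{N}_G$ such that $\mathcal{X}_G\subseteq\mathcal{N}_G$, $\mathcal{N}_G\setminus\mathcal{X}_G$ is finite, and $O_{G,\mathcal{N}_G}\cap\mathbb{Q}$ has a Diophantine definition over $O_{G,\mathcal{N}_G}$.
   Context: All fields are subfields of a fixed algebraic closure of $\mathbb{Q}$ in $\mathbb{C}$. For a number field $F$ and a set $\mathcal{W}$ of non-archimedean primes of $F$, $O_{F,\mathcal{W}}=\{x\in F:\ \mathrm{ord}_{\mathfrak p}x\ge 0 \text{ for all primes }\mathfrak p\notin\mathcal{W}\}$. A prime does not split in an extension if exactly one prime lies above it. A subset $A$ of a ring $R$ has a Diophantine definition over $R$ if there is a polynomial $f(t,x_1,\dots,x_n)$ with coefficients in $R$ such that for all $t\in R$: $t\in A$ iff $\exists x_1,\dots,x_n\in R$ with $f(t,x_1,\dots,x_n)=0$. *)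

(* Defs.v *)
(* All fields are subfields of algC (the algebraic closure of
   Q inside C), represented as predicates algC -> Prop. *)
From HB Require Import structures.
From mathcomp Require Import all_boot all_order all_algebra all_field.
From mathcomp Require Import mpoly.
From Stdlib Require List.
Set Implicit Arguments. Unset Strict Implicit. Unset Printing Implicit Defensive.
Import Order.TTheory GRing.Theory Num.Theory.
Local Open Scope ring_scope.

Definition subsetA := algC -> Prop.

Definition is_subfield (F : subsetA) : Prop :=
  [/\ F 0, F 1,
      (forall x y, F x -> F y -> F (x - y)),
      (forall x y, F x -> F y -> F (x * y)) &
      (forall x, F x -> F (x^-1))].

Definition dimOver (K L : subsetA) (n : nat) : Prop :=
  exists b : 'I_n -> algC,
    [/\ (forall i, L (b i)),
        (forall c : 'I_n -> algC, (forall i, K (c i)) ->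
            \sum_i c i * b i = 0 -> forall i, c i = 0) &
        (forall x, L x -> exists c : 'I_n -> algC,
            (forall i, K (c i)) /\ x = \sum_i c i * b i)].

Definition QQ : subsetA := fun x => x \in Crat.

Definition number_field (F : subsetA) : Prop :=
  is_subfield F /\ exists n, dimOver QQ F n.

Definition genfield (S : subsetA) : subsetA :=
  fun x => forall F, is_subfield F -> (forall y, S y -> F y) -> F x.

Definition compositum (K L : subsetA) : subsetA := genfield (fun x => K x \/ L x).

(* field embeddings of subfields of algC into C = restrictions of ring
   morphisms algC -> algC *)
Definition totally_real (F : subsetA) : Prop :=
  forall (s : {rmorphism algC -> algC}) x, F x -> s x \is Num.real.

Definition galois_closure (K : subsetA) : subsetA :=
  genfield (fun x => exists (s : {rmorphism algC -> algC}) y, K y /\ x = s y).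

Definition cyclic_over_Q (T : subsetA) : Prop :=
  (forall (s : {rmorphism algC -> algC}) x, T x -> T (s x)) /\
  exists s0 : {rmorphism algC -> algC},
    forall s : {rmorphism algC -> algC}, exists k : nat,
      forall x, T x -> s x = iter k s0 x.

Definition ring_of_integers (F : subsetA) : subsetA :=
  fun x => F x /\ x \in Aint.

(* non-archimedean primes of F = nonzero prime ideals of O_F *)
Definition prime_of (F : subsetA) (P : subsetA) : Prop :=
  let O := ring_of_integers F in
  [/\ (forall x, P x -> O x),
      P 0,
      (forall x y, P x -> P y -> P (x + y)) &
      (forall a x, O a -> P x -> P (a * x))] /\
  [/\ ~ P 1,
      (exists x, P x /\ x <> 0) &
      (forall a b, O a -> O b -> P (a * b) -> P a \/ P b)].

(* ord_P x >= 0, for x in F: x lies in the local ring (O_F)_P *)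
Definition ord_nonneg (F P : subsetA) (x : algC) : Prop :=
  exists a b, [/\ ring_of_integers F a, ring_of_integers F b, ~ P b & x = a / b].

Definition OFW (F : subsetA) (W : subsetA -> Prop) : subsetA :=
  fun x => F x /\ forall P, prime_of F P -> ~ W P -> ord_nonneg F P x.

Definition lies_above (F : subsetA) (Q P : subsetA) : Prop :=
  forall x, F x -> (Q x <-> P x).

Definition not_split (F L : subsetA) (P : subsetA) : Prop :=
  exists Q, [/\ prime_of L Q, lies_above F Q P &
    forall Q', prime_of L Q' -> lies_above F Q' P -> forall x, Q' x <-> Q x].

Definition finite_diff (N X : subsetA -> Prop) : Prop :=
  exists s : seq subsetA, forall P, N P -> ~ X P -> List.In P s.

Definition diophantine_over (R A : subsetA) : Prop :=
  exists (n : nat) (f : {mpoly algC[n.+1]}),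
    (forall m, R (f@_m)) /\
    forall t, R t ->
      (A t <-> exists x : 'I_n -> algC, (forall i, R (x i)) /\
         f.@[fun i : 'I_n.+1 => if unlift ord0 i is Some j then x j else t] = 0).

(* Main.v *)
Require Import Defs.
From HB Require Import structures.
From mathcomp Require Import all_boot all_order all_algebra all_field.
From mathcomp Require Import mpoly.
From Stdlib Require List.
From mathcomp Require boolp.
From mathcomp Require Import zify ring lra.
Set Implicit Arguments. Unset Strict Implicit. Unset Printing Implicit Defensive.
Import Order.TTheory GRing.Theory Num.Theory.
Local Open Scope ring_scope.

(** Let [N] consist of [X_G] and of the primes dividing a suitable integer [b], and [R = O_(G,N)]; [Q] is reached from [G] by a chain of descents, each passing from a set [A0], existentially definable over [R], lying between the natural numbers and a field, to such a set [A1] between the natural numbers and the subfield fixed by an automorphism [sig] of prime order of some field [L].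

    One descent uses a quadratic extension [L(sqrt eps)], with [eps] fixed by [sig], whose signs make complex conjugation act as [c : sqrt eps -> - sqrt eps] or as [sig], and whose squareness is prescribed at the primes above [b].  Let [th] generate (a part of) the Galois group of [LT(sqrt eps)] over [L(sqrt eps)].  If [x * c x = 1] and the norm of [x] along [th] is [1], then [sig x / x] is an algebraic integer with all conjugates of absolute value [1]: primes outside [b] either do not split in [T] (so [th] fixes them, and [x] is a unit there) or do not occur in denominators, and at the primes above [b] one of [th], [c], [sig] fixes the prime.  By Kronecker a fixed power of [x] is fixed by [sig].  For such powers [X1], [X2] the equation [X2 - 1 = (X1 - 1) (t + (X1 - 1) r)] gives [t = sig t] modulo [X1 - 1], and making [X1 - 1] divisible by a product of values [f (t + mu i) ^ 2] of the minimal polynomial of a generator of [T] forces an algebraic integer proportional to [t - sig t] to have all conjugates small, hence [t = sig t].  Conversely [X2 = X1 ^ t] realises every natural number [t] as soon as a non-torsion [x] exists; it is built from a prime [q] which splits suitably in [LT].  In place of Chebotarev, [q] comes from a count: an irreducible integer polynomial has, on average over primes, one root mod [q]. *)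

(** * Automorphisms of the algebraic numbers and number fields *)

(** Elements of [R] have denominators at the infinitely many primes of [X_G], and non-splitting in
    [T] is the only control over them. It acts twice. An automorphism [th] moving [T] fixes such a
    prime, so an element of norm 1 along [th] is a unit there. And, outside [b], [f] has no root
    modulo such a prime in the residue field of [L], so [f (t + mu i)] is a unit where [t] is
    integral and has a larger denominator than [t] elsewhere: dividing by it clears the denominators
    of [t].

    The exponent in [f (t + mu i) ^ 2] is due to [sig]: [X1 - 1] is fixed, so it is divisible by the
    values at [t] and at [sig t], but only its square by the product of both. The shifts [mu i]
    serve the primes above [b] and the archimedean places, where a value of [f] may be too divisible
    or too small; each such condition spoils at most one shift. That [X1 - 1] is not 0 is expressed
    by a multiple of the form [(1 - l1 s1) (1 - l2 s2)], with [l1] and [l2] not invertible in [R];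
    with two primes every nonzero integer has such a multiple. As [p] is odd, the square of [th]
    fixes [sqrt eps] and still moves [T]. *)

Notation aut := {rmorphism algC -> algC}.
Lemma exists_fun (X Y : Type) (P : X -> Y -> Prop) :
  (forall x, exists y, P x y) -> exists f, forall x, P x (f x).
Proof. by move=> /boolp.choice[f]; exists f. Qed.

Notation pQtoC := (map_poly (ratr : rat -> algC)).
Notation pZtoC := (map_poly (intr : int -> algC)).

Definition autV (u : aut) : aut := algC_invaut u.
Definition autM (u v : aut) : aut := u \o v.
Lemma autVK (u : aut) x : autV u (u x) = x. Proof. exact: algC_autK. Qed.
Lemma autKV (u : aut) x : u (autV u x) = x. Proof. exact: algC_invautK. Qed.
Lemma autME (u v : aut) x : autM u v x = u (v x). Proof. by []. Qed.

Definition conjs (a : algC) : seq algC :=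
  undup (sval (closed_field_poly_normal (minCpoly a))).
Definition deg (a : algC) := size (conjs a).

Lemma mem_conjs a b : (b \in conjs a) = root (minCpoly a) b.
Proof.
rewrite /conjs mem_undup; case: closed_field_poly_normal => /= r ->.
by rewrite (monicP (minCpoly_monic a)) scale1r root_prod_XsubC.
Qed.

(** The minimal polynomial [r] of [b] divides that of [a]; the cofactor is too small to vanish at
    [a], so [r] does. *)
Lemma minCpoly_root_eq a b : root (minCpoly a) b -> minCpoly b = minCpoly a.
Proof.
have [q [Dq mq] min_q] := minCpolyP a; have [r [Dr mr] min_r] := minCpolyP b.
rewrite Dq min_r => rq.
have [c Dc] : exists c, q = c * r by apply/dvdpP.
suff rc : root (pQtoC r) a.
  by rewrite Dr; congr (pQtoC _); apply/eqP; rewrite -eqp_monic // /eqp rq -min_q rc.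
have: root (pQtoC q) a by rewrite -Dq root_minCpoly.
rewrite Dc rmorphM rootM /= => /orP[ca|//].
have: (q %| c) by rewrite -min_q.
have c0 : c != 0 by apply: contra_neq (monic_neq0 mq) => c0; rewrite Dc c0 mul0r.
have r0 := monic_neq0 mr.
move/(dvdp_leq c0); rewrite Dc size_mul // => sr.
have r1: (1 < size r)%N.
  by have := size_minCpoly b; rewrite Dr size_map_poly.
move: c0 sr r1; rewrite -size_poly_gt0; case: (size c) => // n _.
by case: (size r) => [|[|m]] //; rewrite addSn addnS /= -addSn; move: (n.+1) => n'; lia.
Qed.

(** Separability: a common root of [q2] and its derivative would again have [q2] as minimal
    polynomial, which exceeds the derivative in degree. Hence [undup] removes nothing. *)
Lemma minCpoly_conjs a : minCpoly a = \prod_(z <- conjs a) ('X - z%:P).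
Proof.
rewrite /conjs; case: closed_field_poly_normal => /= r Dr.
have ur : uniq r.
  have [q2 [Dq2 mq2] min2] := minCpolyP a.
  have sepq : separable_poly q2.
    rewrite unlock; apply/negPn/negP => nc.
    have q0 := monic_neq0 mq2.
    have [g0 g1] : gcdp q2 q2^`() != 0 /\ (1 < size (gcdp q2 q2^`()))%N.
      have g0 : gcdp q2 q2^`() != 0 by rewrite gcdp_eq0 negb_and q0.
      split=> //; move: nc; rewrite /coprimep.
      by have := g0; rewrite -size_poly_gt0; case: size => [|[|]].
    have /closed_rootP [z] : size (pQtoC (gcdp q2 q2^`())) != 1%N.
      by rewrite size_map_poly neq_ltn g1 orbT.
    rewrite gcdp_map root_gcd -Dq2 => /andP[rz rz'].
    have [q3 [Dq3 mq3] min3] := minCpolyP z.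
    have e3 : q3 = q2.
      by apply: (map_poly_inj (ratr : {rmorphism rat -> algC})); rewrite -Dq3 -Dq2; apply: minCpoly_root_eq.
    move: rz'; rewrite min3 e3 => /dvdp_leq.
    have dq0 : q2^`() != 0.
      have sq : (1 < size q2)%N by rewrite -(size_map_poly (ratr : {rmorphism rat -> algC})) -Dq2 size_minCpoly.
      apply/eqP => /(congr1 (fun p : {poly rat} => p`_(size q2).-2)) /eqP.
      have sq2 : ((size q2).-2.+1 = (size q2).-1)%N by case: (size q2) sq => [|[|]].
      rewrite coef_deriv coef0 sq2 -lead_coefE (monicP mq2) pnatr_eq0.
      by case: (size q2) sq => [|[|]].
    by move=> /(_ dq0) h; have := leq_trans (lt_size_deriv q0) h; rewrite ltnn.
  have : separable_poly (minCpoly a) by rewrite Dq2 separable_map.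
  rewrite Dr (monicP (minCpoly_monic a)) scale1r.
  by rewrite separable_prod_XsubC.
by rewrite undup_id // {1}Dr (monicP (minCpoly_monic a)) scale1r.
Qed.

(** The number field generated by all conjugates of [a] is a splitting field, so the embedding
    sending [a] to [b] extends to it, and from there to [algC]. *)
Lemma conj_aut a b : root (minCpoly a) b -> exists u : aut, u a = b.
Proof.
pose s := conjs a => rb.
have [Qs [QsC [s1 Ds1 genQs]]] := num_field_exists s.
have /mapP[a1 a1s Da1] : a \in map QsC s1 by rewrite Ds1 mem_conjs root_minCpoly.
have /mapP[b1 b1s Db1] : b \in map QsC s1 by rewrite Ds1 mem_conjs.
pose p1 := minPoly 1 a1.
have Dp1 (x : Qs) : exists q1, map_poly QsC (minPoly 1 x) = pQtoC q1.
  have aP i: (minPoly 1 x)`_i \in 1%VS.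
    by apply/polyOverP; apply: minPolyOver.
  have{aP} a_ i := sig_eqW (vlineP _ _ (aP i)).
  exists (\poly_(i < size (minPoly 1 x)) sval (a_ i)).
  apply/polyP=> i; rewrite !coef_map coef_poly /=; case: ifP => [_|/negbT].
    by case: (a_ i) => c /= ->; rewrite alg_num_field fmorph_rat.
  by rewrite -leqNgt => h; rewrite nth_default // !rmorph0.
have mina: map_poly QsC p1 = minCpoly a.
  have [q1 Dq1] := Dp1 a1.
  have [q2 [Dq2 mq2] min2] := minCpolyP a.
  have ra : root (pQtoC q1) a by rewrite -Dq1 Da1 fmorph_root root_minPoly.
  rewrite Dq1 Dq2; congr (pQtoC _); apply/eqP; rewrite -eqp_monic //; last first.
    by rewrite -(map_monic (ratr : rat -> algC)) -Dq1 map_monic monic_minPoly.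
  rewrite /eqp -min2 ra andbT.
  pose q3 : {poly Qs} := map_poly (fun c : rat => c%:A) q2.
  have q3C : map_poly QsC q3 = pQtoC q2.
    apply/polyP => i; rewrite !coef_map coef_poly /=; case: ifP => [_|/negbT].
      by rewrite alg_num_field fmorph_rat.
    by rewrite -leqNgt => h; rewrite (nth_default _ h) !rmorph0.
  have: p1 %| q3.
    apply: minPoly_dvdp.
      by apply/polyOverP => i; rewrite coef_poly; case: ifP => _; rewrite ?rpred0 // rpredZ // mem1v.
    by rewrite -(fmorph_root QsC) q3C -Da1 -Dq2 root_minCpoly.
  by rewrite -(dvdp_map QsC) q3C Dq1 dvdp_map.
have homQn1: kHom 1 1 (\1%VF : 'End(Qs)) by rewrite kHom1.
have idp (p : {poly Qs}) : map_poly \1%VF p = p.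
  by apply/polyP => i; rewrite coef_map /= id_lfunE.
have rb1: root (map_poly \1%VF (minPoly 1 a1)) b1.
  by rewrite idp -(fmorph_root QsC) -Db1 -/p1 mina.
pose f1 := kHomExtend 1 \1 a1 b1.
have hom1 : kHom 1 <<1; a1>> f1 by exact: (kHomExtendP (sub1v _) homQn1 rb1).
have f1a : f1 a1 = b1 by exact: (kHomExtend_val homQn1 rb1).
have splits : splittingFieldFor <<1; a1>> (\prod_(z <- s1) ('X - z%:P)) {:Qs}.
  exists s1; first exact: eqpxx.
  apply/vspaceP => x; rewrite memvf; apply: subvP x (memvf x).
  rewrite -genQs; apply: adjoin_seqSl; exact: sub1v.
have overp : \prod_(z <- s1) ('X - z%:P) \is a polyOver 1%VS.
  have Dm : map_poly QsC (\prod_(z <- s1) ('X - z%:P)) = \prod_(z <- s) ('X - z%:P).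
    rewrite rmorph_prod -Ds1 big_map; apply: eq_bigr => z _; exact: map_polyXsubC.
  suff -> : \prod_(z <- s1) ('X - z%:P) = p1 by apply: minPolyOver.
  by apply: (map_poly_inj QsC); rewrite Dm mina minCpoly_conjs.
have [g homg gE] := kHom_extends (sub1v _) hom1 overp splits.
have gm : monoid_morphism g by apply/kHom_monoid_morphism.
pose gM := GRing.isMonoidMorphism.Build _ _ g gm.
pose gRM : {rmorphism _ -> _} := HB.pack (fun_of_lfun g) gM.
have [nu Dnu] := extend_algC_subfield_aut QsC gRM.
exists nu; rewrite Da1 -Dnu /= -gE ?memv_adjoin // f1a.
by rewrite Db1.
Qed.

Lemma aut_conjs (u : aut) a : u a \in conjs a.
Proof. by rewrite mem_conjs -(minCpoly_aut u) root_minCpoly. Qed.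

Lemma conjs_uniq a : uniq (conjs a). Proof. exact: undup_uniq. Qed.

Lemma fixQ y : (forall u : aut, u y = y) -> y \in Crat.
Proof.
move=> fy; have [q [Dq mq] _] := minCpolyP y.
have ry z : z \in conjs y -> z = y.
  by rewrite mem_conjs => /conj_aut[u <-]; apply: fy.
have Dr : conjs y = [:: y].
  have yr : y \in conjs y by rewrite mem_conjs root_minCpoly.
  have := conjs_uniq y; case: (conjs y) ry yr => [//|z [|z' r]] ry _.
    by rewrite (ry z) // mem_head.
  by rewrite /= (ry z) ?mem_head // (ry z') ?inE ?eqxx ?orbT.
have : (minCpoly y)`_0 \in Crat by rewrite Dq coef_map Crat_rat.
by rewrite minCpoly_conjs Dr big_seq1 coefB coefX coefC /= sub0r rpredN.
Qed.

(** [fld a] is the field [Q(a)], described as the fixed field of the automorphisms fixing [a]. *)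
Definition fld (a x : algC) : Prop := forall u : aut, u a = a -> u x = x.

Lemma fldE a x (u v : aut) : fld a x -> u a = v a -> u x = v x.
Proof.
move=> ax uv; have := ax (autM (autV v) u); rewrite !autME uv autVK => /(_ erefl) e.
by rewrite -{2}e autKV.
Qed.

Lemma auts_enum a : exists s : 'I_(deg a) -> aut, forall i : 'I_(deg a), s i a = (conjs a)`_i.
Proof.
have /exists_fun[s sE] : forall i : 'I_(deg a), exists u : aut, u a = (conjs a)`_i.
  by move=> i; apply: conj_aut; rewrite -mem_conjs mem_nth.
by exists s.
Qed.

(** Inverting the Vandermonde matrix of the conjugates of [a] expresses the coordinates of [x] in
    the power basis through the conjugates of [x]. The matrix [W] depends on [a] alone, which makes
    later bounds on denominators and sizes uniform in [x]. *)
Lemma fld_coord a : exists (s : 'I_(deg a) -> aut) (W : 'M[algC]_(deg a)),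
  [/\ injective (fun i => s i a), (forall u : aut, exists i, u a = s i a) &
   forall x, fld a x ->
     (forall j, \sum_i s i x * W i j \in Crat) /\
     forall u : aut, u x = \sum_j (\sum_i s i x * W i j) * u a ^+ j].
Proof.
have [s sE] := auts_enum a.
have sinj : injective (fun i => s i a).
  move=> i j; rewrite !sE => /eqP; rewrite nth_uniq ?conjs_uniq ?ltn_ord // => /eqP.
  exact: val_inj.
have ssurj (u : aut) : exists i, u a = s i a.
  have h : (index (u a) (conjs a) < deg a)%N by rewrite index_mem aut_conjs.
  by exists (Ordinal h); rewrite sE nth_index ?aut_conjs.
pose V : 'M[algC]_(deg a) := Vandermonde (deg a) (\row_i s i a).
have Vu : V \in unitmx.
  rewrite unitmxE unitfE det_Vandermonde; apply/prodf_neq0 => i _.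
  apply/prodf_neq0 => j ij; rewrite !mxE subr_eq0; apply/eqP => /sinj e.
  by rewrite e ltnn in ij.
exists s, (invmx V); split=> // x ax.
pose r : 'rV[algC]_(deg a) := (\row_i s i x) *m invmx V.
have rE j : r 0 j = \sum_i s i x * invmx V i j.
  by rewrite !mxE; apply: eq_bigr => i _; rewrite mxE.
have rV : r *m V = \row_i s i x by rewrite mulmxKV.
have rs (u : aut) : u x = \sum_j r 0 j * u a ^+ j.
  have [i ui] := ssurj u; rewrite (fldE ax ui) ui.
  have := congr1 (fun M : 'rV_(deg a) => M 0 i) rV; rewrite !mxE => <-.
  by apply: eq_bigr => j _; congr (_ * _); rewrite !mxE.
split=> [j|u]; last first.
  by rewrite rs; apply: eq_bigr => j _; rewrite rE.
rewrite -rE; apply: fixQ => u.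
suff e : map_mx u r = r.
  by have := congr1 (fun M : 'rV_(deg a) => M 0 j) e; rewrite mxE.
rewrite -[LHS](mulmxK Vu) -[RHS](mulmxK Vu); congr (_ *m _).
rewrite rV; apply/rowP => i; rewrite !mxE.
have := rs (autM (autV u) (s i)); rewrite !autME => /(congr1 u).
rewrite autKV rmorph_sum => ->; apply: eq_bigr => k _.
by rewrite !mxE rmorphM rmorphXn /= autKV.
Qed.

Section FldClosure.
Variable a : algC.
Lemma fld_id : fld a a. Proof. by move=> u. Qed.
Lemma fldD x y : fld a x -> fld a y -> fld a (x + y).
Proof. by move=> fx fy u ua; rewrite rmorphD fx // fy. Qed.
Lemma fldN x : fld a x -> fld a (- x).
Proof. by move=> fx u ua; rewrite rmorphN fx. Qed.
Lemma fldB x y : fld a x -> fld a y -> fld a (x - y).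
Proof. by move=> fx fy u ua; rewrite rmorphB fx // fy. Qed.
Lemma fldM x y : fld a x -> fld a y -> fld a (x * y).
Proof. by move=> fx fy u ua; rewrite rmorphM fx // fy. Qed.
Lemma fldV x : fld a x -> fld a x^-1.
Proof. by move=> fx u ua; rewrite fmorphV fx. Qed.
Lemma fldX x n : fld a x -> fld a (x ^+ n).
Proof. by move=> fx u ua; rewrite rmorphXn /= fx. Qed.
Lemma fld_rat x : x \in Crat -> fld a x.
Proof. by move=> cx u _; apply: aut_Crat. Qed.
Lemma fld_nat n : fld a n%:R.
Proof. by move=> u _; rewrite rmorph_nat. Qed.
Lemma fld_int n : fld a n%:~R.
Proof. by move=> u _; rewrite rmorph_int. Qed.
Lemma fld0 : fld a 0. Proof. exact: fld_nat 0. Qed.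
Lemma fld1 : fld a 1. Proof. exact: fld_nat 1. Qed.
Lemma fld_sum (I : Type) (r : seq I) (P : pred I) (F : I -> algC) :
  (forall i, P i -> fld a (F i)) -> fld a (\sum_(i <- r | P i) F i).
Proof. by move=> h u ua; rewrite rmorph_sum; apply: eq_bigr => i /h; apply. Qed.
Lemma fld_prod (I : Type) (r : seq I) (P : pred I) (F : I -> algC) :
  (forall i, P i -> fld a (F i)) -> fld a (\prod_(i <- r | P i) F i).
Proof. by move=> h u ua; rewrite rmorph_prod; apply: eq_bigr => i /h; apply. Qed.
End FldClosure.

Lemma fld_trans a b x : fld a b -> fld b x -> fld a x.
Proof. by move=> ab bx u ua; apply/bx/ab. Qed.

Lemma fld_aut (u : aut) a x : fld a x -> fld (u a) (u x).
Proof. by move=> ax v vu; apply: (fldE (u := autM v u) ax). Qed.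

Lemma is_subfield_fld a : is_subfield (fld a).
Proof.
split; [exact: fld0 | exact: fld1 | exact: fldB | exact: fldM | exact: fldV].
Qed.

(** The primitive element is a combination with natural coefficients, so it inherits every property
    closed under addition: the second clause serves for integrality, equality of automorphisms and
    membership in subfields. *)
Lemma primitive_element (s : seq algC) : exists z, (forall x, x \in s -> fld z x) /\
  forall F : algC -> Prop, F 0 -> (forall x y, F x -> F y -> F (x + y)) ->
    (forall x, x \in s -> F x) -> F z.
Proof.
have [z [c Dz] [ps Ds]] := algC_PET s; exists z; split.
  move=> x; rewrite Ds => /mapP[p _ ->] u uz.
  by rewrite -horner_map uz -map_poly_comp (eq_map_poly (fmorph_rat _)).
move=> F F0 FD h; rewrite Dz; elim/big_ind: _ => // i _.
have Fi : F s`_i by apply/h/mem_nth.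
by elim: (c i) => [|n IH] //; rewrite mulrSr; apply: FD.
Qed.

Lemma primitive_element_fld (s : seq algC) y z :
 (forall F : algC -> Prop, F 0 -> (forall x y, F x -> F y -> F (x + y)) ->
    (forall x, x \in s -> F x) -> F z) -> (forall x, x \in s -> fld y x) -> fld y z.
Proof. by apply; [exact: fld0 | exact: fldD]. Qed.

Lemma fld_poly a x : fld a x -> exists2 p : {poly algC},
  (forall j, p`_j \in Crat) & (size p <= deg a)%N /\ forall u : aut, u x = p.[u a].
Proof.
move=> ax; have [s [W [_ _ /(_ x ax)[rQ rE]]]] := fld_coord a.
exists (\poly_(j < deg a) (if insub j is Some j' then \sum_i s i x * W i j' else 0)).
  move=> j; rewrite coef_poly; case: ifP => _; rewrite ?Crat0 //.
  by case: insub => [j'|]; rewrite ?Crat0.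
split=> [|u]; first exact: size_poly.
rewrite rE horner_poly; apply: eq_bigr => j _.
by rewrite valK.
Qed.

Lemma fld_min F b x : is_subfield F -> F b -> fld b x -> F x.
Proof.
case=> F0 F1 FB FM FV Fb.
have FN y : F y -> F (- y) by move=> Fy; rewrite -sub0r; apply: FB.
have FD y z : F y -> F z -> F (y + z).
  by move=> Fy Fz; rewrite -[z]opprK; apply/FB/FN.
have Fnat n : F n%:R.
  by elim: n => [//|n IH]; rewrite mulrSr; apply: FD.
have FQ y : y \in Crat -> F y.
  move=> /CratP[q ->]; rewrite /ratr; apply: FM.
    by case: (numq q) => n; rewrite ?NegzE ?mulrNz; [|apply: FN]; apply: Fnat.
  by apply: FV; case: (denq q) => n; rewrite ?NegzE ?mulrNz; [|apply: FN]; apply: Fnat.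
have FX y n : F y -> F (y ^+ n).
  by move=> Fy; elim: n => [|n IH]; rewrite ?expr0 // exprS; apply: FM.
case/fld_poly => p pQ [_ /(_ idfun)/= ->]; rewrite horner_coef.
by elim/big_ind: _ => // i _; apply: FM; [apply: FQ | apply: FX].
Qed.

Lemma conjs_image a x (p : {poly algC}) : (forall u : aut, u x = p.[u a]) ->
  {subset conjs x <= [seq p.[z] | z <- conjs a]}.
Proof.
move=> pE y; rewrite mem_conjs => /conj_aut[u <-].
by rewrite pE map_f // aut_conjs.
Qed.

Lemma deg_mono a x : fld a x -> (deg x <= deg a)%N.
Proof.
case/fld_poly => p _ [_ /conjs_image h].
by have := uniq_leq_size (conjs_uniq x) h; rewrite size_map.
Qed.

Lemma uniq_map_inj (T1 T2 : eqType) (f : T1 -> T2) (s : seq T1) :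
  uniq (map f s) -> {in s &, injective f}.
Proof.
move=> us x y xs ys fxy; rewrite -(nth_index x xs) -(nth_index x ys); congr nth.
apply/eqP; rewrite -(nth_uniq (f x) _ _ us) ?size_map ?index_mem //.
by rewrite !(nth_map x) ?index_mem // !nth_index // fxy.
Qed.

(** The polynomial sending [a] to [x] maps conjugates onto conjugates; equal counts make it
    injective on them, so an automorphism fixing [x] fixes [a]. *)
Lemma deg_eq a x : fld a x -> deg x = deg a -> fld x a.
Proof.
case/fld_poly => p _ [_ pE] e u ux.
have h := conjs_image pE.
have un : uniq [seq p.[z] | z <- conjs a].
  by apply: (leq_size_uniq (conjs_uniq x) h); rewrite size_map -/(deg a) -e.
apply: (uniq_map_inj un); rewrite ?aut_conjs ?mem_conjs ?root_minCpoly //.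
by rewrite -pE ux; have /= := pE idfun.
Qed.

(** An element of maximal degree generates: a primitive element for it and any further [x] still
    lies in [F], hence has no larger degree. *)
Lemma subfield_fld F a : is_subfield F -> (forall x, F x -> fld a x) ->
  exists b, F b /\ forall x, F x <-> fld b x.
Proof.
move=> sF Fa.
pose P n := exists2 b, F b & deg b = n.
have [b Fb bmax] : exists2 b, F b & forall c, F c -> (deg c <= deg b)%N.
  have : exists2 n, P n & forall m, P m -> (m <= n)%N.
    have bnd n : P n -> (n <= deg a)%N by case=> b /Fa /deg_mono le <-.
    have [n0 Pn0] : exists n, P n by exists (deg 0); exists 0 => //; case: sF.
    have := Pn0; have : (deg a - n0 <= deg a)%N by lia.
    move: {2}(deg a) => k; elim: k n0 {Pn0} => [|k IH] n kn Pn.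
      by exists n => // m /bnd; lia.
    case: (boolp.EM (exists2 m, P m & (n < m)%N)) => [[m Pm nm]|no].
      by apply: (IH m) => //; have := bnd _ Pm; lia.
    by exists n => // m Pm; rewrite leqNgt; apply/negP => nm; apply: no; exists m.
  by case=> _ [b Fb <-] h; exists b => // c Fc; apply: h; exists c.
exists b; split=> // x; split; last exact: fld_min.
move=> Fx.
have [z [zs zmin]] := primitive_element [:: b; x].
have zb : fld z b by apply: zs; rewrite mem_head.
have zx : fld z x by apply: zs; rewrite !inE eqxx orbT.
have [F0 F1 FB FM FV] := sF.
have Fz : F z.
  apply: zmin => // [y y' Fy Fy'|y].
    by rewrite -[y']opprK -[- y']sub0r; apply: (FB) => //; apply: FB.
  by rewrite !inE => /orP[] /eqP->.
have e : deg b = deg z by apply/eqP; rewrite eqn_leq deg_mono // bmax.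
exact: fld_trans (deg_eq zb e) zx.
Qed.

Lemma number_field_fld F : number_field F -> exists a, F a /\ forall x, F x <-> fld a x.
Proof.
case=> sF [n [b [bF _ bS]]].
have [z [zs zmin]] := primitive_element [seq b i | i <- enum 'I_n].
have Fsub x : F x -> fld z x.
  case/bS => c [cQ ->]; apply: fld_sum => i _; apply: fldM.
    by apply: fld_rat; apply: cQ.
  by apply: zs; apply/mapP; exists i; rewrite ?mem_enum.
exact: subfield_fld sF Fsub.
Qed.

(** The [s i] represent the conjugates of [w] over [fld p]; sums and products over them are relative
    traces and norms. *)
Lemma fld_orbit p w : exists k (s : 'I_k -> aut),
  [/\ forall i, s i p = p, injective (fun i => s i w) &
      forall v : aut, v p = p -> exists i, v w = s i w].
Proof.
pose Z := [seq z <- conjs w | boolp.asbool (exists u : aut, u p = p /\ u w = z)].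
have [s sE] : exists s : 'I_(size Z) -> aut, forall i, s i p = p /\ s i w = Z`_i.
  have /exists_fun[s sE] : forall i : 'I_(size Z), exists u : aut, u p = p /\ u w = Z`_i.
    move=> i; have : Z`_i \in Z by apply: mem_nth.
    by rewrite mem_filter => /andP[/boolp.asboolP].
  by exists s.
exists (size Z), s; split=> [i|i j|v vp].
- by case: (sE i).
- have [_ ->] := sE i; have [_ ->] := sE j => /eqP.
  rewrite nth_uniq ?filter_uniq ?conjs_uniq // => /eqP; exact: val_inj.
have vZ : v w \in Z.
  by rewrite mem_filter aut_conjs andbT; apply/boolp.asboolP; exists v.
have h : (index (v w) Z < size Z)%N by rewrite index_mem.
by exists (Ordinal h); have [_ ->] := sE (Ordinal h); rewrite nth_index.
Qed.

Lemma orbit_perm p w k (s : 'I_k -> aut) (v : aut) : v p = p ->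
  (forall i, s i p = p) -> injective (fun i => s i w) ->
  (forall v : aut, v p = p -> exists i, v w = s i w) ->
  exists2 f : 'I_k -> 'I_k, bijective f & forall i x, fld w x -> v (s i x) = s (f i) x.
Proof.
move=> vp sp sinj ssurj.
have /exists_fun[f fE] : forall i, exists j, v (s i w) = s j w.
  by move=> i; apply: (ssurj (autM v (s i))); rewrite autME sp.
exists f => [|i x wx]; last first.
  by apply: (fldE (u := autM v (s i)) (v := s (f i)) wx); rewrite autME fE.
apply: injF_bij => i j fij; apply: sinj => /=; apply: (fmorph_inj v).
by rewrite !fE fij.
Qed.

Lemma orbit_prod p w k (s : 'I_k -> aut) x :
  (forall i, s i p = p) -> injective (fun i => s i w) ->
  (forall v : aut, v p = p -> exists i, v w = s i w) -> fld w x ->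
  fld p (\prod_i s i x) /\ fld p (\sum_i s i x).
Proof.
move=> sp sinj ssurj wx; split=> v vp;
  have [f fb fE] := orbit_perm vp sp sinj ssurj.
  rewrite rmorph_prod [RHS](reindex f) /=; last exact: onW_bij.
  by apply: eq_bigr => i _; rewrite fE.
rewrite rmorph_sum [RHS](reindex f) /=; last exact: onW_bij.
by apply: eq_bigr => i _; rewrite fE.
Qed.

(** * Algebraic integers, denominators and finite residue rings *)

Lemma integralAint x : integralOver (intr : int -> algC) x -> x \in Aint.
Proof.
case=> p mpoly_of rp; apply: (root_monic_Aint rp); first exact: monic_map.
by apply/polyOverP => i; rewrite coef_map /= intr_int.
Qed.

Lemma Aint_integral x : x \in Aint -> integralOver (intr : int -> algC) x.
Proof.
move=> /floorpP[q Dq]; exists q; last by rewrite -Dq root_minCpoly.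
have := minCpoly_monic x; rewrite Dq => /monicP.
rewrite lead_coef_map_inj; [|exact: intr_inj|by rewrite rmorph0].
by move=> e; apply/monicP; apply: (@intr_inj algC).
Qed.

Lemma root_Aint (p : {poly algC}) x : p \is monic -> (forall i, p`_i \in Aint) ->
  root p x -> x \in Aint.
Proof.
move=> mpoly_of pA rx; apply: integralAint; apply: (integral_root_monic mpoly_of rx).
by move=> c /(nthP 0)[i _ <-]; apply/Aint_integral.
Qed.

Lemma lead_Aint (c : {poly algC}) x : (forall i, c`_i \in Aint) -> root c x ->
  lead_coef c * x \in Aint.
Proof.
move=> cA rx; case: (leqP (size c) 1) => [s1|s1].
  have := rx; rewrite (size1_polyC s1) rootC => /eqP ->.
  by rewrite polyC0 lead_coef0 mul0r Aint0.
have [m sm] : exists m, size c = m.+2 by case: (size c) s1 => [|[|m]] //; exists m.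
pose d := lead_coef c.
have dE : d = c`_m.+1 by rewrite /d lead_coefE sm.
have d0 : d != 0 by rewrite lead_coef_eq0 -size_poly_eq0 sm.
(* Multiplying the equation [c] of [x] by [d ^ m] turns it into this monic equation for [d * x]. *)
pose P := 'X^(m.+1) + \poly_(i < m.+1) (c`_i * d ^+ (m - i)).
have mP : P \is monic.
  rewrite monicE lead_coefDl ?lead_coefXn // size_polyXn ltnS; exact: size_poly.
apply: (root_Aint mP).
  move=> i; rewrite coefD coefXn coef_poly rpredD ?rpred_nat //.
  by case: ifP => _; rewrite ?rpred0 // rpredM // rpredX // dE cA.
have := rx; rewrite /root horner_coef sm big_ord_recr /= -dE => /eqP e.
rewrite !hornerE horner_poly -/d exprMn -[X in _ + X]mulr1.
have -> : \sum_(i < m.+1) c`_i * d ^+ (m - i) * (d * x) ^+ i = d ^+ m * \sum_(i < m.+1) c`_i * x ^+ i.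
  rewrite mulr_sumr; apply: eq_bigr => i _.
  rewrite exprMn -[in d ^+ m](subnK (ltnSE (ltn_ord i))) exprD; ring.
move: e; set S := \sum_(i < _) _ => e.
have -> : d ^+ m.+1 * x ^+ m.+1 + d ^+ m * S * 1 = d ^+ m * (S + d * x ^+ m.+1).
  by rewrite [d ^+ m.+1]exprS; ring.
by rewrite e mulr0.
Qed.

Lemma intpoly x : exists2 q : {poly int}, root (pZtoC q) x &
  forall l : nat, prime l -> exists i, ~~ (l %| q`_i)%Z.
Proof.
have [r [Dr mr] _] := minCpolyP x.
have [q [a a0 rE]] := rat_poly_scale r.
have q0 : q != 0.
  apply: contra_neq (monic_neq0 mr) => q0; by rewrite rE q0 rmorph0 scaler0.
exists (zprimitive q).
  have := root_minCpoly x; rewrite Dr rE {1}(zpolyEprim q) map_polyZ /= linearZ /=.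
  rewrite linearZ /=; have -> : pQtoC (map_poly intr (zprimitive q)) = pZtoC (zprimitive q).
    by rewrite -map_poly_comp; apply: eq_map_poly => b /=; rewrite ratr_int.
  rewrite /root scalerA hornerZ mulf_eq0 => /orP[|//].
  by rewrite -rmorphM fmorph_eq0 mulf_eq0 invr_eq0 !intr_eq0 (negPf a0) zcontents_eq0 (negPf q0).
move=> l pl; apply: boolp.contrapT => no.
have : (l %| zcontents (zprimitive q))%Z.
  rewrite dvdz_contents; apply/polyOverP => i; apply: boolp.contrapT => ni.
  by apply: no; exists i; apply/negP.
by rewrite zcontents_primitive q0 dvdzE /= dvdn1 => /eqP l1; rewrite l1 in pl.
Qed.

Lemma Aint_denom x : exists2 m : nat, (0 < m)%N & m%:R * x \in Aint.
Proof.
have [q rq nq] := intpoly x.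
have q0 : q != 0 by apply/eqP => q0; have [i] := nq 2%N isT; rewrite q0 coef0 dvdz0.
have : lead_coef (pZtoC q) * x \in Aint.
  by apply: lead_Aint rq => i; rewrite coef_map Aint_int.
rewrite lead_coef_map_inj; [|exact: intr_inj|by rewrite rmorph0].
have := q0; rewrite -lead_coef_eq0; case: (lead_coef q) => n n0 h.
  by exists n => //; rewrite lt0n.
exists n.+1 => //; move: h; rewrite NegzE mulrNz mulNr rpredN.
by [].
Qed.

Lemma Aint_denoms (I : finType) (x : I -> algC) :
  exists2 m : nat, (0 < m)%N & forall i, m%:R * x i \in Aint.
Proof.
have /exists_fun[m mP] : forall i, exists m : nat, (0 < m)%N /\ m%:R * x i \in Aint.
  by move=> i; have [m] := Aint_denom (x i); exists m.
exists (\prod_i m i)%N; first by rewrite prodn_gt0 // => i; case: (mP i).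
move=> i; rewrite (bigD1 i) //= natrM mulrAC rpredM ?rpred_nat //; last first.
by case: (mP i).
Qed.

(** The ring of integers of [fld a] is finite modulo [m]; [cl] labels its classes by coordinates in
    the power basis of [a], possibly more finely than congruence does. *)
Lemma finite_residues a (m : nat) : (0 < m)%N -> exists (T : finType) (cl : algC -> T),
  forall x y, x \in Aint -> y \in Aint -> fld a x -> fld a y -> cl x = cl y ->
  (x - y) / m%:R \in Aint.
Proof.
move=> m0; have [s [W [_ _ cW]]] := fld_coord a; set n := deg a in s W cW *.
have [D D0 DW] := Aint_denoms (fun ij : 'I_n * 'I_n => W ij.1 ij.2).
have [E E0 DE] := Aint_denoms (fun j : 'I_n => a ^+ j).
pose r x j := \sum_i s i x * W i j.
(* [D] makes the coordinates of integers integral, and [E] makes up for powers of [a] that are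
   not. *)
pose M := (m * D * E)%N.
have M0 : (0 < M)%N by rewrite !muln_gt0 m0 D0 E0.
have /exists_fun[k kE] : forall x, exists k : 'I_n -> int,
    x \in Aint -> fld a x -> forall j, (k j)%:~R = D%:R * r x j.
  move=> x; case: (boolp.EM (x \in Aint /\ fld a x)) => [[Ax ax]|no]; last first.
    by exists (fun=> 0) => Ax ax; case: no.
  have /exists_fun[k kE] : forall j, exists z : int, z%:~R = D%:R * r x j.
    move=> j; have : D%:R * r x j \in Num.int.
      apply: Cint_rat_Aint; first by apply: rpredM; [exact: rpred_nat | case: (cW x ax) => h _; apply: h].
      rewrite mulr_sumr rpred_sum // => i _; rewrite mulrCA rpredM ?Aint_aut //.
      exact: (DW (i, j)).
    by move/intrP => [z ->]; exists z.
  by exists k.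
exists {ffun 'I_n -> 'I_M.+1}, (fun x => [ffun j => inord (absz (k x j %% M)%Z)]).
move=> x y Ax Ay ax ay /ffunP e.
have Mz : M%:Z != 0 by rewrite -lt0n.
have dv j : exists z : int, k x j - k y j = z * M%:Z.
  have := congr1 val (e j); rewrite !ffunE /=.
  have bnd z : (absz (z %% M%:Z)%Z < M.+1)%N.
    rewrite ltnS -lez_nat gez0_abs ?modz_ge0 //; apply/ltW/ltz_pmod.
    by rewrite ltz_nat.
  rewrite !inordK // => h.
  have : (k x j == k y j %[mod M])%Z.
    have h1 z : (z %% M)%Z = (absz (z %% M)%Z)%:Z by rewrite gez0_abs // modz_ge0.
    by rewrite h1 h -h1.
  rewrite eqz_mod_dvd => /dvdzP[z ->]; by exists z.
have /exists_fun[z zE] := dv.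
have [_ /(_ idfun)/= xE] := cW x ax; have [_ /(_ idfun)/= yE] := cW y ay.
have -> : (x - y) / m%:R = \sum_j (z j)%:~R * (E%:R * a ^+ j).
  rewrite {1}xE {1}yE -sumrB mulr_suml; apply: eq_bigr => j _.
  rewrite -mulrBl.
  have D0' : D%:R != 0 :> algC by rewrite pnatr_eq0 -lt0n.
  have m0' : m%:R != 0 :> algC by rewrite pnatr_eq0 -lt0n.
  have h : D%:R * (r x j - r y j) = (z j)%:~R * M%:R.
    by rewrite mulrBr -!kE // -rmorphB zE rmorphM.
  have -> : r x j - r y j = (z j)%:~R * M%:R / D%:R by rewrite -h mulrC mulKf.
  by rewrite /M !natrM; field; rewrite D0' m0'.
by rewrite rpred_sum // => j _; rewrite rpredM ?Aint_int.
Qed.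

Lemma pow_residues a (m : nat) : (0 < m)%N -> a \in Aint ->
  exists i j : nat, (i < j)%N /\ (a ^+ i - a ^+ j) / m%:R \in Aint.
Proof.
move=> m0 Aa; have [T [cl clE]] := finite_residues a m0.
pose f (i : 'I_#|T|.+1) := cl (a ^+ i).
have : ~ injective f by move/leq_card; rewrite card_ord ltnn.
move=> ninj; apply: boolp.contrapT => no; apply: ninj => i j fij.
apply: val_inj; case: (ltngtP i j) => // lt; case: no.
  by exists i, j; split=> //; apply: clE; rewrite ?rpredX //; apply/fldX/fld_id.
by exists j, i; split=> //; apply: clE; rewrite ?rpredX //; apply/fldX/fld_id.
Qed.

(** * Primes of the ring of algebraic integers *)

(** Primes of a number field are handled as traces of prime ideals [M] of the ring of all algebraic integers, whose localisation [loc M] is a valuation ring of [algC] with maximal ideal [mloc M]. *)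
Record prm (M : algC -> Prop) : Prop := Prm {
  prmA : forall x, M x -> x \in Aint;
  prmD : forall x y, M x -> M y -> M (x + y);
  prmZ : forall a x, a \in Aint -> M x -> M (a * x);
  prm1 : ~ M 1;
  prmM : forall a b, a \in Aint -> b \in Aint -> M (a * b) -> M a \/ M b;
  prml : exists2 l : nat, prime l & M l%:R }.

Definition loc (M : algC -> Prop) x :=
  exists a b, [/\ a \in Aint, b \in Aint, ~ M b & x = a / b].
Definition mloc (M : algC -> Prop) x :=
  exists a b, [/\ M a, b \in Aint, ~ M b & x = a / b].

Section Prm.
Variables (M : algC -> Prop) (pM : prm M).

Lemma prm0 : M 0.
Proof. by have [l _ Ml] := prml pM; rewrite -(mul0r l%:R); apply: prmZ; rewrite ?rpred0. Qed.
Lemma prmN x : M x -> M (- x).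
Proof. by move=> Mx; rewrite -mulN1r; apply: prmZ; rewrite ?rpredN ?rpred1. Qed.
Lemma prmB x y : M x -> M y -> M (x - y).
Proof. by move=> Mx My; apply: prmD => //; apply: prmN. Qed.
Lemma prmZr a x : a \in Aint -> M x -> M (x * a).
Proof. by move=> Aa Mx; rewrite mulrC; apply: prmZ. Qed.
Lemma prm_nz b : ~ M b -> b != 0.
Proof. by move=> nb; apply/eqP => b0; apply: nb; rewrite b0; apply: prm0. Qed.
Lemma prmXn x n : M x -> M (x ^+ n.+1).
Proof. by move=> Mx; rewrite exprS; apply: prmZr => //; apply/rpredX/(prmA pM). Qed.
Lemma prmX a n : a \in Aint -> M (a ^+ n) -> M a.
Proof.
move=> Aa; elim: n => [/(prm1 pM)//|n IH]; rewrite exprS.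
by case/(prmM pM) => //; rewrite rpredX.
Qed.
Lemma prm_prod (I : Type) (r : seq I) (P : pred I) (F : I -> algC) :
  (forall i, F i \in Aint) -> M (\prod_(i <- r | P i) F i) -> exists2 i, P i & M (F i).
Proof.
move=> FA; elim: r => [|i r IH]; first by rewrite big_nil => /(prm1 pM).
rewrite big_cons; case: ifP => // Pi.
by case/(prmM pM) => // [|Mi]; [apply: rpred_prod | exists i].
Qed.
Lemma prm_nM a b : a \in Aint -> b \in Aint -> ~ M a -> ~ M b -> ~ M (a * b).
Proof. by move=> Aa Ab na nb /(prmM pM)[]. Qed.

Lemma prm_nat_coprime m n : coprime m n -> M m%:R -> M n%:R -> False.
Proof.
move=> cmn Mm Mn; apply: (prm1 pM).
have [u [v e]] := Bezoutz m n.
have : gcdz m n = 1 by rewrite /gcdz /= (eqP cmn).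
rewrite -{}e => /(congr1 (intr : int -> algC)).
rewrite rmorphD !rmorphM /= => e.
suff : M (u%:~R * m%:R + v%:~R * n%:R) by rewrite e.
by apply: (prmD pM); apply: (prmZ pM); rewrite ?Aint_int.
Qed.
Lemma prm_natE l n : prime l -> M l%:R -> M n%:R <-> (l %| n)%N.
Proof.
move=> pl Ml; split=> [Mn|/dvdnP[k ->]]; last by rewrite natrM; apply: prmZ; rewrite ?rpred_nat.
apply: contraT => /negP nd; case: (prm_nat_coprime (m := l) (n := n)) => //.
by rewrite prime_coprime //; apply/negP.
Qed.
Lemma prm_intE l (n : int) : prime l -> M l%:R -> M n%:~R <-> (l %| n)%Z.
Proof.
move=> pl Ml; case: n => n; first exact: prm_natE.
rewrite NegzE mulrNz dvdzE abszN; split=> [/prmN|]; first by rewrite opprK => /(prm_natE _ pl Ml).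
by move=> /(prm_natE _ pl Ml)/prmN.
Qed.

(** Pigeonhole on the powers of [a] modulo [l] shows that primes are maximal. The inverse is a power
    of [a], so it stays in every field containing [a]. *)
Lemma prm_inv a : a \in Aint -> ~ M a -> exists k, M (a ^+ k * a - 1).
Proof.
move=> Aa na; have [l pl Ml] := prml pM.
have [i [j [ij h]]] := pow_residues (prime_gt0 pl) Aa.
have : M (a ^+ i * (1 - a ^+ (j - i))).
  rewrite mulrBr mulr1 -exprD subnKC ?(ltnW ij) //.
  have l0 : l%:R != 0 :> algC by rewrite pnatr_eq0 -lt0n prime_gt0.
  by rewrite -(divfK l0 (_ - _)); apply: prmZ.
case/(prmM pM); rewrite ?rpredB ?rpredX ?rpred1 //.
  by move/(prmX Aa).
move/prmN; rewrite opprB => h1; exists (j - i).-1.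
by rewrite -exprSr prednK // subn_gt0.
Qed.

Lemma loc_Aint a : a \in Aint -> loc M a.
Proof. by move=> Aa; exists a, 1; rewrite divr1 rpred1; split=> //; apply: prm1. Qed.
Lemma loc0 : loc M 0. Proof. exact/loc_Aint/rpred0. Qed.
Lemma loc1 : loc M 1. Proof. exact/loc_Aint/rpred1. Qed.
Lemma loc_nat n : loc M n%:R. Proof. exact/loc_Aint/rpred_nat. Qed.
Lemma locM x y : loc M x -> loc M y -> loc M (x * y).
Proof.
case=> a [b [Aa Ab nb ->]] [c [d [Ac Ad nd ->]]].
exists (a * c), (b * d); split; rewrite ?rpredM //; first exact: prm_nM.
by rewrite mulf_div.
Qed.
Lemma locD x y : loc M x -> loc M y -> loc M (x + y).
Proof.
case=> a [b [Aa Ab nb ->]] [c [d [Ac Ad nd ->]]].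
exists (a * d + c * b), (b * d); split; rewrite ?rpredD ?rpredM //; first exact: prm_nM.
by rewrite addf_div ?prm_nz.
Qed.
Lemma locN x : loc M x -> loc M (- x).
Proof. by move=> lx; rewrite -mulN1r; apply: locM lx; apply: loc_Aint; rewrite rpredN rpred1. Qed.
Lemma locB x y : loc M x -> loc M y -> loc M (x - y).
Proof. by move=> lx ly; apply: locD => //; apply: locN. Qed.
Lemma locX x n : loc M x -> loc M (x ^+ n).
Proof. by move=> lx; elim: n => [|n IH]; [exact: loc1 | rewrite exprS; apply: locM]. Qed.
Lemma loc_sum (I : Type) (r : seq I) (P : pred I) (F : I -> algC) :
  (forall i, P i -> loc M (F i)) -> loc M (\sum_(i <- r | P i) F i).
Proof. by move=> h; elim/big_ind: _ => //; [exact: loc0 | exact: locD]. Qed.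
Lemma loc_prod (I : Type) (r : seq I) (P : pred I) (F : I -> algC) :
  (forall i, P i -> loc M (F i)) -> loc M (\prod_(i <- r | P i) F i).
Proof. by move=> h; elim/big_ind: _ => //; [exact: loc1 | exact: locM]. Qed.

Lemma mloc_M a : M a -> mloc M a.
Proof. by move=> Ma; exists a, 1; rewrite divr1 rpred1; split=> //; apply: prm1. Qed.
Lemma mloc_loc x : mloc M x -> loc M x.
Proof. by case=> a [b [Ma Ab nb ->]]; exists a, b; split=> //; apply: prmA Ma. Qed.
Lemma mlocM x y : loc M x -> mloc M y -> mloc M (x * y).
Proof.
case=> a [b [Aa Ab nb ->]] [c [d [Mc Ad nd ->]]].
exists (a * c), (b * d); split; rewrite ?rpredM //; [exact: prmZ | exact: prm_nM |].
by rewrite mulf_div.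
Qed.
Lemma mlocMr x y : mloc M x -> loc M y -> mloc M (x * y).
Proof. by move=> mx ly; rewrite mulrC; apply: mlocM. Qed.
Lemma mlocD x y : mloc M x -> mloc M y -> mloc M (x + y).
Proof.
case=> a [b [Ma Ab nb ->]] [c [d [Mc Ad nd ->]]].
exists (a * d + c * b), (b * d); split; rewrite ?rpredM //.
- by apply: prmD => //; apply: prmZr.
- exact: prm_nM.
by rewrite addf_div ?prm_nz.
Qed.
Lemma mlocN x : mloc M x -> mloc M (- x).
Proof. by move=> lx; rewrite -mulN1r; apply: mlocM lx; apply: loc_Aint; rewrite rpredN rpred1. Qed.
Lemma mlocB x y : mloc M x -> mloc M y -> mloc M (x - y).
Proof. by move=> lx ly; apply: mlocD => //; apply: mlocN. Qed.
Lemma mloc_Aint a : a \in Aint -> mloc M a -> M a.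
Proof.
move=> Aa [c [d [Mc Ad nd aE]]].
have : M (a * d) by rewrite aE divfK // prm_nz.
by case/(prmM pM).
Qed.
Lemma mloc1 : ~ mloc M 1.
Proof. by move/mloc_Aint; rewrite rpred1 => /(_ isT); apply: prm1. Qed.
Lemma mloc0 : mloc M 0. Proof. exact/mloc_M/prm0. Qed.

Lemma loc_unit x : loc M x -> ~ mloc M x -> loc M x^-1.
Proof.
case=> a [b [Aa Ab nb xE]] nm; exists b, a; split=> //; last by rewrite xE invf_div.
by move=> Ma; apply: nm; exists a, b.
Qed.

(** Induction on the degree. If the leading coefficient [d] and [d * x] both lie in [M], replacing
    the leading term [d X^(m+1)] by [d x X^m] keeps the root [x], lowers the degree and changes
    coefficients only within [M]; otherwise [d * x] over [d] is the fraction sought. *)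
Lemma prufer_step (c : {poly algC}) x : (forall i, c`_i \in Aint) -> root c x ->
  (forall i, fld x c`_i) -> (exists i, ~ M c`_i) ->
  exists a b, [/\ a \in Aint /\ b \in Aint, fld x a /\ fld x b, (~ M a \/ ~ M b) /\ b != 0 & x = a / b].
Proof.
have [n] := ubnP (size c); elim: n c => // n IH c sc cA rx cF nM.
have c0 : c != 0 by apply/eqP => c0; case: nM => i; rewrite c0 coef0; apply; exact: prm0.
pose d := lead_coef c.
have d0 : d != 0 by rewrite lead_coef_eq0.
have dx : d * x \in Aint by apply: lead_Aint.
have dA : d \in Aint by apply: cA.
have dF : fld x d by apply: cF.
case: (boolp.EM (~ M d \/ ~ M (d * x))) => [h|no].
  exists (d * x), d; split=> //; last by rewrite mulrC mulKf.
  - by split=> //; apply: fldM => //; apply: fld_id.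
  - by split=> //; case: h; [right | left].
have [Md Mdx] : M d /\ M (d * x).
  by split; apply: boolp.contrapT => h; apply: no; [left | right].
have [m sm] : exists m, size c = m.+2.
  have := root_size_gt1 c0 rx; by case: (size c) => [|[|m]] // _; exists m.
have dE : d = c`_m.+1 by rewrite /d lead_coefE sm.
pose c' := c - d *: 'X^(m.+1) + (d * x) *: 'X^(m).
have cE i : c'`_i = c`_i - d * (i == m.+1)%:R + d * x * (i == m)%:R.
  by rewrite !coefD coefN !coefZ !coefXn.
apply: (IH c').
- suff : (size c' <= m.+1)%N by move: sc; rewrite sm; lia.
  apply/leq_sizeP => j; rewrite leq_eqVlt => /orP[/eqP <-|mj]; rewrite cE.
    by rewrite eqxx gtn_eqF // mulr0 addr0 mulr1 -dE subrr.
  rewrite gtn_eqF // gtn_eqF ?(ltnW mj) // !mulr0 addr0 subr0 nth_default ?sm //.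
- move=> i; rewrite cE; apply: rpredD; last by rewrite rpredM ?rpred_nat.
  by rewrite rpredB // rpredM ?rpred_nat.
- rewrite /root !hornerE (eqP rx) exprS; apply/eqP; ring.
- move=> i; rewrite cE; apply: fldD; last by apply: fldM; [apply: fldM => //; apply: fld_id | apply: fld_nat].
  by apply: fldB => //; apply: fldM => //; apply: fld_nat.
- case: nM => i ni; exists i; rewrite cE => h; apply: ni.
  have -> : c`_i = (c`_i - d * (i == m.+1)%:R + d * x * (i == m)%:R) + (d * (i == m.+1)%:R - d * x * (i == m)%:R) by ring.
  by apply: (prmD pM) => //; apply: prmB; apply: prmZr; rewrite ?rpred_nat.
Qed.

(* Z-bar is a Pruefer domain: its localisations are valuation rings. *)
Lemma prufer x :
  exists a b, [/\ a \in Aint /\ b \in Aint, fld x a /\ fld x b, (~ M a \/ ~ M b) /\ b != 0 & x = a / b].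
Proof.
have [q rq nq] := intpoly x; have [l pl Ml] := prml pM; have [i qi] := nq l pl.
apply: (prufer_step (c := pZtoC q)) => //.
- by move=> j; rewrite coef_map Aint_int.
- by move=> j; rewrite coef_map; apply: fld_int.
- by exists i; rewrite coef_map => /(prm_intE _ pl Ml); rewrite (negPf qi).
Qed.

Lemma locVm x : ~ loc M x -> x != 0 /\ mloc M x^-1.
Proof.
have [a [b [[Aa Ab] _ [nab b0] xE]]] := prufer x => nl.
have Mb : M b by apply: boolp.contrapT => nb; apply: nl; exists a, b.
have na : ~ M a by case: nab.
split; first by rewrite xE; apply: mulf_neq0; [apply: prm_nz | apply: invr_neq0].
by exists b, a; split=> //; rewrite xE invf_div.
Qed.
Lemma mloc_nloc x : x != 0 -> mloc M x^-1 -> ~ loc M x.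
Proof. by move=> x0 mx lx; apply: mloc1; rewrite -(divff x0); apply: mlocM. Qed.
Lemma nmloc_loc x : x != 0 -> ~ mloc M x -> loc M x^-1.
Proof.
move=> x0 nm; apply: boolp.contrapT => /locVm[_]; by rewrite invrK.
Qed.
Lemma mloc_prime x y : loc M x -> loc M y -> mloc M (x * y) -> mloc M x \/ mloc M y.
Proof.
move=> lx ly mxy; case: (boolp.EM (mloc M x)) => [|nx]; [by left|right].
have x0 : x != 0 by apply/eqP => x0; apply: nx; rewrite x0; apply: mloc0.
by rewrite -(mulKf x0 y); apply: mlocM => //; apply: nmloc_loc.
Qed.

(** Pigeonhole makes [m] divide [a ^ i * (1 - a ^ (j - i))], whose second factor is a unit at [M];
    this stands in for a comparison of valuations. *)
Lemma prm_nil a (m : nat) : (0 < m)%N -> M a ->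
  exists K, forall k, (K <= k)%N -> mloc M (a ^+ k / m%:R).
Proof.
move=> m0 Ma; have Aa := prmA pM Ma.
have [i [j [ij h]]] := pow_residues m0 Aa; exists i.+1 => k ik.
have nu : ~ M (1 - a ^+ (j - i)).
  move=> h1; apply: (prm1 pM).
  have -> : 1 = (1 - a ^+ (j - i)) + a ^+ (j - i) by ring.
  apply: (prmD pM) => //.
  by rewrite -(@prednK (j - i)) ?subn_gt0 //; apply: prmXn.
have li : loc M (a ^+ i / m%:R).
  exists ((a ^+ i - a ^+ j) / m%:R), (1 - a ^+ (j - i)); split=> //.
    by rewrite rpredB ?rpred1 ?rpredX.
  have -> : a ^+ j = a ^+ i * a ^+ (j - i) by rewrite -exprD subnKC // ltnW.
  have n0 := prm_nz nu.
  have m0' : m%:R != 0 :> algC by rewrite pnatr_eq0 -lt0n.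
  by field; rewrite m0' n0.
have -> : a ^+ k / m%:R = (a ^+ (k - i.+1) * (a ^+ i / m%:R)) * a.
  by rewrite -{1}(subnK ik) exprD exprSr; ring.
by apply: mlocM; [apply: locM => //; apply/loc_Aint/rpredX | apply: mloc_M].
Qed.
End Prm.

(** * Existence of primes and the local criterion of integrality *)

Section Existence.
Definition ideal (I : algC -> Prop) :=
  [/\ forall x, I x -> x \in Aint, I 0, forall x y, I x -> I y -> I (x + y) &
      forall a x, a \in Aint -> I x -> I (a * x)].
Definition adj (I : algC -> Prop) y x := exists i a, [/\ I i, a \in Aint & x = i + a * y].

Lemma ideal_adj I y : ideal I -> y \in Aint -> ideal (adj I y).
Proof.
case=> IA I0 ID IZ Ay; split.
- by move=> x [i [a [Ii Aa ->]]]; rewrite rpredD ?rpredM // IA.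
- by exists 0, 0; rewrite mul0r addr0 rpred0.
- move=> _ _ [i [a [Ii Aa ->]]] [j [b [Ij Ab ->]]].
  by exists (i + j), (a + b); split; [apply: ID | rewrite rpredD | ring].
- move=> c _ Ac [i [a [Ii Aa ->]]].
  by exists (c * i), (c * a); split; [apply: IZ | rewrite rpredM | ring].
Qed.

Variables (I : algC -> Prop).
(** [algC] is countable, so a maximal ideal arises by enumeration: stage [n] adjoins the [n]-th
    number when it is integral and the ideal stays proper. *)
Fixpoint chain n : algC -> Prop :=
  if n is n'.+1 then
    let J := chain n' in
    if unpickle n' is Some y then
      if boolp.asbool (y \in Aint /\ ~ adj J y 1) then adj J y else J
    else J
  else I.

(** The union of the chain is maximal, hence prime; a prime factor of [m] lies in it. *)
Lemma prm_ex : ideal I -> ~ I 1 -> (exists2 m : nat, (0 < m)%N & I m%:R) ->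
  exists M, prm M /\ forall x, I x -> M x.
Proof.
move=> iI nI [m m0 Im].
have cP n : ideal (chain n) /\ ~ chain n 1.
  elim: n => [//|n [IH1 IH2]] /=; case: (unpickle n) => [y|//].
  by case: boolp.asboolP => [[Ay ny]|_] //; split=> //; apply: ideal_adj.
have cS n x : chain n x -> chain n.+1 x.
  move=> cx /=; case: (unpickle n) => [y|//].
  case: boolp.asboolP => // _; exists x, 0; by rewrite mul0r addr0 rpred0.
have cmono n k x : (n <= k)%N -> chain n x -> chain k x.
  by move=> nk; rewrite -(subnK nk); elim: (k - n)%N => [//|d IH] /IH /cS.
pose M x := exists n, chain n x.
have IM x : I x -> M x by move=> Ix; exists 0%N.
have MA x : M x -> x \in Aint by case=> n; have [[h _ _ _] _] := cP n; apply: h.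
have MD x y : M x -> M y -> M (x + y).
  move=> [n nx] [k ky]; exists (maxn n k).
  have [[_ _ h _] _] := cP (maxn n k); apply: h.
    by apply: cmono nx; apply: leq_maxl.
  by apply: cmono ky; apply: leq_maxr.
have MZ a x : a \in Aint -> M x -> M (a * x).
  by move=> Aa [n nx]; exists n; have [[_ _ _ h] _] := cP n; apply: h.
have M1 : ~ M 1 by case=> n; have [_] := cP n.
have maxM y : y \in Aint -> ~ M y -> exists a, a \in Aint /\ M (1 - a * y).
  move=> Ay ny; have : chain (pickle y).+1 = chain (pickle y).+1 by [].
  rewrite {2}/chain -/chain pickleK; case: boolp.asboolP => [[_ _] e|no _].
    case: ny; exists (pickle y).+1; rewrite e; exists 0, 1; rewrite mul1r add0r rpred1; split=> //.
    by have [[]] := cP (pickle y).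
  have [i [a [Ii Aa e]]] : adj (chain (pickle y)) y 1.
    by apply: boolp.contrapT => h; apply: no.
  exists a; split=> //; exists (pickle y); have -> : 1 - a * y = i by rewrite {1}e; ring.
  by [].
have Mprime a b : a \in Aint -> b \in Aint -> M (a * b) -> M a \/ M b.
  move=> Aa Ab Mab; case: (boolp.EM (M a)) => [|na]; [by left|right].
  have [c [Ac Mc]] := maxM a Aa na.
  have -> : b = b * (1 - c * a) + c * (a * b) by ring.
  by apply: MD; apply: MZ.
exists M; split=> //; split=> //.
have := IM _ Im; elim/ltn_ind: m m0 {Im} => m IHm m0 Mm.
case: (leqP m 1) => m1.
  by case: M1; move: Mm; have -> : m = 1%N by lia.
have pp := pdiv_prime m1; have dd := pdiv_dvd m.
have mE : m = (pdiv m * (m %/ pdiv m))%N by rewrite mulnC divnK.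
have := Mm; rewrite {1}mE natrM => /Mprime[]; rewrite ?rpred_nat // => h.
  by exists (pdiv m).
apply: IHm h.
  by rewrite ltn_Pdiv // prime_gt1.
by rewrite divn_gt0 ?prime_gt0 // dvdn_leq.
Qed.
End Existence.

(** The denominators of a non-integral [x] form a proper ideal; a prime containing it contradicts
    [loc M x]. *)
Lemma Aint_loc (x : algC) : (forall M, prm M -> loc M x) -> x \in Aint.
Proof.
move=> h; apply/negPn/negP => nA.
pose I b := b \in Aint /\ b * x \in Aint.
have [m m0 mx] := Aint_denom x.
have [M [pM IM]] : exists M, prm M /\ forall x, I x -> M x.
  apply: prm_ex.
  - split=> [y []//||y z [Ay yx] [Az zx]|a y Aa [Ay yx]].
    + by rewrite /I mul0r rpred0.
    + by rewrite /I mulrDl !rpredD.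
    + by split; rewrite -?mulrA rpredM.
  - by case=> _; rewrite mul1r => /idP; rewrite (negPf nA).
  - by exists m => //; split=> //; apply: rpred_nat.
have [a [b [Aa Ab nb xE]]] := h M pM.
have b0 := prm_nz pM nb.
have Ib : I b by split=> //; rewrite xE mulrC divfK.
exact/nb/IM.
Qed.

Lemma prm_over (l : nat) : prime l -> exists M, prm M /\ M l%:R.
Proof.
move=> pl; have l0 : l%:R != 0 :> algC by rewrite pnatr_eq0 -lt0n prime_gt0.
have [M [pM h]] : exists M, prm M /\ forall x, (x \in Aint /\ x / l%:R \in Aint) -> M x.
  apply: prm_ex.
  - split=> [y []//||y z [Ay yx] [Az zx]|a y Aa [Ay yx]].
    + by rewrite mul0r rpred0.
    + by rewrite mulrDl !rpredD.
    + by split; rewrite -?mulrA rpredM.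
  - case=> _; rewrite div1r => h.
    have : ((l%:R)^-1 : algC) \in Num.int by apply: Cint_rat_Aint; rewrite ?rpredV ?rpred_nat.
    move/intrP => [z zE]; have : (l%:Z * z = 1).
      by apply: (@intr_inj algC); rewrite rmorphM /= -zE divff.
    move/(congr1 absz); rewrite abszM /= => /eqP; rewrite muln_eq1 => /andP[/eqP l1 _].
    by rewrite l1 in pl.
  - by exists l; rewrite ?prime_gt0 // divff // rpred_nat rpred1.
exists M; split=> //; apply: h; by rewrite divff // rpred_nat rpred1.
Qed.

(** * Galois action on primes, with [pim u M] the image of [M] under [u], and simultaneous
    approximation *)

Definition pim (u : aut) (M : algC -> Prop) : algC -> Prop := fun x => M (autV u x).

Lemma prm_pim u M : prm M -> prm (pim u M).
Proof.
move=> pM; rewrite /pim; split.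
- by move=> x /(prmA pM); rewrite Aint_aut.
- by move=> x y; rewrite rmorphD; apply: prmD.
- by move=> a x Aa; rewrite rmorphM; apply: prmZ; rewrite ?Aint_aut.
- by rewrite rmorph1; apply: prm1.
- by move=> a b Aa Ab; rewrite rmorphM; apply: prmM; rewrite ?Aint_aut.
- by have [l pl Ml] := prml pM; exists l; rewrite ?rmorph_nat.
Qed.

Lemma pimE (u : aut) M x : pim u M (u x) = M x.
Proof. by rewrite /pim autVK. Qed.

Lemma loc_pim (u : aut) M x : loc (pim u M) (u x) <-> loc M x.
Proof.
split=> [[a [b [Aa Ab nb e]]]|[a [b [Aa Ab nb ->]]]].
  exists (autV u a), (autV u b); rewrite !Aint_aut; split=> //.
  by rewrite -[x](autVK u) e rmorphM fmorphV.
exists (u a), (u b); rewrite !Aint_aut pimE; split=> //.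
by rewrite rmorphM fmorphV.
Qed.
Lemma mloc_pim (u : aut) M x : mloc (pim u M) (u x) <-> mloc M x.
Proof.
split=> [[a [b [Aa Ab nb e]]]|[a [b [Aa Ab nb ->]]]].
  exists (autV u a), (autV u b); rewrite !Aint_aut; split=> //.
  by rewrite -[x](autVK u) e rmorphM fmorphV.
exists (u a), (u b); rewrite !Aint_aut !pimE; split=> //.
by rewrite rmorphM fmorphV.
Qed.

(** [M] and [M'] induce the same prime of [fld w]; statements about primes of a number field are
    phrased this way. *)
Definition sameon w (M M' : algC -> Prop) := forall x, fld w x -> M x <-> M' x.

Lemma sameon_sym w M M' : sameon w M M' -> sameon w M' M.
Proof. by move=> h x /h; apply: iff_sym. Qed.
Lemma sameon_sub w v M M' : fld w v -> sameon w M M' -> sameon v M M'.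
Proof. by move=> wv h x vx; apply: h; apply: fld_trans wv vx. Qed.
Lemma sameon_pim (u : aut) w M M' : sameon w M M' -> sameon (u w) (pim u M) (pim u M').
Proof.
move=> h x ux; rewrite /pim; apply: h.
by have := @fld_aut (autV u) _ _ ux; rewrite autVK.
Qed.

(** By the Pruefer property [x] is a fraction over its own field with numerator or denominator
    outside the prime, so only the trace of the prime matters. *)
Lemma sameon_loc w M M' x : prm M -> prm M' -> sameon w M M' -> fld w x ->
  (loc M x <-> loc M' x) /\ (mloc M x <-> mloc M' x).
Proof.
suff half M1 M2 : prm M1 -> prm M2 -> sameon w M1 M2 -> fld w x ->
  (loc M1 x -> loc M2 x) /\ (mloc M1 x -> mloc M2 x).
  move=> pM pM' s wx; have [h1 h2] := half _ _ pM pM' s wx.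
  by have [h3 h4] := half _ _ pM' pM (sameon_sym s) wx.
move=> pM pM' s wx.
have [a [b [[Aa Ab] [xa xb] [nab b0] xE]]] := prufer pM x.
have sa := s a (fld_trans wx xa); have sb := s b (fld_trans wx xb).
have nb : loc M1 x -> ~ M1 b.
  move=> lx Mb; have na : ~ M1 a by case: nab.
  apply: (mloc_nloc pM _ _ lx); first by rewrite xE; apply: mulf_neq0; [apply: (prm_nz pM) | apply: invr_neq0].
  by exists b, a; split=> //; rewrite xE invf_div.
split=> [lx|mx].
  by exists a, b; split=> // /sb; apply: nb.
have lx := mloc_loc pM mx; exists a, b; split=> //; last by move/sb; apply: nb.
apply/sa; apply: (mloc_Aint pM) => //.
have -> : a = b * x by rewrite xE mulrC divfK.
by apply: mlocM => //; apply: loc_Aint.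
Qed.

(** Primes are maximal: an [x] in [M'] but not in [M] has a power of itself as inverse modulo [M],
    and the inclusion then puts 1 into [M']. *)
Lemma sameon_incl w M M' : prm M -> prm M' ->
  (forall x, x \in Aint -> fld w x -> M x -> M' x) -> sameon w M M'.
Proof.
move=> pM pM' h x wx; split=> [Mx|M'x]; first by apply: h => //; apply: prmA Mx.
apply: boolp.contrapT => nMx; have Ax := prmA pM' M'x.
have [k Mk] := prm_inv pM Ax nMx; apply: (prm1 pM').
have -> : 1 = x ^+ k * x - (x ^+ k * x - 1) by ring.
apply: (prmB pM').
  by apply: prmZ; rewrite ?rpredX.
apply: h => //; first by rewrite rpredB ?rpredM ?rpredX ?rpred1.
by apply: fldB; [apply: fldM => //; apply: fldX | apply: fld1].
Qed.

Lemma sep2 w M M' : prm M -> prm M' -> ~ sameon w M M' ->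
  exists e, [/\ e \in Aint, fld w e, M (e - 1) & M' e].
Proof.
move=> pM pM' ns.
have [x [Ax wx M'x nMx]] : exists x, [/\ x \in Aint, fld w x, M' x & ~ M x].
  apply: boolp.contrapT => no; apply/ns/sameon_sym/sameon_incl => // x Ax wx M'x.
  by apply: boolp.contrapT => nMx; apply: no; exists x.
have [k Mk] := prm_inv pM Ax nMx.
exists (x ^+ k * x); split=> //; first by rewrite rpredM ?rpredX.
  by apply: fldM => //; apply: fldX.
by apply: prmZ; rewrite ?rpredX.
Qed.

Lemma sepn w M k (Ms : 'I_k -> algC -> Prop) : prm M -> (forall i, prm (Ms i)) ->
  (forall i, ~ sameon w M (Ms i)) ->
  exists e, [/\ e \in Aint, fld w e, M (e - 1) & forall i, Ms i e].
Proof.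
move=> pM pMs ns.
have /exists_fun[f fE] : forall i, exists e, [/\ e \in Aint, fld w e, M (e - 1) & Ms i e].
  by move=> i; apply: sep2.
exists (\prod_i f i); split.
- by rewrite rpred_prod // => i _; case: (fE i).
- by apply: fld_prod => i _; case: (fE i).
- suff [] : \prod_i f i \in Aint /\ M (\prod_i f i - 1) by [].
  elim/big_ind: _ => [|x y [Ax Mx] [Ay My]|i _]; first by rewrite rpred1 subrr; split=> //; apply: prm0.
    split; first by rewrite rpredM.
    have -> : x * y - 1 = x * (y - 1) + (x - 1) by ring.
    by apply: prmD => //; apply: prmZ.
  by case: (fE i).
- move=> i; rewrite (bigD1 i) //=; apply: prmZr => //; last by case: (fE i).
  by rewrite rpred_prod // => j _; case: (fE j).
Qed.

Lemma sepn_strong w M k (Ms : 'I_k -> algC -> Prop) (m : nat) : (0 < m)%N ->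
  prm M -> (forall i, prm (Ms i)) -> (forall i, ~ sameon w M (Ms i)) ->
  exists e, [/\ e \in Aint, fld w e, mloc M ((e - 1) / m%:R) & forall i, mloc (Ms i) (e / m%:R)].
Proof.
move=> m0 pM pMs ns; have [e [Ae we Me Mse]] := sepn pM pMs ns.
have /exists_fun[K KE] : forall i, exists K, forall j, (K <= j)%N -> mloc (Ms i) (e ^+ j / m%:R).
  by move=> i; apply: prm_nil.
(* A high power [e2] of [e] is highly divisible at the [Ms i]; then [1 - (1 - e2) ^ K'] keeps this
   and becomes close to 1 at [M]. *)
pose n := (\max_i K i).+1; pose e2 := e ^+ n.
have Ae2 : e2 \in Aint by rewrite rpredX.
have we2 : fld w e2 by apply: fldX.
have subX y j : y \in Aint -> exists2 c, c \in Aint & (1 - y ^+ j) = (1 - y) * c.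
  move=> Ay; exists (\sum_(i < j) y ^+ i); first by rewrite rpred_sum // => i _; rewrite rpredX.
  by rewrite -opprB subrX1 -mulNr opprB.
have Me2 : M (1 - e2).
  have [c Ac ->] := subX e n Ae; apply: prmZr => //.
  by rewrite -opprB; apply: prmN.
have [K' K'E] := prm_nil pM m0 Me2.
exists (1 - (1 - e2) ^+ K'); split.
- by rewrite rpredB ?rpred1 // rpredX // rpredB ?rpred1.
- by apply: fldB; [apply: fld1 | apply/fldX/fldB => //; apply: fld1].
- have -> : (1 - (1 - e2) ^+ K' - 1) / m%:R = - ((1 - e2) ^+ K' / m%:R) by ring.
  by apply: mlocN => //; apply: K'E.
- move=> i; have [c Ac ->] : exists2 c, c \in Aint & 1 - (1 - e2) ^+ K' = (1 - (1 - e2)) * c.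
    by apply: subX; rewrite rpredB ?rpred1.
  have -> : (1 - (1 - e2)) * c / m%:R = c * (e2 / m%:R) by ring.
  apply: mlocM => //; first exact: loc_Aint.
  by apply: KE; rewrite ltnW // ltnS; apply: leq_bigmax.
Qed.

(** Transitivity of the Galois group on the primes above one prime of [fld p]. Otherwise some [x] in
    [M'] has all its conjugates over [fld p] congruent to 1 modulo [M], and its relative norm
    separates the two traces. *)
Lemma prm_trans p w M M' : prm M -> prm M' -> sameon p M M' ->
  exists u : aut, u p = p /\ sameon w M' (pim u M).
Proof.
move=> pM pM' s; apply: boolp.contrapT => no.
have [k [f [fp finj fsurj]]] := fld_orbit p w.
have [e [Ae we Me Mse]] : exists e, [/\ e \in Aint, fld w e, M' (e - 1) &
    forall i, pim (autV (f i)) M e].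
  apply: sepn => // [i|i h]; first exact: prm_pim.
  by apply: no; exists (autV (f i)); split=> //; rewrite -{1}(fp i) autVK.
have Mf i : M (f i e) by have := Mse i; rewrite -{1}[e](autVK (f i)) pimE.
pose x := 1 - e.
have Ax : x \in Aint by rewrite rpredB ?rpred1.
have wx : fld w x by apply: fldB => //; apply: fld1.
have M'x : M' x by rewrite /x -opprB; apply: prmN.
have [Np _] := orbit_prod fp finj fsurj wx.
have M'N : M' (\prod_i f i x).
  have [i iE] := fsurj idfun erefl.
  rewrite (bigD1 i) //=; apply: prmZr => //.
    by rewrite rpred_prod // => j _; rewrite Aint_aut.
  by rewrite -(fldE (u := idfun) (v := f i) wx iE).
have /(prm_prod pM) : M (\prod_i f i x) by apply/s.
case=> [i|i _ Mfx]; first by rewrite Aint_aut.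
apply: (prm1 pM); have -> : 1 = f i x + f i e.
  by rewrite -rmorphD /x subrK rmorph1.
by apply: prmD.
Qed.

(** * Norms and bounds *)
Definition emb (b : algC) : 'I_(deg b) -> aut :=
  sval (boolp.constructive_indefinite_description (auts_enum b)).

Section FieldNorm.
Variable b : algC.

Lemma emb_rt (i : 'I_(deg b)) : emb i b = (conjs b)`_i.
Proof. by rewrite /emb; case: boolp.constructive_indefinite_description. Qed.
Lemma emb_inj : injective (fun i : 'I_(deg b) => emb i b).
Proof.
move=> i j /eqP; rewrite !emb_rt nth_uniq ?conjs_uniq // => /eqP; exact: val_inj.
Qed.
Lemma emb_surj (u : aut) : exists i : 'I_(deg b), u b = emb i b.
Proof.
have h : (index (u b) (conjs b) < deg b)%N by rewrite index_mem aut_conjs.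
by exists (Ordinal h); rewrite emb_rt nth_index ?aut_conjs.
Qed.

Definition fnorm x := \prod_(i < deg b) emb i x.

Lemma fnormM x y : fnorm (x * y) = fnorm x * fnorm y.
Proof. by rewrite -big_split; apply: eq_bigr => i _; rewrite rmorphM. Qed.
Lemma fnorm_eq0 x : (fnorm x == 0) = (x == 0).
Proof.
apply/prodf_eq0/idP => [[i _]|/eqP ->]; first by rewrite fmorph_eq0.
by have [i _] := emb_surj idfun; exists i; rewrite ?rmorph0.
Qed.
Lemma fnorm_rat x : fld b x -> fnorm x \in Crat.
Proof.
move=> bx; apply: fixQ => u.
have [h _] := @orbit_prod 0 b (deg b) (@emb b) x (fun i => rmorph0 _) emb_inj (fun v _ => emb_surj v) bx.
by apply: h; rewrite rmorph0.
Qed.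
Lemma fnorm_int x : x \in Aint -> fld b x -> fnorm x \in Num.int.
Proof.
move=> Ax bx; apply: Cint_rat_Aint; first exact: fnorm_rat.
by rewrite rpred_prod // => i _; rewrite Aint_aut.
Qed.
Lemma fnorm_dvd x : x \in Aint -> fld b x ->
  exists y, [/\ y \in Aint, fld b y & fnorm x = x * y].
Proof.
move=> Ax bx; have [i iE] := emb_surj idfun.
have ex : emb i x = x by rewrite -(fldE (u := idfun) bx iE).
have e : fnorm x = x * \prod_(j | j != i) emb j x by rewrite /fnorm (bigD1 i) //= ex.
case: (eqVneq x 0) => [x0|x0].
  by exists 0; split; rewrite ?rpred0 ?mulr0 //; [apply: fld0 | rewrite e x0 mul0r].
exists (\prod_(j | j != i) emb j x); split=> //.
  by rewrite rpred_prod // => j _; rewrite Aint_aut.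
have -> : \prod_(j | j != i) emb j x = fnorm x / x by rewrite e mulrC mulKf.
by apply: fldM; [apply/fld_rat/fnorm_rat | apply: fldV].
Qed.
Lemma fnorm_small x : x \in Aint -> fld b x -> `|fnorm x| < 1 -> x = 0.
Proof.
move=> Ax bx; have := fnorm_int Ax bx => /intrP[z zE].
rewrite zE -intr_norm -[1]/(1%:~R) ltr_int => z1.
apply/eqP; rewrite -fnorm_eq0 zE intr_eq0 -normr_eq0.
by case: (`|z|) (normr_ge0 z) z1 => [[|n]|] //.
Qed.
End FieldNorm.

Lemma Aint_small x : x \in Aint -> (forall u : aut, `|u x| < 1) -> x = 0.
Proof.
move=> Ax h; apply: (@fnorm_small x) => //.
have [i _] := @emb_surj x idfun.
rewrite normr_prod (bigD1 i) //=.
apply: le_lt_trans (h (emb i)); rewrite -[X in _ <= X]mulr1 ler_wpM2l //.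
by apply: prodr_ile1 => j _; rewrite normr_ge0 ltW.
Qed.

Lemma natC_bound (x : algC) : exists n : nat, `|x| < n%:R.
Proof.
by exists (Num.bound `|x|); apply: archi_boundP.
Qed.

Lemma bounds (I : finType) (x : I -> algC) : exists n : nat, forall i, `|x i| <= n%:R.
Proof.
have /exists_fun[m mP] : forall i, exists m : nat, `|x i| < m%:R by move=> i; apply: natC_bound.
exists (\sum_i m i)%N => i; apply/ltW/(lt_le_trans (mP i)).
by rewrite ler_nat (bigD1 i) //= leq_addr.
Qed.

Lemma bounded_finite b (B : nat) : exists (T : finType) (cl : algC -> T),
  forall x y, x \in Aint -> y \in Aint -> fld b x -> fld b y ->
  (forall u : aut, `|u x| <= B%:R) -> (forall u : aut, `|u y| <= B%:R) ->
  cl x = cl y -> x = y.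
Proof.
have [s [W [_ _ cW]]] := fld_coord b; set n := deg b in s W cW *.
have [D D0 DW] := Aint_denoms (fun ij : 'I_n * 'I_n => W ij.1 ij.2).
have [C CW] := bounds (fun ij : 'I_n * 'I_n => D%:R * W ij.1 ij.2).
pose r x j := \sum_i s i x * W i j.
pose L := (n * (B * C))%N.
have /exists_fun[k kE] : forall x, exists k : 'I_n -> int,
    x \in Aint -> fld b x -> (forall u : aut, `|u x| <= B%:R) ->
    forall j, (k j)%:~R = D%:R * r x j /\ (absz (k j) <= L)%N.
  move=> x; case: (boolp.EM (x \in Aint /\ fld b x)) => [[Ax ax]|no]; last first.
    by exists (fun=> 0) => Ax ax; case: no.
  have /exists_fun[k kE] : forall j, exists z : int, z%:~R = D%:R * r x j.
    move=> j; have : D%:R * r x j \in Num.int.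
      apply: Cint_rat_Aint; first by apply: rpredM; [exact: rpred_nat | case: (cW x ax) => h _; apply: h].
      rewrite mulr_sumr rpred_sum // => i _; rewrite mulrCA rpredM ?Aint_aut //.
      exact: (DW (i, j)).
    by move/intrP => [z ->]; exists z.
  exists k => _ _ bx j; split=> //.
  rewrite -(ler_nat algC) natr_absz intr_norm kE mulr_sumr.
  apply: le_trans (ler_norm_sum _ _ _) _.
  have -> : L%:R = \sum_(i < n) (B * C)%:R :> algC by rewrite sumr_const card_ord /L natrM mulr_natl.
  apply: ler_sum => i _; rewrite mulrCA normrM natrM.
  by apply: ler_pM => //; exact: (CW (i, j)).
exists ({ffun 'I_n -> 'I_(L + L).+1}), (fun x => [ffun j => inord (absz (k x j + L%:Z))]).
move=> x y Ax Ay bx byy Bx By /ffunP e.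
have ke j : k x j = k y j.
  have := congr1 val (e j); rewrite !ffunE /=.
  have [_ h1] := kE x Ax bx Bx j; have [_ h2] := kE y Ay byy By j.
  rewrite !inordK; lia.
have [_ /(_ idfun)/= xE] := cW x bx; have [_ /(_ idfun)/= yE] := cW y byy.
rewrite xE yE; apply: eq_bigr => j _; congr (_ * _).
have D0' : D%:R != 0 :> algC by rewrite pnatr_eq0 -lt0n.
apply: (mulfI D0').
have [<- _] := kE x Ax bx Bx j; have [<- _] := kE y Ay byy By j.
by rewrite ke.
Qed.

(** All powers of [x] lie in a finite set depending on [b] only, so two among the first [#|T| + 1]
    agree; the factorial makes the exponent uniform in [x]. *)
Lemma kronecker b : exists2 H : nat, (0 < H)%N &
  forall x, x \in Aint -> fld b x -> (forall u : aut, `|u x| = 1) -> x ^+ H = 1.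
Proof.
have [T [cl clE]] := bounded_finite b 1.
exists (#|T|)`!; first exact: fact_gt0.
move=> x Ax bx ux.
have x0 : x != 0 by have := ux idfun; rewrite /= => h; rewrite -normr_eq0 h oner_eq0.
pose f (i : 'I_#|T|.+1) := cl (x ^+ i).
have : ~ injective f by move/leq_card; rewrite card_ord ltnn.
have key (i j : 'I_#|T|.+1) : (i < j)%N -> f i = f j -> x ^+ (#|T|)`! = 1.
  move=> ij fij.
  have e : x ^+ i = x ^+ j.
    apply: clE => //; rewrite ?rpredX //; try exact: fldX;
    by move=> u; rewrite rmorphXn normrX ux expr1n.
  have e1 : x ^+ (j - i) = 1.
    have xi0 : x ^+ i != 0 by rewrite expf_eq0 negb_and x0 orbT.
    apply: (mulfI xi0); rewrite mulr1 -exprD subnKC ?(ltnW ij) //.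
  have /dvdnP[c ->] : ((j - i) %| (#|T|)`!)%N.
    by apply: dvdn_fact; rewrite subn_gt0 ij /= (leq_trans (leq_subr _ _)) // -ltnS.
  by rewrite mulnC exprM e1 expr1n.
move=> ninj; apply: boolp.contrapT => no; apply: ninj => i j fij.
apply: val_inj; case: (ltngtP i j) => // lt; case: no.
  exact: key lt fij.
exact: key lt (esym fij).
Qed.

(** * Congruences and unramified primes *)
Definition acong (m : nat) (x y : algC) := (x - y) / m%:R \in Aint.

Section Cong.
Variable m : nat.
Lemma cg_refl x : acong m x x. Proof. by rewrite /acong subrr mul0r rpred0. Qed.
Lemma cg_sym x y : acong m x y -> acong m y x.
Proof. by rewrite /acong -opprB mulNr rpredN. Qed.
Lemma cg_trans y x z : acong m x y -> acong m y z -> acong m x z.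
Proof. by rewrite /acong => h1 h2; have := rpredD h1 h2; rewrite -mulrDl addrA subrK. Qed.
Lemma cgD x y x' y' : acong m x y -> acong m x' y' -> acong m (x + x') (y + y').
Proof.
rewrite /acong => h1 h2; have := rpredD h1 h2; rewrite -mulrDl.
by have -> : x - y + (x' - y') = x + x' - (y + y') by ring.
Qed.
Lemma cgM x y x' y' : y \in Aint -> x' \in Aint -> acong m x y -> acong m x' y' -> acong m (x * x') (y * y').
Proof.
rewrite /acong => Ax Ay' h1 h2.
have -> : (x * x' - y * y') / m%:R = (x - y) / m%:R * x' + y * ((x' - y') / m%:R) by ring.
by rewrite rpredD // rpredM.
Qed.
Lemma cgX x y n : x \in Aint -> y \in Aint -> acong m x y -> acong m (x ^+ n) (y ^+ n).
Proof.
by move=> Ax Ay h; elim: n => [|n IH]; [rewrite !expr0; apply: cg_refl | rewrite !exprS; apply: cgM; rewrite ?rpredX].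
Qed.
Lemma cg_M M x y : (0 < m)%N -> prm M -> M m%:R -> acong m x y -> M y -> M x.
Proof.
move=> m0 pM Mm h My; have m0' : m%:R != 0 :> algC by rewrite pnatr_eq0 -lt0n.
have -> : x = (x - y) / m%:R * m%:R + y by rewrite divfK // subrK.
by apply: prmD => //; apply: prmZ.
Qed.
End Cong.

Section Frobenius.
Variable q : nat.
Hypothesis pq : prime q.
Let q0 : q%:R != 0 :> algC. Proof. by rewrite pnatr_eq0 -lt0n prime_gt0. Qed.

Lemma frobD x y : x \in Aint -> y \in Aint -> acong q ((x + y) ^+ q) (x ^+ q + y ^+ q).
Proof.
move=> Ax Ay; rewrite /acong exprDn.
rewrite (bigD1 ord0) //= (bigD1 ord_max) /=; last by rewrite -val_eqE /= gtn_eqF ?prime_gt0.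
rewrite subn0 subnn bin0 binn !expr0 mulr1 mul1r !mulr1n.
set S := \sum_(i < _ | _) _.
have -> : x ^+ q + (y ^+ q + S) - (x ^+ q + y ^+ q) = S by ring.
rewrite /S mulr_suml rpred_sum // => i /andP[i0 iq].
have /dvdnP[c ->] : (q %| 'C(q, i))%N.
  apply: prime_dvd_bin => //; rewrite lt0n -[_ == 0%N](inj_eq val_inj i ord0) i0 /=.
  by rewrite ltn_neqAle -ltnS ltn_ord andbT -[_ == q](inj_eq val_inj i ord_max).
rewrite -mulr_natr natrM mulrA mulfK //.
by rewrite !rpredM ?rpredX ?rpred_nat.
Qed.

Lemma frobN x : x \in Aint -> acong q ((- x) ^+ q) (- x ^+ q).
Proof.
move=> Ax; have ANx : - x \in Aint by rewrite rpredN.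
have := cg_sym (frobD Ax ANx).
rewrite subrr expr0n gtn_eqF ?prime_gt0 // /acong subr0 => h1.
by rewrite /acong opprK addrC.
Qed.

Lemma frob_int (c : int) : acong q (c%:~R ^+ q) c%:~R.
Proof.
have nat_case n : acong q (n%:R ^+ q) n%:R.
  elim: n => [|n IH]; first by rewrite expr0n gtn_eqF ?prime_gt0 //; apply: cg_refl.
  rewrite -addn1 natrD; apply: cg_trans (frobD _ _) _; rewrite ?rpred_nat ?rpred1 //.
  by apply: cgD => //; rewrite expr1n; apply: cg_refl.
case: c => n; first exact: nat_case.
rewrite NegzE mulrNz; apply: cg_trans (frobN _) _; first by rewrite rpred_nat.
by rewrite /acong -opprD mulNr rpredN; apply: nat_case.
Qed.

Lemma ev_Aint (p : {poly int}) z : z \in Aint -> (pZtoC p).[z] \in Aint.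
Proof.
move=> Az; elim/poly_ind: p => [|p c IH]; first by rewrite rmorph0 horner0 rpred0.
by rewrite rmorphD rmorphM /= map_polyX map_polyC /= !hornerE rpredD ?rpredM ?Aint_int.
Qed.

Lemma frob_poly (p : {poly int}) z : z \in Aint -> acong q ((pZtoC p).[z] ^+ q) (pZtoC p).[z ^+ q].
Proof.
move=> Az; elim/poly_ind: p => [|p c IH].
  by rewrite rmorph0 !horner0 expr0n gtn_eqF ?prime_gt0 //; apply: cg_refl.
rewrite rmorphD rmorphM /= map_polyX map_polyC /= !hornerE.
have Ap := ev_Aint p Az.
apply: cg_trans (frobD _ _) _; rewrite ?rpredM ?Aint_int //.
apply: cgD; last exact: frob_int.
rewrite exprMn; apply: cgM; rewrite ?rpredX ?ev_Aint ?rpredX //; exact: cg_refl.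
Qed.

Lemma frob_polyQ (p : {poly int}) z j : z \in Aint ->
  acong q ((pZtoC p).[z] ^+ (q ^ j)%N) (pZtoC p).[z ^+ (q ^ j)%N].
Proof.
move=> Az; elim: j => [|j IH]; first by rewrite expn0 !expr1; apply: cg_refl.
rewrite expnSr !exprM; apply: cg_trans (frob_poly _ _); rewrite ?rpredX //.
by apply: cgX; rewrite ?rpredX ?ev_Aint ?rpredX.
Qed.

Lemma frobBQ x y j : x \in Aint -> y \in Aint ->
  acong q ((x - y) ^+ (q ^ j)%N) (x ^+ (q ^ j)%N - y ^+ (q ^ j)%N).
Proof.
move=> Ax Ay; elim: j => [|j IH]; first by rewrite expn0 !expr1; apply: cg_refl.
have AxQ := rpredX (q ^ j)%N Ax; have AyQ := rpredX (q ^ j)%N Ay.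
rewrite expnSr !exprM; apply: (@cg_trans _ ((x ^+ (q ^ j) - y ^+ (q ^ j)) ^+ q)).
  by apply: cgX; rewrite ?rpredX ?rpredB.
apply: cg_trans (frobD _ _) _; rewrite ?rpredN //.
by apply: cgD; [apply: cg_refl | apply: frobN].
Qed.

Lemma ev_sub (p : {poly int}) y z : y \in Aint -> z \in Aint ->
  exists2 k, k \in Aint & (pZtoC p).[y] - (pZtoC p).[z] = (y - z) * k.
Proof.
move=> Ay Az; elim/poly_ind: p => [|p c [k Ak kE]].
  by exists 0; rewrite ?rpred0 // rmorph0 !horner0 subrr mulr0.
exists (k * y + (pZtoC p).[z]); first by rewrite rpredD ?rpredM ?ev_Aint.
rewrite rmorphD rmorphM /= map_polyX map_polyC /= !hornerE.
have -> : (pZtoC p).[y] = (pZtoC p).[z] + (y - z) * k by rewrite -kE; ring.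
by ring.
Qed.
End Frobenius.

Lemma Fp_int_eq0 (q : nat) (c : int) : prime q -> (c%:~R : 'F_q) = 0 -> (q %| c)%Z.
Proof.
move=> pq; have cq := pchar_Fp pq.
have h n : ((n%:R : 'F_q) == 0) = (q %| n)%N by rewrite -(dvdn_pcharf cq).
by case: c => n; rewrite ?NegzE ?mulrNz => /eqP; rewrite ?oppr_eq0 h dvdzE.
Qed.
Lemma Fp_poly_eq0 (q : nat) (p : {poly int}) : prime q ->
  map_poly (intr : int -> 'F_q) p = 0 -> exists h : {poly int}, p = q%:Z *: h.
Proof.
move=> pq e; exists (map_poly (fun c => (c %/ q%:Z)%Z) p).
apply/polyP => i; rewrite coefZ coef_map_id0 ?div0z // mulrC divzK //.
by apply: Fp_int_eq0 => //; have := congr1 (fun r : {poly 'F_q} => r`_i) e; rewrite coef_map coef0.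
Qed.

Section Unramified.
Variables (f : {poly int}) (b : algC).
Hypothesis fb : minCpoly b = pZtoC f.
Hypothesis Ab : b \in Aint.
Notation n := (deg b).
Notation rt i := (emb i b).

Lemma rt_Aint (i : 'I_n) : rt i \in Aint. Proof. by rewrite Aint_aut. Qed.

Lemma f_prod z : (pZtoC f).[z] = \prod_(i < n) (z - rt i).
Proof.
rewrite -fb minCpoly_conjs horner_prod (big_nth 0) big_mkord.
by apply: eq_bigr => i _; rewrite !hornerE emb_rt.
Qed.
Lemma f_rt (i : 'I_n) : (pZtoC f).[rt i] = 0.
Proof. by rewrite f_prod (bigD1 i) //= subrr mul0r. Qed.

Lemma ev_emb (p : {poly int}) (u : aut) z : u (pZtoC p).[z] = (pZtoC p).[u z].
Proof.
rewrite -horner_map -map_poly_comp; congr (_.[_]).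
by apply: eq_map_poly => c /=; rewrite rmorph_int.
Qed.

(** [D] is the absolute value of the norm of the product of all differences of conjugates, so away
    from [D] the conjugates of [b] stay distinct modulo [M]. *)
Lemma sep_ex : exists2 D : nat, (0 < D)%N & forall q M, prime q -> prm M -> M q%:R ->
  ~~ (q %| D)%N -> forall i j : 'I_n, i != j -> ~ M (rt i - rt j).
Proof.
pose x := \prod_(i < n) \prod_(j < n | j != i) (rt i - rt j).
have Ax : x \in Aint.
  by rewrite !rpred_prod // => i _; rewrite rpred_prod // => j _; rewrite rpredB ?rt_Aint.
have x0 : x != 0.
  apply/prodf_neq0 => i _; apply/prodf_neq0 => j ji; rewrite subr_eq0.
  by apply: contra_neq ji => /emb_inj.
have [y [Ay _ yE]] := fnorm_dvd Ax (@fld_id x).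
have /intrP[z zE] := fnorm_int Ax (@fld_id x).
exists (absz z).
  by rewrite absz_gt0 -(intr_eq0 algC) -zE fnorm_eq0.
move=> q M pq pM Mq /negP nq i j ij Mij; apply: nq.
suff : M (z%:~R) by move/(prm_intE pM _ pq Mq); rewrite dvdzE.
rewrite -zE yE; apply: prmZr => //.
rewrite /x (bigD1 i) //= (bigD1 j) ?[j == _]eq_sym //= -mulrA.
apply: prmZr => //; rewrite rpredM // rpred_prod // => k _; rewrite ?rpred_prod // => *; rewrite ?rpred_prod // => *;
by rewrite ?rpredB ?rt_Aint.
Qed.

Variables (q : nat) (M : algC -> Prop).
Hypotheses (pq : prime q) (pM : prm M) (Mq : M q%:R).
Hypothesis sep : forall i j : 'I_n, i != j -> ~ M (rt i - rt j).
Let q0 : q%:R != 0 :> algC. Proof. by rewrite pnatr_eq0 -lt0n prime_gt0. Qed.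

(** The values [z ^ (q ^ i)] repeat modulo [q]; as raising to the power [q] is additive modulo [q],
    a common [q ^ i]-th power can be removed modulo the prime [M]. *)
Lemma frob_stable z : z \in Aint -> exists2 j, (0 < j)%N & M (z ^+ (q ^ j)%N - z).
Proof.
move=> Az; have [T [cl clE]] := finite_residues z (prime_gt0 pq).
pose g (i : 'I_#|T|.+1) := cl (z ^+ (q ^ i)%N).
have key (i j : 'I_#|T|.+1) : (i < j)%N -> g i = g j -> exists2 j, (0 < j)%N & M (z ^+ (q ^ j)%N - z).
  move=> ij gij; exists (j - i)%N; first by rewrite subn_gt0.
  have Az' := rpredX (q ^ (j - i))%N Az.
  apply: (@prmX _ pM _ (q ^ i)%N); first by rewrite rpredB.
  apply: cg_M (prime_gt0 pq) pM Mq (frobBQ pq i Az' Az) _.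
  rewrite -exprM -expnD subnK ?(ltnW ij) //.
  have : acong q (z ^+ (q ^ j)) (z ^+ (q ^ i)).
    by apply/cg_sym/clE; rewrite ?rpredX //; apply/fldX/fld_id.
  rewrite /acong => h; rewrite -(divfK q0 (_ - _)); exact: prmZ.
have : ~ injective g by move/leq_card; rewrite card_ord ltnn.
move=> ninj; apply: boolp.contrapT => no; apply: ninj => i j gij.
apply: val_inj; case: (ltngtP i j) => // lt; case: no.
  exact: key lt gij.
exact: key lt (esym gij).
Qed.

(* Since q is unramified, q is a uniformiser at every prime above it. *)
Lemma unram_loc (p : {poly int}) (i : 'I_n) : M (pZtoC p).[rt i] -> loc M ((pZtoC p).[rt i] / q%:R).
Proof.
set z := rt i; set x := _.[z] => Mx.
have Az : z \in Aint := rt_Aint i.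
have Ax : x \in Aint by apply: ev_Aint.
have [j j0 Mj] := frob_stable Az; set Q := (q ^ j)%N in Mj.
have AzQ : z ^+ Q \in Aint by rewrite rpredX.
have l1 : loc M ((z ^+ Q - z) / q%:R).
  have h : acong q ((pZtoC f).[z] ^+ Q) (pZtoC f).[z ^+ Q] by apply: frob_polyQ.
  have Q0 : (0 < q ^ j)%N by rewrite expn_gt0 prime_gt0.
  rewrite f_rt expr0n (gtn_eqF Q0) /= in h.
  move: h; rewrite /acong sub0r mulNr rpredN f_prod (bigD1 i) //= -/z.
  (* Of the factors of [f (z ^ Q)], a number divisible by [q], only [z ^ Q - z] lies in [M]; it
     alone carries the divisibility. *)
  set P := \prod_(k < n | _) _ => h.
  have nP : ~ M P.
    case/(prm_prod pM) => [k|k ki Mk]; first by rewrite rpredB ?rt_Aint.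
    apply: (sep ki).
    have -> : rt k - rt i = (z ^+ Q - z) - (z ^+ Q - rt k) by rewrite /z; ring.
    exact: prmB.
  have AP : P \in Aint by rewrite rpred_prod // => k _; rewrite rpredB ?rt_Aint.
  exists ((z ^+ Q - z) * P / q%:R), P; split=> //.
  by rewrite -mulrA [P / _]mulrC mulrA mulfK //; apply: (prm_nz pM).
have l2 : loc M ((x ^+ Q - x) / q%:R).
  have h : acong q (x ^+ Q) (pZtoC p).[z ^+ Q] by apply: frob_polyQ.
  have [k Ak kE] := ev_sub p AzQ Az.
  have -> : (x ^+ Q - x) / q%:R = (x ^+ Q - (pZtoC p).[z ^+ Q]) / q%:R + (z ^+ Q - z) / q%:R * k.
    by rewrite mulrAC -kE -/x; ring.
  exact: (locD pM (loc_Aint pM h) (locM pM l1 (loc_Aint pM Ak))).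
have Q1 : (1 < Q)%N by rewrite -{1}(exp1n j) ltn_exp2r // prime_gt1.
have nu : ~ M (x ^+ Q.-1 - 1).
  move=> h; apply: (prm1 pM); have -> : 1 = x ^+ Q.-1 - (x ^+ Q.-1 - 1) by ring.
  apply: (prmB pM) => //.
  have -> : Q.-1 = Q.-2.+1 by move: Q1; clear; lia.
  exact: prmXn.
have Au : x ^+ Q.-1 - 1 \in Aint by rewrite rpredB ?rpredX ?rpred1.
have u0 := prm_nz pM nu.
(* Here [x ^ Q - x] is [x] times a unit at [M]. *)
have -> : x / q%:R = (x ^+ Q - x) / q%:R * (x ^+ Q.-1 - 1)^-1.
  have -> : x ^+ Q = x * x ^+ Q.-1 by rewrite -exprS prednK // ltnW.
  by field; rewrite q0 u0.
apply: locM => //; exists 1, (x ^+ Q.-1 - 1); split; rewrite ?rpred1 //.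
by rewrite div1r.
Qed.

Lemma int_loc (z : int) d : loc M (z%:~R / (q%:R ^+ d)) -> (q%:Z ^+ d %| z)%Z.
Proof.
elim: d => [|d IH] h; first by rewrite expr0 dvd1z.
have /IH/dvdzP[w wE] : loc M (z%:~R / q%:R ^+ d).
  have -> : z%:~R / q%:R ^+ d = z%:~R / q%:R ^+ d.+1 * q%:R :> algC.
    by rewrite exprS invfM mulrA mulrAC divfK // mulrC mulrA.
  by apply: locM => //; apply/loc_nat.
have lw : loc M (w%:~R / q%:R).
  move: h; rewrite wE rmorphM rmorphXn /= exprS invfM mulrA.
  have -> : w%:~R * q%:~R ^+ d / q%:R = w%:~R / q%:R * q%:R ^+ d :> algC by rewrite mulrAC.
  by rewrite mulfK // expf_eq0 (negPf q0) andbF.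
have Mw : M w%:~R.
  apply: (mloc_Aint pM); first by rewrite Aint_int.
  rewrite -(divfK q0 w%:~R); apply: mlocM => //; exact: mloc_M.
move/(prm_intE pM _ pq Mq): Mw => /dvdzP[v vE].
by rewrite wE vE -mulrA -exprS dvdz_mull.
Qed.
Lemma loc_int (z : int) d : (q%:Z ^+ d %| z)%Z -> loc M (z%:~R / (q%:R ^+ d)).
Proof.
case/dvdzP => w ->; rewrite rmorphM rmorphXn /= mulfK.
  by apply: loc_Aint => //; rewrite Aint_int.
by rewrite expf_eq0 (negPf q0) andbF.
Qed.

(** Each conjugate in [S] is divisible by [q] at [M], as [q] is a uniformiser there, and an integer
    divisible by [q ^ d] at one prime above [q] is so in the integers. *)
Lemma norm_dvd (p : {poly int}) (z : int) (S : {set 'I_n}) :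
  fnorm b (pZtoC p).[b] = z%:~R ->
  (forall i, i \in S -> M (pZtoC p).[rt i]) -> (q%:Z ^+ #|S| %| z)%Z.
Proof.
move=> zE h; apply: int_loc; rewrite -zE /fnorm (bigID (mem S)) /=.
have -> : q%:R ^+ #|S| = \prod_(i in S) q%:R :> algC by rewrite prodr_const.
rewrite mulrAC -prodf_div; apply: locM => //.
  by apply: loc_prod => // i iS; rewrite ev_emb; apply/unram_loc/h.
by apply: loc_prod => // i _; apply: loc_Aint => //; rewrite Aint_aut ev_Aint.
Qed.

(** Degree one is read off from uniqueness: [z ^ q] is congruent to some conjugate [rt k] with
    [p (rt k)] in [M], so [k = i] and [z ^ q] is congruent to [z]; the factorisation of [X^q - X]
    modulo [q] then gives an integer congruent to [z]. *)
Lemma root_deg1 (p : {poly int}) (i : 'I_n) : M (pZtoC p).[rt i] ->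
  (forall j, M (pZtoC p).[rt j] -> j = i) ->
  exists r : nat, [/\ (r < q)%N, M (rt i - r%:R) & (q %| f.[r%:Z])%Z].
Proof.
move=> Mi uniq_i; set z := rt i.
have Az : z \in Aint := rt_Aint i.
have Mzq : M (z ^+ q - z).
  have h : acong q ((pZtoC f).[z] ^+ q) (pZtoC f).[z ^+ q] by apply: frob_poly.
  rewrite f_rt expr0n gtn_eqF ?prime_gt0 //= in h.
  have : M (pZtoC f).[z ^+ q] by apply: cg_M (prime_gt0 pq) pM Mq (cg_sym h) (prm0 pM).
  rewrite f_prod => /(prm_prod pM)[k|k _ Mk]; first by rewrite rpredB ?rpredX ?rt_Aint.
  suff ki : k = i by rewrite ki in Mk.
  apply: uniq_i.
  have h2 : acong q ((pZtoC p).[z] ^+ q) (pZtoC p).[z ^+ q] by apply: frob_poly.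
  have M2 : M (pZtoC p).[z ^+ q].
    apply: cg_M (prime_gt0 pq) pM Mq (cg_sym h2) _.
    by rewrite -(prednK (prime_gt0 pq)); apply: prmXn.
  have [k' Ak' k'E] := ev_sub p (rpredX q Az) (rt_Aint k).
  have -> : (pZtoC p).[rt k] = (pZtoC p).[z ^+ q] - (z ^+ q - rt k) * k' by rewrite -k'E; ring.
  by apply: prmB => //; apply: prmZr.
have [h hE] : exists h : {poly int}, 'X^q - 'X - \prod_(a < q) ('X - a%:Z%:P) = q%:Z *: h.
  apply: (Fp_poly_eq0 pq); rewrite !rmorphB /= map_polyXn map_polyX rmorph_prod.
  have -> : \prod_(a < q) map_poly (intr : int -> 'F_q) ('X - (a%:Z)%:P) = \prod_(x : 'F_q) ('X - x%:P).
    have cq : (Zp_trunc (pdiv q)).+2 = q by rewrite Fp_cast.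
    rewrite -(big_mkord xpredT (fun a => map_poly (intr : int -> 'F_q) ('X - (a%:Z)%:P))).
    rewrite -[X in index_iota 0 X]cq big_mkord; apply: eq_bigr => x _.
    rewrite rmorphB /= map_polyX map_polyC /=; congr ('X - _%:P).
    exact: natr_Zp.
  by rewrite -finField_genPoly card_Fp // subrr.
have : M (\prod_(a < q) (z - a%:R)).
  have := congr1 (fun p : {poly int} => (pZtoC p).[z]) hE.
  rewrite !rmorphB /= map_polyXn map_polyX rmorph_prod hornerD hornerN horner_prod !hornerE.
  rewrite (eq_bigr (fun a : 'I_q => z - a%:R)) => [e|a _]; last first.
    by rewrite rmorphB /= map_polyX map_polyC !hornerE.
  have -> : \prod_(a < q) (z - a%:R) = z ^+ q - z - (pZtoC (q%:Z *: h)).[z] by rewrite -e; ring.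
  apply: prmB => //; rewrite map_polyZ /= hornerZ; apply: prmZr => //; exact: ev_Aint.
case/(prm_prod pM) => [a|r _ Mr]; first by rewrite rpredB ?rpred_nat.
exists r; split=> //.
apply/(prm_intE pM _ pq Mq).
have [k Ak kE] := ev_sub f Az (rpred_nat _ r : r%:R \in Aint).
have -> : (f.[r%:Z])%:~R = (pZtoC f).[r%:R] by rewrite -[r%:R in RHS]/(r%:Z%:~R) horner_map.
have -> : (pZtoC f).[r%:R] = - ((z - r%:R) * k) by rewrite -kE f_rt sub0r opprK.
by apply: prmN => //; apply: prmZr.
Qed.
End Unramified.

(** * Counting roots modulo primes *)
Lemma card_sets (T : finType) : #|{: {set T}}| = (2 ^ #|T|)%N.
Proof.
by rewrite -(cardsT T) -card_powerset -[LHS]cardsT; apply: eq_card => A; rewrite !inE subsetT.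
Qed.

Lemma floor_root n N : (0 < n)%N -> exists s, (s ^ n <= N < s.+1 ^ n)%N.
Proof.
move=> n0; elim: N => [|N [s /andP[h1 h2]]].
  by exists 0%N; rewrite exp0n // exp1n.
case: (ltnP N.+1 (s.+1 ^ n)%N) => h.
  by exists s; rewrite h leqW.
exists s.+1; rewrite h /=; apply: leq_trans (_ : (s.+1 ^ n).+1 <= _)%N; first by rewrite ltnS.
by rewrite ltn_exp2r.
Qed.

(** Moduli are treated one after the other, each costing its size, so repeated moduli are harmless:
    later, several roots modulo one prime occur together. *)
Lemma pigeon (T : finType) (I : eqType) (q : I -> nat) (h : I -> T -> int) (l : seq I) (A : {set T}) :
  (forall x, x \in l -> 0 < q x)%N -> (\prod_(x <- l) q x < #|A|)%N ->
  exists a a', [/\ a \in A, a' \in A, a != a' & forall x, x \in l -> (q x %| h x a - h x a')%Z].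
Proof.
elim: l A => [|x l IH] A q0 hA.
  move: hA; rewrite big_nil => /card_gt1P[a [a' [aA a'A aa']]].
  by exists a, a'.
have qx : (0 < q x)%N by apply: q0; rewrite mem_head.
pose B (c : 'I_(q x)) := [set a in A | (h x a %% q x)%Z == c%:Z].
have [c hc] : exists c, (\prod_(y <- l) q y < #|B c|)%N.
  apply/existsP; apply: contraLR hA; rewrite negb_exists => /forallP no.
  rewrite -leqNgt big_cons.
  have -> : #|A| = (\sum_c #|B c|)%N.
    have [g gE] : exists g : T -> 'I_(q x), forall a, (h x a %% q x)%Z = (g a)%:Z.
      have qz : (q x)%:Z != 0 by rewrite -lt0n.
      have lt a : (absz (h x a %% q x)%Z < q x)%N.
        by rewrite -ltz_nat gez0_abs ?modz_ge0 // ltz_pmod.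
      by exists (fun a => Ordinal (lt a)) => a /=; rewrite gez0_abs ?modz_ge0.
    rewrite -sum1_card (partition_big g xpredT) //=; apply: eq_bigr => c _.
    rewrite -sum1_card; apply: eq_bigl => a; rewrite inE gE.
    by rewrite eqz_nat -val_eqE.
  rewrite -[X in (_ <= X * _)%N](card_ord (q x)) -sum_nat_const.
  by apply: leq_sum => c _; have := no c; rewrite -leqNgt.
have [|a [a' [aB a'B aa' hh]]] := IH (B c) _ hc.
  by move=> y yl; apply: q0; rewrite inE yl orbT.
move: aB a'B; rewrite !inE => /andP[aA ea] /andP[a'A ea'].
exists a, a'; split=> // y; rewrite inE => /predU1P[->|]; last exact: hh.
by rewrite -eqz_mod_dvd (eqP ea) (eqP ea').
Qed.

Lemma prime_pow_prod_dvd (k : nat -> nat) N L :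
  (forall q, prime q -> q ^ k q %| N)%N ->
  (\prod_(0 <= q < L | prime q) q ^ k q %| N)%N.
Proof.
move=> h; elim: L => [|L IH]; first by rewrite big_geq // dvd1n.
rewrite big_mkcond big_nat_recr //= -big_mkcond /=; case: ifP => pL; last by rewrite muln1.
rewrite Gauss_dvd ?IH ?h // coprime_sym.
rewrite big_seq_cond; elim/big_ind: _ => [|x y cx cy|q]; first exact: coprimen1.
  by rewrite coprimeMr cx cy.
rewrite mem_index_iota => /andP[/andP[_ qL] pq].
by rewrite coprimeXl // coprimeXr // prime_coprime // dvdn_prime2 // gtn_eqF.
Qed.

Definition intpol n (a : 'I_n -> int) : {poly int} := \sum_i a i *: 'X^i.
Lemma pv_ev n (a : 'I_n -> int) z : (pZtoC (intpol a)).[z] = \sum_i (a i)%:~R * z ^+ i.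
Proof.
rewrite /intpol rmorph_sum horner_sum; apply: eq_bigr => i _ /=.
by rewrite map_polyZ /= map_polyXn hornerZ hornerXn.
Qed.
Lemma pv_horner n (a : 'I_n -> int) z : (intpol a).[z] = \sum_i a i * z ^+ i.
Proof. by rewrite /intpol horner_sum; apply: eq_bigr => i _; rewrite hornerZ hornerXn. Qed.
Lemma pv_coef n (a : 'I_n -> int) (i : 'I_n) : (intpol a)`_i = a i.
Proof.
rewrite /intpol coef_sum (bigD1 i) //= coefZ coefXn eqxx mulr1 big1 ?addr0 // => j ji.
rewrite coefZ coefXn; have -> : (i == j :> nat) = false by rewrite eq_sym; apply/negbTE.
by rewrite mulr0.
Qed.
Lemma size_pv n (a : 'I_n -> int) : (size (intpol a) <= n)%N.
Proof.
apply/leq_sizeP => j nj; rewrite /intpol coef_sum big1 // => i _.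
by rewrite coefZ coefXn gtn_eqF ?mulr0 // (leq_trans (ltn_ord i)).
Qed.

Section OneField.
Variables (f : {poly int}) (b : algC).
Hypothesis fb : minCpoly b = pZtoC f.
Hypothesis Ab : b \in Aint.
Notation n := (deg b).
Notation rt i := (emb i b).

Lemma deg_gt0 : (0 < n)%N.
Proof. by have [[i hi] _] := @emb_surj b idfun; apply: leq_trans hi. Qed.

Lemma pv_inj (a : 'I_n -> int) : (pZtoC (intpol a)).[b] = 0 -> forall i, a i = 0.
Proof.
move=> e i; rewrite -pv_coef.
suff -> : intpol a = 0 by rewrite coef0.
apply: (map_inj_poly (@intr_inj algC)); rewrite ?rmorph0 //.
apply: (@roots_geq_poly_eq0 _ _ (conjs b)) (conjs_uniq b) _.
  apply/allP => z; rewrite mem_conjs => /conj_aut[u <-].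
  by rewrite /root -(ev_emb) e rmorph0.
by apply: leq_trans (size_pv a); rewrite size_poly.
Qed.

Lemma pv_bound : exists2 C : nat, (0 < C)%N & forall (a : 'I_n -> int) s (u : aut),
  (forall i, `|a i| <= s%:Z) -> `|u (pZtoC (intpol a)).[b]| <= (C * s)%:R.
Proof.
have [C CE] := bounds (fun ki : 'I_n * 'I_n => rt ki.1 ^+ ki.2).
exists (n * C).+1 => // a s u h.
have [k uk] := emb_surj b u; rewrite ev_emb uk pv_ev.
apply: le_trans (ler_norm_sum _ _ _) _.
apply: (@le_trans _ _ (\sum_(i < n) (s * C)%:R)).
  apply: ler_sum => i _; rewrite normrM natrM; apply: ler_pM => //; last exact: (CE (k, i)).
  by rewrite -intr_norm -[s%:R]/(s%:Z%:~R) ler_int.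
by rewrite sumr_const card_ord -mulrnA ler_nat; nia.
Qed.

Lemma pv_Aint (a : 'I_n -> int) : (pZtoC (intpol a)).[b] \in Aint.
Proof. exact: ev_Aint. Qed.
Lemma ev_fld (p : {poly int}) : fld b (pZtoC p).[b].
Proof. by move=> u ub; rewrite ev_emb ub. Qed.

Lemma norm_bound x (B : nat) : (forall u : aut, `|u x| <= B%:R) -> `|fnorm b x| <= (B ^ n)%:R.
Proof.
move=> h; rewrite /fnorm normr_prod natrX.
have -> : B%:R ^+ n = \prod_(i < n) B%:R :> algC by rewrite prodr_const card_ord.
by apply: ler_prod => i _; rewrite normr_ge0 h.
Qed.

(** For large [q], a pair [(q, r)] stands for the prime of degree one of [fld b] generated by [q]
    and [b - r]; sets of pairs stand for squarefree products of such primes. *)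
Definition rootpair y0 (x : nat * nat) :=
  [&& prime x.1, (y0 < x.1)%N, (x.2 < x.1)%N & (x.1 %| f.[x.2%:Z])%Z].

(** Distinct roots modulo [q] are congruent to distinct conjugates of [b] modulo a prime [M] above
    [q], so each contributes its own factor [q] to the norm. *)
Lemma roots_dvd (D : nat) : (forall q M, prime q -> prm M -> M q%:R ->
    ~~ (q %| D)%N -> forall i j : 'I_n, i != j -> ~ M (rt i - rt j)) -> (0 < D)%N ->
  forall (p : {poly int}) (z : int), fnorm b (pZtoC p).[b] = z%:~R ->
  forall X (Z : {set 'I_X.+1 * 'I_X.+1}),
  (forall x, x \in Z -> rootpair D (val x.1, val x.2) /\ (val x.1 %| p.[(val x.2)%:Z])%Z) ->
  (\prod_(x in Z) val x.1 %| absz z)%N.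
Proof.
move=> sepD D0 p z zE X Z hZ.
pose k (q : nat) := #|[set x in Z | val x.1 == q]|.
have -> : (\prod_(x in Z) val x.1 = \prod_(0 <= q < X.+1 | prime q) q ^ k q)%N.
  rewrite (partition_big (fun x : 'I_X.+1 * 'I_X.+1 => x.1) (fun q : 'I_X.+1 => prime q)); last first.
    by move=> x /hZ[/and4P[]].
  rewrite big_mkord; apply: eq_bigr => q _ /=.
  rewrite (eq_bigr (fun=> val q)) => [|x /andP[_ /eqP <-] //].
  by rewrite prod_nat_const; congr (_ ^ _)%N; apply: eq_card => x; rewrite !inE.
apply: prime_pow_prod_dvd => q pq.
case: (posnP (k q)) => [->|kq]; first by rewrite dvd1n.
have Dq : ~~ (q %| D)%N.
  move: kq; rewrite /k card_gt0 => /set0Pn[x]; rewrite inE => /andP[/hZ[/and4P[_ h _ _] _] /eqP e].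
  by apply/negP => /dvdn_leq; rewrite -e => /(_ D0); rewrite leqNgt h.
have [M [pM Mq]] := prm_over pq.
have sepM := sepD q M pq pM Mq Dq.
set Zq := [set x in Z | val x.1 == q] in k kq *.
have rE x : x \in Zq -> exists i : 'I_n, M (rt i - (val x.2)%:R).
  rewrite inE => /andP[/hZ[/and4P[_ _ _ h] _] /eqP e].
  have : M (pZtoC f).[(val x.2)%:R].
    rewrite -[(val x.2)%:R]/((val x.2)%:Z%:~R) horner_map; apply/(prm_intE pM _ pq Mq).
    by rewrite -e.
  rewrite (f_prod fb) => /(prm_prod pM)[i|i _ Mi]; first by rewrite rpredB ?rpred_nat ?rt_Aint.
  by exists i; rewrite -opprB; apply: prmN.
have [g gE] : exists g : 'I_X.+1 * 'I_X.+1 -> 'I_n, forall x, x \in Zq -> M (rt (g x) - (val x.2)%:R).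
  apply: (@exists_fun _ _ (fun x i => x \in Zq -> M (rt i - (val x.2)%:R))) => x.
  case: (boolP (x \in Zq)) => [/rE[i Mi]|_]; first by exists i.
  by exists (Ordinal deg_gt0).
have ginj : {in Zq &, injective g}.
  move=> x y xZ yZ gxy; have Mx := gE x xZ; have My := gE y yZ.
  have : M ((val x.2)%:Z - (val y.2)%:Z)%:~R.
    rewrite rmorphB /=; have -> : (val x.2)%:~R - (val y.2)%:~R = (rt (g y) - (val y.2)%:R) - (rt (g x) - (val x.2)%:R) by rewrite gxy; ring.
    exact: prmB.
  move/(prm_intE pM _ pq Mq) => dv.
  move: xZ yZ; rewrite !inE => /andP[/hZ[/and4P[_ _ lx _] _] /eqP ex] /andP[/hZ[/and4P[_ _ ly _] _] /eqP ey].
  rewrite /= in lx ly; rewrite ex in lx; rewrite ey in ly.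
  have : (val x.2 == val y.2 %[mod q])%Z by rewrite eqz_mod_dvd.
  rewrite !modz_nat eqz_nat !modn_small // => /eqP e2.
  case: x y ex ey e2 {gxy Mx My lx ly dv} => [x1 x2] [y1 y2] /= ex ey e2.
  by congr (_, _); apply: val_inj; rewrite //= ex ey.
have := @norm_dvd f b fb Ab q M pq pM Mq sepM p z (g @: Zq) zE.
rewrite card_in_imset // dvdzE abszX /=; apply.
move=> i /imsetP[x xZ ->].
have [c Ac cE] := ev_sub p (rt_Aint Ab (g x)) (rpred_nat _ (val x.2) : (val x.2)%:R \in Aint).
have -> : (pZtoC p).[rt (g x)] = (rt (g x) - (val x.2)%:R) * c + (pZtoC p).[(val x.2)%:R] by rewrite -cE; ring.
apply: prmD => //; first by apply: prmZr => //; apply: gE.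
rewrite -[(val x.2)%:R]/((val x.2)%:Z%:~R) horner_map; apply/(prm_intE pM _ pq Mq).
by move: xZ; rewrite inE => /andP[/hZ[_ h] /eqP <-].
Qed.

(** Each set of roots mod primes with product at most [X] is, by pigeonhole, the root set of a small element of [Z[b]], which has a bounded number of such sets. *)
Lemma root_sets_upper : exists y0 C : nat, forall X (A : {set {set 'I_X.+1 * 'I_X.+1}}),
  (forall J, J \in A -> (forall x, x \in J -> rootpair y0 (val x.1, val x.2)) /\
     (\prod_(x in J) val x.1 <= X)%N) -> (#|A| <= C * X)%N.
Proof.
have [D D0 sepD] := sep_ex Ab; have [C1 C10 C1E] := pv_bound.
pose C2 := (C1 ^ n)%N.
(* The first factor counts the possible leftover sets [Zs d :\: J], whose primes and roots are at
   most [C2]; [3 ^ n] comes from [2 * S + 1 <= 3 * S]. *)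
exists D, (2 ^ (C2.+1 * C2.+1) * 3 ^ n)%N => X A hA.
case: (posnP X) => [X0|X0].
  rewrite (_ : A = set0) ?cards0 //; apply/setP => J; rewrite inE; apply/negbTE/negP => /hA[h1].
  by rewrite leqNgt => /negP; apply; rewrite {1}X0 prodn_cond_gt0 // => x /h1/and4P[/prime_gt0].
have [S /andP[S1 S2]] := floor_root X deg_gt0.
have S0 : (0 < S)%N.
  by rewrite lt0n; apply/eqP => e; move: S2; rewrite e exp1n ltnNge X0.
pose Zs (d : 'I_n -> int) := [set x : 'I_X.+1 * 'I_X.+1 | rootpair D (val x.1, val x.2) && (val x.1 %| (intpol d).[(val x.2)%:Z])%Z].
have /exists_fun[d dE] : forall J, exists d : 'I_n -> int, J \in A ->
   [/\ forall i, `|d i| <= S%:Z, J \subset Zs d & (\prod_(x in Zs d :\: J) val x.1 <= C2)%N].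
  move=> J; case: (boolP (J \in A)) => [/hA[hJ NJ]|_]; last by exists (fun=> 0).
  set N := (\prod_(x in J) _)%N in NJ.
  have N0 : (0 < N)%N by rewrite prodn_cond_gt0 // => x /hJ/and4P[/prime_gt0].
  (* The box of coefficients up to [s] has more than [N] points, enough for the pigeonhole, while
     [s ^ n <= N] keeps the norm of the difference within a constant times [N]. *)
  have [s /andP[s1 s2]] := floor_root N deg_gt0.
  have [a [a' [_ _ aa' ha]]] := @pigeon {ffun 'I_n -> 'I_s.+1} _ (fun x : 'I_X.+1 * 'I_X.+1 => val x.1)
     (fun x a => (intpol (fun i => (val (a i))%:Z)).[(val x.2)%:Z]) (enum J) setT
     (fun x => ltac:(by rewrite mem_enum => /hJ/and4P[/prime_gt0]))
     (ltac:(by rewrite big_enum /= cardsT card_ffun !card_ord)).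
  pose d i : int := (val (a i))%:Z - (val (a' i))%:Z.
  have dS i : `|d i| <= s%:Z.
    by have := ltn_ord (a i); have := ltn_ord (a' i); rewrite /d !ltnS /=; lia.
  have JZ : J \subset Zs d.
    apply/subsetP => x xJ; rewrite inE hJ //=.
    have := ha x; rewrite mem_enum => /(_ xJ).
    congr (_ %| _)%Z; rewrite !pv_horner -sumrB; apply: eq_bigr => i _.
    by rewrite -mulrBl.
  have sS : (s <= S)%N.
    rewrite leqNgt; apply/negP => lt; have : (S.+1 ^ n <= X)%N.
      by apply: leq_trans (leq_trans s1 NJ); rewrite leq_exp2r ?deg_gt0.
    by rewrite leqNgt S2.
  exists d => _; split=> //.
    by move=> i; apply: le_trans (dS i) _; rewrite lez_nat.
  have /intrP[z zE] := fnorm_int (pv_Aint d) (ev_fld (intpol d)).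
  have z0 : z != 0.
    rewrite -(intr_eq0 algC) -zE fnorm_eq0; apply/eqP => /pv_inj d0.
    case/negP: aa'; apply/eqP/ffunP => i; apply: val_inj => /=.
    by have /eqP := d0 i; rewrite /d subr_eq0 eqz_nat => /eqP.
  have dv := @roots_dvd D sepD D0 (intpol d) z zE X (Zs d) _.
  have {}dv : (\prod_(x in Zs d) val x.1 %| absz z)%N.
    by apply: dv => x; rewrite inE => /andP[].
  have lez : (absz z <= C2 * N)%N.
    apply: (@leq_trans ((C1 * s) ^ n)); last by rewrite expnMn leq_mul2l s1 orbT.
    rewrite -(ler_nat algC) natr_absz intr_norm -zE; apply: norm_bound => u; exact: C1E.
  have := dvdn_leq _ dv; rewrite absz_gt0 => /(_ z0) le1.
  have := leq_trans le1 lez.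
  rewrite (bigID (mem J)) /= (eq_bigl (mem J)) => [|x]; last first.
    by rewrite /= andb_idl // => /(subsetP JZ).
  rewrite mulnC leq_pmul2r // (eq_bigl (mem (Zs d :\: J))) // => x.
  by rewrite /= in_setD andbC.
pose code (J : {set 'I_X.+1 * 'I_X.+1}) : {ffun 'I_n -> 'I_(S + S).+1} * {set 'I_C2.+1 * 'I_C2.+1} :=
  ([ffun i => inord (absz (d J i + S%:Z))],
   [set y | [exists x, (x \in Zs (d J) :\: J) && (val x.1 == val y.1) && (val x.2 == val y.2)]]).
have cinj : {in A &, injective code}.
  move=> J J' JA J'A [e1 e2]; have [b1 b2 b3] := dE J JA; have [b1' b2' b3'] := dE J' J'A.
  have ed : d J = d J'.
    apply: boolp.funext => i; have := congr1 (fun g : {ffun 'I_n -> 'I_(S + S).+1} => val (g i)) e1.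
    have := b1 i; have := b1' i => h1 h2; rewrite !ffunE /= !inordK; lia.
  have small J0 x : (\prod_(x in Zs (d J0) :\: J0) val x.1 <= C2)%N -> x \in Zs (d J0) :\: J0 -> (x.1 < C2.+1)%N /\ (x.2 < C2.+1)%N.
    move=> le xZ; have x1 : (val x.1 <= C2)%N.
      apply: leq_trans le; rewrite (bigD1 x) //= leq_pmulr // prodn_cond_gt0 // => y /andP[].
      by rewrite !inE => /andP[_ /andP[/and4P[/prime_gt0]]].
    split; rewrite ltnS //; apply: leq_trans x1; apply: ltnW.
    by move: xZ; rewrite !inE => /andP[_ /andP[/and4P[]]].
  have sub J1 J2 : (\prod_(x in Zs (d J1) :\: J1) val x.1 <= C2)%N -> (code J1).2 = (code J2).2 -> Zs (d J1) :\: J1 \subset Zs (d J2) :\: J2.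
    move=> le /setP e; apply/subsetP => x xZ; have [x1 x2] := small J1 x le xZ.
    have := e (Ordinal x1, Ordinal x2); rewrite !inE /=.
    have -> : [exists x0, (x0 \in Zs (d J1) :\: J1) && (val x0.1 == val x.1) && (val x0.2 == val x.2)].
      by apply/existsP; exists x; rewrite xZ !eqxx.
    move/esym/existsP => [y /andP[/andP[yZ /eqP y1] /eqP y2]].
    suff -> : x = y by rewrite inE in yZ; move: yZ; rewrite !inE.
    by case: x y y1 y2 {x1 x2 yZ xZ} => [? ?] [? ?] /= y1 y2; congr (_, _); apply: val_inj.
  have e3 : Zs (d J) :\: J = Zs (d J') :\: J'.
    by apply/eqP; rewrite eqEsubset !sub.
  have rec (J0 : {set 'I_X.+1 * 'I_X.+1}) : J0 \subset Zs (d J0) -> J0 = Zs (d J0) :\: (Zs (d J0) :\: J0).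
    move=> s; apply/setP => x; rewrite !in_setD negb_and negbK.
    case: (boolP (x \in J0)) => [/(subsetP s) ->|_] //=.
    by rewrite andNb.
  by rewrite (rec J b2) (rec J' b2') e3 ed.
rewrite -(card_in_imset cinj); apply: leq_trans (max_card _) _.
rewrite card_prod card_ffun card_sets card_prod !card_ord mulnC -mulnA leq_mul2l.
apply/orP; right; apply: (@leq_trans ((3 * S) ^ n)); last by rewrite expnMn leq_mul2l S1 orbT.
rewrite leq_exp2r ?deg_gt0 //; lia.
Qed.
End OneField.

Lemma PoszXn (q k : nat) : q%:Z ^+ k = (q ^ k)%N.
Proof. by elim: k => [|k IH] //; rewrite exprS IH expnS PoszM. Qed.

Lemma div_close (x y d : nat) : (x %/ d.+1 = y %/ d.+1)%N -> `|x%:Z - y%:Z| <= d%:Z.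
Proof.
move=> e; have h1 := divn_eq x d.+1; have h2 := divn_eq y d.+1; rewrite e in h1.
have h3 := ltn_pmod x (ltn0Sn d); have h4 := ltn_pmod y (ltn0Sn d).
move: h1 h2; move: (y %/ _ * _)%N => w; lia.
Qed.

Lemma shift_le Y c0 C1 B : (0 < B)%N -> (1 + Y * (c0 * B) + Y * (C1 * B) <= (1 + Y * (c0 + C1)) * B)%N.
Proof. nia. Qed.
Lemma shift_le_mul Y C1 B : (1 + Y * (C1 + 2) * B + Y * (C1 * B) <= 1 + Y * ((2 * C1 + 2) * B))%N.
Proof. nia. Qed.
Lemma shift_ge Y C1 B : (0 < Y)%N -> (B <= 1 + Y * (C1 + 2) * B)%N.
Proof. nia. Qed.
Lemma shift_gt Y C1 B : (Y * (C1 * B) < 1 + Y * (C1 + 2) * B)%N.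
Proof. nia. Qed.
Lemma quarter_mul u v y : (4 * v <= y)%N -> (v * u * 4 <= u * y)%N.
Proof. nia. Qed.
Lemma half_le_sub a b c g : (a <= c)%N -> (2 * b <= a)%N -> (g + b = c)%N -> (a <= 2 * g)%N.
Proof. lia. Qed.
Lemma ord_dist_le B (i j : 'I_B.+1) : `|(val i)%:Z - (val j)%:Z| <= B%:Z.
Proof. have := ltn_ord i; have := ltn_ord j; rewrite /=; lia. Qed.
Lemma ord_abs_le B (i : 'I_B.+1) : `|(val i)%:Z| <= B%:Z.
Proof. have := ltn_ord i; rewrite /=; lia. Qed.

Lemma box_dominates_bad t C B n : (t ^ 2 <= (C * B) ^ n)%N -> (64 * C <= B)%N -> (0 < n)%N -> (4 * (2 ^ n * t) <= B ^ n)%N.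
Proof.
move=> h hB n0; rewrite -(@leq_exp2r _ _ 2) //.
have e : ((2 ^ n) ^ 2 = 4 ^ n)%N by rewrite -expnM mulnC expnM.
have -> : ((4 * (2 ^ n * t)) ^ 2 = 16 * (4 ^ n * t ^ 2))%N by rewrite !expnMn e.
apply: (@leq_trans (16 * (4 ^ n * (C * B) ^ n))); first by rewrite !leq_mul2l h !orbT.
apply: (@leq_trans ((64 * C * B) ^ n)).
  rewrite -[(64 * C * B)%N]mulnA [((64 * _) ^ n)%N]expnMn [X in (X <= _)%N]mulnA leq_mul2r; apply/orP; right.
  have -> : (64 ^ n = 16 ^ n * 4 ^ n)%N by rewrite -expnMn.
  by rewrite leq_mul2r -{1}[16%N]expn1 leq_exp2l // n0 orbT.
by rewrite -expnM [(n * 2)%N]mulnC expnM leq_exp2r // expnS expn1 leq_mul2r hB orbT.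
Qed.

Section LowerBound.
Variables (f : {poly int}) (b : algC).
Hypothesis fb : minCpoly b = pZtoC f.
Hypothesis Ab : b \in Aint.
Notation n := (deg b).
Notation rt i := (emb i b).

Section Shifted.
Variables (K Y : nat).
Hypothesis Y0 : (0 < Y)%N.
Hypothesis KY : (Y %| K.-1)%N.
Hypothesis K0 : (0 < K)%N.

(** Since [K] is 1 modulo [Y], these elements are prime to [Y], which will be divisible by the [D]
    of [sep_ex] and by all small primes. *)
Definition sh (a : 'I_n -> int) : {poly int} := K%:Z%:P + Y%:Z *: intpol a.
Definition shv a := (pZtoC (sh a)).[b].

Lemma sh_ev a z : (pZtoC (sh a)).[z] = K%:R + Y%:R * (pZtoC (intpol a)).[z].
Proof.
rewrite /sh rmorphD /= map_polyZ map_polyC /= hornerD hornerC hornerZ.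
by rewrite !pmulrn.
Qed.
Lemma shv_Aint a : shv a \in Aint. Proof. exact: ev_Aint. Qed.
Lemma shv_fld a : fld b (shv a). Proof. exact: ev_fld. Qed.
Lemma shv_emb a (u : aut) : u (shv a) = (pZtoC (sh a)).[u b].
Proof. exact: ev_emb. Qed.

Lemma sh_copr a M : prm M -> M Y%:R -> forall u : aut, ~ M (u (shv a)).
Proof.
move=> pM MY u Ma; apply: (prm1 pM).
have -> : 1 = u (shv a) - ((K.-1)%:R + Y%:R * (pZtoC (intpol a)).[u b]).
  rewrite shv_emb sh_ev -{1}(prednK K0) -natr1; ring.
apply: prmB => //; apply: prmD => //.
  by case/dvdnP: KY => k ->; rewrite natrM; apply: prmZ; rewrite ?rpred_nat.
by apply: prmZr => //; apply: ev_Aint; rewrite Aint_aut.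
Qed.

Section AtPrime.
Variables (a : 'I_n -> int) (z : int).
Hypothesis za : fnorm b (shv a) = z%:~R.
Variables (q : nat) (M : algC -> Prop).
Hypotheses (pq : prime q) (pM : prm M) (Mq : M q%:R).

Lemma sh_dvd : (q %| z)%Z <-> exists i : 'I_n, M (emb i (shv a)).
Proof.
rewrite -(prm_intE pM z pq Mq) -za; split=> [/(prm_prod pM)[i|i _ h]|[i h]].
- by rewrite Aint_aut shv_Aint.
- by exists i.
rewrite /fnorm (bigD1 i) //=; apply: prmZr => //.
by apply: rpred_prod => j _; rewrite Aint_aut shv_Aint.
Qed.
Lemma sh_dvdY : (q %| z)%Z -> ~~ (q %| Y)%N.
Proof.
case/sh_dvd => i Mi; apply/negP => qY; apply: (sh_copr pM _ Mi).
exact/(prm_natE pM _ pq Mq).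
Qed.
End AtPrime.

Lemma fnormE a : exists z : int, fnorm b (shv a) = z%:~R.
Proof. by have /intrP[z ->] := fnorm_int (shv_Aint a) (shv_fld a); exists z. Qed.

Variable D : nat.
Hypothesis D0 : (0 < D)%N.
Hypothesis DY : (D %| Y)%N.
Hypothesis sepD : forall q M, prime q -> prm M -> M q%:R ->
    ~~ (q %| D)%N -> forall i j : 'I_n, i != j -> ~ M (rt i - rt j).

(** If two conjugates lie in [M], the difference gets one factor [q] from each; if only one does, it
    carries the whole of [q ^ 2] in both norms, hence in the difference. *)
Lemma bad_dvd q M a a' z z' : prime q -> prm M -> M q%:R ->
  fnorm b (shv a) = z%:~R -> fnorm b (shv a') = z'%:~R ->
  ((q ^ 2)%N %| z)%Z -> ((q ^ 2)%N %| z')%Z ->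
  (forall i : 'I_n, M (emb i (shv a)) <-> M (emb i (shv a'))) ->
  loc M (fnorm b (pZtoC (intpol (fun i => a i - a' i))).[b] / q%:R ^+ 2).
Proof.
move=> pq pM Mq za z'a qz qz' same.
have q0 : q%:R != 0 :> algC by rewrite pnatr_eq0 -lt0n prime_gt0.
have q1z : (q %| z)%Z by apply: dvdz_trans qz; rewrite dvdzE /= dvdn_exp.
have nY := sh_dvdY za pq pM Mq q1z.
have nD : ~~ (q %| D)%N by apply: contra nY => /dvdn_trans; apply.
have sepM := sepD pq pM Mq nD.
set d := (pZtoC (intpol _)).[b].
have dE : Y%:R * d = shv a - shv a'.
  rewrite /shv !sh_ev /d !pv_ev opprD addrACA subrr add0r -mulrBr -sumrB; congr (_ * _).
  by apply: eq_bigr => i _; rewrite rmorphB mulrBl.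
have Ad : d \in Aint by apply: ev_Aint.
have nYM : ~ M Y%:R by move/(prm_natE pM _ pq Mq); apply/negP.
have LY x : loc M (Y%:R * x) -> loc M x.
  move=> h; have Yn0 : Y%:R != 0 :> algC by rewrite pnatr_eq0 -lt0n.
  rewrite -(mulKf Yn0 x); apply: locM h => //; apply: loc_unit => //; first exact: loc_nat.
  by move/mloc_Aint => /(_ pM); rewrite rpred_nat => /(_ isT).
have Md (i : 'I_n) : M (emb i (shv a)) -> M (emb i d).
  move=> h; have h' := (same i).1 h; apply: mloc_Aint; rewrite ?Aint_aut //.
  have : M (Y%:R * emb i d).
    have -> : Y%:R * emb i d = emb i (shv a) - emb i (shv a').
      by rewrite -rmorphB -dE rmorphM rmorph_nat.
    exact: prmB.
  case/(prmM pM) => //; rewrite ?rpred_nat ?Aint_aut //; exact: mloc_M.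
have [k Mk] := (sh_dvd za pq pM Mq).1 q1z.
case: (boolp.EM (exists2 j, j != k & M (emb j (shv a)))) => [[j jk Mj]|only].
  rewrite /fnorm (bigD1 k) //= (bigD1 j) //= mulrA expr2 invfM mulrACA.
  rewrite [X in loc M X](_ : _ = (emb k d / q%:R) * (emb j d / q%:R) * \prod_(i < n | (i != k) && (i != j)) emb i d); last by ring.
  apply: locM => //; last by apply: loc_prod => // i _; apply: loc_Aint; rewrite ?Aint_aut.
  have h (i : 'I_n) : M (emb i (shv a)) -> loc M (emb i d / q%:R).
    move=> Mi; have := Md i Mi; rewrite /d ev_emb => Mdi.
    have := unram_loc fb Ab pq pM Mq sepM Mdi; exact.
  by apply: locM => //; apply: h.
have key a0 z0 : fnorm b (shv a0) = z0%:~R -> ((q ^ 2)%N %| z0)%Z -> (forall j, j != k -> ~ M (emb j (shv a0))) ->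
    loc M (emb k (shv a0) / q%:R ^+ 2).
  move=> z0a qz0 ho; have := @loc_int q M pq pM z0 2; rewrite PoszXn => /(_ qz0).
  rewrite -z0a /fnorm (bigD1 k) //=; set P := \prod_(i < n | i != k) _ => h.
  have AP : P \in Aint by apply: rpred_prod => i _; rewrite Aint_aut shv_Aint.
  have nP : ~ M P.
    by move/(prm_prod pM) => [i|i ik]; [rewrite Aint_aut shv_Aint | apply: ho].
  have P0 := prm_nz pM nP.
  have -> : emb k (shv a0) / q%:R ^+ 2 = emb k (shv a0) * P / q%:R ^+ 2 * P^-1 by field; rewrite P0 q0.
  apply: locM => //; apply: loc_unit => //; first exact: loc_Aint.
  by move/mloc_Aint => /(_ pM AP).
have k1 : loc M (emb k d / q%:R ^+ 2).
  apply: LY; have -> : Y%:R * (emb k d / q%:R ^+ 2) = emb k (shv a) / q%:R ^+ 2 - emb k (shv a') / q%:R ^+ 2.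
    by rewrite mulrA -mulrBl -rmorphB -dE rmorphM rmorph_nat.
  apply: locB => //; [apply: (key a z) | apply: (key a' z')] => // j jk Mj; apply: only; exists j => //.
  exact/same.
rewrite /fnorm (bigD1 k) //= mulrAC; apply: locM => //.
by apply: loc_prod => // i _; apply: loc_Aint; rewrite ?Aint_aut.
Qed.

Definition tup B (a : {ffun 'I_n -> 'I_B.+1}) (i : 'I_n) : int := (val (a i))%:Z.

(** Tuples with the same set of conjugates in [M] and in the same small box differ by an element of
    norm divisible by [q ^ 2] yet smaller, hence by 0. So there are at most [2 ^ n] bad tuples per
    small box. *)
Lemma bad_count C1 B q (A : {set {ffun 'I_n -> 'I_B.+1}}) : prime q -> (0 < C1)%N ->
  (forall (a : 'I_n -> int) s (u : aut), (forall i, `|a i| <= s%:Z) -> `|u (pZtoC (intpol a)).[b]| <= (C1 * s)%:R) ->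
  (forall a z, a \in A -> fnorm b (shv (tup a)) = z%:~R -> ((q ^ 2)%N %| z)%Z) ->
  (#|A| * q ^ 2 <= 2 ^ n * q ^ 2 + (4 * C1 * B) ^ n)%N.
Proof.
move=> pq C10 C1E hA; have [M [pM Mq]] := prm_over pq.
have n0 := deg_gt0 b.
(* The boxes have side [s + 1] with [s] maximal for [(C1 * s) ^ n < q ^ 2]. *)
have [w /andP[w1 w2]] := floor_root (q ^ 2).-1 n0.
have q20 : (0 < q ^ 2)%N by rewrite expn_gt0 prime_gt0.
pose s := (w %/ C1)%N.
have s1 : ((C1 * s) ^ n < q ^ 2)%N.
  rewrite -(prednK q20) ltnS; apply: leq_trans w1; rewrite leq_exp2r //.
  by rewrite mulnC leq_divM.
have s2 : (q ^ 2 <= (C1 * s.+1) ^ n)%N.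
  rewrite -(prednK q20); apply: leq_trans w2 _; rewrite leq_exp2r //.
  by rewrite mulnC -ltn_divLR.
pose L := (B %/ s.+1)%N.
have ltL (i : 'I_B.+1) : (i %/ s.+1 < L.+1)%N by rewrite ltnS leq_div2r // -ltnS.
have /exists_fun[lab labE] : forall a : {ffun 'I_n -> 'I_B.+1}, exists S : {set 'I_n}, forall i, i \in S <-> M (emb i (shv (tup a))).
  move=> a; exists [set i | boolp.asbool (M (emb i (shv (tup a))))] => i; rewrite inE.
  by split=> /boolp.asboolP.
pose code (a : {ffun 'I_n -> 'I_B.+1}) := (lab a, [ffun i => Ordinal (ltL (a i))]).
have cinj : {in A &, injective code}.
  move=> a a' aA a'A [e1 /ffunP e2].
  have [z zE] := fnormE (tup a); have [z' z'E] := fnormE (tup a').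
  have := @bad_dvd q M (tup a) (tup a') z z' pq pM Mq zE z'E (hA _ _ aA zE) (hA _ _ a'A z'E) _.
  have h (i : 'I_n) : M (emb i (shv (tup a))) <-> M (emb i (shv (tup a'))).
    by split=> /(labE _ i).2 h; apply/(labE _ i).1; move: h; rewrite e1.
  move=> /(_ h); set p := intpol _ => lN.
  have /intrP[x xE] := fnorm_int (ev_Aint p Ab) (ev_fld p).
  have dv : (q%:Z ^+ 2 %| x)%Z by apply: (int_loc pq pM Mq); rewrite -xE.
  have le : (absz x <= (C1 * s) ^ n)%N.
    rewrite -(ler_nat algC) natr_absz intr_norm -xE; apply: norm_bound => u; apply: C1E => i.
    have := congr1 val (e2 i); rewrite !ffunE /= /tup => e.
    exact: div_close.
  have x0 : x = 0.
    apply/eqP; rewrite -absz_eq0 -leqn0 leqNgt; apply/negP => xp.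
    have := dvdn_leq xp; rewrite -[absz x]/(absz x) => /(_ (q ^ 2)%N) hh.
    have : (q ^ 2 <= absz x)%N by apply: hh; move: dv; rewrite dvdzE abszX.
    by rewrite leqNgt (leq_ltn_trans le s1).
  have : (pZtoC p).[b] = 0 by apply/eqP; rewrite -(fnorm_eq0 b) xE x0.
  move/pv_inj => e0; apply/ffunP => i; apply: val_inj; have := e0 i.
  by move/eqP; rewrite subr_eq0 => /eqP[].
have cA : (#|A| <= 2 ^ n * L.+1 ^ n)%N.
  rewrite -(card_in_imset cinj); apply: leq_trans (max_card _) _.
  by rewrite card_prod card_ffun card_sets ?card_prod !card_ord.
case: (leqP s.+1 B) => sB; last first.
  apply: leq_trans (leq_addr _ _); rewrite leq_mul2r; apply/orP; right.
  by move: cA; rewrite /L divn_small // exp1n muln1.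
apply: leq_trans (leq_addl _ _).
apply: (@leq_trans ((2 ^ n * L.+1 ^ n) * (C1 * s.+1) ^ n)); first exact: leq_mul.
rewrite -!expnMn leq_exp2r //.
have h1 : (L * s.+1 <= B)%N by apply: leq_divM.
have h2 : (L.+1 * s.+1 <= 2 * B)%N by rewrite mulSn mul2n -addnn leq_add.
have -> : (2 * L.+1 * (C1 * s.+1) = 2 * C1 * (L.+1 * s.+1))%N by ring.
have -> : (4 * C1 * B = 2 * C1 * (2 * B))%N by ring.
by rewrite leq_mul2l h2 orbT.
Qed.
End Shifted.

(** The witnesses are the root sets of the elements [K + Y * sum_i a_i b^i], whose norms are positive and squarefree for a positive proportion of the tuples [a]. *)
Lemma root_sets_lower y0 : exists C3 B0, forall B X, (B0 <= B)%N -> (C3 * B ^ n <= X)%N ->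
  exists A : {set {set 'I_X.+1 * 'I_X.+1}},
   (forall I, I \in A -> (forall x, x \in I -> rootpair f y0 (val x.1, val x.2)) /\
      (B ^ n <= \prod_(x in I) val x.1 <= C3 * B ^ n)%N) /\ (B ^ n <= 2 * #|A|)%N.
Proof.
have [D D0 sepD] := sep_ex Ab; have [C1 C10 C1E] := pv_bound Ab.
have n0 := deg_gt0 b.
(* All bad primes exceed [y], so [E / q ^ 2] sums over them to at most [E / y]; the last summand
   makes this at most a quarter of [B ^ n]. *)
pose y := (y0 + D + 4 * (4 * C1) ^ n)%N.
have y1 : (0 < y)%N by rewrite /y !addn_gt0 D0 orbT.
have y0y : (y0 <= y)%N by rewrite /y -addnA leq_addr.
have Dy : (D <= y)%N by rewrite /y addnAC leq_addl.
pose Y := (D * y`!)%N.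
pose c0 := (2 * C1 + 2)%N.
pose C := (1 + Y * (c0 + C1))%N.
have Y0 : (0 < Y)%N by rewrite muln_gt0 D0 fact_gt0.
have DY : (D %| Y)%N by apply: dvdn_mulr.
have gty q : prime q -> ~~ (q %| Y)%N -> (y < q)%N.
  move=> pq; apply: contraR; rewrite -leqNgt => qy.
  by apply/dvdn_mull/dvdn_fact; rewrite qy prime_gt0.
exists (C ^ n)%N, (64 * C)%N => B X hB hX.
have B1 : (0 < B)%N by apply: leq_trans hB; rewrite muln_gt0.
(* This offset dominates the varying part in every conjugate, so norms are bounded below and
   quotients of two elements are close to 1. *)
pose K := (1 + Y * (c0 * B))%N.
have KY : (Y %| K.-1)%N by rewrite /K add1n /= dvdn_mulr.
pose al (a : {ffun 'I_n -> 'I_B.+1}) := shv K Y (tup a).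
have pvB (a : {ffun 'I_n -> 'I_B.+1}) (u : aut) : `|u (pZtoC (intpol (tup a))).[b]| <= (C1 * B)%:R.
  by apply: C1E => i; exact: ord_abs_le.
have alE a (u : aut) : u (al a) = K%:R + Y%:R * u (pZtoC (intpol (tup a))).[b].
  by rewrite /al /shv sh_ev rmorphD rmorphM !rmorph_nat.
have al_le a (u : aut) : `|u (al a)| <= (C * B)%:R.
  rewrite alE; apply: le_trans (ler_normD _ _) _; rewrite normrM !normr_nat.
  apply: (@le_trans _ _ (K%:R + Y%:R * (C1 * B)%:R)); first by rewrite lerD2l ler_wpM2l ?ler0n.
  by rewrite -natrM -natrD ler_nat; apply: shift_le.
have al_ge a (u : aut) : (1 + Y * (C1 + 2) * B)%:R <= `|u (al a)|.
  rewrite alE; apply: le_trans (lerB_normD _ _).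
  rewrite normrM !normr_nat; apply: (@le_trans _ _ (K%:R - Y%:R * (C1 * B)%:R)).
    by rewrite lerBrDr -natrM -natrD ler_nat; apply: shift_le_mul.
  by rewrite lerB // ler_wpM2l ?ler0n.
have /exists_fun[z zE] : forall a : {ffun 'I_n -> 'I_B.+1}, exists z : int, fnorm b (al a) = z%:~R.
  by move=> a; apply: fnormE.
have z_le a : (absz (z a) <= (C * B) ^ n)%N.
  by rewrite -(ler_nat algC) natr_absz intr_norm -zE; apply: norm_bound => u; apply: al_le.
have z_ge a : (B ^ n <= absz (z a))%N.
  rewrite -(ler_nat algC) natr_absz intr_norm -zE /fnorm normr_prod natrX.
  have -> : B%:R ^+ n = \prod_(i < n) B%:R :> algC by rewrite prodr_const card_ord.
  apply: ler_prod => i _; rewrite ler0n /=; apply: le_trans (al_ge a _).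
  by rewrite ler_nat; apply: shift_ge.
have z0 a : (0 < absz (z a))%N by apply: leq_trans (z_ge a); rewrite expn_gt0 B1.
have [t /andP[t1 t2]] := @floor_root 2 ((C * B) ^ n) isT.
pose Bad (q : nat) := [set a : {ffun 'I_n -> 'I_B.+1} | prime q && (q ^ 2 %| absz (z a))%N].
pose Good := [set a : {ffun 'I_n -> 'I_B.+1} | [forall q : 'I_t.+1, a \notin Bad q]].
have goodP a q : a \in Good -> prime q -> ~~ (q ^ 2 %| absz (z a))%N.
  rewrite inE => /forallP ga pq; case: (ltnP q t.+1) => qt.
    by have := ga (Ordinal qt); rewrite inE pq.
  apply/negP => /(dvdn_leq (z0 a)); rewrite leqNgt => /negP; apply.
  apply: leq_ltn_trans (z_le a) _; apply: leq_trans t2 _.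
  by rewrite leq_exp2r.
have badY q a : a \in Bad q -> (y < q)%N.
  rewrite inE => /andP[pq qz]; apply: gty => //; have [M [pM Mq]] := prm_over pq.
  apply: (sh_dvdY KY isT (zE a) pq pM Mq).
  by rewrite dvdzE /=; apply: dvdn_trans qz; rewrite dvdn_exp.
pose E := ((4 * C1 * B) ^ n)%N.
have cBad q : (y < q)%N -> (#|Bad q|%:R <= (2 ^ n)%:R + E%:R / (q ^ 2)%:R :> rat).
  move=> yq; case: (posnP #|Bad q|) => [->|].
    by rewrite addr_ge0 ?ler0n // divr_ge0 ?ler0n.
  rewrite card_gt0 => /set0Pn[a0]; rewrite inE => /andP[pq _].
  have q2 : (0 : rat) < (q ^ 2)%:R by rewrite ltr0n expn_gt0 prime_gt0.
  rewrite -(ler_pM2r q2) mulrDl divfK ?gt_eqF // -!natrM -natrD ler_nat.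
  apply: (bad_count Y0 KY isT DY sepD pq C10 C1E) => a z' /=; rewrite inE pq /= => h.
  rewrite -/(al a) zE => /intr_inj <-; by rewrite dvdzE.
have cG : (B ^ n <= 2 * #|Good|)%N.
  (* Comparison with the telescoping sum of [1 / (q - 1) - 1 / q]. *)
  have invsq : \sum_(q < t.+1 | (y < q)%N) (1 / (q ^ 2)%:R : rat) <= 1 / y%:R.
        have : forall t, (y <= t)%N -> \sum_(q < t.+1 | (y < q)%N) (1 / (q ^ 2)%:R : rat) <= 1 / y%:R - 1 / t%:R.
      elim=> [|t' IH]; first by rewrite leqn0 => /eqP e; rewrite e in y1.
      rewrite leq_eqVlt => /predU1P[<-|yt].
        by rewrite subrr big1 // => q; rewrite ltnNge -ltnS ltn_ord.
      rewrite big_mkcond big_ord_recr /= -big_mkcond /= yt.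
      have {IH} := IH yt; set S := \sum_(_ < _ | _) _ => IH.
      have t1n : (0 < t')%N by apply: leq_trans y1 yt.
      have t1' : (0 : rat) < t'%:R by rewrite ltr0n.
      have e : 1 / (t'.+1 ^ 2)%:R <= 1 / t'%:R - 1 / t'.+1%:R :> rat.
        have -> : 1 / t'%:R - 1 / t'.+1%:R = 1 / (t' * t'.+1)%:R :> rat.
          rewrite natrM -!natr1; field; rewrite ?natr1 ?pnatr_eq0 -?lt0n ?t1n //.
        rewrite !div1r lef_pV2 ?posrE ?ltr0n ?expn_gt0 ?muln_gt0 //; last by rewrite (leq_trans y1 yt).
        by rewrite ler_nat expnS expn1 leq_mul2r leqnSn.
      by apply: le_trans (lerD IH e) _; rewrite addrA subrK.
    case: (leqP y t) => yt h; last first.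
      rewrite big1 ?divr_ge0 ?ler0n // => q; rewrite ltnNge => /negP[].
      by apply: leq_trans (ltnW yt); rewrite -ltnS.
    have := h t yt; have : 0 <= 1 / t%:R :> rat by rewrite divr_ge0 ?ler0n.
    lra.
  have cGc : (#|~: Good| <= \sum_(q < t.+1 | (y < q)%N) #|Bad q|)%N.
    have sub : ~: Good \subset \bigcup_(q < t.+1 | (y < q)%N) Bad q.
      apply/subsetP => a; rewrite inE [_ \in Good]inE negb_forall => /existsP[q].
      by rewrite negbK => h; apply/bigcupP; exists q => //; apply: badY h.
    apply: leq_trans (subset_leq_card sub) _.
    by elim/big_rec2: _ => [|q k W _ IH]; [rewrite cards0 | apply: leq_trans (leq_card_setU _ _).1 _; rewrite leq_add2l].
  have c1 : (#|~: Good|%:R <= (2 ^ n * t)%:R + E%:R / y%:R :> rat).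
    apply: (@le_trans _ _ (\sum_(q < t.+1 | (y < q)%N) #|Bad q|)%:R); first by rewrite ler_nat.
    rewrite natr_sum; apply: (@le_trans _ _ (\sum_(q < t.+1 | (y < q)%N) ((2 ^ n)%:R + E%:R / (q ^ 2)%:R))).
      by apply: ler_sum => q yq; apply: cBad.
    rewrite big_split /= lerD //.
      rewrite sumr_const -mulrnA ler_nat leq_mul2l; apply/orP; right.
      apply: (@leq_trans #|[pred q : 'I_t.+1 | q != ord0]|).
        by apply: subset_leq_card; apply/subsetP => q; rewrite !inE => h; apply/eqP => e; rewrite /in_mem /= e in h.
      by rewrite cardC1 card_ord.
    rewrite (eq_bigr (fun q : 'I_t.+1 => E%:R * (1 / (q ^ 2)%:R))) => [|q _]; last by rewrite mul1r.
    by rewrite -mulr_sumr -[y%:R^-1]mul1r ler_wpM2l ?ler0n.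
  have c2 : E%:R / y%:R <= (B ^ n)%:R / 4 :> rat.
    have y1' : (0 : rat) < y%:R by rewrite ltr0n.
    rewrite ler_pdivrMr // mulrAC ler_pdivlMr // -!natrM ler_nat /E expnMn.
    have : (4 * (4 * C1) ^ n <= y)%N by rewrite /y leq_addl.
    exact: quarter_mul.
  have c3 : (4 * (2 ^ n * t) <= B ^ n)%N.
    by apply: box_dominates_bad t1 hB n0.
  have c4 : (#|Good| + #|~: Good| = B.+1 ^ n)%N.
    by rewrite cardsC card_ffun !card_ord.
  have c5 : (B ^ n <= B.+1 ^ n)%N by rewrite leq_exp2r.
  have {}c3 : 4 * (2 ^ n * t)%:R <= (B ^ n)%:R :> rat by rewrite -natrM ler_nat.
  have c6 : 2 * #|~: Good|%:R <= (B ^ n)%:R :> rat by lra.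
  have {}c6 : (2 * #|~: Good| <= B ^ n)%N by move: c6; rewrite -natrM ler_nat.
  exact: half_le_sub c5 c6 c4.
have CBn : ((C * B) ^ n = C ^ n * B ^ n)%N by rewrite expnMn.
pose I (a : {ffun 'I_n -> 'I_B.+1}) := [set x : 'I_X.+1 * 'I_X.+1 | rootpair f y (val x.1, val x.2) && (val x.1 %| (sh K Y (tup a)).[(val x.2)%:Z])%Z].
have yD q x2 : rootpair f y (q, x2) -> rootpair f D (q, x2).
  by case/and4P => ? h ? ?; apply/and4P; split=> //; apply: leq_ltn_trans h.
have yy0 q x2 : rootpair f y (q, x2) -> rootpair f y0 (q, x2).
  by case/and4P => ? h ? ?; apply/and4P; split=> //; apply: leq_ltn_trans h.
have uniqi a q M : a \in Good -> prime q -> prm M -> M q%:R -> (q %| z a)%Z ->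
    forall i j : 'I_n, M (emb i (al a)) -> M (emb j (al a)) -> i = j.
  move=> ga pq pM Mq qz i j Mi Mj; apply/eqP; apply: contraNT (goodP a q ga pq) => ij.
  have nD : ~~ (q %| D)%N by apply: contra (sh_dvdY KY isT (zE a) pq pM Mq qz) => /dvdn_trans; apply.
  have := norm_dvd fb Ab pq pM Mq (sepD q M pq pM Mq nD) (S := [set i; j]) (zE a) _.
  rewrite cards2 ij PoszXn dvdzE /=; apply=> k; rewrite !inE -ev_emb -/(al a).
  by case/orP => /eqP ->.
have rootE a q M (i : 'I_n) : a \in Good -> prime q -> prm M -> M q%:R -> M (emb i (al a)) ->
    exists x, [/\ x \in I a, val x.1 = q & M (rt i - (val x.2)%:R)].
  move=> ga pq pM Mq Mi.
  have qz : (q %| z a)%Z by apply/(sh_dvd (zE a) pq pM Mq); exists i.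
  have [|j Mj|r [rq Mr qr]] := root_deg1 fb Ab pq pM Mq (p := sh K Y (tup a)) (i := i) _ _.
  - by rewrite -ev_emb.
  - by apply: (uniqi a q M) => //; rewrite /al /shv ev_emb.
  have qX : (q < X.+1)%N.
    rewrite ltnS; apply: leq_trans hX; rewrite -CBn; apply: leq_trans (z_le a).
    by apply: dvdn_leq => //; rewrite dvdzE in qz.
  have rX : (r < X.+1)%N by apply: ltn_trans rq qX.
  exists (Ordinal qX, Ordinal rX); split=> //; rewrite inE /=; apply/andP; split.
    by apply/and4P; split=> //; apply: gty => //; apply: (sh_dvdY KY isT (zE a) pq pM Mq).
  apply/(prm_intE pM _ pq Mq).
  have [c Ac cE] := ev_sub (sh K Y (tup a)) (rt_Aint Ab i) (rpred_nat _ r : r%:R \in Aint).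
  have -> : (sh K Y (tup a)).[r%:Z]%:~R = (pZtoC (sh K Y (tup a))).[rt i] - (rt i - r%:R) * c.
    by rewrite -cE opprB addrC subrK -[r%:R]/(r%:Z%:~R) horner_map.
  apply: prmB => //; first by rewrite -ev_emb.
  exact: prmZr.
have prodI a : a \in Good -> (\prod_(x in I a) val x.1 = absz (z a))%N.
  move=> ga; apply/eqP; rewrite eqn_dvd; apply/andP; split.
    apply: (roots_dvd fb Ab sepD D0 (zE a)) => x; rewrite inE => /andP[h1 h2]; split=> //.
    exact: yD.
  apply/(dvdn_partP _ (z0 a)) => q; rewrite mem_primes => /and3P[pq _ qz].
  rewrite p_part; have l1 : logn q (absz (z a)) = 1%N.
    apply/eqP; rewrite eqn_leq -pfactor_dvdn // expn1 qz andbT leqNgt.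
    by rewrite -pfactor_dvdn // goodP.
  rewrite l1 expn1; have [M [pM Mq]] := prm_over pq.
  have [i Mi] := (sh_dvd (zE a) pq pM Mq).1 qz.
  have [x [xI xq _]] := rootE a q M i ga pq pM Mq Mi.
  by rewrite (bigD1 x) //= xq dvdn_mulr.
have Iinj : {in Good &, injective I}.
  move=> a a' ga ga' eI.
  have al0 : al a != 0 by rewrite -(fmorph_eq0 (idfun : aut)) -normr_gt0; apply: lt_le_trans (al_ge a idfun); rewrite ltr0n.
  have AlA a1 : al a1 \in Aint by apply: shv_Aint.
  (* Equal root sets make [k] integral, the norms being squarefree; as all conjugates of [k - 1] are
     below 1 in absolute value, [k = 1]. *)
  pose k := al a' / al a.
  have Ak : k \in Aint.
    apply: Aint_loc => M pM; case: (boolp.EM (M (al a))) => [Ma|nMa]; last by exists (al a'), (al a).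
    have [q pq Mq] := prml pM.
    have [i0 i0E] := emb_surj b (idfun : aut); rewrite /= in i0E.
    have ei0 a1 : emb i0 (al a1) = al a1 by rewrite /al /shv ev_emb -i0E.
    have Mi0 : M (emb i0 (al a)) by rewrite ei0.
    have qz : (q %| z a)%Z by apply/(sh_dvd (zE a) pq pM Mq); exists i0.
    have nY := sh_dvdY KY isT (zE a) pq pM Mq qz.
    have nD : ~~ (q %| D)%N by apply: contra nY => /dvdn_trans; apply.
    have sepM := sepD q M pq pM Mq nD.
    have [x [xI xq Mx]] := rootE a q M i0 ga pq pM Mq Mi0.
    have Mi0' : M (emb i0 (al a')).
      rewrite /al /shv ev_emb.
      have [c Ac cE] := ev_sub (sh K Y (tup a')) (rt_Aint Ab i0) (rpred_nat _ (val x.2) : (val x.2)%:R \in Aint).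
      have -> : (pZtoC (sh K Y (tup a'))).[rt i0] = (rt i0 - (val x.2)%:R) * c + ((sh K Y (tup a')).[(val x.2)%:Z])%:~R.
        by rewrite -cE -(horner_map (intr : {rmorphism int -> algC})) /= subrK.
      apply: prmD => //; first exact: prmZr.
      apply/(prm_intE pM _ pq Mq); rewrite -xq.
      by move: xI; rewrite eI inE => /andP[].
    have q0 : q%:R != 0 :> algC by rewrite pnatr_eq0 -lt0n prime_gt0.
    have l1 : loc M (al a' / q%:R).
      have := @unram_loc f b fb Ab q M pq pM Mq sepM (sh K Y (tup a')) i0.
      by rewrite -ev_emb -/(al a') ei0; apply; rewrite -[al a']ei0.
    have l2 : ~ mloc M (al a / q%:R).
      move=> h; have [w [Aw _ wE]] := fnorm_dvd (AlA a) (shv_fld K Y (tup a)).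
      have /dvdzP[v vE] := qz.
      have : mloc M v%:~R.
        have -> : v%:~R = (al a / q%:R) * w.
          have : fnorm b (al a) = v%:~R * q%:R by rewrite zE vE rmorphM.
          by rewrite wE => e; rewrite mulrAC e mulfK.
        by apply: mlocMr => //; apply: loc_Aint.
      move/(mloc_Aint pM) => /(_ (rpred_int _ _)) /(prm_intE pM _ pq Mq) qv.
      have := goodP a q ga pq; rewrite vE abszM /= expnS expn1 dvdn_pmul2r ?prime_gt0 //.
      by rewrite dvdzE in qv; rewrite qv.
    have -> : k = (al a' / q%:R) * (al a / q%:R)^-1 by rewrite /k; field; rewrite q0 al0.
    by apply: locM => //; apply: nmloc_loc => //; rewrite mulf_neq0 ?invr_neq0.
  have k1 : k - 1 = 0.
    apply: Aint_small => [|u]; first by rewrite rpredB ?rpred1.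
    have u0 : 0 < `|u (al a)| by rewrite normr_gt0 fmorph_eq0.
    have -> : k - 1 = (al a' - al a) / al a by rewrite /k; field.
    rewrite fmorph_div normrM normfV ltr_pdivrMr // mul1r.
    apply: lt_le_trans (al_ge a u).
    have -> : u (al a' - al a) = Y%:R * u (pZtoC (intpol (fun i => tup a' i - tup a i))).[b].
      rewrite rmorphB !alE opprD addrACA subrr add0r -mulrBr -rmorphB; congr (_ * u _).
      rewrite !pv_ev -sumrB; apply: eq_bigr => i _; by rewrite rmorphB mulrBl.
    rewrite normrM normr_nat; apply: (@le_lt_trans _ _ (Y%:R * (C1 * B)%:R)).
      rewrite ler_wpM2l ?ler0n //; apply: C1E => i; rewrite /tup.
      exact: ord_dist_le.
    by rewrite -natrM ltr_nat; apply: shift_gt.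
  have eal : al a' = al a.
    by move/eqP: k1; rewrite subr_eq0 => /eqP k1; rewrite -[RHS]mul1r -k1 divfK.
  apply/ffunP => i; apply: val_inj.
  have : (pZtoC (intpol (fun i => tup a' i - tup a i))).[b] = 0.
    have e : Y%:R * (pZtoC (intpol (tup a'))).[b] = Y%:R * (pZtoC (intpol (tup a))).[b].
      by have := eal; rewrite -[al a']/((idfun : aut) (al a')) -[al a]/((idfun : aut) (al a)) !alE => /addrI.
    have Yn0 : Y%:R != 0 :> algC by rewrite pnatr_eq0 -lt0n.
    have {}e := mulfI Yn0 e.
    rewrite -[RHS](subrr (pZtoC (intpol (tup a'))).[b]) {2}e !pv_ev -sumrB.
    by apply: eq_bigr => j _; rewrite rmorphB mulrBl.
  move/pv_inj => /(_ i) /eqP; rewrite subr_eq0 => /eqP[]; by [].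
exists (I @: Good); split; last by rewrite card_in_imset.
move=> J /imsetP[a ga ->]; split; last by rewrite prodI // z_ge -CBn z_le.
by move=> x; rewrite inE => /andP[/yy0].
Qed.
End LowerBound.

(** Sizes at different scales do not overlap, so the scale of a set can be recovered from its
    product. *)
Lemma scale_le (c B0 m i i' N : nat) : (0 < B0)%N -> (0 < m)%N ->
  ((B0 * c.+1 ^ i) ^ m <= N)%N -> (N <= c * (B0 * c.+1 ^ i') ^ m)%N -> (i <= i')%N.
Proof.
move=> B00 m0 h1 h2; rewrite leqNgt; apply/negP => lt.
have h3 : ((B0 * c.+1 ^ i') ^ m * c.+1 <= (B0 * c.+1 ^ i) ^ m)%N.
  apply: (@leq_trans ((B0 * c.+1 ^ i') ^ m * c.+1 ^ m)).
    by apply: leq_mul => //; rewrite -[X in (X <= _)%N]expn1; apply: leq_pexp2l.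
  by rewrite -expnMn leq_exp2r // -mulnA leq_mul2l -expnSr leq_pexp2l ?orbT.
have h4 : (0 < (B0 * c.+1 ^ i') ^ m)%N by rewrite expn_gt0 muln_gt0 B00 expn_gt0.
move: (leq_trans h3 (leq_trans h1 h2)) h4; move: ((_ * _) ^ m)%N => w; nia.
Qed.

(** Two roots of [f2] over every root of [f1] would give [2 ^ #|I|] sets over each set [I], contradicting the two linear counts. *)
Lemma few_roots (f1 f2 : {poly int}) b1 b2 :
  minCpoly b1 = pZtoC f1 -> b1 \in Aint -> minCpoly b2 = pZtoC f2 -> b2 \in Aint ->
  forall y0 (ov : nat * nat -> nat * nat -> Prop),
  (forall x, rootpair f1 y0 x -> exists y1 y2, [/\ rootpair f2 y0 y1 /\ rootpair f2 y0 y2,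
     y1.1 = x.1 /\ y2.1 = x.1, y1 != y2 & ov x y1 /\ ov x y2]) ->
  (forall x x' y, rootpair f1 y0 x -> rootpair f1 y0 x' -> ov x y -> ov x' y -> x = x') -> False.
Proof.
move=> fb1 Ab1 fb2 Ab2 y0 ov h1 h2.
have [y0' [C UBE]] := root_sets_upper fb2 Ab2.
have [C3 [B0' LBE]] := root_sets_lower fb1 Ab1 (y0 + y0').
have m0 := deg_gt0 b1; set m := deg b1 in m0 LBE.
set y := (y0 + y0')%N in LBE.
(* There are [k + 1] pairs of scales with the same product [Z], each yielding at least [Z / 4] pairs
   of sets, and [X] bounds the product over a pair; [k] is chosen so that all pairs together exceed
   the upper bound [C * X]. *)
pose c := C3.+1; pose B0 := B0'.+1; pose k := (4 * C * c ^ 2)%N.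
pose Z := ((B0 ^ 2 * c.+1 ^ k) ^ m)%N; pose X := (c ^ 2 * Z)%N.
have Z0 : (0 < Z)%N by rewrite expn_gt0 muln_gt0 !expn_gt0.
pose B i := (B0 * c.+1 ^ i)%N.
have BZ i : (i <= k)%N -> (B i ^ m * B (k - i) ^ m = Z)%N.
  by move=> ik; rewrite -expnMn /B mulnACA -expnD subnKC // -expn2.
have Bpos i : (0 < B i)%N by rewrite muln_gt0 expn_gt0.
pose S := {set 'I_X.+1 * 'I_X.+1}.
have /exists_fun[A AE] : forall i : 'I_k.+1, exists A : {set S},
   (forall I, I \in A -> (forall x, x \in I -> rootpair f1 y (val x.1, val x.2)) /\
      (B i ^ m <= \prod_(x in I) val x.1 <= c * B i ^ m)%N) /\ (B i ^ m <= 2 * #|A|)%N.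
  move=> i; have ik : (i <= k)%N by rewrite -ltnS.
  have [||A [hA cA]] := LBE (B i) X.
  - by apply: leq_trans (leqnSn _) _; rewrite /B -/B0 -[X in (X <= _)%N]muln1 leq_mul2l expn_gt0 orbT.
  - rewrite /X -(BZ i) // mulnA; apply: (@leq_trans (c ^ 2 * B i ^ m)).
      by apply: leq_mul => //; apply: leq_trans (leqnSn _) _; rewrite -/c expnS expn1 leq_pmulr.
    by rewrite leq_pmulr // expn_gt0 Bpos.
  exists A; split=> // I /hA[h /andP[l1 l2]]; split=> //; rewrite l1; apply: leq_trans l2 _.
  by rewrite leq_mul2r leqnSn orbT.
pose V (x : 'I_X.+1 * 'I_X.+1) := rootpair f1 y (val x.1, val x.2).
have rp (f : {poly int}) w x : (w <= y)%N -> rootpair f y x -> rootpair f w x.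
  by move=> wy /and4P[? l ? ?]; apply/and4P; split=> //; apply: leq_ltn_trans l.
have y0y : (y0 <= y)%N by apply: leq_addr.
have y0'y : (y0' <= y)%N by apply: leq_addl.
have /exists_fun[g gE] : forall x : 'I_X.+1 * 'I_X.+1, exists g : ('I_X.+1 * 'I_X.+1) * ('I_X.+1 * 'I_X.+1), V x ->
   [/\ rootpair f2 y0' (val g.1.1, val g.1.2) /\ rootpair f2 y0' (val g.2.1, val g.2.2),
     val g.1.1 = val x.1 /\ val g.2.1 = val x.1, g.1 != g.2 &
     ov (val x.1, val x.2) (val g.1.1, val g.1.2) /\ ov (val x.1, val x.2) (val g.2.1, val g.2.2)].
  move=> x; case: (boolP (V x)) => [Vx|_]; last by exists (x, x).
  have [[a1 a2] [[c1 c2] [[r1 r2] [/= e1 e2] ne [o1 o2]]]] := h1 _ (rp _ _ _ y0y Vx).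
  have gt : (y < val x.1)%N by case/and4P: Vx.
  have lt (u : nat) : (u < val x.1)%N -> (u < X.+1)%N by move=> h; apply: ltn_trans h (ltn_ord _).
  have la2 : (a2 < X.+1)%N by apply: lt; case/and4P: r1 => _ _ /=; rewrite e1.
  have lc2 : (c2 < X.+1)%N by apply: lt; case/and4P: r2 => _ _ /=; rewrite e2.
  exists ((x.1, Ordinal la2), (x.1, Ordinal lc2)) => _ /=.
  rewrite /= in e1 e2; move: r1 r2 ne o1 o2; rewrite e1 e2 => r1 r2 ne o1 o2.
  split=> //.
  by split; [case/and4P: r1 => ? ? ? ?|case/and4P: r2 => ? ? ? ?]; apply/and4P; split=> //; apply: leq_ltn_trans gt.
have gi x x' : V x -> V x' -> ((g x).1 = (g x').1 \/ (g x).1 = (g x').2 \/ (g x).2 = (g x').2) -> x = x'.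
  move=> Vx Vx' h; have [_ _ _ [o1 o2]] := gE x Vx; have [_ _ _ [o1' o2']] := gE x' Vx'.
  have : (val x.1, val x.2) = (val x'.1, val x'.2).
    case: h => [e|[e|e]]; apply: (h2 _ _ _ (rp _ _ _ y0y Vx) (rp _ _ _ y0y Vx')).
    + exact: o1.
    + by rewrite e.
    + exact: o1.
    + by rewrite e.
    + exact: o2.
    + by rewrite e.
  by case: x x' {h o1 o2 o1' o2' Vx Vx'} => [x1 x2] [x1' x2'] [/val_inj -> /val_inj ->].
pose P := [set w : 'I_k.+1 * (S * S) | (w.2.1 \in A w.1) && (w.2.2 \in A (rev_ord w.1))].
pose g1 x := (g x).1; pose g2 x := (g x).2.
(* A pair of sets is encoded by taking the first root above the members of one and the second root
   above the members of the other. *)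
pose F (w : 'I_k.+1 * (S * S)) := (g1 @: w.2.1) :|: (g2 @: w.2.2).
have PV w : w \in P -> (forall x, x \in w.2.1 -> V x) /\ (forall x, x \in w.2.2 -> V x).
  by rewrite inE => /andP[/(AE _).1[? _] /(AE _).1[? _]].
have ne12 x x' : V x -> V x' -> g1 x <> g2 x'.
  move=> Vx Vx' e; have ex := gi x x' Vx Vx' (or_intror (or_introl e)).
  by have [_ _ /eqP ne _] := gE x Vx; apply: ne; rewrite -/(g1 x) e -ex.
have Fin1 w x : w \in P -> V x -> (g1 x \in F w) = (x \in w.2.1).
  move=> wP Vx; have [V1 V2] := PV w wP; rewrite in_setU; apply/orP/idP => [[/imsetP[x' x'I e]|/imsetP[x' x'I e]]|xI].
  - by rewrite (gi x x') //; [apply: V1 | left].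
  - by case: (ne12 x x' Vx (V2 _ x'I)).
  - by left; apply: imset_f.
have Fin2 w x : w \in P -> V x -> (g2 x \in F w) = (x \in w.2.2).
  move=> wP Vx; have [V1 V2] := PV w wP; rewrite in_setU; apply/orP/idP => [[/imsetP[x' x'I e]|/imsetP[x' x'I e]]|xI].
  - by case: (ne12 x' x (V1 _ x'I) Vx).
  - by rewrite (gi x x') //; [apply: V2 | right; right].
  - by right; apply: imset_f.
have Finj : {in P &, injective F}.
  move=> w w' wP w'P eF.
  have [V1 V2] := PV w wP; have [V1' V2'] := PV w' w'P.
  have e1 : w.2.1 = w'.2.1.
    apply/setP => x; apply/idP/idP => h; [have Vx := V1 x h|have Vx := V1' x h].
      by rewrite -Fin1 // -eF Fin1.
    by rewrite -Fin1 // eF Fin1.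
  have e2 : w.2.2 = w'.2.2.
    apply/setP => x; apply/idP/idP => h; [have Vx := V2 x h|have Vx := V2' x h].
      by rewrite -Fin2 // -eF Fin2.
    by rewrite -Fin2 // eF Fin2.
  have e3 : w.1 = w'.1.
    move: (wP) (w'P); rewrite !inE -e1 => /andP[/(AE _).1[_ /andP[l1 l2]] _] /andP[/(AE _).1[_ /andP[l1' l2']] _].
    by apply: val_inj; apply/eqP; rewrite eqn_leq (scale_le _ m0 l1 l2') // (scale_le _ m0 l1' l2).
  by case: w w' e1 e2 e3 {eF V1 V2 V1' V2' wP w'P} => [i [I I']] [i' [I0 I0']] /= -> -> ->.
have := UBE X (F @: P) _; rewrite card_in_imset //.
have h : forall J, J \in F @: P -> (forall x, x \in J -> rootpair f2 y0' (val x.1, val x.2)) /\ (\prod_(x in J) val x.1 <= X)%N.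
  move=> J /imsetP[w wP ->]; have [V1 V2] := PV w wP; split.
    by move=> x /setUP[/imsetP[x' /V1/gE[[? _] _ _ _] ->]|/imsetP[x' /V2/gE[[_ ?] _ _ _] ->]].
  have dis : [disjoint g1 @: w.2.1 & g2 @: w.2.2].
    rewrite -setI_eq0; apply/eqP/setP => x; rewrite !inE; apply/negP => /andP[/imsetP[x1 /V1 ? ->] /imsetP[x2 /V2 ? ]].
    exact: ne12.
  rewrite /F (eq_bigl (mem [predU g1 @: w.2.1 & g2 @: w.2.2])) => [|x]; last by rewrite !inE.
  rewrite bigU //= !big_imset /=; first last.
  - by move=> x x' /V1 ? /V1 ? e; apply: gi => //; left.
  - by move=> x x' /V2 ? /V2 ? e; apply: gi => //; right; right.
  rewrite (eq_bigr (fun x : 'I_X.+1 * 'I_X.+1 => val x.1)) => [|x /V1/gE[_ [? _] _ _] //].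
  rewrite [X in (_ * X <= _)%N](eq_bigr (fun x : 'I_X.+1 * 'I_X.+1 => val x.1)) => [|x /V2/gE[_ [_ ?] _ _] //].
  move: wP; rewrite inE => /andP[/(AE _).1[_ /andP[_ l1]] /(AE _).1[_ /andP[_ l2]]].
  apply: leq_trans (leq_mul l1 l2) _; rewrite mulnACA /X /= subSS BZ // -ltnS //.
move=> /(_ h) {h} le.
have cP : (4 * #|P| >= k.+1 * Z)%N.
  have -> : #|P| = (\sum_(i < k.+1) #|A i| * #|A (rev_ord i)|)%N.
    rewrite -sum1_card (partition_big (fun w : 'I_k.+1 * (S * S) => w.1) xpredT) //=; apply: eq_bigr => i _.
    rewrite sum1_card -cardsX -(card_imset _ (_ : injective (fun v : S * S => (i, v)))); last by move=> v v' [].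
    apply: eq_card => w; rewrite unfold_in /= [w \in P]inE; apply/andP/imsetP => [[/andP[a1 a2] /eqP e]|[v]].
      by exists w.2; rewrite ?inE -?e ?a1 ?a2 //; case: (w).
    by rewrite inE => /andP[? ?] -> /=; split=> //; apply/andP.
  rewrite big_distrr /=; apply: (@leq_trans (\sum_(i < k.+1) Z)); first by rewrite sum_nat_const card_ord.
  apply: leq_sum => i _; rewrite -(BZ i); last by rewrite -ltnS.
  have := leq_mul (AE i).2 (AE (rev_ord i)).2; rewrite /= subSS => h; apply: leq_trans h _.
  by rewrite mulnACA.
have kZ : (k * Z = 4 * (C * X))%N by rewrite /k /X !mulnA.
have : (k.+1 * Z <= k * Z)%N.
  by apply: leq_trans cP _; rewrite kZ leq_mul2l /=.
by rewrite leq_pmul2r // ltnn.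
Qed.

(** * Decomposition groups *)
Fixpoint autX (u : aut) k : aut := if k is k'.+1 then autM u (autX u k') else idfun.
Lemma autXE u k x : autX u k x = iter k u x.
Proof. by elim: k => //= k ->. Qed.

Lemma nrm_sym a (u : aut) : fld a (u a) -> fld (u a) a.
Proof.
move=> h; apply: (deg_eq h); rewrite /deg; congr (size _).
by rewrite /conjs (@minCpoly_root_eq a (u a)) // -mem_conjs aut_conjs.
Qed.
Lemma nrm_fld a (u : aut) x : fld a (u a) -> fld a x -> fld a (u x).
Proof. by move=> h ax; apply: fld_trans h _; apply: fld_aut. Qed.
Lemma nrm_V a (u : aut) : fld a (u a) -> fld a (autV u a).
Proof. by move/nrm_sym => h; have := @fld_aut (autV u) _ _ h; rewrite autVK. Qed.
Lemma nrm_fldV a (u : aut) x : fld a (u a) -> fld a x -> fld a (autV u x).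
Proof. by move=> /nrm_V h; apply: nrm_fld. Qed.
Lemma nrm_X a (u : aut) k : fld a (u a) -> fld a (autX u k a).
Proof. by move=> h; elim: k => [|k IH] /=; [apply: fld_id | apply: nrm_fld]. Qed.

(** [u] lies in the decomposition group of the prime of [fld a] below [M]. *)
Definition dec a M (u : aut) := sameon a M (pim u M).

Lemma dec_mul a M (u v : aut) : fld a (u a) -> dec a M u -> dec a M v -> dec a M (autM u v).
Proof.
move=> h du dv x ax; rewrite (du x ax) {1}/pim (dv _ (nrm_fldV h ax)) /pim.
suff -> : autV (autM u v) x = autV v (autV u x) by [].
by apply: (fmorph_inj (autM u v)); rewrite autKV autME !autKV.
Qed.
Lemma dec_ext a M (u v : aut) : fld a (u a) -> u a = v a -> dec a M u -> dec a M v.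
Proof.
move=> h uv du x ax; rewrite (du x ax) /pim.
suff -> : autV u x = autV v x by [].
apply: (fmorph_inj v); rewrite autKV; have ay := nrm_fldV h ax.
by rewrite -(fldE ay uv) autKV.
Qed.
Lemma dec1 a M : dec a M idfun.
Proof.
move=> x ax; rewrite /pim; suff -> : autV idfun x = x by [].
by apply: (fmorph_inj (idfun : aut)); rewrite autKV.
Qed.
Lemma dec_X a M (u : aut) k : fld a (u a) -> dec a M u -> dec a M (autX u k).
Proof. by move=> h du; elim: k => [|k IH] /=; [apply: dec1 | apply: dec_mul]. Qed.
Lemma dec_sub a b M u : fld a b -> dec a M u -> dec b M u.
Proof. by move=> ab; apply: sameon_sub. Qed.

(** In a group of prime order, [u] is itself a power of each of its nontrivial powers. *)
Lemma dec_gen a M (u : aut) l k : prime l -> fld a (u a) -> autX u l a = a ->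
  (0 < k < l)%N -> dec a M (autX u k) -> dec a M u.
Proof.
move=> pl nu ul /andP[k0 kl] dk.
have cop : coprime k l by rewrite coprime_sym prime_coprime // gtnNdvd.
have [s1 [s2 e]] : exists s1 s2, (s1 * k = s2 * l + 1)%N.
  have [s1 s2 e _] := egcdnP l k0; exists s1, s2; rewrite e; congr (_ + _)%N.
  exact/eqP.
have hX i : autX u (i * l) a = a.
  elim: i => [|i IH] //; rewrite mulSn autXE iterD -!autXE IH //.
apply: (@dec_ext a M (autX (autX u k) s1)); first exact/nrm_X/nrm_X.
  have -> : autX (autX u k) s1 a = autX u (s1 * k) a.
    by elim: (s1) => [|i IH] //=; rewrite IH mulSn [RHS]autXE iterD -!autXE.
  by rewrite e addn1 /= hX.
by apply: dec_X => //; apply: nrm_X.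
Qed.

Lemma int_coord a : exists2 D : nat, (0 < D)%N & forall x, x \in Aint -> fld a x ->
  exists k : 'I_(deg a) -> int, D%:R * x = \sum_j (k j)%:~R * a ^+ j.
Proof.
have [s [W [_ _ cW]]] := fld_coord a; set n := deg a in s W cW *.
have [D D0 DW] := Aint_denoms (fun ij : 'I_n * 'I_n => W ij.1 ij.2).
exists D => // x Ax ax; have [cQ /(_ idfun)/= xE] := cW x ax.
have /exists_fun[k kE] : forall j, exists z : int, z%:~R = D%:R * \sum_i s i x * W i j.
  move=> j; have /intrP[z ->] : D%:R * (\sum_i s i x * W i j) \in Num.int; last by exists z.
  apply: Cint_rat_Aint; first by apply: rpredM; [exact: rpred_nat | apply: cQ].
  rewrite mulr_sumr rpred_sum // => i _; rewrite mulrCA rpredM ?Aint_aut //.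
  exact: (DW (i, j)).
exists k; rewrite {1}xE mulr_sumr; apply: eq_bigr => j _.
by rewrite kE mulrA.
Qed.

Lemma int_den a : exists2 D : nat, (0 < D)%N & forall x, x \in Aint -> fld a x ->
  exists p : {poly int}, D%:R * x = (pZtoC p).[a].
Proof.
have [D D0 h] := int_coord a; exists D => // x Ax ax; have [k kE] := h x Ax ax.
by exists (intpol k); rewrite pv_ev kE.
Qed.

Lemma Aint_minCpoly a : a \in Aint -> exists f : {poly int}, minCpoly a = pZtoC f.
Proof. by rewrite unfold_in => /floorpP[f fE]; exists f. Qed.

Section ResInt.
Variables (q D : nat) (a : algC).
Hypotheses (pq : prime q) (D0 : (0 < D)%N) (Dq : ~~ (q %| D)%N) (Aa : a \in Aint).
Hypothesis DE : forall x, x \in Aint -> fld a x -> exists p : {poly int}, D%:R * x = (pZtoC p).[a].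

Lemma inv_mod : exists D', (q %| (D * D')%:Z - 1)%Z.
Proof.
have cop : coprime D q by rewrite coprime_sym prime_coprime.
have [s1 s2 e _] := egcdnP q D0; exists s1.
move/eqP: cop => cop; rewrite cop in e.
by apply/dvdzP; exists s2%:Z; rewrite mulnC e PoszD PoszM addrK.
Qed.

(** [D * x] is a polynomial in [a], hence congruent to the value of this polynomial at [r], and [D]
    is invertible modulo [q]. *)
Lemma res_int M (r : int) : prm M -> M q%:R -> M (a - r%:~R) ->
  forall x, x \in Aint -> fld a x -> exists c : int, M (x - c%:~R).
Proof.
move=> pM Mq Mr x Ax ax; have [p pE] := DE Ax ax; have [D' /dvdzP[w wE]] := inv_mod.
have [c Ac cE] := ev_sub p Aa (rpred_int _ r : r%:~R \in Aint).
exists (D'%:Z * p.[r]).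
have -> : x - (D'%:Z * p.[r])%:~R = D'%:R * ((a - r%:~R) * c) - q%:R * (w%:~R * x).
  have hD : (D' * D)%:R = w%:~R * q%:R + 1 :> algC.
    have /(congr1 (fun z : int => z%:~R : algC)) : (D * D')%:Z = w * q + 1 by rewrite -wE subrK.
    by rewrite rmorphD rmorphM /= mulnC.
  rewrite -cE -pE horner_map rmorphM /= mulrBr [D'%:R * (D%:R * x)]mulrA -natrM hD -!pmulrn; ring.
apply: prmB => //; first by apply: prmZ; rewrite ?rpred_nat //; apply: prmZr.
by apply: prmZr => //; rewrite rpredM ?rpred_int.
Qed.

Lemma same_res M M' (r : int) : prm M -> M q%:R -> M (a - r%:~R) ->
  prm M' -> M' q%:R -> M' (a - r%:~R) -> sameon a M M'.
Proof.
have half M1 M2 : prm M1 -> M1 q%:R -> M1 (a - r%:~R) ->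
  prm M2 -> M2 q%:R -> M2 (a - r%:~R) -> forall x, x \in Aint -> fld a x -> M1 x -> M2 x.
  move=> p1 q1 r1 p2 q2 r2 x Ax ax M1x; have [p pE] := DE Ax ax.
  have [c Ac cE] := ev_sub p Aa (rpred_int _ r : r%:~R \in Aint).
  have h : M1 (p.[r])%:~R.
    have -> : (p.[r])%:~R = D%:R * x - (a - r%:~R) * c by rewrite -cE -pE horner_map opprB addrC subrK.
    by apply: prmB => //; [apply: prmZ; rewrite ?rpred_nat | apply: prmZr].
  have h2 : M2 (D%:R * x).
    have -> : D%:R * x = (a - r%:~R) * c + (p.[r])%:~R by rewrite -cE -pE horner_map subrK.
    apply: prmD => //; first exact: prmZr.
    by apply/(prm_intE p2 _ pq q2); apply/(prm_intE p1 _ pq q1).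
  have [] := prmM p2 _ Ax h2; rewrite ?rpred_nat // => Md.
  by case/negP: Dq; apply/(prm_natE p2 _ pq q2).
by move=> *; apply: sameon_incl => //; apply: half.
Qed.
End ResInt.

Lemma res_range q M (z : algC) (c : int) : prime q -> prm M -> M q%:R -> M (z - c%:~R) ->
  exists2 s : nat, (s < q)%N & M (z - s%:R).
Proof.
move=> pq pM Mq Mc; have q0 : q%:Z != 0 by rewrite -lt0n prime_gt0.
exists (absz (c %% q)%Z); first by rewrite -ltz_nat gez0_abs ?modz_ge0 // ltz_pmod // ltz_nat prime_gt0.
rewrite natr_absz ger0_norm ?modz_ge0 //.
have -> : z - ((c %% q)%Z)%:~R = (z - c%:~R) + q%:R * ((c %/ q)%Z)%:~R.
  have /(congr1 (fun z : int => z%:~R : algC)) := divz_eq c q; rewrite rmorphD rmorphM /= => ->.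
  by rewrite -!pmulrn; ring.
by apply: prmD => //; apply: prmZr; rewrite ?rpred_int.
Qed.

Section Decomp.
Variables (a2 a1 : algC) (l : nat) (u : aut).
Hypotheses (A2 : a2 \in Aint) (A1 : a1 \in Aint).
Hypotheses (nu : fld a2 (u a2)) (pl : prime l) (ul : autX u l a2 = a2).
Hypothesis a1E : forall x, fld a1 x <-> fld a2 x /\ u x = x.

(** The other conjugates of [M] under [u] differ from [M], so [x] can be multiplied by an [e] that
    is 1 at [M] and vanishes at all of them; the trace of [e * x] lies in the fixed field and is
    congruent to [x]. *)
Lemma decomp_trace M : prm M -> ~ dec a2 M u ->
  (forall x, x \in Aint -> fld a1 x -> exists c : int, M (x - c%:~R)) ->
  forall x, x \in Aint -> fld a2 x -> exists c : int, M (x - c%:~R).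
Proof.
move=> pM nd h x Ax ax.
have l0 : (0 < l)%N := prime_gt0 pl.
pose Ms (i : 'I_l.-1) := pim (autV (autX u i.+1)) M.
have ns i : ~ sameon a2 M (Ms i).
  move=> s; apply: nd; apply: (@dec_gen a2 M u l i.+1) => //.
    have := ltn_ord i; move: (nat_of_ord i) => k; rewrite /=; lia.
  have := sameon_sym (@sameon_pim (autX u i.+1) _ _ _ s).
  have nX := nrm_X i.+1 nu.
  have e : forall y, pim (autX u i.+1) (Ms i) y = M y.
    move=> y; rewrite /pim; congr M; apply: (fmorph_inj (autV (autX u i.+1))).
    by rewrite autKV.
  move=> s' y ay; have yy : fld (autX u i.+1 a2) y by apply: fld_trans ay; apply: nrm_sym.
  by rewrite -(e y) -(s' y yy).
have [e [Ae we Me Mse]] := sepn pM (fun i => prm_pim _ pM) ns.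
pose t := \sum_(i < l) autX u i (e * x).
have At : t \in Aint by rewrite rpred_sum // => i _; rewrite Aint_aut rpredM.
have aex : fld a2 (e * x) by apply: fldM.
have a2t : fld a2 t by apply: fld_sum => i _; apply: nrm_fld => //; apply: nrm_X.
have ut : u t = t.
  rewrite /t rmorph_sum -(prednK l0) big_ord_recr big_ord_recl /= addrC; congr (_ + _).
  have := fldE aex (u := autX u l) (v := idfun) ul; by rewrite -{1}(prednK l0).
have [c Mc] := h t At ((a1E t).2 (conj a2t ut)).
exists c; have -> : x - c%:~R = (t - c%:~R) - (t - e * x) - (e - 1) * x by ring.
apply: prmB => //; last by apply: prmZr.
apply: prmB => //; rewrite /t -(prednK l0) big_ord_recl /= addrAC subrr add0r.
suff h1 : forall i : 'I_l.-1, M (autX u i.+1 (e * x)).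
  by elim/big_ind: _ => [|? ? ? ?|i _]; [apply: prm0 | apply: prmD | apply: h1].
move=> i; rewrite rmorphM; apply: prmZr => //; first by rewrite Aint_aut.
have := Mse i; rewrite /Ms /pim.
suff -> : autV (autV (autX u i.+1)) e = autX u i.+1 e by [].
by apply: (fmorph_inj (autV (autX u i.+1))); rewrite autKV autVK.
Qed.

(** Otherwise, for almost all [q], every root mod [q] of the minimal polynomial of [a1] would lift to a prime of [Q(a2)] of degree one with a different conjugate, i.e. to two roots for [a2]. *)
Lemma decomp_prime g y0 : fld a1 g -> g \in Aint -> exists q M (c : int),
  [/\ prime q, (y0 < q)%N, prm M, M q%:R & dec a2 M u /\ M (g - c%:~R)].
Proof.
move=> a1g Ag; apply: boolp.contrapT => no.
have [f1 fb1] := Aint_minCpoly A1; have [f2 fb2] := Aint_minCpoly A2.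
have [D1 D10 D1E] := int_den a1; have [D2 D20 D2E] := int_den a2.
pose y := (y0 + D1 + D2)%N.
have ndv q D : (0 < D)%N -> (D <= y)%N -> (y < q)%N -> ~~ (q %| D)%N.
  by move=> d0 dy yq; apply/negP => /(dvdn_leq d0); rewrite leqNgt (leq_ltn_trans dy).
have D1y : (D1 <= y)%N by rewrite /y addnAC leq_addl.
have D2y : (D2 <= y)%N by rewrite /y leq_addl.
have y0y : (y0 <= y)%N by rewrite /y -addnA leq_addr.
pose ov (x z : nat * nat) := z.1 = x.1 /\ exists M, [/\ prm M, M x.1%:R, M (a1 - x.2%:R) & M (a2 - z.2%:R)].
apply: (few_roots fb1 A1 fb2 A2 (y0 := y) (ov := ov)).
  move=> [q r] /and4P[/= pq yq rq qf].
  have nD1 := ndv q D1 D10 D1y yq; have nD2 := ndv q D2 D20 D2y yq.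
  have [M [pM Mq Mr]] : exists M, [/\ prm M, M q%:R & M (a1 - r%:R)].
    have [M0 [pM0 Mq0]] := prm_over pq.
    have : M0 (pZtoC f1).[r%:R] by rewrite -[r%:R]/(r%:Z%:~R) horner_map; apply/(prm_intE pM0 _ pq Mq0).
    rewrite (f_prod fb1) => /(prm_prod pM0)[i|i _ Mi]; first by rewrite rpredB ?rpred_nat ?rt_Aint.
    exists (pim (autV (emb i)) M0); split; first exact: prm_pim.
      by rewrite -(rmorph_nat (autV (emb i)) q) pimE.
    rewrite -(autVK (emb i) (a1 - r%:R)) pimE rmorphB rmorph_nat -opprB; exact: prmN.
  have res1 : forall x, x \in Aint -> fld a1 x -> exists c : int, M (x - c%:~R).
    exact: (res_int pq D10 nD1 A1 D1E (r := r)).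
  have nd : ~ dec a2 M u.
    move=> d; have [c Mc] := res1 g Ag a1g; apply: no; exists q, M, c; split=> //.
    exact: leq_ltn_trans yq.
  have res2 := decomp_trace pM nd res1.
  have [s0 s0q Ms0] : exists2 s : nat, (s < q)%N & M (a2 - s%:R).
    have [c0 Mc0] := res2 a2 A2 (@fld_id a2); exact: (res_range pq pM Mq Mc0).
  have pM' := prm_pim u pM.
  have Mq' : pim u M q%:R by rewrite -(rmorph_nat u) pimE.
  have [s1 s1q Ms1] : exists2 s : nat, (s < q)%N & pim u M (a2 - s%:R).
    have [|c1 Mc1] := res2 (autV u a2) _ (nrm_V nu); first by rewrite Aint_aut.
    apply: (res_range pq pM' Mq' (c := c1)).
    by rewrite -(autKV u (a2 - c1%:~R)) pimE rmorphB rmorph_int.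
  have rootf M1 s : prm M1 -> M1 q%:R -> M1 (a2 - s%:R) -> (q %| f2.[s%:Z])%Z.
    move=> p1 q1 m1; apply/(prm_intE p1 _ pq q1).
    have [c Ac cE] := ev_sub f2 A2 (rpred_nat _ s : s%:R \in Aint).
    have -> : (f2.[s%:Z])%:~R = - ((a2 - s%:R) * c).
      rewrite -cE opprB -[s%:R]/(s%:Z%:~R) horner_map.
      suff -> : (pZtoC f2).[a2] = 0 by rewrite subr0.
      by apply/eqP; rewrite -fb2 -/(root _ _) root_minCpoly.
    by apply: prmN => //; apply: prmZr.
  exists (q, s0), (q, s1); split=> //.
  - by split; apply/and4P; split=> //; [apply: (rootf M) | apply: (rootf (pim u M))].
  - apply/eqP => -[e]; apply: nd; rewrite -e in Ms1.
    exact: (same_res pq nD2 A2 D2E (r := s0)).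
  - split; split=> //; first by exists M.
    exists (pim u M); split=> //.
    have [_ ua1] := (a1E a1).1 (@fld_id a1).
    by rewrite -{1}ua1 -(rmorph_nat u r) -rmorphB pimE.
move=> [q r] [q' r'] [q2 s] /and4P[/= pq yq rq qf] /and4P[/= pq' yq' rq' qf'] [/= e1 [M [pM Mq Mr Ms]]] [/= e2 [M' [pM' Mq' Mr' Ms']]].
rewrite -e1 -?e2 in pq yq rq qf pq' yq' rq' qf' Mq Mq' *.
have nD2 := ndv q2 D2 D20 D2y yq.
have s12 := same_res pq nD2 A2 D2E (r := s) pM Mq Ms pM' Mq' Ms'.
have a21 : fld a2 a1 by case/a1E: (@fld_id a1).
have Mr2 : M' (a1 - r%:R) by apply/s12 => //; apply: fldB => //; apply: fld_nat.
have : M' (r%:Z - r'%:Z)%:~R.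
  have -> : (r%:Z - r'%:Z)%:~R = (a1 - r'%:R) - (a1 - r%:R) by rewrite rmorphB /=; ring.
  exact: prmB.
move/(prm_intE pM' _ pq Mq'); rewrite -eqz_mod_dvd !modz_nat eqz_nat !modn_small // => /eqP e3.
by rewrite e3.
Qed.
End Decomp.

Lemma autVV (u : aut) x : autV (autV u) x = u x.
Proof. by apply: (fmorph_inj (autV u)); rewrite autKV autVK. Qed.
Lemma pimV (u : aut) M x : pim (autV u) M x = M (u x).
Proof. by rewrite /pim autVV. Qed.

Lemma sep_aut b : b \in Aint -> exists2 D : nat, (0 < D)%N & forall M, prm M -> ~ M D%:R ->
  forall u v : aut, u b <> v b -> ~ M (u b - v b).
Proof.
move=> Ab; have [D D0 sD] := sep_ex Ab; exists D => // M pM nD u v uv.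
have [q pq Mq] := prml pM; have [i ui] := emb_surj b u; have [j vj] := emb_surj b v.
rewrite ui vj; apply: (sD q M) => //.
  by apply/negP => /(prm_natE pM _ pq Mq).
by apply/eqP => ij; apply: uv; rewrite ui vj ij.
Qed.

(** A by-product of the lower count: a set of root pairs whose product exceeds 1 is nonempty. *)
Lemma deg1_prime a y0 : a \in Aint -> exists q M (r : nat),
  [/\ prime q, (y0 < q)%N, prm M, M q%:R & M (a - r%:R)].
Proof.
move=> Aa; have [f fa] := Aint_minCpoly Aa.
have [C [B0 h]] := root_sets_lower fa Aa y0.
have n0 := deg_gt0 a.
have [|A [hA cA]] := h (maxn 2 B0) (C * maxn 2 B0 ^ deg a)%N _ (leqnn _); first exact: leq_maxr.
have b1 : (1 < maxn 2 B0 ^ deg a)%N.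
  by apply: (@leq_trans (2 ^ deg a)); [rewrite -{1}(expn0 2) ltn_exp2l | rewrite leq_exp2r // leq_maxl].
have : (0 < #|A|)%N by move: (leq_trans b1 cA); case: #|A|.
rewrite card_gt0 => /set0Pn[I /hA[hI /andP[l1 _]]].
have : I != set0.
  by apply/eqP => I0; move: (leq_trans b1 l1); rewrite I0 big_set0.
case/set0Pn => x /hI/and4P[/= pq yq rq qf].
have [M0 [pM0 Mq0]] := prm_over pq.
have : M0 (pZtoC f).[(val x.2)%:R].
  by rewrite -[(val x.2)%:R]/((val x.2)%:Z%:~R) horner_map; apply/(prm_intE pM0 _ pq Mq0).
rewrite (f_prod fa) => /(prm_prod pM0)[i|i _ Mi]; first by rewrite rpredB ?rpred_nat ?rt_Aint.
exists (val x.1), (pim (autV (emb i)) M0), (val x.2); split=> //; first exact: prm_pim.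
  by rewrite pimV rmorph_nat.
by rewrite pimV rmorphB rmorph_nat -opprB; apply: prmN.
Qed.

(** By transitivity, one prime above each [q] together with its images under the embeddings of
    [fld a] gives them all. *)
Lemma fin_primes a (b : nat) : (0 < b)%N -> exists (I : finType) (Ms : I -> algC -> Prop),
  (forall i, prm (Ms i)) /\ forall M, prm M -> M b%:R -> exists i, sameon a M (Ms i).
Proof.
move=> b0.
have /exists_fun[M0 M0E] : forall q : 'I_b.+1, exists M, prm M /\ (prime q -> M q%:R).
  move=> q; case: (boolP (prime q)) => [/prm_over[M [pM Mq]]|_]; first by exists M.
  by have [M [pM _]] := prm_over (isT : prime 2); exists M.
pose Ms (i : 'I_b.+1 * 'I_(deg a)) := pim (autV (emb i.2)) (M0 i.1).
exists ('I_b.+1 * 'I_(deg a))%type, Ms; split=> [i|M pM Mb]; first by apply: prm_pim; case: (M0E i.1).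
have [q pq Mq] := prml pM.
have qb : (q < b.+1)%N.
  by rewrite ltnS; apply: dvdn_leq => //; apply/(prm_natE pM _ pq Mq).
have [pM0 /(_ pq) M0q] := M0E (Ordinal qb); set M1 := M0 _ in pM0 M0q.
have same0 : sameon 0 M1 M.
  move=> x x0.
  have xQ : x \in Crat by apply: fixQ => u; apply: x0; rewrite rmorph0.
  have half N N' : prm N -> prm N' -> N q%:R -> N' q%:R -> N x -> N' x.
    move=> pN pN' Nq Nq' Nx.
    have /intrP[z ez] : x \in Num.int by apply: Cint_rat_Aint xQ (prmA pN Nx).
    by rewrite ez in Nx *; apply/(prm_intE pN' _ pq Nq'); apply/(prm_intE pN _ pq Nq).
  by split; apply: half.
have [u [_ su]] := prm_trans a pM0 pM same0.
have [j uj] := emb_surj a (autV u).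
exists (Ordinal qb, j) => x ax; rewrite (su x ax) /Ms pimV /pim /=.
by rewrite (fldE ax uj).
Qed.

(** * Finiteness of the class number *)
Section Hurwitz.
Variable b : algC.
Hypothesis Ab : b \in Aint.
Notation n := (deg b).

Lemma rat_coord x : fld b x -> exists r : 'I_n -> rat, x = \sum_j ratr (r j) * b ^+ j.
Proof.
move=> bx; have [s [W [_ _ cW]]] := fld_coord b.
have [cQ /(_ idfun)/= xE] := cW x bx.
have /exists_fun[r rE] : forall j, exists r : rat, \sum_i s i x * W i j = ratr r.
  by move=> j; apply/CratP.
by exists r; rewrite {1}xE; apply: eq_bigr => j _; rewrite rE.
Qed.

(** Pigeonhole on the fractional parts of the multiples of [x] in the power basis of [b]: two of
    them agree up to [1 / s]. This weak division algorithm is the source of the finiteness of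
    classes. *)
Lemma hurwitz : exists2 H : nat, (0 < H)%N & forall x, fld b x ->
  exists (t : nat) w, [/\ (0 < t <= H)%N, w \in Aint, fld b w & `|fnorm b (t%:R * x - w)| < 1].
Proof.
have [C CE] := bounds (fun ki : 'I_n * 'I_n => emb ki.1 b ^+ ki.2).
have n0 := deg_gt0 b.
pose s := (n * C).+1.
have s0 : (0 : rat) < s%:R by rewrite ltr0n.
exists (s ^ n)%N; first by rewrite expn_gt0.
move=> x bx; have [r xE] := rat_coord bx.
pose k (t : nat) j := Num.floor (s%:R * (t%:R * r j) : rat).
pose box (t : 'I_(s ^ n).+1) : {ffun 'I_n -> 'I_s} := [ffun j => inord (absz (k t j %% s)%Z)].
have [t [t' [tt' bE]]] : exists t t' : 'I_(s ^ n).+1, (t < t')%N /\ box t = box t'.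
  have : ~ injective box by move/leq_card; rewrite card_ffun !card_ord ltnn.
  move=> ninj; apply: boolp.contrapT => no; apply: ninj => i j fij.
  apply: val_inj; case: (ltngtP i j) => // lt; case: no; first by exists i, j.
  by exists j, i.
have /exists_fun[z zE] : forall j, exists z : int, k t' j - k t j = z * s%:Z.
  move=> j; apply/dvdzP; rewrite -eqz_mod_dvd.
  have sz : s%:Z != 0 by [].
  have bnd y : (absz (y %% s%:Z)%Z < s)%N.
    by rewrite -ltz_nat gez0_abs ?modz_ge0 // ltz_pmod.
  have := congr1 (fun g : {ffun 'I_n -> 'I_s} => val (g j)) bE; rewrite !ffunE /= !inordK ?bnd // => h.
  have h1 y : (y %% s)%Z = (absz (y %% s)%Z)%:Z by rewrite gez0_abs // modz_ge0.
  by rewrite h1 -h -h1.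
pose d j := (t' - t)%:R * r j - (z j)%:~R.
have dE j : `|d j| <= s%:R^-1.
  have e : s%:R * d j = (s%:R * (t'%:R * r j) - (k t' j)%:~R) - (s%:R * (t%:R * r j) - (k t j)%:~R).
    have ez : (z j)%:~R * s%:R = (k t' j)%:~R - (k t j)%:~R :> rat.
      by have /(congr1 (fun y : int => y%:~R : rat)) := zE j; rewrite rmorphB rmorphM /= => ->.
    rewrite /d natrB ?(ltnW tt') // mulrBr [s%:R * (z j)%:~R]mulrC ez; ring.
  have fl (y : rat) : 0 <= y - (Num.floor y)%:~R < 1.
    have /andP[h1 h2] := floor_itv y.
    by rewrite subr_ge0 h1 ltrBlDl; move: h2; rewrite rmorphD /= addrC.
  have /andP[a1 a2] := fl (s%:R * (t'%:R * r j)); have /andP[c1 c2] := fl (s%:R * (t%:R * r j)).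
  rewrite -(ler_pM2l s0) mulfV ?gt_eqF // -(ger0_norm (ltW s0)) -normrM e ler_norml.
  rewrite -/(k _ _) -/(k _ _) in a1 a2 c1 c2 *; apply/andP; split; lra.
pose w := \sum_j (z j)%:~R * b ^+ j.
have bw : fld b w by apply: fld_sum => j _; apply: fldM; [apply: fld_int | apply/fldX/fld_id].
have Aw : w \in Aint by rewrite rpred_sum // => j _; rewrite rpredM ?rpredX ?Aint_int.
exists (t' - t)%N, w; split=> //.
  by rewrite subn_gt0 tt' /= (leq_trans (leq_subr _ _)) // -ltnS.
have eE : (t' - t)%:R * x - w = \sum_j ratr (d j) * b ^+ j.
  rewrite xE mulr_sumr -sumrB; apply: eq_bigr => j _.
  by rewrite /d rmorphB rmorphM /= ratr_nat ratr_int mulrA mulrBl.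
have ub (i : 'I_n) : `|emb i ((t' - t)%:R * x - w)| <= (n * C)%:R / s%:R.
  rewrite eE rmorph_sum; apply: le_trans (ler_norm_sum _ _ _) _.
  apply: (@le_trans _ _ (\sum_(j < n) C%:R / s%:R)).
    apply: ler_sum => j _; rewrite rmorphM rmorphXn fmorph_rat normrM mulrC; apply: ler_pM => //.
      exact: (CE (i, j)).
    have := dE j; rewrite -(ler_rat algC) fmorphV /= rmorph_nat ratr_norm; exact.
  by rewrite sumr_const card_ord natrM [_ * C%:R]mulr_natl [(C%:R *+ n) / _]mulrnAl.
have c1 : (n * C)%:R / s%:R < 1 :> algC by rewrite ltr_pdivrMr ?ltr0n // mul1r ltr_nat.
have c0 : 0 <= (n * C)%:R / s%:R :> algC by rewrite divr_ge0 ?ler0n.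
rewrite /fnorm normr_prod; apply: (@le_lt_trans _ _ (((n * C)%:R / s%:R) ^+ n)).
  have -> : ((n * C)%:R / s%:R) ^+ n = \prod_(i < n) ((n * C)%:R / s%:R) :> algC by rewrite prodr_const card_ord.
  by apply: ler_prod => i _; rewrite normr_ge0 ub.
by rewrite exprn_ilt1 // -lt0n.
Qed.

Lemma min_norm (I : algC -> Prop) : (forall a, I a -> a \in Aint /\ fld b a) ->
  (exists2 a, I a & a != 0) -> exists a0, [/\ I a0, a0 != 0 &
   forall a, I a -> a != 0 -> `|fnorm b a0| <= `|fnorm b a|].
Proof.
move=> hI [a1 I1 a10].
have nat_norm a : I a -> exists k : nat, `|fnorm b a| = k%:R.
  move=> /hI[Aa ba]; have /intrP[z ->] := fnorm_int Aa ba.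
  by exists (absz z); rewrite natr_absz intr_norm.
pose P k := boolp.asbool (exists a, [/\ I a, a != 0 & `|fnorm b a| = k%:R]).
have exP : exists k, P k.
  by have [k kE] := nat_norm a1 I1; exists k; apply/boolp.asboolP; exists a1.
case: (ex_minnP exP) => k /boolp.asboolP[a0 [I0 a00 kE]] kmin.
exists a0; split=> // a Ia na; have [k' k'E] := nat_norm a Ia.
by rewrite kE k'E ler_nat; apply: kmin; apply/boolp.asboolP; exists a.
Qed.

Variables (q : nat) (Q : algC -> Prop).
Hypotheses (pq : prime q) (pQ : prm Q) (Qq : Q q%:R).

Let Ik k a := [/\ a \in Aint, fld b a & loc Q (a / q%:R ^+ k)].

(** [Ik k] is the part of the ideal of [q ^ k] at [Q]. Divided by an element [c k] of least norm and
    multiplied by [m], it becomes integral, and is recorded by its residues modulo [m]. Two indices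
    [k < l] have the same record; then multiplication by [pi = c l / c k] maps [Ik k] onto [Ik l],
    so [pi] is a unit away from [Q] and lies in [Q]. *)
Lemma prime_power_generator : exists pi, [/\ pi \in Aint, fld b pi, Q pi & forall M, prm M -> M pi -> sameon b M Q].
Proof.
have q0 : q%:R != 0 :> algC by rewrite pnatr_eq0 -lt0n prime_gt0.
have [H H0 HE] := hurwitz.
pose m := H`!.
have m0 : (0 < m)%N := fact_gt0 _.
have mz : m%:R != 0 :> algC by rewrite pnatr_eq0 -lt0n.
have IkD k a a' : Ik k a -> Ik k a' -> Ik k (a - a').
  by case=> A1 b1 l1 [A2 b2 l2]; split; [rewrite rpredB | apply: fldB | rewrite mulrBl; apply: locB].
have IkM k a c : c \in Aint -> fld b c -> Ik k a -> Ik k (c * a).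
  move=> Ac bc [A1 b1 l1]; split; [by rewrite rpredM | exact: fldM | rewrite -mulrA; apply: locM => //; exact: loc_Aint].
have Ikq k : Ik k (q%:R ^+ k).
  split; [by rewrite rpredX ?rpred_nat | by apply/fldX/fld_nat|].
  by rewrite mulfV ?expf_neq0 //; apply: loc1.
have /exists_fun[c cE] : forall k, exists c, [/\ Ik k c, c != 0 &
    forall a, Ik k a -> a != 0 -> `|fnorm b c| <= `|fnorm b a|].
  move=> k; apply: min_norm; first by move=> a [].
  by exists (q%:R ^+ k); [apply: Ikq | rewrite expf_neq0].
have cI k : Ik k (c k) by case: (cE k).
have c0 k : c k != 0 by case: (cE k).
have div k a : Ik k a -> m%:R * (a / c k) \in Aint.
  move=> Ia; have [_ ba _] := Ia; have [_ bc _] := cI k.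
  have [t [w [/andP[t0 tH] Aw bw nw]]] := HE _ (fldM ba (fldV bc)).
  have e : t%:R * a = w * c k.
    apply/eqP; rewrite -subr_eq0; apply: contraTT nw => ne.
    have Id : Ik k (t%:R * a - w * c k).
      by apply: IkD; apply: IkM => //; [rewrite rpred_nat | apply: fld_nat].
    case: (cE k) => _ _ /(_ _ Id ne) le.
    have fc : 0 < `|fnorm b (c k)| by rewrite normr_gt0 fnorm_eq0.
    have e : t%:R * (a / c k) - w = (t%:R * a - w * c k) / c k by field.
    have e2 : fnorm b (t%:R * a - w * c k) = fnorm b (t%:R * (a / c k) - w) * fnorm b (c k).
      by rewrite -fnormM e divfK.
    rewrite e2 normrM in le; apply/negbT/le_gtF.
    by rewrite -(ler_pM2r fc) mul1r.
  have e1 : t%:R * (a / c k) = w by rewrite mulrA e mulfK.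
  have /dvdnP[k' ->] : (t %| m)%N by apply: dvdn_fact; rewrite t0.
  by rewrite natrM -mulrA e1 rpredM ?rpred_nat.
have fdiv k a : Ik k a -> fld b (m%:R * (a / c k)).
  case=> _ ba _; have [_ bc _] := cI k.
  by apply: fldM; [apply: fld_nat | apply: fldM => //; apply: fldV].
have [T [cl clE]] := finite_residues b m0.
pose code k : {set T} := [set y | boolp.asbool (exists2 a, Ik k a & cl (m%:R * (a / c k)) = y)].
have trans k l : code k = code l -> forall a, Ik k a -> Ik l (a * (c l / c k)).
  move=> /setP kl a Ia; have := kl (cl (m%:R * (a / c k))); rewrite !inE.
  have -> : boolp.asbool (exists2 a0, Ik k a0 & cl (m%:R * (a0 / c k)) = cl (m%:R * (a / c k))).
    by apply/boolp.asboolP; exists a.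
  move/esym/boolp.asboolP => [a' Ia' e].
  have := clE _ _ (div k a Ia) (div l a' Ia') (fdiv k a Ia) (fdiv l a' Ia') (esym e).
  have -> : (m%:R * (a / c k) - m%:R * (a' / c l)) / m%:R = a / c k - a' / c l by field; rewrite mz !c0.
  move=> Aw.
  have -> : a * (c l / c k) = (a / c k - a' / c l) * c l - (- 1) * a'.
    by rewrite mulN1r opprK; field; rewrite !c0.
  apply: IkD; apply: IkM => //; try by rewrite rpredN rpred1.
    have [_ ba _] := Ia; have [_ ba' _] := Ia'; have [_ bk _] := cI k; have [_ bl _] := cI l.
    by apply: fldB; apply: fldM => //; apply: fldV.
  by apply: fldN; apply: fld1.
have [k [l [kl ekl]]] : exists k l, (k < l)%N /\ code k = code l.
  pose g (i : 'I_#|{: {set T}}|.+1) := code i.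
  have : ~ injective g by move/leq_card; rewrite card_ord ltnn.
  move=> ninj; apply: boolp.contrapT => no; apply: ninj => i j fij.
  apply: val_inj; case: (ltngtP i j) => // lt; case: no; first by exists i, j.
  by exists j, i.
pose pi := c l / c k.
have pi0 : pi != 0 by rewrite mulf_neq0 ?invr_neq0.
have bpi : fld b pi by have [_ bk _] := cI k; have [_ bl _] := cI l; apply: fldM => //; apply: fldV.
have piQ : mloc Q pi.
  have [_ _ h] := trans k l ekl _ (Ikq k).
  have -> : pi = q%:R ^+ (l - k) * (q%:R ^+ k * pi / q%:R ^+ l).
    rewrite mulrA mulrA -exprD subnK ?(ltnW kl) //; field; exact: expf_neq0.
  apply: mlocMr => //; rewrite -(prednK (_ : 0 < l - k)%N) ?subn_gt0 //.
  by apply: mloc_M => //; apply: prmXn.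
have unit_at j M : prm M -> ~ sameon b M Q -> exists2 a, Ik j a & ~ M a.
  move=> pM ns; have qj0 : (0 < q ^ j)%N by rewrite expn_gt0 prime_gt0.
  have [e [Ae be e1 e2]] := sepn_strong qj0 pM (fun _ : 'I_1 => pQ) (fun _ => ns).
  have qn0 : (q ^ j)%:R != 0 :> algC by rewrite pnatr_eq0 -lt0n.
  exists e; first by split=> //; rewrite -natrX; apply: mloc_loc => //; apply: (e2 ord0).
  move=> Me; apply: (prm1 pM).
  have -> : 1 = e - (e - 1) by ring.
  apply: prmB => //; apply: mloc_Aint; rewrite ?rpredB ?rpred1 //.
  have -> : e - 1 = (q ^ j)%:R * ((e - 1) / (q ^ j)%:R) by rewrite mulrC divfK.
  by apply: mlocM => //; apply: loc_nat.
have locpi M : prm M -> ~ sameon b M Q -> loc M pi /\ loc M pi^-1.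
  move=> pM ns; split.
    have [a Ia na] := unit_at k M pM ns; have a0 := prm_nz pM na.
    have [A1 _ _] := trans k l ekl a Ia; have [A2 _ _] := Ia.
    by exists (a * pi), a; split=> //; rewrite mulrC mulKf.
  have [a Ia na] := unit_at l M pM ns; have a0 := prm_nz pM na.
  have [A1 _ _] := trans l k (esym ekl) a Ia; have [A2 _ _] := Ia.
  exists (a * (c k / c l)), a; split=> //; rewrite [a * _]mulrC mulfK //.
  by rewrite /pi invf_div.
exists pi; split=> //.
- apply: Aint_loc => M pM; case: (boolp.EM (sameon b M Q)) => [s|ns]; last by case: (locpi M pM ns).
  by apply/(sameon_loc pM pQ s bpi).1; apply: mloc_loc.
- apply: mloc_Aint => //.
  apply: Aint_loc => M pM; case: (boolp.EM (sameon b M Q)) => [s|ns]; last by case: (locpi M pM ns).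
  by apply/(sameon_loc pM pQ s bpi).1; apply: mloc_loc.
- move=> M pM Mpi; apply: boolp.contrapT => ns; have [_ h] := locpi M pM ns.
  by apply: (mloc1 pM); rewrite -(mulfV pi0); apply: mlocMr => //; apply: mloc_M.
Qed.
End Hurwitz.

(** Pigeonhole on the integral elements [c ^ K * x ^ i]; dividing the congruence by [x ^ i] costs
    only powers of [c], harmless once [c] is invertible. *)
Lemma pow_cong1 b x (c m : nat) : (0 < m)%N -> (0 < c)%N -> fld b x -> x != 0 -> c%:R * x \in Aint -> c%:R * x^-1 \in Aint ->
  exists N j : nat, (0 < N)%N /\ c%:R ^+ j * ((x ^+ N - 1) / m%:R) \in Aint.
Proof.
move=> m0 c0 bx x0 A1 A2; have [T [cl clE]] := finite_residues b m0.
have cz : c%:R != 0 :> algC by rewrite pnatr_eq0 -lt0n.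
pose K := #|T|.
have AK (i : 'I_K.+1) : c%:R ^+ K * x ^+ i \in Aint.
  have -> : c%:R ^+ K * x ^+ i = c%:R ^+ (K - i) * (c%:R * x) ^+ i.
    by rewrite exprMn mulrA -exprD subnK // -ltnS.
  by rewrite rpredM ?rpredX ?rpred_nat.
pose f (i : 'I_K.+1) := cl (c%:R ^+ K * x ^+ i).
have [i [j [ij fij]]] : exists i j : 'I_K.+1, (i < j)%N /\ f i = f j.
  have : ~ injective f by move/leq_card; rewrite card_ord ltnn.
  move=> ninj; apply: boolp.contrapT => no; apply: ninj => i j fij.
  apply: val_inj; case: (ltngtP i j) => // lt; case: no; first by exists i, j.
  by exists j, i.
have bK (i' : 'I_K.+1) : fld b (c%:R ^+ K * x ^+ i') by apply: fldM; apply: fldX => //; apply: fld_nat.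
have h := clE _ _ (AK j) (AK i) (bK j) (bK i) (esym fij).
exists (j - i)%N, (K + i)%N; rewrite subn_gt0 ij; split=> //.
have -> : c%:R ^+ (K + i) * ((x ^+ (j - i) - 1) / m%:R) =
   ((c%:R ^+ K * x ^+ j - c%:R ^+ K * x ^+ i) / m%:R) * (c%:R * x^-1) ^+ i.
  have -> : x ^+ j = x ^+ (j - i) * x ^+ i by rewrite -exprD subnK // ltnW.
  have mz : m%:R != 0 :> algC by rewrite pnatr_eq0 -lt0n.
  rewrite exprD exprMn exprVn; field; by rewrite expf_neq0 ?mz.
by rewrite rpredM ?rpredX.
Qed.

(** * Dimensions, quadratic extensions and primes of number fields *)
Lemma primitive_element_aut (s : seq algC) : exists z, [/\ forall x, x \in s -> fld z x,
  forall u v : aut, (forall x, x \in s -> u x = v x) -> u z = v z,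
  forall y, (forall x, x \in s -> fld y x) -> fld y z,
  forall F, is_subfield F -> (forall x, x \in s -> F x) -> F z &
  (forall x, x \in s -> x \in Aint) -> z \in Aint].
Proof.
have [z [z1 z2]] := primitive_element s; exists z; split=> //.
- move=> u v h; apply: (z2 (fun y => u y = v y)) => //; first by rewrite !rmorph0.
  by move=> x y; rewrite !rmorphD => -> ->.
- by move=> y; apply: primitive_element_fld.
- move=> F [F0 F1 FB FM FV] h; apply: z2 => // x y Fx Fy.
  by rewrite -[y]opprK -[- y]sub0r; apply: (FB) => //; apply: (FB).
- move=> h; apply: (z2 (fun y => y \in Aint)) => [|x y|//]; [exact: rpred0 | exact: rpredD].
Qed.

Lemma autX_add (u : aut) i j x : autX u (i + j) x = autX u i (autX u j x).
Proof. by rewrite !autXE iterD. Qed.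
Lemma autX_mul (u : aut) i j x : autX u (i * j) x = autX (autX u j) i x.
Proof. by elim: i => [|i IH] //; rewrite mulSn autX_add IH. Qed.
Lemma autX_fix (u : aut) k x : u x = x -> autX u k x = x.
Proof. by move=> h; elim: k => //= k ->. Qed.

(** On a normal field an automorphism acts freely on the embeddings up to its order, so all its
    cycles have one length [o], which divides their number. *)
Lemma free_order a (u : aut) : (forall v : aut, fld a (v a)) ->
  exists o, [/\ (0 < o)%N, (o %| deg a)%N & forall k, autX u k a = a <-> (o %| k)%N].
Proof.
move=> na.
have /exists_fun[f fE] : forall i : 'I_(deg a), exists j : 'I_(deg a), u (emb i a) = emb j a.
  by move=> i; have [j h] := emb_surj a (autM u (emb i)); exists j.
have finj : injective f.
  by move=> i j ij; apply: emb_inj => /=; apply: (fmorph_inj u); rewrite !fE ij.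
have itE k i : emb (iter k f i) a = autX u k (emb i a).
  by elim: k => //= k IH; rewrite -fE IH.
have fix_all k i : iter k f i = i -> autX u k a = a.
  move=> h; have := itE k i; rewrite h => /esym e.
  have := @fld_aut (emb i) _ _ (na (autV (emb i))); rewrite autKV; exact.
have all_fix k i : autX u k a = a -> iter k f i = i.
  move=> h; apply: emb_inj => /=; rewrite itE; exact: na.
have n0 := deg_gt0 a.
pose i0 := Ordinal n0; pose o := order f i0.
have o0 : (0 < o)%N by apply: order_gt0.
have uo : autX u o a = a by apply: (fix_all _ i0); apply: iter_order.
have uE k : autX u k a = a <-> (o %| k)%N.
  split=> [h|/dvdnP[m ->]]; last by rewrite autX_mul; apply: autX_fix.
  have h2 : autX u (k %% o) a = a.
    by move: h; rewrite {1}(divn_eq k o) addnC autX_add autX_mul (autX_fix _ uo).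
  have := all_fix _ i0 h2 => /(congr1 (findex f i0)).
  rewrite findex_iter ?ltn_mod // findex0 => e; by rewrite /dvdn e.
exists o; split=> //.
have oall i : order f i = o.
  apply/eqP; rewrite eqn_dvd; apply/andP; split.
    have := all_fix o i uo => h.
    have h2 : iter (o %% order f i) f i = i.
      move: h; rewrite {1}(divn_eq o (order f i)) addnC iterD.
      have -> : iter (o %/ order f i * order f i) f i = i; last by [].
      by elim: (_ %/ _)%N => [|m IH] //; rewrite mulSn iterD IH iter_order.
    have := congr1 (findex f i) h2; rewrite findex_iter ?ltn_mod ?order_gt0 // findex0 => e.
    by rewrite /dvdn e.
  by apply/uE/(fix_all _ i)/iter_order.
rewrite -[deg a]card_ord -(@fcard_order_set _ f finj o predT) ?dvdn_mull //.
  by apply/subsetP => i _; rewrite inE oall.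
Qed.

Lemma powers_free a n (c : 'I_n -> algC) : (n <= deg a)%N -> (forall i, c i \in Crat) ->
  \sum_i c i * a ^+ i = 0 -> forall i, c i = 0.
Proof.
move=> na cQ e i; pose P := \poly_(j < n) (if insub j is Some j' then c j' else 0).
have Pc (j : 'I_n) : P`_j = c j by rewrite coef_poly ltn_ord valK.
rewrite -Pc; suff -> : P = 0 by rewrite coef0.
apply: (@roots_geq_poly_eq0 _ _ (conjs a)) (conjs_uniq a) _.
  apply/allP => z; rewrite mem_conjs => /conj_aut[u <-]; apply/rootP.
  rewrite /P horner_poly; transitivity (u (\sum_i c i * a ^+ i)); last by rewrite e rmorph0.
  rewrite rmorph_sum; apply: eq_bigr => j _.
  by rewrite valK rmorphM rmorphXn; congr (_ * _); have /CratP[r ->] := cQ j; rewrite fmorph_rat.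
by apply: leq_trans (size_poly _ _) _.
Qed.

Lemma dim_deg F a n : (forall x, F x <-> fld a x) -> dimOver QQ F n -> n = deg a.
Proof.
move=> Fa [b [Fb indep span]].
have /exists_fun[A AE] : forall j : 'I_n, exists r : 'I_(deg a) -> algC, (forall k, r k \in Crat) /\ b j = \sum_k r k * a ^+ k.
  move=> j; have [r rE] := rat_coord ((Fa _).1 (Fb j)).
  by exists (fun k => ratr (r k)); split=> // k; apply/CratP; exists (r k).
have /exists_fun[B BE] : forall k : 'I_(deg a), exists r : 'I_n -> algC, (forall j, r j \in Crat) /\ a ^+ k = \sum_j r j * b j.
  by move=> k; have [r [r1 r2]] := span (a ^+ k) ((Fa _).2 (fldX k (@fld_id a))); exists r.
pose MA : 'M[algC]_(n, deg a) := \matrix_(j, k) A j k.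
pose MB : 'M[algC]_(deg a, n) := \matrix_(k, j) B k j.
have AQ j k : A j k \in Crat by case: (AE j).
have BQ k j : B k j \in Crat by case: (BE k).
have dQ (i j : nat) : (i == j)%:R \in (Crat : {pred algC}) by rewrite rpred_nat.
have AB : MA *m MB = 1%:M.
  apply/matrixP => i j; rewrite !mxE; apply/eqP; rewrite -subr_eq0; apply/eqP.
  under eq_bigr do rewrite !mxE.
  apply: (indep (fun j => \sum_k A i k * B k j - (i == j)%:R)).
    by move=> j'; apply: rpredB; rewrite ?rpred_nat // rpred_sum // => k _; rewrite rpredM.
  under eq_bigr => j' _ do rewrite mulrBl.
  rewrite sumrB; apply/eqP; rewrite subr_eq0; apply/eqP.
  rewrite [RHS](bigD1 i) //= eqxx mul1r [X in _ + X]big1 ?addr0 => [|j' /negbTE ji]; last by rewrite eq_sym ji mul0r.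
  rewrite [RHS](AE i).2; under eq_bigr do rewrite mulr_suml.
  rewrite exchange_big; apply: eq_bigr => k _ /=; rewrite (BE k).2 mulr_sumr.
  by apply: eq_bigr => j' _; rewrite mulrA.
have BA : MB *m MA = 1%:M.
  apply/matrixP => i j; rewrite !mxE; apply/eqP; rewrite -subr_eq0; apply/eqP.
  under eq_bigr do rewrite !mxE.
  apply: (@powers_free a (deg a) (fun j => \sum_k B i k * A k j - (i == j)%:R)) => //.
    by move=> j'; apply: rpredB; rewrite ?rpred_nat // rpred_sum // => k _; rewrite rpredM.
  under eq_bigr => j' _ do rewrite mulrBl.
  rewrite sumrB; apply/eqP; rewrite subr_eq0; apply/eqP.
  rewrite [RHS](bigD1 i) //= eqxx mul1r [X in _ + X]big1 ?addr0 => [|j' /negbTE ji]; last by rewrite eq_sym ji mul0r.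
  rewrite [RHS](BE i).2; under eq_bigr do rewrite mulr_suml.
  rewrite exchange_big; apply: eq_bigr => k _ /=; rewrite (AE k).2 mulr_sumr.
  by apply: eq_bigr => j' _; rewrite mulrA.
by apply/eqP; rewrite eqn_leq (mulmx1_min AB) (mulmx1_min BA).
Qed.

Lemma quad_ext K G : is_subfield K -> is_subfield G -> (forall x, K x -> G x) -> dimOver K G 2 ->
  exists w, [/\ G w, ~ K w, K (w ^+ 2) & forall x, G x -> exists a b, [/\ K a, K b & x = a + b * w]].
Proof.
move=> sK [G0 G1 GB GM GV] KG [b [Gb indep span]].
have [K0 K1 KB KM KV] := sK.
have KN x : K x -> K (- x) by move=> Kx; rewrite -sub0r; apply: (KB).
have KD x y : K x -> K y -> K (x + y) by move=> Kx Ky; rewrite -[y]opprK; apply/KB/KN.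
have i01 : (ord_max : 'I_2) = lift ord0 ord0 by apply: val_inj.
have span2 x : G x -> exists r s, [/\ K r, K s & x = r * b ord0 + s * b ord_max].
  move=> /span[c [Kc ->]]; exists (c ord0), (c ord_max); split=> //.
  by rewrite !big_ord_recl big_ord0 addr0 -i01.
have ind2 r s : K r -> K s -> r * b ord0 + s * b ord_max = 0 -> r = 0 /\ s = 0.
  move=> Kr Ks e; pose c (i : 'I_2) := if i == ord0 then r else s.
  have := indep c _ _ => h; have c0 : c ord0 = r by [].
  have c1 : c ord_max = s by [].
  rewrite -c0 -c1; split; apply: h; try (by move=> i; rewrite /c; case: ifP);
    by rewrite !big_ord_recl big_ord0 addr0 -i01 c0 c1.
have [x Gx nKx] : exists2 x, G x & ~ K x.
  apply: boolp.contrapT => no.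
  have GK x : G x -> K x by move=> Gx; apply: boolp.contrapT => nK; apply: no; exists x.
  have [h1 h2] := ind2 (b ord_max) (- b ord0) (GK _ (Gb _)) (KN _ (GK _ (Gb _))) ltac:(by ring).
  have b1 : b ord_max = 0 by [].
  have [_ h3] := ind2 0 1 K0 K1 ltac:(by rewrite b1 mulr0 mul0r addr0).
  by move/eqP: h3; rewrite oner_eq0.
have [r0 [s0 [Kr0 Ks0 e0]]] := span2 1 G1.
have [r1 [s1 [Kr1 Ks1 e1]]] := span2 x Gx.
pose D := r0 * s1 - r1 * s0.
have KDD : K D by apply: (KB); apply: (KM).
have D0 : D != 0.
  apply/eqP => D0.
  have h1 : s0 * x = s1.
    have : s0 * x - s1 = - D * b ord0.
      have -> : s0 * x - s1 = s0 * (r1 * b ord0 + s1 * b ord_max) - s1 * (r0 * b ord0 + s0 * b ord_max) by rewrite -e0 -e1 mulr1.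
      by rewrite /D; ring.
    by rewrite D0 oppr0 mul0r => /eqP; rewrite subr_eq0 => /eqP.
  have h2 : r0 * x = r1.
    have : r0 * x - r1 = D * b ord_max.
      have -> : r0 * x - r1 = r0 * (r1 * b ord0 + s1 * b ord_max) - r1 * (r0 * b ord0 + s0 * b ord_max) by rewrite -e0 -e1 mulr1.
      by rewrite /D; ring.
    by rewrite D0 mul0r => /eqP; rewrite subr_eq0 => /eqP.
  case: (eqVneq s0 0) => [s00|s0n].
    case: (eqVneq r0 0) => [r00|r0n].
      by move/eqP: e0; rewrite s00 r00 !mul0r addr0 oner_eq0.
    by apply: nKx; rewrite -(mulKf r0n x) h2; apply: (KM) => //; apply: (KV).
  by apply: nKx; rewrite -(mulKf s0n x) h1; apply: (KM) => //; apply: (KV).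
have bas y : G y -> exists r s, [/\ K r, K s & y = r + s * x].
  move=> /span2[r [s [Kr Ks ->]]].
  exists ((r * s1 - s * r1) / D), ((r0 * s - s0 * r) / D); split.
  - by apply: (KM); [apply: (KB); apply: (KM) | apply: (KV)].
  - by apply: (KM); [apply: (KB); apply: (KM) | apply: (KV)].
  have e : (r * s1 - s * r1) * (r0 * b ord0 + s0 * b ord_max) + (r0 * s - s0 * r) * (r1 * b ord0 + s1 * b ord_max) = D * (r * b ord0 + s * b ord_max).
    by rewrite /D; ring.
  rewrite -e0 -e1 mulr1 in e; by apply: (mulfI D0); rewrite -e; field.
have [c0 [c1 [Kc0 Kc1 e2]]] := bas (x ^+ 2) (GM _ _ Gx Gx).
have K2 : K 2^-1 by apply: (KV); apply: (KD).
(* Completing the square in [x ^ 2 = c0 + c1 * x]. *)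
exists (x - c1 / 2); split.
- by apply: GB => //; apply: KG; apply: (KM).
- by move=> h; apply: nKx; rewrite -(subrK (c1 / 2) x); apply: (KD) => //; apply: (KM).
- have -> : (x - c1 / 2) ^+ 2 = c0 + (c1 / 2) ^+ 2.
    have -> : (x - c1 / 2) ^+ 2 = x ^+ 2 - c1 * x + (c1 / 2) ^+ 2 by field.
    by rewrite e2; ring.
  by apply: (KD) => //; rewrite expr2; apply: (KM); apply: (KM).
move=> y /bas[r [s [Kr Ks ->]]]; exists (r + s * (c1 / 2)), s; split=> //; last by ring.
by apply: (KD) => //; apply: (KM) => //; apply: (KM).
Qed.

Lemma trace_prime w M : prm M -> prime_of (fld w) (fun x => fld w x /\ M x).
Proof.
move=> pM; split; split.
- by move=> x [wx Mx]; split=> //; apply: prmA Mx.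
- by split; [apply: fld0 | apply: prm0].
- by move=> x y [wx Mx] [wy My]; split; [apply: fldD | apply: prmD].
- by move=> a x [wa Aa] [wx Mx]; split; [apply: fldM | apply: prmZ].
- by case=> _; apply: prm1.
- have [q pq Mq] := prml pM; exists q%:R; split; first by split=> //; apply: fld_nat.
  by apply/eqP; rewrite pnatr_eq0 -lt0n prime_gt0.
- by move=> a b [wa Aa] [wb Ab] [_ /(prmM pM Aa Ab)[]]; [left | right].
Qed.

(** A prime containing [b] is a union of residue classes modulo [b], and there are finitely many of
    these. *)
Lemma prime_ext w (b : nat) : (0 < b)%N -> exists s : seq subsetA,
  forall P, prime_of (fld w) P -> P b%:R -> List.In P s.
Proof.
move=> b0; have [T [cl clE]] := finite_residues w b0.
pose code (P : subsetA) : {set T} := [set y | boolp.asbool (exists2 x, P x & cl x = y)].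
have inj P P' : prime_of (fld w) P -> prime_of (fld w) P' -> P b%:R -> P' b%:R -> code P = code P' -> P = P'.
  have half P1 P2 : prime_of (fld w) P1 -> prime_of (fld w) P2 -> P1 b%:R -> P2 b%:R -> code P1 = code P2 -> forall x, P1 x -> P2 x.
    move=> [[O1 _ _ _] _] [[O2 z2 D2 Z2] _] _ Pb /setP e x Px.
    have := e (cl x); rewrite !inE.
    have -> : boolp.asbool (exists2 x0, P1 x0 & cl x0 = cl x) by apply/boolp.asboolP; exists x.
    move/esym/boolp.asboolP => [y Py cxy].
    have [wx Ax] := O1 x Px; have [wy Ay] := O2 y Py.
    have h := clE x y Ax Ay wx wy (esym cxy).
    have bz : b%:R != 0 :> algC by rewrite pnatr_eq0 -lt0n.
    have -> : x = y + (x - y) / b%:R * b%:R by rewrite divfK // addrC subrK.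
    apply: D2 => //; apply: Z2 => //; split=> //.
    by apply: fldM; [apply: fldB | apply/fldV/fld_nat].
  move=> p1 p2 h1 h2 e; apply: boolp.funext => x; apply: boolp.propext; split; apply: half => //.
have /exists_fun[g gE] : forall A : {set T}, exists P : subsetA,
    (exists P, [/\ prime_of (fld w) P, P b%:R & code P = A]) -> [/\ prime_of (fld w) P, P b%:R & code P = A].
  move=> A; case: (boolp.EM (exists P, [/\ prime_of (fld w) P, P b%:R & code P = A])) => [[P h]|no].
    by exists P.
  by exists (fun=> True).
exists (map g (enum {: {set T}})) => P pP Pb.
have [p1 p2 p3] := gE (code P) (ex_intro _ P (And3 pP Pb erefl)).
have -> : P = g (code P) by apply: inj.
have : code P \in enum {: {set T}} by rewrite mem_enum.
elim: (enum _) => // A s IH; rewrite inE => /predU1P[->|/IH h]; [by left | by right].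
Qed.

Lemma prime_has_nat w P : prime_of (fld w) P -> exists2 n : nat, (0 < n)%N & P n%:R.
Proof.
move=> [[OP P0 PD PZ] [P1 [x [Px /eqP x0]] PM]].
have [wx Ax] := OP x Px; have [y [Ay wy e]] := fnorm_dvd Ax wx.
have /intrP[z ze] := fnorm_int Ax wx.
have z0 : z != 0 by rewrite -(intr_eq0 algC) -ze fnorm_eq0.
exists (absz z); first by rewrite absz_gt0.
have Pz : P z%:~R by rewrite -ze e mulrC; apply: PZ.
rewrite natr_absz intr_norm; case: (lerP 0 z) => h.
  by rewrite ger0_norm ?ler0z.
rewrite ltr0_norm ?ltrz0 // -mulN1r; apply: PZ => //.
by split; [apply/fldN/fld1 | rewrite rpredN rpred1].
Qed.

(** * The fields G and T, and the ring R *)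
Definition normal a := forall u : aut, fld a (u a).

Lemma subfield_gen S : is_subfield (genfield S).
Proof.
split.
- by move=> F [].
- by move=> F [].
- by move=> x y hx hy F sF h; have [_ _ FB _ _] := sF; apply: (FB); [apply: hx | apply: hy].
- by move=> x y hx hy F sF h; have [_ _ _ FM _] := sF; apply: (FM); [apply: hx | apply: hy].
- by move=> x hx F sF h; have [_ _ _ _ FV] := sF; apply: (FV); apply: hx.
Qed.

Lemma galois_closure_aut K (u : aut) x : galois_closure K x -> galois_closure K (u x).
Proof.
move=> h F sF hF; apply: (h (fun y => F (u y))).
  have [F0 F1 FB FM FV] := sF; split.
  - by rewrite rmorph0.
  - by rewrite rmorph1.
  - by move=> a b; rewrite rmorphB; apply: FB.
  - by move=> a b; rewrite rmorphM; apply: FM.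
  - by move=> a; rewrite fmorphV; apply: FV.
by move=> y [s [z [Kz ->]]]; apply: hF; exists (autM u s), z.
Qed.

(** [lamh] generates the normal closure of [fld om], a field obtained from [K] by a square root [w].
    An automorphism has order [o] prime to [p] on the closure of [K]; its [o]-th power changes the
    conjugates of [w] at most by signs, so twice that exponent kills it, and [p] is odd. *)
Lemma ext_exponent_prime_to K om p : is_subfield K -> (forall x, K x -> fld om x) -> dimOver K (fld om) 2 ->
  (exists d, dimOver QQ (galois_closure K) d /\ ~~ (p %| d)%N) -> prime p -> odd p ->
  exists lamh, [/\ normal lamh, forall u : aut, fld lamh (u om) &
    forall u : aut, exists e, [/\ (0 < e)%N, ~~ (p %| e)%N & autX u e lamh = lamh]].
Proof.
move=> sK KG dim [d [dimd pd]] pp op.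
have [w [Gw nKw Kw2 wspan]] := quad_ext sK (is_subfield_fld om) KG dim.
have nf : number_field (galois_closure K).
  by split; [exact: subfield_gen | exists d].
have [k [Gk kE]] := number_field_fld nf.
have dE := dim_deg kE dimd.
have nk : normal k by move=> u; exact: (kE _).1 (@galois_closure_aut K u k Gk).
have Kk (u : aut) x : K x -> fld k (u x).
  by move=> Kx; apply/kE => F sF h; apply: h; exists u, x.
have [lamh [l1 l2 l3 l4 _]] := primitive_element_aut (conjs om).
have nl : normal lamh.
  move=> u; have l5 : fld (u lamh) lamh.
    apply: l3 => x xo; have /conj_aut[v vE] : root (minCpoly om) x by rewrite -mem_conjs.
    have : fld lamh (autV u x) by apply: l1; rewrite -vE; apply: (aut_conjs (autM (autV u) v)).
    by move/(@fld_aut u); rewrite autKV.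
  have := @fld_aut (autV u) _ _ l5; rewrite autVK => l6.
  by have := nrm_V l6; rewrite autVV.
exists lamh; split=> // [u|u]; first exact/l1/aut_conjs.
have [o [o0 od oE]] := free_order u nk.
have fixk x : fld k x -> autX u o x = x.
  by move=> kx; apply: (fldE (u := autX u o) (v := idfun) kx); apply/oE.
exists (o * 2)%N; split; first by rewrite muln_gt0 o0.
  rewrite Euclid_dvdM // negb_or; apply/andP; split.
    by apply: contra pd => /dvdn_trans; apply; rewrite dE.
  by rewrite dvdn_prime2 //; apply: contraL op => /eqP ->.
apply: (l2 (autX u (o * 2)) idfun) => x xo /=.
have /conj_aut[v <-] : root (minCpoly om) x by rewrite -mem_conjs.
have [a [c [Ka Kc ->]]] := wspan om (@fld_id om).
rewrite rmorphD rmorphM [LHS]rmorphD rmorphM.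
have fix2 y : fld k y -> autX u (o * 2) y = y by move=> ky; rewrite muln2 -addnn autX_add !fixk.
congr (_ + _ * _); try by apply/fix2/Kk.
have : (autX u o (v w)) ^+ 2 = (v w) ^+ 2 by rewrite -!rmorphXn /=; apply/fixk/Kk.
move/eqP; rewrite eqf_sqr => /orP[] /eqP e; rewrite muln2 -addnn autX_add e ?e //.
by rewrite rmorphN e opprK.
Qed.

Section Global.
Variables (gam om lamh : algC) (p : nat).
Hypotheses (pp : prime p) (op : odd p) (Ag : gam \in Aint) (acong : deg gam = p) (ng : normal gam).
Hypotheses (nl : normal lamh) (lom : fld lamh om).
Hypothesis EXP : forall u : aut, exists e, [/\ (0 < e)%N, ~~ (p %| e)%N & autX u e lamh = lamh].

Lemma T_order (u : aut) : u gam <> gam -> forall k, autX u k gam = gam <-> (p %| k)%N.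
Proof.
move=> ug; have [o [o0 od oE]] := free_order u ng; rewrite acong in od.
have /primeP[_ /(_ o od)/orP[/eqP o1|/eqP <-]] := pp; last exact: oE.
by case: ug; have [_ h] := oE 1%N; apply: h; rewrite o1.
Qed.
Lemma T_pow (u : aut) : autX u p gam = gam.
Proof.
case: (eqVneq (u gam) gam) => [h|/eqP h]; first exact: autX_fix.
by apply/(T_order h).
Qed.
Lemma T_gen (u v : aut) : u gam <> gam -> exists j, v gam = autX u j gam.
Proof.
move=> ug.
have /exists_fun[f fE] : forall j : 'I_p, exists i : 'I_(deg gam), autX u j gam = emb i gam.
  by move=> j; apply: emb_surj.
have finj : injective f.
  have half (i j : 'I_p) : (i <= j)%N -> f i = f j -> i = j.
    move=> ij e; have : autX u (j - i) gam = gam.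
      apply: (fmorph_inj (autX u i)); rewrite -autX_add subnKC // !fE e //.
    move/(T_order ug) => dv; apply: val_inj; apply/eqP; rewrite eqn_leq ij /= -subn_eq0.
    move: dv; case: (posnP (j - i)) => [-> //|h] /(dvdn_leq h).
    by rewrite leqNgt (leq_ltn_trans (leq_subr _ _)).
  move=> i j e; case: (leqP i j) => [ij|/ltnW ij]; first exact: half.
  by symmetry; apply: half.
have [i vi] := emb_surj gam v.
have [j jE] : exists j, f j = i.
  have /codomP[j ->] : i \in codom f by apply: inj_card_onto => //; rewrite !card_ord acong.
  by exists j.
by exists j; rewrite fE jE vi.
Qed.
Lemma T_move_pow (u : aut) k : u gam <> gam -> ~~ (p %| k)%N -> autX u k gam <> gam.
Proof. by move=> ug pk /(T_order ug) h; rewrite h in pk. Qed.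
Lemma T_moved : exists u : aut, u gam <> gam.
Proof.
apply: boolp.contrapT => no.
have h (u : aut) : u gam = gam by apply: boolp.contrapT => ug; apply: no; exists u.
have : (1 < deg gam)%N by rewrite acong prime_gt1.
move=> n1; pose i0 := Ordinal (ltnW n1); pose i1 := Ordinal n1.
by have := @emb_inj gam i0 i1; rewrite /= !h => /(_ erefl).
Qed.
Lemma T_irr : gam \notin Crat.
Proof.
by apply/negP => /CratP[r rE]; have [u] := T_moved; rewrite rE fmorph_rat.
Qed.
Lemma T_conj (g u : aut) : u gam <> gam -> autM g (autM u (autV g)) gam <> gam.
Proof.
move=> ug; rewrite !autME => h; apply: ug.
have {}h : u (autV g gam) = autV g gam by apply: (fmorph_inj g); rewrite autKV.
have : fld (autV g gam) gam.
  by have := nrm_sym (ng (autV g)).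
by move=> /(_ u h).
Qed.

(** [T] is disjoint from [fld lamh]: the [e]-th power of [u] becomes trivial on [lamh], but not on
    [T], where [u] has order [p]. *)
Lemma ex_moving_aut : exists th : aut, th lamh = lamh /\ th gam <> gam.
Proof.
have [u ug] := T_moved; have [e [e0 pe ue]] := EXP u.
by exists (autX u e); split=> //; apply: T_move_pow.
Qed.

(** [inert M] plays the role of "the prime below [M] does not split in [T]", in a form that is stable under conjugation. *)
Definition inert M := forall be, normal be -> exists th : aut, [/\ th lamh = lamh, th gam <> gam & dec be M th].

Lemma inert_pim (g : aut) M : inert M -> inert (pim g M).
Proof.
move=> h be nb; have [th [t1 t2 t3]] := h be nb.
exists (autM g (autM th (autV g))); split.
- have := fldE (nl (autV g)) (u := th) (v := idfun) t1; rewrite !autME /= => ->; exact: autKV.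
- exact: T_conj.
move=> x bx; rewrite {1}/pim (t3 _ (fld_trans (nb (autV g)) (fld_aut (u := autV g) bx))) /pim.
suff -> : autV g (autV (autM g (autM th (autV g))) x) = autV th (autV g x) by [].
by apply: (fmorph_inj (autM g th)); rewrite !autME !autKV -[RHS](autKV (autM g (autM th (autV g)))) !autME.
Qed.

Definition trace M : subsetA := fun x => fld om x /\ M x.

(** As only one prime lies above, [th0] fixes the prime of [fld w]; correcting it by an automorphism
    over [fld w] makes it fix the prime of [fld be], and a power prime to [p] restores triviality on
    [lamh]. *)
Lemma inert_nsplit w M P : prm M -> fld w om -> fld w gam ->
  (forall x, fld om x -> M x <-> P x) -> not_split (fld om) (fld w) P -> inert M.
Proof.
move=> pM wo wg MP [Q [pQ Qab uQ]] be nb.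
have [th0 [t1 t2]] := ex_moving_aut.
have ab1 : lies_above (fld om) (fun x => fld w x /\ M x) P.
  move=> x ox; rewrite -(MP x ox); split=> [[]//|Mx]; split=> //; exact: fld_trans ox.
have ab2 : lies_above (fld om) (fun x => fld w x /\ pim th0 M x) P.
  move=> x ox; have e : autV th0 x = x.
    by apply: (fmorph_inj th0); rewrite autKV; apply/esym/(fld_trans lom ox).
  rewrite -(MP x ox) /pim e; split=> [[]//|Mx]; split=> //; exact: fld_trans ox.
have q1 := uQ _ (trace_prime w pM) ab1; have q2 := uQ _ (trace_prime w (prm_pim th0 pM)) ab2.
have s : sameon w M (pim th0 M).
  by move=> x wx; split=> h; [have [_ ] := (q2 x).2 ((q1 x).1 (conj wx h)) | have [_ ] := (q1 x).2 ((q2 x).1 (conj wx h))].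
have [u [uw su]] := prm_trans be pM (prm_pim th0 pM) s.
pose de := autM (autV u) th0.
have uVg : autV u gam = gam by apply: (fmorph_inj u); rewrite autKV; apply/esym/wg.
have dg : de gam <> gam.
  rewrite /de autME => h; apply: t2; apply: (fmorph_inj (autV u)); by rewrite h uVg.
have dd : dec be M de.
  move=> x bx; have ub : fld be (u x) by apply: fld_trans (nb u) _; apply: fld_aut.
  have := su (u x) ub; rewrite pimE => <-; rewrite /pim.
  suff -> : autV de x = autV th0 (u x) by [].
  by apply: (fmorph_inj de); rewrite autKV /de autME autKV autVK.
have [e [e0 pe ee]] := EXP de.
by exists (autX de e); split=> //; [apply: T_move_pow | apply: dec_X].
Qed.

Section Ring.
Variables (XG : subsetA -> Prop) (s : seq subsetA) (w : algC) (b : nat).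
Hypothesis XGp : forall P, XG P -> prime_of (fld om) P.
Hypotheses (wo : fld w om) (wg : fld w gam).
Hypothesis XGs : forall P, XG P -> ~ List.In P s -> not_split (fld om) (fld w) P.
Hypothesis b0 : (0 < b)%N.
Hypothesis sb : forall P, XG P -> List.In P s -> P b%:R.

Definition NN P := XG P \/ (prime_of (fld om) P /\ P b%:R).
Notation R := (OFW (fld om) NN).

Lemma NN_prime P : NN P -> prime_of (fld om) P.
Proof. by case=> [/XGp|[]]. Qed.

(** A prime of [XG] not containing [b] does not split, and this passes to conjugates by [inert_pim];
    so if [M] is not inert, no conjugate of it induces a prime at which [R] allows denominators. *)
Lemma inert_or M : prm M -> ~ M b%:R -> inert M \/ forall g : aut, ~ NN (trace (pim g M)).
Proof.
move=> pM nb; case: (boolp.EM (inert M)) => [|ni]; [by left | right=> g h].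
have nbg : ~ trace (pim g M) b%:R by case=> _; rewrite /pim rmorph_nat.
case: h => [X|[_ h]]; last exact: nbg.
have ns := XGs X (fun i => nbg (sb X i)).
apply: ni; have -> : M = pim (autV g) (pim g M).
  by apply: boolp.funext => x; rewrite pimV pimE.
apply: inert_pim; apply: (inert_nsplit (w := w) (P := trace (pim g M))) => //; first exact: prm_pim.
by move=> x ox; split=> [|[]].
Qed.

Lemma R_loc M x : prm M -> ~ NN (trace M) -> R x -> loc M x.
Proof.
move=> pM nN [_ h]; have [a [c [[oa Aa] [oc Ac] nc ->]]] := h _ (trace_prime om pM) nN.
by exists a, c; split=> // Mc; apply: nc.
Qed.
Lemma R_int x : fld om x -> x \in Aint -> R x.
Proof.
move=> ox Ax; split=> // P [[OP P0 PD PZ] [P1 _ _]] _; exists x, 1; rewrite divr1; split=> //.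
by split; [apply: fld1 | apply: rpred1].
Qed.
Lemma R_nat n : R n%:R. Proof. by apply: R_int; rewrite ?rpred_nat //; apply: fld_nat. Qed.
Lemma on_D P x y : prime_of (fld om) P -> ord_nonneg (fld om) P x -> ord_nonneg (fld om) P y ->
  ord_nonneg (fld om) P (x - y) /\ ord_nonneg (fld om) P (x * y).
Proof.
case=> [[OP P0 PD PZ] [P1 _ PM]] [a [c [[oa Aa] [oc Ac] nc ->]]] [a' [c' [[oa' Aa'] [oc' Ac'] nc' ->]]].
have c0 : c != 0 by apply/eqP => e; apply: nc; rewrite e.
have c0' : c' != 0 by apply/eqP => e; apply: nc'; rewrite e.
have ncc : ~ P (c * c') by case/(PM c c' (conj oc Ac) (conj oc' Ac')).
split; [exists (a * c' - a' * c), (c * c') | exists (a * a'), (c * c')]; split=> //; try (by field; rewrite c0 c0').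
- by split; [apply: fldB; apply: fldM | rewrite rpredB ?rpredM].
- by split; [apply: fldM | rewrite rpredM].
- by split; [apply: fldM | rewrite rpredM].
- by split; [apply: fldM | rewrite rpredM].
Qed.
Lemma R_B x y : R x -> R y -> R (x - y).
Proof. by case=> ox hx [oy hy]; split=> [|P pP nP]; [exact: fldB | have [] := on_D pP (hx P pP nP) (hy P pP nP)]. Qed.
Lemma R_M x y : R x -> R y -> R (x * y).
Proof. by case=> ox hx [oy hy]; split=> [|P pP nP]; [exact: fldM | have [] := on_D pP (hx P pP nP) (hy P pP nP)]. Qed.
Lemma R_natV q : (q %| b)%N -> R (q%:R^-1).
Proof.
move=> qb; split; first by apply/fldV/fld_nat.
move=> P pP nN; exists 1, q%:R; rewrite div1r; split=> //.
- by split; [apply: fld1 | apply: rpred1].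
- by split; [apply: fld_nat | apply: rpred_nat].
move=> Pq; apply: nN; right; split=> //; case/dvdnP: qb => k ->.
have [[_ _ _ PZ] _] := pP; rewrite natrM; apply: PZ => //.
by split; [apply: fld_nat | apply: rpred_nat].
Qed.
End Ring.
End Global.

Lemma four_neq0 : (4 : algC) != 0. Proof. by rewrite pnatr_eq0. Qed.

Lemma mloc4 M x : prm M -> mloc M (x / 4) -> mloc M x.
Proof.
move=> pM h; have -> : x = 4 * (x / 4) by rewrite mulrC divfK // four_neq0.
by apply: mlocM => //; apply: loc_nat.
Qed.

Lemma loc_sqr M x : prm M -> loc M (x ^+ 2) -> loc M x.
Proof.
move=> pM h; apply: boolp.contrapT => /(locVm pM)[x0 m].
apply: (mloc1 pM); have -> : 1 = x ^+ 2 * (x^-1 * x^-1) by field.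
by apply: mlocM => //; apply: mlocM => //; apply: mloc_loc.
Qed.

(** * Prescribing squareness at finitely many primes *)

Section Epsilon.
Variables (phi : algC) (S : (algC -> Prop) -> Prop).
Hypothesis Sphi : forall M M', prm M -> prm M' -> sameon phi M M' -> S M -> S M'.

(** On [S], [e] is 1 modulo [4 M], so that it is a local square; off [S], it is a unit and not a
    square modulo [4 M]. [S M] will say that [sig] fixes the prime of [fld lam] below [M]. *)
Definition rule M e := (S M -> mloc M ((e - 1) / 4)) /\
  (~ S M -> ~ M e /\ forall n, fld phi n -> ~ mloc M ((e * n ^+ 2 - 1) / 4)).

Lemma rule_shift M e e' : prm M -> e \in Aint -> e' \in Aint -> mloc M ((e - e') / 4) -> rule M e -> rule M e'.
Proof.
move=> pM Ae Ae' d [r1 r2]; split=> [/r1 h|/r2[h1 h2]].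
  have -> : (e' - 1) / 4 = (e - 1) / 4 - (e - e') / 4 by field.
  exact: mlocB.
have ne' : ~ M e'.
  move=> Me'; apply: h1; apply: mloc_Aint => //; have -> : e = e' + (e - e') by ring.
  by apply: mlocD => //; [apply: mloc_M | apply: mloc4].
split=> // n fn h; apply: (h2 n fn).
have ln : loc M n.
  apply: boolp.contrapT => /(locVm pM)[n0 mn]; apply: ne'; apply: mloc_Aint => //.
  have -> : e' = ((e' * n ^+ 2 - 1) + 1) * (n^-1 * n^-1) by field.
  apply: mlocM => //; first by apply: locD (loc1 pM) => //; apply/mloc_loc/mloc4.
  by apply: mlocM => //; apply: mloc_loc.
have -> : (e * n ^+ 2 - 1) / 4 = (e' * n ^+ 2 - 1) / 4 + (e - e') / 4 * n ^+ 2 by field.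
by apply: mlocD => //; apply: mlocMr => //; apply: locX.
Qed.

Lemma rule_same M M' e : prm M -> prm M' -> e \in Aint -> fld phi e -> sameon phi M M' -> rule M e -> rule M' e.
Proof.
move=> pM pM' Ae fe s [r1 r2]; have s' := sameon_sym s.
have f4 : fld phi 4 by apply: fld_nat.
split=> [S'|nS'].
  apply/(sameon_loc pM pM' s _).2; last by apply: r1; apply: Sphi s' S'.
  by apply: fldM; [apply: fldB => //; apply: fld1 | apply: fldV].
have [|h1 h2] := r2; first by move=> SM; apply: nS'; apply: Sphi s SM.
split=> [/s' h|n fn h]; first exact/h1/h.
apply: (h2 n fn); apply/(sameon_loc pM pM' s _).2 => //.
by apply: fldM; [apply: fldB; [apply: fldM => //; apply: fldX | apply: fld1] | apply: fldV].
Qed.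

(** The geometric series in [1 - y], cut off where its remainder lies in [4 M]. *)
Lemma inv_mod4 M a : prm M -> a \in Aint -> fld phi a -> ~ M a ->
  exists d, [/\ d \in Aint, fld phi d & mloc M ((a * d - 1) / 4)].
Proof.
move=> pM Aa fa na; have [k Mk] := prm_inv pM Aa na.
set y := a ^+ k * a in Mk.
have Ay : y \in Aint by rewrite rpredM ?rpredX.
have fy : fld phi y by apply: fldM => //; apply: fldX.
have M1y : M (1 - y) by rewrite -opprB; apply: prmN.
have [K /(_ K (leqnn _)) hK] := prm_nil pM (isT : 0 < 4)%N M1y.
exists (a ^+ k * \sum_(i < K) (1 - y) ^+ i); split.
- by rewrite rpredM ?rpredX // rpred_sum // => i _; rewrite rpredX // rpredB ?rpred1.
- by apply: fldM; [apply: fldX | apply: fld_sum => i _; apply/fldX/fldB => //; apply: fld1].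
have -> : a * (a ^+ k * \sum_(i < K) (1 - y) ^+ i) = 1 - (1 - y) ^+ K.
  rewrite -[RHS]opprB subrX1 mulrA [a * _]mulrC -/y; ring.
have -> : (1 - (1 - y) ^+ K - 1) / 4 = - ((1 - y) ^+ K / 4) by field.
exact: mlocN.
Qed.

(** Squaring is not injective, hence not surjective, on the finite set of unit classes modulo [4 M]: [1] and [-1] are distinct classes with the same square. *)
Lemma nonsquare_unit M : prm M -> exists u, [/\ u \in Aint, fld phi u, ~ M u &
  forall n, fld phi n -> ~ mloc M ((u * n ^+ 2 - 1) / 4)].
Proof.
move=> pM; apply: boolp.contrapT => no.
pose A x := [/\ x \in Aint, fld phi x & ~ M x].
pose eqv x y := mloc M ((x - y) / 4).
have eqvS x y : eqv x y -> eqv y x.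
  by rewrite /eqv -opprB mulNr => h; rewrite -[X in mloc M X]opprK; apply: mlocN => //; rewrite opprK.
have eqvT x y z : eqv x y -> eqv y z -> eqv x z.
  by rewrite /eqv => h1 h2; have := mlocD pM h1 h2; rewrite -mulrDl addrA subrK.
have eqvX x y : A x -> A y -> eqv x y -> eqv (x ^+ 2) (y ^+ 2).
  move=> [Ax _ _] [Ay _ _] h; rewrite /eqv subr_sqr mulrAC; apply: mlocMr => //.
  by apply: loc_Aint => //; rewrite rpredD.
have /exists_fun[n nE] : forall u, exists n, A u -> A n /\ eqv u (n ^+ 2).
  move=> u; case: (boolp.EM (A u)) => [Au|nA]; last by exists 0.
  have [Auu fu nu] := Au.
  have [n [fn mn]] : exists n, fld phi n /\ mloc M ((u * n ^+ 2 - 1) / 4).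
    apply: boolp.contrapT => no'; apply: no; exists u; split=> // n fn h; apply: no'.
    by exists n.
  have mun := mloc4 pM mn.
  have lun : loc M (u * n ^+ 2) by rewrite -[u * n ^+ 2](subrK 1); apply: locD => //; [apply: mloc_loc | apply: loc1].
  have n0 : n != 0.
    apply/eqP => n0; apply: (mloc1 pM); rewrite n0 expr0n mulr0 sub0r in mun.
    by rewrite -[1]opprK; apply: mlocN.
  have ln : loc M n.
    apply: loc_sqr => //; have u0 := prm_nz pM nu.
    have -> : n ^+ 2 = u^-1 * (u * n ^+ 2) by rewrite mulKf.
    by apply: locM => //; apply: loc_unit => //; [apply: loc_Aint | move/(mloc_Aint pM Auu)].
  have nmn : ~ mloc M n.
    move=> h; apply: (mloc1 pM); have -> : 1 = u * n * n - (u * n ^+ 2 - 1) by ring.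
    by apply: mlocB => //; apply: mlocM => //; apply: locM => //; apply: loc_Aint.
  have lnV := loc_unit ln nmn.
  have [a [c [[Aa Ac] [fa fc] [nac c0] e]]] := prufer pM n^-1.
  have {}fa : fld phi a by apply: fld_trans fa; apply: fldV.
  have {}fc : fld phi c by apply: fld_trans fc; apply: fldV.
  have a0 : a != 0.
    by apply/eqP => a0; move/eqP: e; rewrite a0 mul0r invr_eq0 (negbTE n0).
  have na : ~ M a.
    move=> Ma; case: nac => // nc; apply: nc; apply: mloc_Aint => //.
    have -> : c = n * a by rewrite -[n]invrK e; field; rewrite c0 a0.
    by apply: mlocM => //; apply: mloc_M.
  have nc : ~ M c.
    move=> Mc; apply: na; apply: mloc_Aint => //.
    have -> : a = n^-1 * c by rewrite e divfK.
    by apply: mlocM => //; apply: mloc_M.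
  have [d [Ad fd hd]] := inv_mod4 pM Ac fc nc.
  exists (a * d) => _; have Aad : a * d \in Aint by rewrite rpredM.
  have nad : ~ M (a * d).
    move=> h; apply: (mloc1 pM).
    have -> : 1 = n * (a * d) - (c * d - 1) by rewrite -[n]invrK e; field; rewrite c0 a0.
    by apply: mlocB => //; [apply: mlocM => //; apply: mloc_M | apply: mloc4].
  split; first by split=> //; apply: fldM.
  have e1 : mloc M ((n^-1 - a * d) / 4).
    have -> : (n^-1 - a * d) / 4 = n^-1 * (- ((c * d - 1) / 4)) by rewrite e; field.
    by apply: mlocM => //; apply: mlocN.
  have -> : u = (u * n ^+ 2 - 1) * n^-1 ^+ 2 + n^-1 ^+ 2 by field.
  rewrite /eqv; have -> : ((u * n ^+ 2 - 1) * n^-1 ^+ 2 + n^-1 ^+ 2 - (a * d) ^+ 2) / 4 =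
     (u * n ^+ 2 - 1) / 4 * n^-1 ^+ 2 + (n^-1 - a * d) / 4 * (n^-1 + a * d) by field.
  apply: mlocD => //; apply: mlocMr => //; first exact: locX.
  by apply: locD => //; apply: loc_Aint.
have [q pq Mq] := prml pM.
have q40 : (0 < 4 * q)%N by rewrite muln_gt0 /= prime_gt0.
have [T [cl clE]] := finite_residues phi q40.
pose P k := boolp.asbool (exists x : 'I_k -> algC, (forall i, A (x i)) /\ (forall i j, eqv (x i) (x j) -> i = j)).
have exP : exists k, P k.
  by exists 0%N; apply/boolp.asboolP; exists (fun=> 0); split; case.
have bP k : P k -> (k <= #|T|)%N.
  move/boolp.asboolP => [x [xA xE]].
  have inj : injective (fun i => cl (x i)).
    move=> i j e; apply: xE; have [A1 f1 _] := xA i; have [A2 f2 _] := xA j.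
    have q0 : q%:R != 0 :> algC by rewrite pnatr_eq0 -lt0n prime_gt0.
    have h := clE _ _ A1 A2 f1 f2 e.
    rewrite /eqv; have -> : (x i - x j) / 4 = (x i - x j) / (4 * q)%:R * q%:R by rewrite natrM; field; rewrite q0.
    by apply: mlocM => //; [apply: loc_Aint | apply: mloc_M].
  by have := leq_card _ inj; rewrite card_ord.
case: (ex_maxnP exP bP) => k /boolp.asboolP[x [xA xE]] kmax.
pose y i := n (x i).
have yA i : A (y i) by case: (nE _ (xA i)).
have ysq i : eqv (x i) (y i ^+ 2) by case: (nE _ (xA i)).
have yE i j : eqv (y i) (y j) -> i = j.
  move=> h; apply: xE; apply: (eqvT _ _ _ (ysq i)); apply: (eqvT _ _ _ _ (eqvS _ _ (ysq j))).
  exact: eqvX.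
have cov u : A u -> exists i, eqv u (y i).
  move=> Au; apply: boolp.contrapT => nu.
  suff /kmax : P k.+1 by rewrite ltnn.
  apply/boolp.asboolP; exists (fun i => if unlift ord0 i is Some j then y j else u); split.
    by move=> i; case: unliftP => [j _|_].
  move=> i j; case: unliftP => [i' ->|->]; case: unliftP => [j' ->|->] // h.
  - by rewrite (yE _ _ h).
  - by case: nu; exists i'; apply: eqvS.
  - by case: nu; exists j'.
have A1 : A 1 by split; [apply: rpred1 | apply: fld1 | apply: prm1].
have AN1 : A (- 1).
  by split; [rewrite rpredN rpred1 | apply/fldN/fld1 | move/(prmN pM); rewrite opprK; apply: prm1].
have [i hi] := cov _ A1; have [j hj] := cov _ AN1.
have e1 : eqv (x i) 1.
  by have := eqvX _ _ A1 (yA i) hi; rewrite expr1n => h; apply: eqvT (ysq i) (eqvS _ _ h).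
have e2 : eqv (x j) 1.
  by have := eqvX _ _ AN1 (yA j) hj; rewrite sqrrN expr1n => h; apply: eqvT (ysq j) (eqvS _ _ h).
have ij : i = j by apply: xE; apply: eqvT e1 (eqvS _ _ e2).
rewrite -ij in hj; have : eqv 1 (- 1) := eqvT _ _ _ hi (eqvS _ _ hj).
rewrite /eqv => h; apply: (mloc1 pM).
have -> : 1 = 2 * ((1 - -1) / 4) :> algC by field.
by apply: mlocM => //; apply: loc_nat.
Qed.

Lemma rule_list (l : seq (algC -> Prop)) : (forall M, List.In M l -> prm M) ->
  exists e, [/\ e \in Aint, fld phi e & forall M, List.In M l -> rule M e].
Proof.
elim: l => [|M l IH] h; first by exists 0; split=> //; apply: fld0.
have [|e [Ae fe he]] := IH; first by move=> M' i; apply: h; right.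
have pM : prm M by apply: h; left.
case: (boolp.EM (exists2 M', List.In M' l & sameon phi M M')) => [[M' i s]|no].
  exists e; split=> // M'' [<-|]; last exact: he.
  by apply: rule_same (sameon_sym s) (he _ i) => //; apply: h; right.
have [u [Au fu ru]] : exists u, [/\ u \in Aint, fld phi u & rule M u].
  case: (boolp.EM (S M)) => [SM|nS].
    exists 1; split; [apply: rpred1 | apply: fld1|].
    by split=> [_|//]; rewrite subrr mul0r; apply: mloc0.
  have [u [Au fu nu hu]] := nonsquare_unit pM.
  by exists u; split.
pose Ms (i : 'I_(size l)) := nth M l i.
have nthIn i : (i < size l)%N -> List.In (nth M l i) l.
  by elim: (l) i => [|a l' IH'] [|i] //= il; [left | right; apply: IH'].
have pMs i : prm (Ms i) by apply: h; right; apply: nthIn.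
have nMs i : ~ sameon phi M (Ms i) by move=> s; apply: no; exists (Ms i) => //; apply: nthIn.
have [d [Ad fd d1 d2]] := sepn_strong (isT : 0 < 4)%N pM pMs nMs.
(* [d] is close to 1 at [M] and to 0 at the primes already treated. *)
exists (e + d * (u - e)); split.
- by rewrite rpredD ?rpredM ?rpredB.
- by apply: fldD => //; apply: fldM => //; apply: fldB.
have Ae' : e + d * (u - e) \in Aint by rewrite rpredD ?rpredM ?rpredB.
have Inth (l' : seq (algC -> Prop)) M' : List.In M' l' -> exists2 i, (i < size l')%N & nth M l' i = M'.
  by elim: l' => //= a l' IH' [->|/IH'[i il <-]]; [exists 0%N | exists i.+1].
move=> M' [<-|i].
  apply: (@rule_shift _ u) => //.
  have -> : (u - (e + d * (u - e))) / 4 = (u - e) * (- ((d - 1) / 4)) by field.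
  by apply: mlocM => //; [apply: loc_Aint; rewrite ?rpredB | apply: mlocN].
have [j jl jE] := Inth _ _ i.
have pM' : prm M' by apply: h; right.
apply: (@rule_shift _ e) => //; last exact: he.
have -> : (e - (e + d * (u - e))) / 4 = (e - u) * (d / 4) by field.
apply: mlocM => //; first by apply: loc_Aint; rewrite ?rpredB.
by have := d2 (Ordinal jl); rewrite /Ms /= jE.
Qed.

Lemma rule_ex (b : nat) : (0 < b)%N ->
  exists e, [/\ e \in Aint, fld phi e & forall M, prm M -> M b%:R -> rule M e].
Proof.
move=> b0; have [I [Ms [pMs cov]]] := fin_primes phi b0.
have mapIn i : List.In (Ms i) (map Ms (enum I)).
  have : i \in enum I by rewrite mem_enum.
  by elim: (enum I) => // a s IH; rewrite inE => /predU1P[->|/IH h]; [left | right].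
have [M|e [Ae fe he]] := @rule_list (map Ms (enum I)).
  by elim: (enum I) => //= a s IH [<-|/IH].
exists e; split=> // M pM Mb; have [i s] := cov M pM Mb.
exact: rule_same (sameon_sym s) (he _ (mapIn i)).
Qed.
End Epsilon.

Lemma dec_mloc be M (w : aut) x : prm M -> fld be (w be) -> dec be M w -> fld be x ->
  (mloc M (w x) <-> mloc M x) /\ (loc M (w x) <-> loc M x).
Proof.
move=> pM nw d bx; have pM' := prm_pim w pM.
have [h1 h2] := sameon_loc pM pM' d (nrm_fld nw bx).
by rewrite h2 h1 mloc_pim loc_pim.
Qed.

(** The polynomial with roots [autX sig i lam] has coefficients fixed by [sig], hence by [w], so
    [w lam] is one of its roots. *)
Lemma conj_cyc lam phi (sig w : aut) l : (0 < l)%N -> fld lam (sig lam) -> autX sig l lam = lam ->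
  (forall x, fld phi x <-> fld lam x /\ sig x = x) -> w phi = phi ->
  exists j, w lam = autX sig j lam.
Proof.
move=> l0 ns sl phiE wp.
pose P : {poly algC} := \prod_(i < l) ('X - (autX sig i lam)%:P).
have mapP (v : aut) : map_poly v P = \prod_(i < l) ('X - (v (autX sig i lam))%:P).
  by rewrite rmorph_prod /=; apply: eq_bigr => i _; rewrite rmorphB /= map_polyX map_polyC.
have sP : map_poly sig P = P.
  rewrite mapP /P -(prednK l0) big_ord_recr [RHS]big_ord_recl /= mulrC; congr (_ * _).
  by have := sl; rewrite -{1}(prednK l0) /= => ->.
have cP k : fld phi P`_k.
  apply/phiE; split; last by rewrite -coef_map sP.
  move=> v vl; have vP : map_poly v P = P.
    by rewrite mapP; apply: eq_bigr => i _; rewrite (nrm_X i ns vl).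
  by rewrite -{2}vP coef_map.
have wP : map_poly w P = P by apply/polyP => k; rewrite coef_map /= cP.
have e0 : P.[w lam] = 0.
  by rewrite -wP horner_map /P horner_prod (bigD1 (Ordinal l0)) //= hornerXsubC subrr mul0r rmorph0.
move: e0; rewrite /P horner_prod => /eqP /prodf_eq0[j _].
by rewrite hornerXsubC subr_eq0 => /eqP ->; exists j.
Qed.

(** * The extension [LT(sqrt eps)] *)

Section Step.
Variables (gam lamh : algC) (p : nat).
Hypotheses (pp : prime p) (op : odd p) (Ag : gam \in Aint) (acong : deg gam = p) (ng : normal gam).
Hypotheses (nl : normal lamh).
Hypothesis EXP : forall u : aut, exists e, [/\ (0 < e)%N, ~~ (p %| e)%N & autX u e lamh = lamh].
Variables (lam phi eps sq : algC) (sig : aut) (l : nat).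
Hypotheses (lh : fld lamh lam) (ns : fld lam (sig lam)) (pl : prime l) (sl : autX sig l lam = lam).
Hypothesis sigm : sig lam <> lam.
Hypothesis phiE : forall x, fld phi x <-> fld lam x /\ sig x = x.
Hypotheses (Aeps : eps \in Aint) (feps : fld phi eps) (sqE : sq ^+ 2 = eps).
Hypothesis csq : exists u : aut, [/\ u lam = lam, u gam = gam & u sq <> sq].

Lemma p_ndvd_l : ~~ (p %| l)%N.
Proof.
apply/negP; rewrite dvdn_prime2 // => /eqP pE.
have [e [e0 pe ee]] := EXP sig.
have se : autX sig e lam = lam by apply: lh.
case: sigm; have sl' := sl; rewrite -pE in sl'; have [s1 s2 h _] := egcdnP p e0.
have cop : gcdn e p = 1%N by apply/eqP; rewrite -/(coprime e p) coprime_sym prime_coprime.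
rewrite cop addn1 in h.
have : autX sig (s1 * e) lam = lam by rewrite autX_mul; apply: autX_fix.
by rewrite h /= autX_mul (autX_fix _ sl').
Qed.

Lemma lam_eps : fld lam eps /\ sig eps = eps.
Proof. exact/phiE. Qed.

Lemma sq_pm (w : aut) : w eps = eps -> w sq = sq \/ w sq = - sq.
Proof.
rewrite -sqE rmorphXn => /eqP; rewrite eqf_sqr => /orP[] /eqP; by [left | right].
Qed.

Lemma sq_pm2 (w : aut) : w sq = sq \/ w sq = - sq -> w (w sq) = sq.
Proof. by case=> e; rewrite e ?rmorphN e ?opprK. Qed.

(** [th] is the square of an automorphism moving [T], which makes it fix [sq]; it still moves [gam]
    as [p] is odd. The lift [s] of [sig] is corrected by a power of [th0] to fix [gam] and, if
    necessary, by [c] to fix [sq]. *)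
Lemma step_auts : exists be (th c s : aut), [/\ [/\ fld be lam, fld be gam, fld be sq &
  forall u v : aut, u lam = v lam -> u gam = v gam -> u sq = v sq -> u be = v be],
  (lam \in Aint -> be \in Aint) /\ (forall w : aut, fld be (w lam) -> fld be (w sq) -> fld be (w be)),
  [/\ th lam = lam, th gam <> gam & th sq = sq],
  [/\ c lam = lam, c gam = gam & c sq = - sq] &
  [/\ s lam = sig lam, s gam = gam & s sq = sq]].
Proof.
have [be [b1 b2 b3 b4 b5]] := primitive_element_aut [:: lam; gam; sq].
have [th0 [t1 t2]] := ex_moving_aut pp acong ng EXP.
have [fe se] := lam_eps.
have th0lam x : fld lam x -> th0 x = x by move=> lx; apply: (fld_trans lh lx).
have [c [c1 c2 c3]] := csq.
have c4 : c sq = - sq.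
  by have ce : c eps = eps by [apply: fe]; case: (sq_pm ce) => // e; case: c3.
have th0sq := sq_pm (th0lam _ fe).
have [j jE] := T_gen pp acong ng sig t2.
pose s1 := autM (autX th0 (p.-1 * j)) sig.
have fixX k x : fld lam x -> autX th0 k x = x.
  by move=> lx; apply/autX_fix/th0lam.
have s1lam : s1 lam = sig lam by rewrite /s1 autME fixX.
have s1gam : s1 gam = gam.
  rewrite /s1 autME jE -autX_add -mulSnr prednK ?prime_gt0 // mulnC autX_mul.
  by apply: autX_fix; apply: T_pow pp acong ng th0.
have s1eps : s1 eps = eps by rewrite /s1 autME se fixX.
have [s [s2 s3 s4]] : exists s : aut, [/\ s lam = sig lam, s gam = gam & s sq = sq].
  case: (sq_pm s1eps) => e; first by exists s1.
  exists (autM c s1); split; first by rewrite autME s1lam; apply: ns.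
    by rewrite autME s1gam.
  by rewrite autME e rmorphN c4 opprK.
have nbe (w : aut) : fld be (w lam) -> fld be (w sq) -> fld be (w be).
  move=> w1 w2; apply: (b4 (fun x => fld be (w x))).
    split.
    - by rewrite rmorph0; apply: fld0.
    - by rewrite rmorph1; apply: fld1.
    - by move=> x y; rewrite rmorphB; apply: fldB.
    - by move=> x y; rewrite rmorphM; apply: fldM.
    - by move=> x; rewrite fmorphV; apply: fldV.
  move=> x; rewrite !inE => /or3P[] /eqP -> //.
  by apply: fld_trans (ng w); apply: b1; rewrite !inE eqxx orbT.
have th2sq := sq_pm2 th0sq.
exists be, (autM th0 th0), c, s; split=> //.
- split; try by apply: b1; rewrite !inE eqxx ?orbT.
  by move=> u v e1 e2 e3; apply: b2 => x; rewrite !inE => /or3P[] /eqP ->.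
- split=> // Al; apply: b5 => x; rewrite !inE => /or3P[] /eqP -> //.
  apply: Aint_loc => M pM; apply: loc_sqr => //; rewrite sqE; exact: loc_Aint.
- rewrite !autME; split=> //; first by rewrite !th0lam //; apply: fld_id.
  apply: (@T_move_pow gam p pp acong ng th0 2) => //.
  by rewrite dvdn_prime2 //; apply: contraL op => /eqP ->.
Qed.

Variables (be : algC) (th c s : aut).
Hypotheses (bl : fld be lam) (bg : fld be gam) (bs : fld be sq).
Hypothesis bgen : forall u v : aut, u lam = v lam -> u gam = v gam -> u sq = v sq -> u be = v be.
Hypothesis bstab : forall w : aut, fld be (w lam) -> fld be (w sq) -> fld be (w be).
Hypotheses (thl : th lam = lam) (thg : th gam <> gam) (ths : th sq = sq).
Hypotheses (cl : c lam = lam) (cgam : c gam = gam) (cs : c sq = - sq).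
Hypotheses (sl1 : s lam = sig lam) (sgam : s gam = gam) (ss : s sq = sq).

Lemma stab (w : aut) : fld lam (w lam) -> w eps = eps -> fld be (w be).
Proof.
move=> w1 w2; apply: bstab; first exact: fld_trans bl w1.
by case: (sq_pm w2) => ->; [|apply: fldN].
Qed.
Lemma stab_id (w : aut) : w lam = lam -> fld be (w be).
Proof.
move=> w1; apply: stab; first by rewrite w1; apply: fld_id.
by case: lam_eps => h _; apply: h.
Qed.
Lemma th_stable : fld be (th be). Proof. exact: stab_id. Qed.
Lemma c_stable : fld be (c be). Proof. exact: stab_id. Qed.
Lemma s_eps : s eps = eps.
Proof. by have [fe se] := lam_eps; rewrite -{2}se; apply: (fldE fe). Qed.
Lemma s_stable : fld be (s be).
Proof. by apply: stab; [rewrite sl1 | exact: s_eps]. Qed.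
Lemma s_lam x : fld lam x -> s x = sig x.
Proof. by move=> lx; apply: (fldE lx). Qed.
Lemma comm_th_s : th (s be) = s (th be).
Proof.
apply: (bgen (u := autM th s) (v := autM s th)); rewrite !autME.
- by rewrite thl sl1; apply: ns.
- rewrite sgam; apply/esym; have := ng th; exact.
- by rewrite ss ths ss.
Qed.
Lemma comm_c_s : c (s be) = s (c be).
Proof.
apply: (bgen (u := autM c s) (v := autM s c)); rewrite !autME.
- by rewrite cl sl1; apply: ns.
- by rewrite sgam cgam sgam.
- by rewrite ss cs rmorphN ss.
Qed.
Lemma comm_th_c : th (c be) = c (th be).
Proof.
apply: (bgen (u := autM th c) (v := autM c th)); rewrite !autME.
- by rewrite thl cl thl.
- by rewrite cgam; apply/esym/(ng th).
- by rewrite ths cs rmorphN ths.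
Qed.
Lemma th_pow : autX th p be = be.
Proof.
apply: (bgen (u := autX th p) (v := idfun)) => /=; try exact: autX_fix.
exact: T_pow pp acong ng th.
Qed.
Lemma c_invol : c (c be) = be.
Proof.
apply: (bgen (u := autM c c) (v := idfun)); rewrite !autME /=; first by rewrite !cl.
  by rewrite !cgam.
by rewrite cs rmorphN cs opprK.
Qed.

(** The square of [w] fixes [sq], so on [fld be] it is a nontrivial power of [th], which has prime
    order [p]. *)
Lemma dec_th M (w : aut) : w lam = lam -> w gam <> gam -> dec be M w -> dec be M th.
Proof.
move=> w1 w2 d; have [fe _] := lam_eps.
have w2sq := sq_pm2 (sq_pm (fe w w1)).
pose w' := autM w w.
have d' : dec be M w' by apply: dec_mul => //; apply: stab_id.
have w'g : w' gam <> gam.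
  apply: (@T_move_pow gam p pp acong ng w 2) => //.
  by rewrite dvdn_prime2 //; apply: contraL op => /eqP ->.
have [j jE] := T_gen pp acong ng w' thg.
have e : w' be = autX th (j %% p) be.
  apply: bgen; first by rewrite !autME !w1 autX_fix.
    rewrite jE {1}(divn_eq j p) addnC autX_add autX_mul; congr (autX _ _ _).
    by apply: autX_fix; apply: T_pow pp acong ng th.
  by rewrite !autME w2sq autX_fix.
have jp : (j %% p != 0)%N.
  by apply/eqP => j0; move: e; rewrite j0 /= => e; apply: w'g; apply: bg.
apply: (@dec_gen be M th p (j %% p)%N pp th_stable th_pow).
  by rewrite lt0n jp ltn_mod prime_gt0.
by apply: dec_ext d' => //; apply: stab_id; rewrite /w' !autME !w1.
Qed.

(** The product of [A = (sq - 1) / 2] and [A + 1] lies in [M], so exactly one of them does;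
    [w sq = - sq] would exchange them up to sign. *)
Lemma eps1_sq M (w : aut) : prm M -> mloc M ((eps - 1) / 4) -> fld be (w be) -> dec be M w -> w sq <> - sq.
Proof.
move=> pM h nw d wsq.
pose A := (sq - 1) / 2.
have h2 : mloc M (A * (A + 1)).
  have -> // : A * (A + 1) = (eps - 1) / 4 by rewrite /A -sqE; field.
have bA : fld be A by apply: fldM; [apply: fldB => //; apply: fld1 | apply/fldV/fld_nat].
have lA : loc M A.
  apply: boolp.contrapT => /(locVm pM)[A0 mA]; apply: (mloc_nloc pM A0 mA).
  have -> : A = (A * (A + 1)) * A^-1 - 1 by field.
  by apply: locB => //; [exact: mloc_loc (mlocM pM (mloc_loc pM h2) mA) | apply: loc1].
have wA : w A = - (A + 1) by rewrite /A fmorph_div rmorphB rmorph1 rmorph_nat wsq; field.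
have b1A : fld be (A + 1) by apply: fldD => //; apply: fld1.
have wA1 : w (A + 1) = - A by rewrite rmorphD wA rmorph1; ring.
case: (mloc_prime pM lA (locD pM lA (loc1 pM)) h2) => m.
  have := (dec_mloc pM nw d bA).1.2 m; rewrite wA => m'.
  apply: (mloc1 pM); have -> : 1 = - (- (A + 1) + A) by ring.
  by apply: mlocN => //; apply: mlocD.
have := (dec_mloc pM nw d b1A).1.2 m; rewrite wA1 => m'.
have := mlocD pM m m'; have -> : A + 1 + - A = 1 by ring.
exact: mloc1.
Qed.

(** If [sig] fixes the prime of [fld lam], it lifts to some [t] fixing the prime of [fld be]; then
    [t sq = sq], and either [t] acts as [s], or [autX t l] is trivial on [lam] and moves [gam].
    Otherwise, unless [th] or [c] fixes the prime, its decomposition group over [fld phi] is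
    trivial, and the trace of a multiple of [sq] is a [y] in [fld phi] congruent to [sq] modulo
    [4 M], against the choice of [eps]. *)
Lemma rule_dec M : prm M -> rule phi (fun M => dec lam M sig) M eps ->
  [\/ dec be M th, dec be M c | dec be M s].
Proof.
move=> pM [r1 r2]; have [fe se] := lam_eps.
case: (boolp.EM (dec lam M sig)) => [dl|ndl].
  have h1 := r1 dl.
  have dls : dec lam M s by apply: dec_ext dl.
  have [u [ul su]] := prm_trans be pM (prm_pim s pM) dls.
  pose t := autM (autV u) s.
  have uVl x : fld lam x -> autV u x = x.
    by move=> lx; apply: (fmorph_inj u); rewrite autKV; apply/esym/lx.
  have dt : dec be M t.
    move=> x bx; have ub : fld be (u x) by apply: nrm_fld => //; apply: stab_id.
    have := su (u x) ub; rewrite pimE => <-; rewrite /pim.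
    suff -> : autV t x = autV s (u x) by [].
    by apply: (fmorph_inj t); rewrite autKV /t autME autKV autVK.
  have tl x : fld lam x -> t x = sig x.
    by move=> lx; rewrite /t autME s_lam // uVl //; apply: nrm_fld.
  have te : t eps = eps by rewrite tl.
  have ntb : fld be (t be) by apply: stab => //; rewrite tl //; apply: fld_id.
  have tsq : t sq = sq.
    by case: (sq_pm te) => // h; case: (eps1_sq pM h1 ntb dt).
  case: (boolp.EM (t gam = gam)) => [tg|tg].
    apply: Or33; apply: dec_ext dt => //; apply: bgen; rewrite ?tg ?tsq ?ss ?sgam //.
    by rewrite tl ?sl1 //; apply: fld_id.
  apply: Or31; apply: (@dec_th M (autX t l)).
  - have -> : autX t l lam = autX sig l lam; last by [].
    elim: (l) => //= k ->; apply: tl; exact: nrm_X.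
  - exact: (@T_move_pow gam p pp acong ng t l tg p_ndvd_l).
  - exact: dec_X.
have [neps hn] := r2 ndl.
apply: boolp.contrapT => no.
have nth' : ~ dec be M th by move=> h; apply: no; apply: Or31.
have nc' : ~ dec be M c by move=> h; apply: no; apply: Or32.
have [k [f [fp finj fsurj]]] := fld_orbit phi be.
have [i0 i0E] := fsurj idfun erefl; rewrite /= in i0E.
have bphi : fld be phi by apply: fld_trans bl _; have [] := (phiE phi).1 (@fld_id phi).
have nofix i : i != i0 -> ~ dec be M (autV (f i)).
  move=> ii0 d; pose w := autV (f i).
  have wp : w phi = phi by rewrite -{1}(fp i) /w autVK.
  have [j wl] := conj_cyc (prime_gt0 pl) ns sl phiE wp.
  have lw : fld lam (w lam) by rewrite wl; apply: nrm_X.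
  have we : w eps = eps by apply: feps.
  have nwb := stab lw we.
  have wl' : w lam = autX sig (j %% l) lam.
    by rewrite wl {1}(divn_eq j l) addnC autX_add autX_mul (autX_fix _ sl).
  case: (posnP (j %% l)) => [j0|j0]; last first.
    apply: ndl; apply: (@dec_gen lam M sig l (j %% l)%N pl ns sl); first by rewrite j0 ltn_mod prime_gt0.
    by apply: dec_ext (dec_sub bl d).
  rewrite j0 /= in wl'.
  case: (boolp.EM (w gam = gam)) => [wg|wg]; last exact/nth'/(dec_th wl' wg d).
  case: (sq_pm we) => wsq.
    have wb : w be = be by apply: (bgen (u := w) (v := idfun)).
    case/eqP: ii0; apply: finj => /=; rewrite -i0E.
    by rewrite -{1}wb /w autKV.
  apply: nc'; apply: dec_ext d => //; apply: bgen; rewrite ?cl ?cgam ?cs //.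
have nP (j : 'I_#|[pred i | i != i0]|) : ~ sameon be M (pim (autV (f (enum_val j))) M).
  by apply: nofix; have := enum_valP j.
have [e [Ae fe' e1 e2]] := sepn_strong (isT : 0 < 4)%N pM (fun j => prm_pim _ pM) nP.
have e3 i : i != i0 -> mloc M (f i e / 4).
  move=> ii0; have iin : i \in [pred i | i != i0] by [].
  have := e2 (enum_rank_in iin i); rewrite enum_rankK_in //.
  have -> : e / 4 = autV (f i) (f i e / 4) by rewrite fmorph_div rmorph_nat autVK.
  by rewrite mloc_pim.
have Asq : sq \in Aint by apply: Aint_loc => M' pM'; apply: loc_sqr => //; rewrite sqE; apply: loc_Aint.
pose y := \sum_i f i (e * sq).
have fy : fld phi y.
  by have [] := orbit_prod fp finj fsurj (fldM fe' bs).
have Ay : y \in Aint by rewrite rpred_sum // => i _; rewrite Aint_aut rpredM.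
have f0 x : fld be x -> f i0 x = x by move=> bx; apply/esym/(fldE (u := idfun) bx).
have ysq : mloc M ((y - sq) / 4).
  rewrite /y (bigD1 i0) //= f0; last exact: fldM.
  have -> : forall S : algC, (e * sq + S - sq) / 4 = (e - 1) / 4 * sq + S / 4 by move=> S; field.
  apply: mlocD => //; first by apply: mlocMr => //; apply: loc_Aint.
  rewrite mulr_suml; elim/big_ind: _ => [|a b ha hb|i ii0]; [exact: mloc0 | exact: mlocD |].
  rewrite rmorphM mulrAC; apply: mlocMr; [exact: pM | exact: e3 | by apply: loc_Aint; rewrite ?Aint_aut].
have ey : mloc M ((eps - y ^+ 2) / 4).
  have -> : (eps - y ^+ 2) / 4 = (y - sq) / 4 * (- (y + sq)) by rewrite -sqE; field.
  by apply: mlocMr => //; apply: loc_Aint; rewrite ?rpredN ?rpredD.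
have ny : ~ M y.
  move=> My; apply: neps; apply: mloc_Aint => //.
  have -> : eps = (eps - y ^+ 2) + y * y by ring.
  by apply: mlocD => //; [apply: mloc4 | apply: mlocM; [| apply: loc_Aint | apply: mloc_M]].
have y0 := prm_nz pM ny.
have lyV : loc M y^-1.
  by apply: loc_unit; [apply: loc_Aint | move/(mloc_Aint pM Ay)].
apply: (hn y^-1); first exact: fldV.
have -> : (eps * y^-1 ^+ 2 - 1) / 4 = (eps - y ^+ 2) / 4 * y^-1 ^+ 2 by field.
by apply: mlocMr => //; apply: locX.
Qed.
End Step.

Lemma normal_closure a : exists b, [/\ normal b, fld b a,
  forall u v : aut, (forall g : aut, u (g a) = v (g a)) -> u b = v b,
  forall y, (forall g : aut, fld y (g a)) -> fld y b & a \in Aint -> b \in Aint].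
Proof.
have [z [z1 z2 z3 _ z5]] := primitive_element_aut (conjs a).
have rtE x : x \in conjs a -> exists g : aut, g a = x by rewrite mem_conjs => /conj_aut.
exists z; split; last by move=> Aa; apply: z5 => x /rtE[g <-]; rewrite Aint_aut.
- move=> u; have l5 : fld (u z) z.
    apply: z3 => x /rtE[v vE].
    have : fld z (autV u x) by apply: z1; rewrite -vE; apply: (aut_conjs (autM (autV u) v)).
    by move/(@fld_aut u); rewrite autKV.
  have := @fld_aut (autV u) _ _ l5; rewrite autVK => l6.
  by have := nrm_V l6; rewrite autVV.
- exact/z1/(aut_conjs idfun).
- by move=> u v e; apply: z2 => x /rtE[g <-].
- by move=> y h; apply: z3 => x /rtE[g <-].
Qed.

Lemma sqr_gt0_conj (x : algC) : 0 < x ^+ 2 -> x^* = x.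
Proof.
move=> h; have : (x^*) ^+ 2 = x ^+ 2 by rewrite -rmorphXn /=; apply/conj_Creal/gtr0_real.
move/eqP; rewrite eqf_sqr => /orP[] /eqP // e.
have := mul_conjC_ge0 x; rewrite e mulrN -expr2 oppr_ge0 => h2.
by have := lt_le_trans h h2; rewrite ltxx.
Qed.
Lemma sqr_lt0_conj (x : algC) : x ^+ 2 < 0 -> x^* = - x.
Proof.
move=> h; have : (x^*) ^+ 2 = x ^+ 2 by rewrite -rmorphXn /=; apply/conj_Creal/ltr0_real.
move/eqP; rewrite eqf_sqr => /orP[] /eqP // e.
have := mul_conjC_ge0 x; rewrite e -expr2 => h2.
by have := le_lt_trans h2 h; rewrite ltxx.
Qed.
Lemma norm1_conj (x : algC) : x * x^* = 1 -> `|x| = 1.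
Proof. by move=> h; apply/eqP; rewrite -sqrp_eq1 ?normr_ge0 // normCK h. Qed.

Lemma telescope_aut (u : aut) x k : x != 0 ->
  \prod_(j < k) autX u j (u x / x) = autX u k x / x.
Proof.
move=> x0; elim: k => [|k IH]; first by rewrite big_ord0 divff.
rewrite big_ord_recr /= IH rmorphM fmorphV; have a0 : autX u k x != 0 by rewrite fmorph_eq0.
have -> : autX u k (u x) = u (autX u k x) by rewrite !autXE -iterSr.
by field; rewrite x0 a0.
Qed.

Lemma mloc_prodn M k (F : 'I_k.+1 -> algC) : prm M -> (forall i, mloc M (F i)) -> mloc M (\prod_i F i).
Proof.
move=> pM h; rewrite big_ord_recl; apply: mlocMr => //.
by apply: loc_prod => // i _; apply: mloc_loc.
Qed.

(** Since [u] fixes the prime, all factors have the same valuation, and these valuations add up to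
    0. *)
Lemma loc_prod1 be M (u : aut) k x : prm M -> fld be (u be) -> dec be M u -> fld be x -> (0 < k)%N ->
  \prod_(j < k) autX u j x = 1 -> loc M x /\ loc M x^-1.
Proof.
move=> pM nu d bx k0 e.
have nX j := nrm_X j nu; have dX j := dec_X j nu d.
case: k k0 e => // k _ e; split; apply: boolp.contrapT => /(locVm pM)[_ m]; apply: (mloc1 pM).
  rewrite -[1]invr1 -e -prodfV; apply: mloc_prodn => // j.
  by rewrite -fmorphV; apply/(dec_mloc pM (nX j) (dX j) (fldV bx)).1.
rewrite invrK in m; rewrite -e; apply: mloc_prodn => // j.
by apply/(dec_mloc pM (nX j) (dX j) bx).1.
Qed.

Lemma good_index (m : nat) (J : finType) (bad : J -> 'I_m -> Prop) : (#|J| < m)%N ->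
  (forall j i i', bad j i -> bad j i' -> i = i') -> exists i, forall j, ~ bad j i.
Proof.
move=> lt u; apply: boolp.contrapT => no.
have /exists_fun[f fE] : forall i, exists j, bad j i.
  move=> i; apply: boolp.contrapT => nj; apply: no; exists i => j bj; apply: nj; by exists j.
have finj : injective f by move=> i i' e; apply: (u (f i)) => //; rewrite e.
by have := leq_card f finj; rewrite card_ord leqNgt lt.
Qed.

Lemma prod_norm_le1 (r : seq algC) (F : algC -> algC) :
  (forall z, z \in r -> `|F z| <= 1) -> `|\prod_(z <- r) F z| <= 1.
Proof.
elim: r => [|a r IH] h; first by rewrite big_nil normr1.
rewrite big_cons normrM mulr_ile1 ?normr_ge0 ?h ?mem_head // IH // => z zr.
by apply: h; rewrite inE zr orbT.
Qed.

(** * Soundness of the descent *)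

Section Sound.
Variables (gam lamh : algC) (p : nat).
Hypotheses (pp : prime p) (op : odd p) (Ag : gam \in Aint) (acong : deg gam = p) (ng : normal gam).
Hypotheses (rg : forall u : aut, u gam \is Num.real).
Hypotheses (nl : normal lamh).
Hypothesis EXP : forall u : aut, exists e, [/\ (0 < e)%N, ~~ (p %| e)%N & autX u e lamh = lamh].
Variables (lam phi eps sq : algC) (sig : aut) (l : nat).
Hypotheses (lh : fld lamh lam) (ns : fld lam (sig lam)) (pl : prime l) (sl : autX sig l lam = lam).
Hypothesis phiE : forall x, fld phi x <-> fld lam x /\ sig x = x.
Hypotheses (Aeps : eps \in Aint) (feps : fld phi eps) (sqE : sq ^+ 2 = eps).
Variables (be : algC) (th c s : aut).
Hypotheses (bl : fld be lam) (bg : fld be gam) (bs : fld be sq).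
Hypothesis bgen : forall u v : aut, u lam = v lam -> u gam = v gam -> u sq = v sq -> u be = v be.
Hypothesis bstab : forall w : aut, fld be (w lam) -> fld be (w sq) -> fld be (w be).
Hypotheses (thl : th lam = lam) (thg : th gam <> gam) (ths : th sq = sq).
Hypotheses (cl : c lam = lam) (cgam : c gam = gam) (cs : c sq = - sq).
Hypotheses (sl1 : s lam = sig lam) (sgam : s gam = gam) (ss : s sq = sq).
Hypothesis ARCH : forall g : aut,
  ((forall x, fld lam x -> g x \is Num.real) /\ g eps < 0) \/
  ((forall x, fld lam x -> (g x)^* = g (sig x)) /\ 0 < g eps).

Variables (b : nat) (Good : (algC -> Prop) -> Prop).
Hypothesis b0 : (0 < b)%N.
Hypothesis GoodP : forall (g : aut) M, Good M -> Good (pim g M).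
Hypothesis inert_good : forall M, prm M -> ~ M b%:R -> inert gam lamh M \/ Good M.
Hypothesis decb : forall M, prm M -> M b%:R -> [\/ dec be M th, dec be M c | dec be M s].
Hypothesis sepT : forall M, prm M -> ~ M b%:R -> forall u v : aut, u gam <> v gam -> ~ M (u gam - v gam).

Let th_stable : fld be (th be) := th_stable phiE feps sqE bl bs bstab thl.
Let c_stable : fld be (c be) := c_stable phiE feps sqE bl bs bstab cl.
Let s_stable : fld be (s be) := s_stable ns phiE feps sqE bl bs bstab sl1.
Let cths : th (s be) = s (th be) := comm_th_s ng ns bgen thl ths sl1 sgam ss.
Let ccs : c (s be) = s (c be) := comm_c_s ns bgen cl cgam cs sl1 sgam ss.
Let thp : autX th p be = be := th_pow pp acong ng bgen thl ths.
Let c2 : c (c be) = be := c_invol bgen cl cgam cs.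

(** The counterpart of [R] in the larger field [fld be], stable under its automorphisms. *)
Definition RB x := fld be x /\ forall M, prm M -> Good M -> loc M x.
Lemma RB_D x y : RB x -> RB y -> RB (x + y).
Proof. by move=> [bx hx] [by_ hy]; split=> [|M pM g]; [exact: fldD | apply: locD => //; [exact: hx | exact: hy]]. Qed.
Lemma RB_N x : RB x -> RB (- x).
Proof. by move=> [bx hx]; split=> [|M pM g]; [exact: fldN | apply: locN => //; exact: hx]. Qed.
Lemma RB_B x y : RB x -> RB y -> RB (x - y).
Proof. by move=> hx hy; apply: RB_D => //; apply: RB_N. Qed.
Lemma RB_M x y : RB x -> RB y -> RB (x * y).
Proof. by move=> [bx hx] [by_ hy]; split=> [|M pM g]; [exact: fldM | apply: locM => //; [exact: hx | exact: hy]]. Qed.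
Lemma RB_int x : fld be x -> x \in Aint -> RB x.
Proof. by move=> bx Ax; split=> // M pM _; apply: loc_Aint. Qed.
Lemma RB_nat n : RB n%:R. Proof. by apply: RB_int; [apply: fld_nat | rewrite rpred_nat]. Qed.
Lemma RB_aut (w : aut) x : fld be (w be) -> RB x -> RB (w x).
Proof.
move=> nw [bx hx]; split=> [|M pM g]; first exact: nrm_fld.
apply/(@loc_pim (autV w) M (w x)); rewrite autVK; apply: hx; [exact: prm_pim | exact: GoodP].
Qed.

Lemma dec_conj_s M (w : aut) : fld be (w be) -> w (s be) = s (w be) -> dec be M w -> dec be (pim (autV s) M) w.
Proof.
move=> nw ws d x bx; have -> : pim w (pim (autV s) M) x = M (s (autV w x)) by rewrite /pim autVV.
rewrite pimV (d _ (nrm_fld s_stable bx)) /pim.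
suff -> : autV w (s x) = s (autV w x) by [].
apply: (fmorph_inj w); rewrite autKV; have bx' := nrm_fldV nw bx.
have := fldE (u := autM w s) (v := autM s w) bx' ws; rewrite !autME => ->.
by rewrite autKV.
Qed.

Lemma inert_dec M : prm M -> inert gam lamh M -> dec be M th.
Proof.
move=> pM h; have [be' [nb' bb' _ _ _]] := normal_closure be.
have [w [w1 w2 w3]] := h be' nb'.
by apply: (dec_th pp op acong ng phiE feps sqE bl bg bs bgen bstab thl thg ths (lh w1) w2 (dec_sub bb' w3)).
Qed.

Lemma autX_s_l : autX s l be = be.
Proof.
apply: (bgen (u := autX s l) (v := idfun)) => /=; try exact: autX_fix.
have -> : autX s l lam = autX sig l lam; last by [].
by elim: (l) => //= k ->; exact: (s_lam sl1 (nrm_X k ns)).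
Qed.

Definition inU x := [/\ RB x, x * c x = 1 & \prod_(j < p) autX th j x = 1].

Lemma U_loc x : inU x -> forall M, prm M -> loc M (s x / x).
Proof.
case=> [Rx ux px] M pM; have [bx _] := Rx.
have x0 : x != 0 by apply/eqP => e; move/eqP: ux; rewrite e mul0r eq_sym oner_eq0.
have suff_loc : (loc M x /\ loc M x^-1) -> (loc (pim (autV s) M) x) -> loc M (s x / x).
  move=> [_ h1] h2; apply: locM => //.
  by apply/(@loc_pim (autV s) M (s x)); rewrite autVK.
have by_th M' : prm M' -> dec be M' th -> loc M' x /\ loc M' x^-1.
  by move=> pM' d; apply: (loc_prod1 pM' th_stable d bx (prime_gt0 pp) px).
have by_c M' : prm M' -> dec be M' c -> loc M' x /\ loc M' x^-1.
  move=> pM' d; apply: (loc_prod1 (k := 2) pM' c_stable d bx) => //.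
  by rewrite !big_ord_recl big_ord0 /= mulr1.
have pM' := prm_pim (autV s) pM.
case: (boolp.EM (M b%:R)) => [Mb|nMb].
  case: (decb pM Mb) => d.
  - by apply: suff_loc; [exact: by_th | case: (by_th _ pM' (dec_conj_s th_stable cths d))].
  - by apply: suff_loc; [exact: by_c | case: (by_c _ pM' (dec_conj_s c_stable ccs d))].
  (* When [s] fixes the prime, the product of [s x / x] along [s] telescopes to 1. *)
  have w0 : fld be (s x / x) by apply: fldM; [exact: nrm_fld | exact: fldV].
  have [] // := loc_prod1 (k := l) pM s_stable d w0 (prime_gt0 pl) _.
  rewrite telescope_aut // (fldE (u := autX s l) (v := idfun) bx autX_s_l) /=; exact: divff.
case: (inert_good pM nMb) => [i|g].
  have d := inert_dec pM i.
  by apply: suff_loc; [exact: by_th | case: (by_th _ pM' (dec_conj_s th_stable cths d))].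
(* At a good prime the inverse of [x] is its image under [c], again without denominator. *)
have -> : x^-1 = c x by rewrite -[RHS](mulKf x0) ux mulr1.
have [_ h] : RB (s x * c x) by apply: RB_M; apply: RB_aut.
exact: h.
Qed.

(** Where conjugation acts as [c], [x] and [s x] themselves have absolute value 1; where it acts as
    [s], the quotient does because [s] inverts it. *)
Lemma U_norm x (g : aut) : inU x -> `|g (s x / x)| = 1.
Proof.
case=> [[bx _] ux _].
have x0 : x != 0 by apply/eqP => e; move/eqP: ux; rewrite e mul0r eq_sym oner_eq0.
pose cj : aut := Num.conj.
case: (ARCH g) => [[hr he]|[hr he]].
  have e : cj (g be) = g (c be).
    apply: (bgen (u := autM cj g) (v := autM g c)); rewrite !autME.
    - by rewrite cl; apply/conj_Creal/hr/fld_id.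
    - by rewrite cgam; apply/conj_Creal/rg.
    - by rewrite cs rmorphN; apply: sqr_lt0_conj; rewrite -rmorphXn sqE.
  have eb y : fld be y -> y * c y = 1 -> `|g y| = 1.
    move=> by_ uy; apply: norm1_conj.
    have := fldE (u := autM cj g) (v := autM g c) by_ e; rewrite !autME => ->.
    by rewrite -rmorphM uy rmorph1.
  have us : s x * c (s x) = 1.
    have -> : c (s x) = s (c x) by apply: (fldE (u := autM c s) (v := autM s c) bx ccs).
    by rewrite -rmorphM ux rmorph1.
  by rewrite rmorphM fmorphV normrM normfV (eb _ bx ux) (eb _ (nrm_fld s_stable bx) us) divr1.
have e : cj (g be) = g (s be).
  apply: (bgen (u := autM cj g) (v := autM g s)); rewrite !autME.
  - by rewrite sl1; apply/hr/fld_id.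
  - by rewrite sgam; apply/conj_Creal/rg.
  - by rewrite ss; apply: sqr_gt0_conj; rewrite -rmorphXn sqE.
have ex y : fld be y -> (g y)^* = g (s y).
  by move=> by_; apply: (fldE (u := autM cj g) (v := autM g s) by_ e).
have ssx : s (s x) = x.
  by apply: (fmorph_inj g); rewrite -(ex _ (nrm_fld s_stable bx)) -(ex _ bx) conjCK.
have w0 : fld be (s x / x) by apply: fldM; [exact: nrm_fld | exact: fldV].
apply: norm1_conj; rewrite ex // -rmorphM [s (_ / _)]rmorphM fmorphV ssx.
have sx0 : s x != 0 by rewrite fmorph_eq0.
by have -> : s x / x * (x / s x) = 1 by [field; rewrite x0 sx0]; rewrite rmorph1.
Qed.

Lemma U_fix : exists2 h, (0 < h)%N & forall x, inU x -> s (x ^+ h) = x ^+ h.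
Proof.
have [h h0 hE] := kronecker be; exists h => // x Ux; have [[bx _] ux _] := Ux.
have x0 : x != 0 by apply/eqP => e; move/eqP: ux; rewrite e mul0r eq_sym oner_eq0.
have w0 : fld be (s x / x) by apply: fldM; [exact: nrm_fld | exact: fldV].
have := hE _ (Aint_loc (U_loc Ux)) w0 (fun g => U_norm g Ux).
rewrite expr_div_n => e; rewrite rmorphXn /=.
by rewrite -[RHS]mul1r -e divfK // expf_neq0.
Qed.

Notation f := (minCpoly gam).
Lemma fE y : f.[y] = \prod_(z <- conjs gam) (y - z).
Proof. by rewrite minCpoly_conjs horner_prod; apply: eq_bigr => z _; rewrite hornerXsubC. Qed.
Lemma conjsP z : z \in conjs gam -> exists u : aut, u gam = z.
Proof. by rewrite mem_conjs => /conj_aut. Qed.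

Variables (m mu : nat).

(** When [y] is not integral at [M], both [y / (y - z)] and [1 / (y - z)] are, for integral [z], so
    the inverse of [f y] absorbs one factor [y]; when it is integral, the hypothesis bounds each
    factor. *)
Lemma loc_finv M y : prm M -> (forall z, z \in conjs gam -> y - z != 0) ->
  (loc M y -> forall z, z \in conjs gam -> loc M (m`!%:R / (y - z))) ->
  loc M ((m`! ^ p)%:R / f.[y]) /\ loc M ((m`! ^ p)%:R * y / f.[y]).
Proof.
move=> pM nz h; set D := m`!.
have Arts z : z \in conjs gam -> z \in Aint by case/conjsP => u <-; rewrite Aint_aut.
have Dp (r : seq algC) : (D ^ size r)%:R / \prod_(z <- r) (y - z) = \prod_(z <- r) (D%:R / (y - z)).
  by elim: r => [|a r IH]; rewrite ?big_nil ?divr1 // !big_cons -IH expnS natrM invfM mulrACA.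
have szr : size (conjs gam) = p := acong.
case: (boolp.EM (loc M y)) => [ly|nly].
  have l1 : loc M ((D ^ p)%:R / f.[y]).
    rewrite fE -szr Dp big_seq; apply: loc_prod => // z zr; exact: h.
  by split=> //; rewrite mulrAC; apply: locM.
have [y0 my] := locVm pM nly.
have u1 z : z \in conjs gam -> loc M (y / (y - z)).
  move=> zr; have yz := nz z zr.
  have mz : mloc M (z * y^-1) by apply: mlocM => //; apply/loc_Aint/Arts.
  have -> : y / (y - z) = (1 - z * y^-1)^-1.
    have -> : y - z = y * (1 - z * y^-1) by field.
    by rewrite invfM mulrA mulfV // mul1r.
  apply: loc_unit; first by apply: locB => //; [apply: loc1 | apply: mloc_loc].
  by move=> h'; apply: (mloc1 pM); rewrite -(subrK (z * y^-1) 1); apply: mlocD.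
have u2 z : z \in conjs gam -> loc M (y - z)^-1.
  by move=> zr; rewrite -[(y - z)^-1](mulKf y0); apply: locM => //; [apply: mloc_loc | apply: u1].
have fV : (f.[y])^-1 = \prod_(z <- conjs gam) (y - z)^-1 by rewrite fE prodfV.
have lD : loc M ((D ^ p)%:R) by apply: loc_nat.
split; first by apply: locM => //; rewrite fV big_seq; apply: loc_prod.
rewrite -mulrA; apply: locM => //; rewrite fV.
case: (conjs gam) szr u1 u2 => [e|z0 r _ u1 u2]; first by move: (prime_gt0 pp); rewrite -e.
rewrite big_cons mulrA; apply: locM => //; first by apply: u1; rewrite mem_head.
by rewrite big_seq; apply: loc_prod => // z zr; apply: u2; rewrite inE zr orbT.
Qed.

Variables (I : finType) (Ms : I -> algC -> Prop).
Hypothesis pMs : forall k, prm (Ms k).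
Hypothesis covMs : forall M, prm M -> M b%:R -> exists k, sameon be M (Ms k).
Hypothesis muE : (b %| mu.-1)%N.
Hypothesis mu0 : (0 < mu)%N.
Hypothesis m_big : ((#|I| + deg be) * 2 * p < m)%N.

Lemma fld_conjs z : z \in conjs gam -> fld be z.
Proof. by case/conjsP => u <-; apply: fld_trans bg (ng u). Qed.

(** For each prime above [b] or embedding, each root [z] and each of the two elements, at most one
    shift is bad. At a prime, two bad shifts would make [mu * (i' - i)] too divisible, since [mu] is
    a unit there and [i' - i] divides the factorial of [m]; at an embedding, shifts are at least
    [mu] apart. *)
Lemma good_shift (x : bool -> algC) : (forall a, fld be (x a)) -> exists i : 'I_m, forall a,
   (forall M, prm M -> M b%:R -> forall z, z \in conjs gam -> loc M (m`!%:R / (x a + (mu * i)%:R - z))) /\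
   (forall (g : aut) z, z \in conjs gam -> mu%:R / 2 <= `|g (x a + (mu * i)%:R - z)|).
Proof.
move=> bx.
pose J := (((I + 'I_(deg be)) * bool) * 'I_(deg gam))%type.
pose bad (j : J) (i : 'I_m) := let z := emb j.2 gam in let y := x j.1.2 + (mu * i)%:R - z in
  match j.1.1 with
  | inl k => Ms k b%:R /\ mloc (Ms k) (y / m`!%:R)
  | inr g => `|emb g y| < mu%:R / 2
  end.
have mf0 : m`!%:R != 0 :> algC by rewrite pnatr_eq0 -lt0n fact_gt0.
have [|[[k a] zi] i i' |i hi] := @good_index m J bad.
- by rewrite !card_prod card_sum card_bool !card_ord acong.
- rewrite /bad /=; have wl (Q : 'I_m -> Prop) : (forall i i' : 'I_m, (i < i')%N -> Q i -> Q i' -> False) ->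
    Q i -> Q i' -> i = i'.
    move=> h q q'; apply: val_inj; case: (ltngtP i i') => // lt; [case: (h i i') | case: (h i' i)] => //.
  case: k => [k|g].
    apply: (wl (fun i => Ms k b%:R /\ mloc (Ms k) ((x a + (mu * i)%:R - emb zi gam) / m`!%:R))).
    clear i i' wl; move=> i i' lt [Mb h1] [_ h2]; have pM := pMs k.
    have := mlocB pM h2 h1; rewrite -mulrBl.
    have -> : x a + (mu * i')%:R - emb zi gam - (x a + (mu * i)%:R - emb zi gam) = mu%:R * (i' - i)%:R.
      by rewrite natrB ?(ltnW lt) // !natrM; ring.
    have /dvdnP[q qE] : (i' - i %| m`!)%N.
      by apply: dvdn_fact; rewrite subn_gt0 lt /= (leq_trans (leq_subr _ _)) // ltnW.
    have d0 : (i' - i)%:R != 0 :> algC by rewrite pnatr_eq0 -lt0n subn_gt0.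
    move=> h3; have : mloc (Ms k) (q%:R * (mu%:R * (i' - i)%:R / m`!%:R)) by apply: mlocM => //; apply: loc_nat.
    have q0 : q%:R != 0 :> algC by apply: contra mf0 => /eqP q0; rewrite qE natrM q0 mul0r.
    have -> : q%:R * (mu%:R * (i' - i)%:R / m`!%:R) = mu%:R :> algC by rewrite qE natrM; field; rewrite q0 d0.
    move/mloc_Aint => /(_ pM); rewrite rpred_nat => /(_ isT) Mmu.
    apply: (prm1 pM); have -> : 1 = mu%:R - (mu.-1)%:R :> algC by rewrite -{1}(prednK mu0) -natr1; ring.
    apply: prmB => //; case/dvdnP: muE => w ->; rewrite natrM; apply: prmZ => //; exact: rpred_nat.
  apply: (wl (fun i => `|emb g (x a + (mu * i)%:R - emb zi gam)| < mu%:R / 2)).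
  clear i i' wl; move=> i i' lt h1 h2.
  have h3 : `|emb g (x a + (mu * i')%:R - emb zi gam) - emb g (x a + (mu * i)%:R - emb zi gam)| < mu%:R.
    apply: le_lt_trans (ler_normB _ _) _; have -> : mu%:R = mu%:R / 2 + mu%:R / 2 :> algC by field.
    exact: ltrD.
  move: h3; rewrite -rmorphB.
  have -> : x a + (mu * i')%:R - emb zi gam - (x a + (mu * i)%:R - emb zi gam) = (mu * (i' - i))%:R.
    by rewrite mulnBr natrB ?leq_mul2l ?(ltnW lt) ?orbT //; ring.
  rewrite rmorph_nat normr_nat ltr_nat ltnNge => /negP; apply.
  by rewrite leq_pmulr // subn_gt0.
exists i => a; split=> [M pM Mb z zr|g z zr].
  have [k sk] := covMs pM Mb.
  have by_ : fld be (x a + (mu * i)%:R - z) by apply: fldB; [apply: fldD => //; apply: fld_nat | exact: fld_conjs].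
  have bq : fld be (m`!%:R / (x a + (mu * i)%:R - z)) by apply: fldM; [apply: fld_nat | apply: fldV].
  apply/(sameon_loc pM (pMs k) sk bq).1.
  have [u uz] := conjsP zr; have [zi ziE] := emb_surj gam u.
  have := hi ((inl k, a), zi); rewrite /bad /= -ziE uz => nb.
  case: (eqVneq (x a + (mu * i)%:R - z) 0) => [->|y0]; first by rewrite invr0 mulr0; apply: loc0.
  rewrite -invf_div; apply: nmloc_loc => //; first by rewrite mulf_neq0 ?invr_neq0.
  by move=> h; apply: nb; split=> //; apply/sk => //; apply: fld_nat.
have by_ : fld be (x a + (mu * i)%:R - z) by apply: fldB; [apply: fldD => //; apply: fld_nat | exact: fld_conjs].
have [gi giE] := emb_surj be g; rewrite (fldE by_ giE).
have [u uz] := conjsP zr; have [zi ziE] := emb_surj gam u.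
have := hi ((inr gi, a), zi); rewrite /bad /= -ziE uz => /negP.
by rewrite -real_leNgt ?normr_real // rpredM ?rpredV ?realn.
Qed.

Lemma f_aut (w : aut) y : w f.[y] = f.[w y].
Proof.
rewrite -horner_map; congr (_.[_]); have [q [-> _] _] := minCpolyP gam.
by rewrite -map_poly_comp; apply: eq_map_poly => a /=; apply: fmorph_rat.
Qed.

Definition shift_prod t := \prod_(i < m) f.[t + (mu * i)%:R] ^+ 2.

Hypothesis mu_big : exists C : nat, (forall (g : aut) z, z \in conjs gam -> `|g z| <= C%:R) /\
  (8 * (m`! ^ p) ^ 2 * C.+1 < mu)%N.

Lemma fRB t : RB t -> RB f.[t].
Proof.
move=> [bt ht]; rewrite fE; split.
  by rewrite big_seq; apply: fld_prod => z zr; apply: fldB => //; apply: fld_conjs.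
move=> M pM g; rewrite big_seq; apply: loc_prod => // z zr; apply: locB => //; first exact: ht.
by apply: loc_Aint => //; have [u <-] := conjsP zr; rewrite Aint_aut.
Qed.

(** The automorphism [th] fixes the prime and [t] but moves [z], so [t - z] in the prime would put
    [z - th z] there, against [sepT]. *)
Lemma inert_root M t z : prm M -> ~ M b%:R -> inert gam lamh M -> fld lam t -> loc M t -> z \in conjs gam -> loc M (t - z)^-1.
Proof.
move=> pM nb i lt lt' zr; have [u uz] := conjsP zr.
have Az : z \in Aint by rewrite -uz Aint_aut.
apply: loc_unit; first by apply: locB => //; apply: loc_Aint.
have d := inert_dec pM i; have bt := fld_trans bl lt.
have bz := fld_conjs zr.
move=> h; have h2 := (dec_mloc pM th_stable d (fldB bt bz)).1.2 h.
have tt : th t = t by apply: lt.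
rewrite rmorphB tt in h2.
have := mlocB pM h2 h; have -> : t - th z - (t - z) = z - th z by ring.
move/mloc_Aint => /(_ pM); rewrite rpredB ?Aint_aut // => /(_ isT).
rewrite -uz; apply: (sepT pM nb (u := u) (v := autM th u)); rewrite autME => e.
apply: thg; have gz : fld (u gam) gam by have := nrm_sym (ng u).
by apply: (gz th); rewrite -e.
Qed.

Lemma descent_sound h t x1 x2 u r v s1 s2 (l1 l2 : nat) : fld lam t -> RB t -> inU x1 -> inU x2 ->
  (forall x, inU x -> s (x ^+ h) = x ^+ h) -> RB u -> RB r -> RB s1 -> RB s2 ->
  x1 ^+ h - 1 = shift_prod t * u -> x2 ^+ h - 1 = (x1 ^+ h - 1) * (t + (x1 ^+ h - 1) * r) ->
  (x1 ^+ h - 1) * v = (1 - l1%:R * s1) * (1 - l2%:R * s2) ->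
  (exists M, [/\ prm M, Good M & M l1%:R]) -> (exists M, [/\ prm M, Good M & M l2%:R]) -> sig t = t.
Proof.
move=> lt Rt U1 U2 hU Ru Rr Rs1 Rs2 e1 e2 e3 hl1 hl2.
set X := x1 ^+ h - 1 in e1 e2 e3.
(* Each factor on the right of [e3] is 1 modulo a good prime, so neither vanishes. *)
have X0 : X != 0.
  apply/eqP => X0; rewrite X0 mul0r in e3.
  have no l0 s0 : RB s0 -> (exists M, [/\ prm M, Good M & M l0%:R]) -> 1 - l0%:R * s0 != 0.
    move=> [_ hs0] [M [pM g Ml]]; apply/eqP => e; apply: (mloc1 pM).
    by move/eqP: e; rewrite subr_eq0 => /eqP ->; apply: mlocMr => //; [apply: mloc_M | apply: hs0].
  by move/esym/eqP: e3; rewrite mulf_eq0 (negbTE (no _ _ Rs1 hl1)) (negbTE (no _ _ Rs2 hl2)).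
have sX : s X = X by rewrite rmorphB rmorph1 hU.
have st : s t = sig t := s_lam sl1 lt.
(* Apply [s] to [e2] and cancel [X], which [s] fixes. *)
have dt : t - s t = X * (s r - r).
  have := congr1 s e2; rewrite rmorphB rmorph1 hU // rmorphM sX rmorphD rmorphM sX e2.
  move/(mulfI X0) => e; have e4 : t - s t = (t + X * r) - X * r - s t by ring.
  by rewrite e4 e; ring.
have sZ : s (shift_prod t) = shift_prod (s t).
  by rewrite rmorph_prod; apply: eq_bigr => i _; rewrite rmorphXn /= f_aut rmorphD rmorph_nat.
pose W := u * s u * (s r - r) ^+ 2.
have RW : RB W.
  by apply: RB_M; [apply: RB_M => //; apply: RB_aut | rewrite expr2; apply: RB_M; apply: RB_B => //; apply: RB_aut].
have dt2 : (t - s t) ^+ 2 = shift_prod t * shift_prod (s t) * W.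
  have -> : (t - s t) ^+ 2 = X * s X * (s r - r) ^+ 2 by rewrite sX dt; ring.
  rewrite e1 rmorphM sZ /W; ring.
have bt := fld_trans bl lt; have Rst := RB_aut s_stable Rt.
have lst : fld lam (s t) by rewrite st; apply: nrm_fld.
pose x (a : bool) := if a then t else s t.
have [i hi] : exists i : 'I_m, forall a,
   (forall M, prm M -> M b%:R -> forall z, z \in conjs gam -> loc M (m`!%:R / (x a + (mu * i)%:R - z))) /\
   (forall (g : aut) z, z \in conjs gam -> mu%:R / 2 <= `|g (x a + (mu * i)%:R - z)|).
  by apply: good_shift => -[]; [|case: Rst].
pose y a := x a + (mu * i)%:R.
have ly a : fld lam (y a) by apply: fldD; [case: a | apply: fld_nat].
have hmu : 0 < mu%:R / 2 :> algC by rewrite divr_gt0 ?ltr0n.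
have yz a z : z \in conjs gam -> y a - z != 0.
  by move=> zr; rewrite -(fmorph_eq0 (idfun : aut)) -normr_gt0; apply: lt_le_trans hmu ((hi a).2 idfun z zr).
have fy0 a : f.[y a] != 0 by rewrite fE prodf_seq_neq0; apply/allP => z zr /=; apply: yz.
have ty : t - s t = y true - y false by rewrite /y /=; ring.
pose D := (m`! ^ p)%:R : algC.
have D0 : D != 0 by rewrite pnatr_eq0 -lt0n expn_gt0 fact_gt0.
(* Integral at primes above [b] and at inert ones by [loc_finv], at good ones because its square is;
   the size of [mu] makes all its conjugates small. *)
pose e := D ^+ 2 * (t - s t) / (f.[y true] * f.[y false]).
have eE : e = (D * y true / f.[y true]) * (D / f.[y false]) - (D / f.[y true]) * (D * y false / f.[y false]).
  by rewrite /e ty; field; rewrite !fy0.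
have Ae : e \in Aint.
  apply: Aint_loc => M pM.
  have two : (forall a, loc M (y a) -> forall z, z \in conjs gam -> loc M (m`!%:R / (y a - z))) -> loc M e.
    move=> hh; rewrite eE.
    have h1 a := loc_finv pM (yz a) (hh a).
    have [[a1 a2] [b1 b2]] := (h1 true, h1 false).
    by apply: locB => //; apply: locM.
  case: (boolp.EM (M b%:R)) => [Mb|nMb].
    by apply: two => a _ z zr; apply: (hi a).1.
  case: (inert_good pM nMb) => [ii|g].
    apply: two => a la z zr; apply: locM => //; first exact: loc_nat.
    exact: (inert_root pM nMb ii (ly a) la zr).
  apply: loc_sqr => //.
  have Zq a : RB (x a) -> loc M (shift_prod (x a) / f.[y a] ^+ 2).
    move=> Rx; rewrite /shift_prod (bigD1 i) //= -/(y a) mulrAC mulfV ?expf_neq0 // mul1r.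
    apply: loc_prod => // j _; apply: locX => //.
    have [_ h'] : RB f.[x a + (mu * j)%:R] by apply/fRB/RB_D => //; apply: RB_nat.
    exact: h'.
  have -> : e ^+ 2 = D ^+ 4 * (shift_prod t / f.[y true] ^+ 2) * (shift_prod (s t) / f.[y false] ^+ 2) * W.
    have -> : e ^+ 2 = D ^+ 4 * (t - s t) ^+ 2 / (f.[y true] ^+ 2 * f.[y false] ^+ 2).
      by rewrite /e; field; rewrite !fy0.
    by rewrite dt2; field; rewrite !fy0.
  apply: locM => //; last by case: RW => _; apply.
  apply: locM => //; last exact: (Zq false).
  apply: locM => //; last exact: (Zq true).
  by apply: locX => //; apply: loc_nat.
have e0 : e = 0.
  have [C [CE muC]] := mu_big.
  apply: Aint_small => // g.
  set hh := mu%:R / 2 in hmu.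
  have hh1 : 1 <= hh.
    rewrite /hh ler_pdivlMr ?ltr0n // mul1r ler_nat; apply: leq_trans muC.
    by rewrite ltnS !muln_gt0 !expn_gt0 fact_gt0.
  have szr : size (conjs gam) = p := acong.
  have inv1 a z : z \in conjs gam -> `|g (y a - z)^-1| <= hh^-1.
    move=> zr; rewrite fmorphV normfV lef_pV2 ?posrE ?normr_gt0 ?fmorph_eq0 ?yz //.
    exact: (hi a).2.
  have inv1' a z : z \in conjs gam -> `|g (y a - z)^-1| <= 1.
    by move=> zr; apply: le_trans (inv1 a z zr) _; rewrite invf_le1.
  have gfV a : g (f.[y a])^-1 = \prod_(z <- conjs gam) g (y a - z)^-1 by rewrite fE -prodfV rmorph_prod.
  have B1 a : `|g (f.[y a])^-1| <= hh^-1.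
    rewrite gfV; move: szr (inv1 a) (inv1' a).
    case: (conjs gam) => [ee|z0 rr _ i1 i2]; first by move: (prime_gt0 pp); rewrite -ee.
    rewrite big_cons normrM -[hh^-1]mulr1; apply: ler_pM; rewrite ?normr_ge0 //.
      by apply: i1; rewrite mem_head.
    by apply: prod_norm_le1 => z zr; apply: i2; rewrite inE zr orbT.
  have B2 a : `|g (y a / f.[y a])| <= C.+1%:R.
    rewrite rmorphM gfV; move: szr (inv1' a) (fun z => CE g z) (yz a).
    case: (conjs gam) => [ee|z0 rr _ i2 Cz yz']; first by move: (prime_gt0 pp); rewrite -ee.
    have z0r : z0 \in z0 :: rr by rewrite mem_head.
    rewrite big_cons mulrA normrM -[C.+1%:R]mulr1; apply: ler_pM; rewrite ?normr_ge0 //; last first.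
      by apply: prod_norm_le1 => z zr; apply: i2; rewrite inE zr orbT.
    have -> : g (y a) * g (y a - z0)^-1 = 1 + g z0 * g (y a - z0)^-1.
      by rewrite -!rmorphM -[1 in RHS](rmorph1 g) -rmorphD; congr (g _); field; apply: yz'.
    apply: le_trans (ler_normD _ _) _; rewrite normr1 -natr1 addrC lerD2r normrM -[C%:R]mulr1.
    by apply: ler_pM; rewrite ?normr_ge0 ?Cz ?i2.
  have ->  : g e = D * g (y true / f.[y true]) * (D * g (f.[y false])^-1) - (D * g (f.[y true])^-1) * (D * g (y false / f.[y false])).
    by rewrite eE rmorphB !rmorphM !rmorph_nat; ring.
  apply: le_lt_trans (ler_normB _ _) _; rewrite !normrM !normr_nat.
  have D0' : 0 <= D by rewrite ler0n.
  apply: (@le_lt_trans _ _ (D * C.+1%:R * (D * hh^-1) + (D * hh^-1) * (D * C.+1%:R))).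
    by apply: lerD; apply: ler_pM; rewrite ?mulr_ge0 ?normr_ge0 ?ler_wpM2l // ?B1 ?B2.
  have -> : D * C.+1%:R * (D * hh^-1) + (D * hh^-1) * (D * C.+1%:R) = (2 * (m`! ^ p) ^ 2 * C.+1)%:R / hh.
    have -> : (2 * (m`! ^ p) ^ 2 * C.+1)%:R = 2 * D ^+ 2 * C.+1%:R :> algC by rewrite natrM [(2 * _)%:R]natrM natrX.
    by ring.
  rewrite ltr_pdivrMr // mul1r /hh ltr_pdivlMr ?ltr0n // -natrM ltr_nat; apply: leq_ltn_trans muC.
  by rewrite mulnAC leq_mul2r mulnAC leq_mul2r orbT.
have h2 : t - s t = 0.
  have : D ^+ 2 * (t - s t) = e * (f.[y true] * f.[y false]) by rewrite /e; field; rewrite !fy0.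
  by rewrite e0 mul0r => /eqP; rewrite mulf_eq0 expf_eq0 (negbTE D0) /= => /eqP.
by move/eqP: h2; rewrite subr_eq0 -st => /eqP.
Qed.
End Sound.

(** * Existential definitions *)

Inductive term := Var of nat | Cst of algC | Add of term & term | Mul of term & term.
Fixpoint ev (e : nat -> algC) (p : term) : algC :=
  match p with Var i => e i | Cst a => a | Add p q => ev e p + ev e q | Mul p q => ev e p * ev e q end.
Fixpoint ren (g : nat -> nat) (p : term) : term :=
  match p with Var i => Var (g i) | Cst a => Cst a | Add p q => Add (ren g p) (ren g q) | Mul p q => Mul (ren g p) (ren g q) end.
Lemma ev_ren e g p : ev e (ren g p) = ev (e \o g) p.
Proof. by elim: p => //= p -> q ->. Qed.
Definition zeros e (ps : seq term) := forall p, List.In p ps -> ev e p = 0.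
Lemma zeros_nil e : zeros e [::]. Proof. by []. Qed.
Lemma zeros_cons e p ps : zeros e (p :: ps) <-> ev e p = 0 /\ zeros e ps.
Proof.
split=> [h|[h1 h2] q [<-//|]]; last exact: h2.
by split; [apply: h; left | move=> q i; apply: h; right].
Qed.
Lemma zeros_cat e ps qs : zeros e (ps ++ qs) <-> zeros e ps /\ zeros e qs.
Proof.
elim: ps => [|p ps IH] /=; first by split=> [h|[]//]; split.
by rewrite !zeros_cons IH; split=> [[? []]|[[]]].
Qed.
Lemma zeros_ren e g ps : zeros e (map (ren g) ps) <-> zeros (e \o g) ps.
Proof.
elim: ps => [|p ps IH] /=; first by split=> _; apply: zeros_nil.
rewrite !zeros_cons; rewrite ev_ren.
by split=> -[h /IH].
Qed.
Lemma zeros_flat (T : Type) e (F : T -> seq term) (l : seq T) : zeros e (flatten (map F l)) <-> forall x, List.In x l -> zeros e (F x).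
Proof.
elim: l => [|x l IH] /=; first by split=> // _; apply: zeros_nil.
rewrite zeros_cat IH; split=> [[h1 h2] y [<-//|]|h]; first exact: h2.
by split; [apply: h; left | move=> y i; apply: h; right].
Qed.

(** Systems with arbitrary algebraic constants, variable 0 carrying the element; [combine] and
    [diophantine_over_dio] turn them into one polynomial over [R]. *)
Definition dio (R A : subsetA) := exists ps : seq term, forall t, A t <->
  exists e, [/\ forall i : nat, R (e i), e 0%N = t & zeros e ps].

Lemma dio_self R : dio R R.
Proof.
exists [::] => t; split=> [Rt|[e [Re <- _]]//]; exists (fun=> t); by split.
Qed.

Lemma dio_ex R A d k (qs : seq term) : dio R A ->
  dio R (fun t => exists w : nat -> algC, [/\ forall i, R (w i), w 0%N = t, forall i, (i < k)%N -> A (w (d + i)%N) & zeros w qs]).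
Proof.
(* Variables are interleaved modulo [K]: residue 0 holds the outer system, residue [i + 1] the copy
   of [ps] certifying that the variable [d + i] lies in [A]. *)
case=> ps psE; pose K := k.+1.
pose sys i := Add (Var i.+1) (Mul (Cst (-1)) (Var ((d + i) * K)%N)) :: map (ren (fun j => j * K + i.+1)%N) ps.
exists (map (ren (fun j => j * K)%N) qs ++ flatten (map sys (iota 0 k))) => t.
have Inio i : List.In i (iota 0 k) <-> (i < k)%N.
  have -> : (i < k)%N = (i \in iota 0 k) by rewrite mem_iota.
  elim: (iota 0 k) => [|a l IH] //=; rewrite inE; split=> [[->|/IH ->]|/predU1P[->|/IH]]; rewrite ?eqxx ?orbT //; by [left | right].
have sysE e i : zeros e (sys i) <-> e i.+1 = e ((d + i) * K)%N /\ zeros (e \o (fun j => j * K + i.+1)%N) ps.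
  rewrite /sys zeros_cons zeros_ren /= mulN1r; split=> -[h1 h2]; split=> //; first by apply/eqP; rewrite -subr_eq0 h1.
  by rewrite h1 subrr.
split=> [[w [Rw wt Aw wq]]|[e [Re e0 /zeros_cat[h1 /zeros_flat h2]]]].
  have /exists_fun[e eE] : forall i, exists e, (forall j, R (e j)) /\ ((i < k)%N -> e 0%N = w (d + i)%N /\ zeros e ps).
    move=> i; case: (boolP (i < k)%N) => [ik|_]; last by exists w.
    by have /psE[e [e1 e2 e3]] := Aw i ik; exists e.
  pose e' n := if (n %% K == 0)%N then w (n %/ K)%N else e (n %% K).-1 (n %/ K)%N.
  have e'0 j : e' (j * K)%N = w j by rewrite /e' modnMl eqxx mulnK.
  have e'S j i : (i < k)%N -> e' (j * K + i.+1)%N = e i j.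
    by move=> ik; rewrite /e' modnMDl modn_small ?ltnS //= divnMDl // divn_small ?ltnS // addn0.
  exists e'; split.
  - by move=> n; rewrite /e'; case: ifP => _ //; case: (eE (n %% K).-1).
  - by rewrite -[0%N](mul0n K) e'0.
  apply/zeros_cat; split.
    by apply/zeros_ren; rewrite (_ : e' \o _ = w) //; apply: boolp.funext => j /=.
  apply/zeros_flat => i /Inio ik; apply/sysE; have [_ /(_ ik)[i1 i2]] := eE i.
  rewrite e'0 -i1 -(e'S 0%N i ik) mul0n; split=> //.
  by rewrite (_ : e' \o _ = e i) //; apply: boolp.funext => j /=; rewrite e'S.
exists (e \o (fun j => j * K)%N); split=> //=.
  move=> i ik; have /sysE[s1 s2] := h2 i ((Inio i).2 ik).
  by apply/psE; exists (e \o (fun j => j * K + i.+1)%N); split=> //=.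
exact/zeros_ren.
Qed.

Lemma dio_ext R A B : (forall t, A t <-> B t) -> dio R A -> dio R B.
Proof. by move=> h [ps hp]; exists ps => t; rewrite -h. Qed.

Fixpoint bnd p := match p with Var i => i.+1 | Cst _ => 0%N | Add p q | Mul p q => maxn (bnd p) (bnd q) end.
Lemma ev_ext e e' p n : (bnd p <= n)%N -> (forall i, (i < n)%N -> e i = e' i) -> ev e p = ev e' p.
Proof.
move=> h he; elim: p h => [i|a|p IHp q IHq|p IHp q IHq] //= h; first exact: he.
  by move: h; rewrite geq_max => /andP[/IHp -> /IHq ->].
by move: h; rewrite geq_max => /andP[/IHp -> /IHq ->].
Qed.
Fixpoint csts p := match p with Var _ => [::] | Cst a => [:: a] | Add p q | Mul p q => csts p ++ csts q end.
Lemma ev_fldC k e p : (forall i, fld k (e i)) -> (forall a, a \in csts p -> fld k a) -> fld k (ev e p).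
Proof.
move=> ke; elim: p => [i|a|p IHp q IHq|p IHp q IHq] h /=; first exact: ke.
- by apply: h; rewrite mem_head.
- by apply: fldD; [apply: IHp | apply: IHq] => a ha; apply: h; rewrite mem_cat ha ?orbT.
- by apply: fldM; [apply: IHp | apply: IHq] => a ha; apply: h; rewrite mem_cat ha ?orbT.
Qed.

(** A root of unity of prime order [q > deg k + 1] has degree [q - 1], too large for [fld k]. *)
Lemma fld_ext k : exists tau, ~ fld k tau.
Proof.
have [q [_ [_ [pq kq _ _ _]]]] := deg1_prime (deg k).+1 (rpred1 _ : 1 \in Aint).
have [z pz] := C_prim_root_exists (prime_gt0 pq).
exists z => /deg_mono; apply/negP; rewrite -ltnNge.
have : size (minCpoly z) = q.
  rewrite (minCpoly_cyclotomic pz) -(Cintr_Cyclotomic pz) size_map_inj_poly ?rmorph0 //; last exact: intr_inj.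
  by rewrite size_Cyclotomic totient_prime // prednK ?prime_gt0.
rewrite minCpoly_conjs size_prod_XsubC -/(deg z) => zq.
by move: kq; rewrite -zq ltnS.
Qed.

(** Two equations [f = g = 0] over a field [k] are equivalent to [f + tau g = 0] for any [tau] outside [k]. *)
Lemma combine om (R : subsetA) (ps : seq term) : (forall x, R x -> fld om x) ->
  exists p, forall e, (forall i, R (e i)) -> (ev e p = 0 <-> zeros e ps).
Proof.
move=> Rom; elim: ps => [|p ps [q IH]]; first by exists (Cst 0) => e _; split=> // _; apply: zeros_nil.
have [k [k1 _]] := primitive_element (om :: csts p ++ csts q).
have [tau ktau] := fld_ext k.
exists (Add p (Mul (Cst tau) q)) => e Re /=; rewrite zeros_cons -(IH e Re).
have ke i : fld k (e i) by apply: fld_trans (Rom _ (Re i)); apply: k1; rewrite mem_head.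
have kp : fld k (ev e p) by apply: ev_fldC => // a ha; apply: k1; rewrite inE mem_cat ha orbT.
have kq : fld k (ev e q) by apply: ev_fldC => // a ha; apply: k1; rewrite inE mem_cat ha !orbT.
split=> [h|[-> ->]]; last by rewrite mulr0 addr0.
suff q0 : ev e q = 0 by rewrite q0 mulr0 addr0 in h.
apply/eqP/negPn/negP => q0; apply: ktau.
have -> : tau = - ev e p / ev e q.
  by apply: (mulIf q0); rewrite divfK //; apply/eqP; rewrite -addr_eq0 addrC h.
by apply: fldM; [apply: fldN | apply: fldV].
Qed.

Fixpoint mpoly_of n (p : term) : {mpoly algC[n.+1]} :=
  match p with Var i => mpolyX _ (mnm1 (inord i)) | Cst a => mpolyC _ a | Add p q => mpoly_of n p + mpoly_of n q | Mul p q => mpoly_of n p * mpoly_of n q end.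
Lemma mpoly_of_ev n p v : meval v (mpoly_of n p) = ev (fun i => v (inord i)) p.
Proof.
elim: p => [i|a|p IHp q IHq|p IHp q IHq] /=; rewrite ?mevalXU ?mevalC //.
  by rewrite mevalD IHp IHq.
by rewrite mevalM IHp IHq.
Qed.
Lemma mpoly_of_aut n p k (u v : aut) : (forall a, a \in csts p -> fld k a) -> u k = v k -> map_mpoly u (mpoly_of n p) = map_mpoly v (mpoly_of n p).
Proof.
move=> h uv; elim: p h => [i|a|p IHp q IHq|p IHp q IHq] h /=.
- by rewrite !map_mpolyX.
- by rewrite !map_mpolyC; congr mpolyC; apply: (fldE (h a _) uv); rewrite mem_head.
- by rewrite !rmorphD /= IHp ?IHq // => a ha; apply: h; rewrite mem_cat ha ?orbT.
- by rewrite !rmorphM /= IHp ?IHq // => a ha; apply: h; rewrite mem_cat ha ?orbT.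
Qed.
Lemma mpoly_of_map n p (u : aut) v : meval (fun i => u (v i)) (map_mpoly u (mpoly_of n p)) = u (meval v (mpoly_of n p)).
Proof.
elim: p => [i|a|p IHp q IHq|p IHp q IHq] /=.
- by rewrite map_mpolyX !mevalXU.
- by rewrite map_mpolyC !mevalC.
- by rewrite (rmorphD (map_mpoly u)) /= !mevalD rmorphD IHp IHq.
- by rewrite (rmorphM (map_mpoly u)) /= !mevalM rmorphM IHp IHq.
Qed.

(** Coefficients outside the field of [R] are removed by taking the product of the conjugates of the polynomial. *)
Lemma diophantine_over_dio om (R A : subsetA) : (forall x, R x -> fld om x) -> (forall x, fld om x -> x \in Aint -> R x) ->
  dio R A -> diophantine_over R A.
Proof.
move=> Rom RA [ps psE].
have [p pE] := combine ps Rom.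
pose n := bnd p.
have [k [k1 _]] := primitive_element (om :: csts p).
have kom : fld k om by apply: k1; rewrite mem_head.
have kc a : a \in csts p -> fld k a by move=> ha; apply: k1; rewrite inE ha orbT.
have [N [s [sp sinj ssurj]]] := fld_orbit om k.
pose P := mpoly_of n p.
pose Q := \prod_(i < N) map_mpoly (s i) P.
have vQ (v : aut) : v om = om -> map_mpoly v Q = Q.
  move=> vo; have [f fb fE] := orbit_perm vo sp sinj ssurj.
  rewrite /Q rmorph_prod /= [RHS](reindex f) /=; last exact: onW_bij.
  apply: eq_bigr => i _; rewrite -(mpoly_of_aut n kc (u := autM v (s i)) (v := s (f i))).
    apply/mpolyP => m; rewrite !mcoeff_map_mpoly //=.
  by rewrite autME; apply: fE; apply: fld_id.
have Qc m : fld om Q@_m by move=> v vo; rewrite -[in RHS](vQ v vo) mcoeff_map_mpoly.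
have [D D0 DA] : exists2 D : nat, (0 < D)%N & forall m, D%:R * Q@_m \in Aint.
  have [D D0 DE] := Aint_denoms (fun i : 'I_(size (msupp Q)) => Q@_(nth 0%MM (msupp Q) i)).
  exists D => // m; case: (boolP (m \in msupp Q)) => [mQ|/memN_msupp_eq0 ->]; last by rewrite mulr0 rpred0.
  have lt : (index m (msupp Q) < size (msupp Q))%N by rewrite index_mem.
  by have := DE (Ordinal lt); rewrite /= nth_index.
have evQ v : (forall i, fld om (v i)) -> (D%:R *: Q).@[v] = 0 <-> P.@[v] = 0.
  move=> ov; rewrite mevalZ rmorph_prod /=.
  have e i : (map_mpoly (s i) P).@[v] = s i P.@[v].
    rewrite -[RHS](_ : (map_mpoly (s i) P).@[fun j => s i (v j)] = _).
      by apply: meval_eq => j; apply/esym/ov.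
    exact: mpoly_of_map.
  split=> [/eqP|P0].
    rewrite mulf_eq0 pnatr_eq0 -leqn0 leqNgt D0 /= => /prodf_eq0[i _].
    by rewrite e fmorph_eq0 => /eqP.
  by have [i0 _] := ssurj idfun erefl; rewrite (bigD1 i0) //= e P0 rmorph0 mul0r mulr0.
exists n, (D%:R *: Q); split=> [m|t Rt].
  by rewrite mcoeffZ; apply: RA => //; apply: fldM => //; apply: fld_nat.
rewrite psE; split=> [[e [Re e0 /(pE e Re) ze]]|[x [Rx zx]]].
  exists (fun j => e (lift ord0 j)); split=> //; apply/evQ.
    by move=> i; case: unlift => [j|]; apply: Rom.
  rewrite /P mpoly_of_ev -[RHS]ze; apply: (@ev_ext _ _ p n.+1) => // i ilt.
  case: unliftP => [j|] /(congr1 val) /=; rewrite inordK // => ->; by rewrite ?lift0 ?e0.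
set v := fun i : 'I_n.+1 => _ in zx.
have Rv i : R (v i) by rewrite /v; case: unlift.
exists (fun i => v (inord i)); split=> //; first by rewrite /v (_ : inord 0 = ord0) ?unlift_none //; apply: val_inj; rewrite /= inordK.
apply/(pE _ (fun i => Rv _)); rewrite -mpoly_of_ev; apply/evQ => // i; exact: Rom.
Qed.

(** Polynomial functions of the variables, so that systems can be written semantically. *)
Definition pfun (F : (nat -> algC) -> algC) := exists p, forall e, ev e p = F e.
Lemma pf_var i : pfun (fun e => e i). Proof. by exists (Var i). Qed.
Lemma pf_cst a : pfun (fun=> a). Proof. by exists (Cst a). Qed.
Lemma pf_add F G : pfun F -> pfun G -> pfun (fun e => F e + G e).
Proof. by case=> p pE [q qE]; exists (Add p q) => e /=; rewrite pE qE. Qed.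
Lemma pf_mul F G : pfun F -> pfun G -> pfun (fun e => F e * G e).
Proof. by case=> p pE [q qE]; exists (Mul p q) => e /=; rewrite pE qE. Qed.
Lemma pf_sub F G : pfun F -> pfun G -> pfun (fun e => F e - G e).
Proof.
case=> p pE [q qE]; exists (Add p (Mul (Cst (-1)) q)) => e /=.
by rewrite pE qE mulN1r.
Qed.
Lemma pf_sum n (F : 'I_n -> (nat -> algC) -> algC) : (forall i, pfun (F i)) -> pfun (fun e => \sum_i F i e).
Proof.
move=> /exists_fun[f fE]; exists (foldr Add (Cst 0) [seq f i | i <- index_enum 'I_n]) => e.
by elim: (index_enum _) => [|i r IH]; rewrite ?big_nil // big_cons /= fE IH.
Qed.
Lemma pf_prod n (F : 'I_n -> (nat -> algC) -> algC) : (forall i, pfun (F i)) -> pfun (fun e => \prod_i F i e).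
Proof.
move=> /exists_fun[f fE]; exists (foldr Mul (Cst 1) [seq f i | i <- index_enum 'I_n]) => e.
by elim: (index_enum _) => [|i r IH]; rewrite ?big_nil // big_cons /= fE IH.
Qed.
Lemma pf_exp n F : pfun F -> pfun (fun e => F e ^+ n).
Proof.
move=> h; have [p pE] := pf_prod (fun _ : 'I_n => h); exists p => e.
by rewrite pE prodr_const card_ord.
Qed.
Lemma pf_horner (P : {poly algC}) F : pfun F -> pfun (fun e => P.[F e]).
Proof.
move=> h; have [p pE] := @pf_sum (size P) (fun i e => P`_i * F e ^+ i) (fun i => pf_mul (pf_cst _) (pf_exp i h)).
by exists p => e; rewrite pE horner_coef.
Qed.

Lemma dio_sys R A d k Fs : dio R A -> (forall F, List.In F Fs -> pfun F) ->
  dio R (fun t => exists w : nat -> algC, [/\ forall i, R (w i), w 0%N = t, forall i, (i < k)%N -> A (w (d + i)%N) &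
    forall F, List.In F Fs -> F w = 0]).
Proof.
move=> dA hF; have [qs qE] : exists qs, forall e, zeros e qs <-> forall F, List.In F Fs -> F e = 0.
  elim: Fs hF => [|F Fs IH] h; first by exists [::] => e; split=> // _; apply: zeros_nil.
  have [|qs qE] := IH; first by move=> G i; apply: h; right.
  have [p pE] := h F (or_introl erefl); exists (p :: qs) => e; rewrite zeros_cons pE.
  split=> [[h1 h2] G [<-//|]|h']; first exact: (qE e).1.
  by split; [apply: h'; left | apply/qE => G i; apply: h'; right].
apply: dio_ext (dio_ex d k qs dA) => t; split=> -[w [w1 w2 w3 w4]]; exists w; split=> //; exact/qE.
Qed.

(** An element of [Z[B][y]] given by natural-number coefficients: the difference of two of them makes a negative coefficient available. *)
Definition form n (y : algC) (c : nat -> algC) B := y * \sum_(k < n) (c k - c (n + k)%N) * B ^+ k.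

Lemma form_aut n y c B (w : aut) : w y = y -> (forall k, (k < n.*2)%N -> w (c k) = c k) -> w (form n y c B) = form n y c (w B).
Proof.
move=> wy wc; rewrite /form rmorphM wy rmorph_sum; congr (_ * _); apply: eq_bigr => k _.
rewrite rmorphM rmorphB rmorphXn !wc // -addnn ?ltn_add2l ?ltn_addr //.
Qed.

(** The order [Z + D O] of [Q(be)] with [q] inverted; [D] is chosen so that [D O] lies in [Z[be]]. *)
Section Wring.
Variables (be : algC) (q D : nat).
Definition condr x := exists j (i : int) a, [/\ fld be a, a \in Aint & q%:R ^+ j * x = i%:~R + D%:R * a].
Lemma condr_int (i : int) : condr i%:~R.
Proof. by exists 0%N, i, 0; rewrite expr0 mul1r mulr0 addr0 rpred0; split=> //; apply: fld0. Qed.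
Lemma condr_nat n : condr n%:R. Proof. exact: (condr_int n). Qed.
Lemma condr_mulD j x : fld be x -> q%:R ^+ j * x \in Aint -> condr (D%:R * x).
Proof.
move=> bx Ax; exists j, 0, (q%:R ^+ j * x); split=> //; last by rewrite add0r mulrCA.
by apply: fldM => //; apply/fldX/fld_nat.
Qed.
Lemma condr_M x y : condr x -> condr y -> condr (x * y).
Proof.
case=> j [i [a [ba Aa e]]] [j' [i' [a' [ba' Aa' e']]]].
exists (j + j')%N, (i * i'), (i%:~R * a' + i'%:~R * a + D%:R * (a * a')); split.
- by rewrite -?addrA; repeat apply: fldD; repeat apply: fldM => //; try apply: fld_int; apply: fld_nat.
- by rewrite !rpredD ?rpredM ?rpred_int ?rpred_nat.
- by rewrite exprD mulrACA e e' intrM; ring.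
Qed.
Lemma condr_D x y : condr x -> condr y -> condr (x + y).
Proof.
case=> j [i [a [ba Aa e]]] [j' [i' [a' [ba' Aa' e']]]].
exists (j + j')%N, (q%:Z ^+ j' * i + q%:Z ^+ j * i'), (q%:R ^+ j' * a + q%:R ^+ j * a'); split.
- by apply: fldD; apply: fldM => //; apply/fldX/fld_nat.
- by rewrite rpredD ?rpredM ?rpredX ?rpred_nat.
rewrite exprD mulrDr mulrAC e -[_ * _ * y]mulrA e' rmorphD !rmorphM !rmorphXn /= -!pmulrn; ring.
Qed.
Lemma condr_N x : condr x -> condr (- x).
Proof. by move=> h; rewrite -mulN1r; apply: condr_M => //; apply: (condr_int (-1)). Qed.
Lemma condr_B x y : condr x -> condr y -> condr (x - y).
Proof. by move=> hx hy; apply: condr_D => //; apply: condr_N. Qed.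
Lemma condr_X x n : condr x -> condr (x ^+ n).
Proof. by move=> hx; elim: n => [|n IH]; [apply: (condr_nat 1) | rewrite exprS; apply: condr_M]. Qed.
Lemma condr_sum n (F : nat -> algC) : (forall i, condr (F i)) -> condr (\sum_(i < n) F i).
Proof. by move=> h; elim: n => [|n IH]; [rewrite big_ord0; apply: (condr_nat 0) | rewrite big_ord_recr; apply: condr_D]. Qed.

Hypothesis q0 : (0 < q)%N.
Lemma condr_Aint x : condr x -> exists j, q%:R ^+ j * x \in Aint.
Proof. by case=> j [i [a [ba Aa e]]]; exists j; rewrite e rpredD ?rpredM ?rpred_int ?rpred_nat. Qed.
Lemma condr_fld x : condr x -> fld be x.
Proof.
case=> j [i [a [ba Aa e]]]; have q1 : q%:R ^+ j != 0 :> algC by rewrite expf_neq0 // pnatr_eq0 -lt0n.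
rewrite -(mulKf q1 x) e; apply: fldM; first by apply/fldV/fldX/fld_nat.
by apply: fldD; [apply: fld_int | apply: fldM => //; apply: fld_nat].
Qed.

Hypothesis DE : forall x, x \in Aint -> fld be x ->
  exists k : 'I_(deg be) -> int, D%:R * x = \sum_j (k j)%:~R * be ^+ j.
(** The sign of each integer coefficient decides which of the two natural coefficients carries it;
    slot [2 * deg be] stores the denominator [q ^ j]. *)
Lemma condr_form x : condr x -> exists j c, [/\ forall k, exists n : nat, c k = n%:R,
   c ((deg be).*2) = q%:R ^+ j & x = form (deg be) (q%:R ^- j) c be].
Proof.
case=> j [i [a [ba Aa e]]]; have q1 : q%:R ^+ j != 0 :> algC by rewrite expf_neq0 // pnatr_eq0 -lt0n.
have [k kE] := DE Aa ba; set n := deg be in k kE *.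
have n0 : (0 < n)%N := deg_gt0 be.
pose f s : int := (if insub s is Some t then k t else 0) + (if s == 0%N then i else 0).
pose c s : nat := if (s < n)%N then (if f s is Posz t then t else 0%N)
  else if (s < n.*2)%N then (if f (s - n)%N is Negz t then t.+1 else 0%N) else (q ^ j)%N.
exists j, (fun s => (c s)%:R); split=> [s||].
- by exists (c s).
- by rewrite /c ltnn ltnNge -addnn leq_addr /= natrX.
have fE s : (s < n)%N -> (c s)%:R - (c (n + s)%N)%:R = (f s)%:~R :> algC.
  move=> sn; rewrite /c sn ltnNge leq_addr /= -addnn ltn_add2l sn addKn.
  by case: (f s) => t; rewrite ?subr0 ?sub0r ?NegzE ?mulrNz.
have -> : x = (i%:~R + D%:R * a) / q%:R ^+ j by rewrite -e mulrC mulKf.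
rewrite /form mulrC kE; congr (_ * _).
transitivity (\sum_(s < n) (k s)%:~R * be ^+ s + \sum_(s < n) (if s == 0%N :> nat then i%:~R else 0) * be ^+ s).
  rewrite addrC; congr (_ + _); rewrite (bigD1 (Ordinal n0)) //= expr0 mulr1 big1 ?addr0 // => s.
  by rewrite -val_eqE /= => /negbTE ->; rewrite mul0r.
rewrite -big_split /=; apply: eq_bigr => s _; rewrite fE // -mulrDl; congr (_ * _).
by rewrite /f valK rmorphD /=; congr (_ + _); case: ifP.
Qed.
End Wring.

Section Encode.
Variables (R A0 : subsetA) (gam be lam : algC) (th c sig : aut) (p h m mu l1 l2 D q : nat) (Good : (algC -> Prop) -> Prop).
Hypotheses (dA : dio R A0) (NA : forall n : nat, A0 n%:R) (Al : forall x, A0 x -> fld lam x).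
Hypotheses (Rn : forall n : nat, R n%:R) (RM : forall x y, R x -> R y -> R (x * y)).
Hypotheses (q0 : (0 < q)%N) (Rq : R q%:R^-1).
Hypothesis Rloc : forall x M, R x -> prm M -> Good M -> loc M x.
Hypotheses (bl : fld be lam) (Ab : be \in Aint) (thl : th lam = lam) (cl : c lam = lam).
Hypothesis DE : forall x, x \in Aint -> fld be x ->
  exists k : 'I_(deg be) -> int, D%:R * x = \sum_j (k j)%:~R * be ^+ j.
Hypothesis descent_sound : forall t x1 x2 u r v s1 s2, fld lam t -> RB be Good t ->
  inU p be th c Good x1 -> inU p be th c Good x2 -> RB be Good u -> RB be Good r -> RB be Good s1 -> RB be Good s2 ->
  x1 ^+ h - 1 = shift_prod gam m mu t * u -> x2 ^+ h - 1 = (x1 ^+ h - 1) * (t + (x1 ^+ h - 1) * r) ->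
  (x1 ^+ h - 1) * v = (1 - l1%:R * s1) * (1 - l2%:R * s2) -> sig t = t.
Hypothesis descent_complete : forall n : nat, exists x1 x2 u r v s1 s2 : algC,
  [/\ condr be q D x1 /\ condr be q D x2, x1 * c x1 = 1 /\ \prod_(j < p) autX th j x1 = 1,
    x2 * c x2 = 1 /\ \prod_(j < p) autX th j x2 = 1,
    [/\ condr be q D u, condr be q D r, condr be q D v, condr be q D s1 & condr be q D s2] &
    [/\ x1 ^+ h - 1 = shift_prod gam m mu n%:R * u, x2 ^+ h - 1 = (x1 ^+ h - 1) * (n%:R + (x1 ^+ h - 1) * r) &
        (x1 ^+ h - 1) * v = (1 - l1%:R * s1) * (1 - l2%:R * s2)]].

Let nn := deg be.
(** Variable 0 is [t]; seven blocks of length [W] follow, each with [2 * nn] coefficients and a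
    denominator, and then the seven inverses [yy] of the denominators. *)
Let W := nn.*2.+1.
Let cf (w : nat -> algC) a k := w (1 + a * W + k)%N.
Let yy (w : nat -> algC) a := w (1 + 7 * W + a)%N.
Let fm w a B := form nn (yy w a) (cf w a) B.
Let X w := fm w 0 be ^+ h - 1.

Let Rnat1 j : R (q%:R ^- j).
Proof. by elim: j => [|j IH]; [rewrite invr1; apply: (Rn 1) | rewrite exprS invfM; apply: RM]. Qed.

Lemma pf_fm a B : pfun (fun w => fm w a B).
Proof.
apply: pf_mul; first exact: pf_var.
by apply: pf_sum => k; apply: pf_mul; [apply: pf_sub; apply: pf_var | apply: pf_cst].
Qed.

Let eqs := [seq (fun w => cf w a nn.*2 * yy w a - 1) | a <- iota 0 7] ++
  [:: (fun w => fm w 0 be * fm w 0 (c be) - 1); (fun w => fm w 1 be * fm w 1 (c be) - 1);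
      (fun w => \prod_(j < p) fm w 0 (autX th j be) - 1); (fun w => \prod_(j < p) fm w 1 (autX th j be) - 1);
      (fun w => X w - shift_prod gam m mu (w 0%N) * fm w 2 be);
      (fun w => fm w 1 be ^+ h - 1 - X w * (w 0%N + X w * fm w 3 be));
      (fun w => X w * fm w 4 be - (1 - l1%:R * fm w 5 be) * (1 - l2%:R * fm w 6 be))].

Lemma pf_eqs F : List.In F eqs -> pfun F.
Proof.
have pX : pfun X by apply: pf_sub; [apply/pf_exp/pf_fm | apply: pf_cst].
rewrite /eqs /=; do 7! (case=> [<-|]; first by apply: pf_sub; [apply: pf_mul; apply: pf_var | apply: pf_cst]).
do 2! (case=> [<-|]; first by apply: pf_sub; [apply: pf_mul; apply: pf_fm | apply: pf_cst]).
do 2! (case=> [<-|]; first by apply: pf_sub; [apply: pf_prod => j; apply: pf_fm | apply: pf_cst]).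
case=> [<-|].
  apply: pf_sub => //; apply: pf_mul; last exact: pf_fm.
  by apply: pf_prod => i; apply/pf_exp/pf_horner/pf_add; [apply: pf_var | apply: pf_cst].
case=> [<-|].
  apply: pf_sub; first by apply: pf_sub; [apply/pf_exp/pf_fm | apply: pf_cst].
  by apply: pf_mul => //; apply: pf_add; [apply: pf_var | apply: pf_mul => //; apply: pf_fm].
case=> [<-|//].
apply: pf_sub; first by apply: pf_mul => //; apply: pf_fm.
by apply: pf_mul; apply: pf_sub; try apply: pf_mul; try apply: pf_cst; apply: pf_fm.
Qed.

(** Coefficients range over [A0], whose elements lie in [fld lam] and are therefore fixed by [th]
    and [c]: a conjugate of an encoded element is the same form at a conjugate of [be], and the norm
    conditions become polynomial in the variables. *)
Lemma descent_encode : exists A1, [/\ dio R A1, forall n : nat, A1 n%:R & forall t, A1 t -> A0 t /\ sig t = t].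
Proof.
exists (fun t => exists w : nat -> algC, [/\ forall i, R (w i), w 0%N = t, forall i, (i < 1 + 7 * W)%N -> A0 (w i) &
    forall F, List.In F eqs -> F w = 0]).
have wE F w x y : (forall G, List.In G eqs -> G w = 0) -> List.In F eqs -> F w = x - y -> x = y.
  by move=> h1 h2 e; apply/eqP; rewrite -subr_eq0 -e h1.
split.
- by apply: (dio_sys 0 (1 + 7 * W) dA) => F; apply: pf_eqs.
- move=> n; have [x1 [x2 [u [r [v [s1 [s2 [[W1 W2] [c1 p1] [c2 p2] [Wu Wr Wv Ws1 Ws2] [e1 e2 e3]]]]]]]]] := descent_complete n.
  pose F (a : 'I_7) := nth 0 [:: x1; x2; u; r; v; s1; s2] a.
  have /exists_fun[j /exists_fun[cc ccE]] a : exists j cc, [/\ forall k, exists n : nat, cc k = n%:R,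
    cc (nn.*2) = q%:R ^+ j & F a = form nn (q%:R ^- j) cc be].
    apply: (condr_form q0 DE); rewrite /F; case: a => a; do 7? (case: a => [|a] //=).
  pose w i := if i is i'.+1 then (if (i' < 7 * W)%N then cc (inord (i' %/ W)) (i' %% W)%N
     else q%:R ^- j (inord (i' - 7 * W))) else n%:R.
  have Wpos : (0 < W)%N by [].
  have cfE (a : 'I_7) k : (k < W)%N -> cf w a k = cc a k.
    move=> kW; rewrite /cf add1n addSn /w.
    have -> : (a * W + k < 7 * W)%N.
      by apply: leq_trans (_ : (a.+1 * W <= _)%N); [rewrite mulSn addnC ltn_add2r | rewrite leq_mul2r ltn_ord orbT].
    by rewrite divnMDl // divn_small // addn0 modnMDl modn_small // inord_val.
  have yyE (a : 'I_7) : yy w a = q%:R ^- j a.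
    by rewrite /yy /w add1n addSn ltnNge leq_addr /= addKn inord_val.
  have fmE (a : 'I_7) (z : aut) : z lam = lam -> fm w a (z be) = z (F a).
    move=> zl; have [deg ce ->] := ccE a.
    rewrite (form_aut (y := q%:R ^- j a)) ?fmorphV ?rmorphXn /= ?rmorph_nat //; last first.
      by move=> k _; have [n' ->] := deg k; rewrite rmorph_nat.
    rewrite /fm /form yyE; congr (_ * _); apply: eq_bigr => k _; rewrite !cfE //.
      by rewrite /W ltnS -addnn leq_add2l ltnW.
    by rewrite /W ltnS -addnn (leq_trans (ltnW (ltn_ord k))) // leq_addr.
  have fmB (a : 'I_7) : fm w a be = F a by exact: (fmE a idfun erefl).
  have o (a : nat) (a7 : (a < 7)%N) : fm w a be = F (Ordinal a7) by exact: (fmB (Ordinal a7)).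
  have thX k : autX th k lam = lam by apply: autX_fix.
  exists w; split.
  + case=> [|i]; rewrite /w /=; first exact: Rn.
    case: ifP => _ //; have [h1 _ _] := ccE (inord (i %/ W)); have [n' ->] := h1 (i %% W)%N; exact: Rn.
  + by [].
  + case=> [_|i]; rewrite /w /=; first exact: NA.
    rewrite add1n ltnS => ->; have [h1 _ _] := ccE (inord (i %/ W)); have [n' ->] := h1 (i %% W)%N; exact: NA.
  have eq1 (a : nat) : (a < 7)%N -> cf w a nn.*2 * yy w a - 1 = 0.
    move=> a7; rewrite (cfE (Ordinal a7)) // (yyE (Ordinal a7)); have [_ -> _] := ccE (Ordinal a7).
    by rewrite mulfV ?subrr // expf_neq0 // pnatr_eq0 -lt0n.
  have i0 : (0 < 7)%N by []. have i1 : (1 < 7)%N by [].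
  move=> G; rewrite /eqs /=; do 7! (case=> [<-|]; first exact: eq1).
  case=> [<-|]; first by rewrite (o 0%N i0) (fmE (Ordinal i0) c cl) /F /= c1 subrr.
  case=> [<-|]; first by rewrite (o 1%N i1) (fmE (Ordinal i1) c cl) /F /= c2 subrr.
  case=> [<-|].
    by under eq_bigr => k _ do rewrite (fmE (Ordinal i0) _ (thX k)); rewrite /F /= p1 subrr.
  case=> [<-|].
    by under eq_bigr => k _ do rewrite (fmE (Ordinal i1) _ (thX k)); rewrite /F /= p2 subrr.
  case=> [<-|]; first by rewrite /X !o /F /= e1 subrr.
  case=> [<-|]; first by rewrite /X !o /F /= e2 subrr.
  by case=> [<-|//]; rewrite /X !o /F /= e3 subrr.
move=> t [w [Rw w0 Aw eq]].
have At : A0 t by rewrite -w0; apply: Aw.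
split=> //.
have dy (a : nat) : (a < 7)%N -> cf w a nn.*2 * yy w a = 1.
  move=> a7; apply: (wE (fun w => cf w a nn.*2 * yy w a - 1)) eq _ _ => //.
  rewrite /eqs /=; by do 7? (case: a a7 => [|a] a7; [by repeat (try (by left); right)|]).
have Acf (a : nat) k : (a < 7)%N -> (k < W)%N -> A0 (cf w a k).
  move=> a7 kW; apply: Aw; rewrite add1n addSn ltnS.
  by apply: leq_trans (_ : (a.+1 * W <= _)%N); [rewrite mulSn addnC ltn_add2r | rewrite leq_mul2r a7 orbT].
have Ly (a : nat) : (a < 7)%N -> fld lam (yy w a).
  move=> a7; have lc := Al (Acf a nn.*2 a7 (leqnn _)).
  have c0 : cf w a nn.*2 != 0 by apply/eqP => e; move/eqP: (dy a a7); rewrite e mul0r eq_sym oner_eq0.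
  by rewrite -(mulKf c0 (yy w a)) dy // mulr1; apply: fldV.
have fmE (a : nat) (z : aut) : (a < 7)%N -> z lam = lam -> fm w a (z be) = z (fm w a be).
  move=> a7 zl; rewrite /fm form_aut //; first exact: Ly.
  by move=> k kn; apply: (Al (Acf a k a7 _) zl); rewrite ltnS ltnW.
have Rfm (a : nat) : (a < 7)%N -> RB be Good (fm w a be).
  move=> a7; split.
    apply: fldM; first exact: fld_trans bl (Ly a a7).
    apply: fld_sum => k _; apply: fldM; last exact/fldX/fld_id.
    apply: fldB; apply: fld_trans bl _; apply/Al/Acf => //.
      by rewrite /W ltnS -addnn (leq_trans (ltnW (ltn_ord k))) // leq_addr.
    by rewrite /W ltnS -addnn leq_add2l ltnW.
  move=> M pM g; apply: (locM pM); first exact: Rloc (Rw _) pM g.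
  apply: loc_sum => // k _; apply: locM => //; last by apply: loc_Aint; rewrite ?rpredX.
  by apply: (locB pM); apply: (Rloc (Rw _) pM g).
have U (a : nat) : (a < 7)%N -> fm w a be * fm w a (c be) = 1 -> \prod_(j < p) fm w a (autX th j be) = 1 ->
   inU p be th c Good (fm w a be).
  move=> a7; rewrite fmE // => h1 h2; split=> //; first exact: Rfm.
  by rewrite -[RHS]h2; apply: eq_bigr => j _; rewrite fmE //; apply: autX_fix.
have Ee F x y : List.In F (drop 7 eqs) -> F w = x - y -> x = y.
  by move=> i; apply: wE eq _; do 7! right; exact: i.
rewrite /eqs /= in Ee; rewrite -w0.
apply: (descent_sound (t := w 0%N) (x1 := fm w 0 be) (x2 := fm w 1 be) (u := fm w 2 be) (r := fm w 3 be) (v := fm w 4 be)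
  (s1 := fm w 5 be) (s2 := fm w 6 be)); try exact: Rfm.
- by rewrite w0; apply: Al.
- rewrite w0; split; first exact: fld_trans bl (Al At).
  by move=> M pM g; rewrite -w0; apply: Rloc.
- by apply: U => //; apply: Ee; [left; reflexivity | | do 2! right; left; reflexivity | ].
- by apply: U => //; apply: Ee; [do 1! right; left; reflexivity | | do 3! right; left; reflexivity | ].
- by apply: Ee; [do 4! right; left; reflexivity | ].
- by apply: Ee; [do 5! right; left; reflexivity | ].
- by apply: Ee; [do 6! right; left; reflexivity | ].
Qed.
End Encode.

Lemma shift_prod_int gam m mu n : gam \in Aint -> gam \notin Crat -> exists2 z : int, z != 0 & shift_prod gam m mu n%:R = z%:~R.
Proof.
move=> Ag ig; have [f fE] := Aint_minCpoly Ag.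
exists (\prod_(i < m) f.[n%:Z + (mu * i)%:Z] ^+ 2).
  apply/prodf_neq0 => i _; apply/expf_neq0/negP => /eqP e.
  have r0 : root (minCpoly gam) (n + mu * i)%:R.
    apply/rootP; rewrite fE -[(n + mu * i)%:R]/((n + mu * i)%:Z%:~R : algC).
    by rewrite horner_map /= PoszD e.
  case/conj_aut: r0 => u ue; case/negP: ig.
  by rewrite -(autVK u gam) ue rmorph_nat rpred_nat.
rewrite rmorph_prod; apply: eq_bigr => i _; rewrite rmorphXn /= fE; congr (_ ^+ 2).
by rewrite -horner_map /= rmorphD.
Qed.

Lemma abs_sgn (z : int) : z != 0 -> z%:~R^-1 = (sgz z)%:~R / `|z|%:R :> algC.
Proof.
move=> z0; have zc0 : z%:~R != 0 :> algC by rewrite intr_eq0.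
have -> : `|z|%:R = (sgz z)%:~R * z%:~R :> algC by rewrite -rmorphM /= -abszEsg.
have s0 : (sgz z)%:~R != 0 :> algC by rewrite intr_eq0 sgz_eq0.
by field; rewrite zc0 s0.
Qed.

(** * Completeness of the descent *)

(** Write [m] as a part prime to [l1] times a power of [l1]; the first is invertible modulo [l1],
    the second modulo [l2]. *)
Lemma split_coprime (m l1 l2 : nat) : (0 < m)%N -> prime l1 -> prime l2 -> l1 <> l2 ->
  exists k s1 s2 : int, (m%:Z * k = (1 - l1%:Z * s1) * (1 - l2%:Z * s2))%R.
Proof.
move=> m0 p1 p2 ne; have [m' cm mE] := pfactor_coprime p1 m0.
have c2 : coprime l2 (l1 ^ logn l1 m) by apply: coprimeXr; rewrite prime_coprime // dvdn_prime2 //; apply/eqP => e; apply: ne.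
have bez (a b : nat) : coprime a b -> exists u v : int, b%:Z * u = 1 - a%:Z * v.
  move=> co; have [u [v e]] := Bezoutz a b; exists v, u.
  have : gcdz a b = 1 by rewrite /gcdz /=; move/eqP: co => ->.
  by rewrite -e => <-; ring.
have [k1 [s1 e1]] := bez _ _ cm; have [k2 [s2 e2]] := bez _ _ c2.
exists (k1 * k2), s1, s2; rewrite -e1 -e2 {1}mE PoszM; ring.
Qed.

Section Compl.
Variables (be x0 gam : algC) (th c : aut) (p q e D h m mu l1 l2 : nat).
Hypotheses (Ag : gam \in Aint) (ig : gam \notin Crat).
Hypotheses (q0 : (0 < q)%N) (D0 : (0 < D)%N) (h0 : (0 < h)%N).
Hypotheses (bx0 : fld be x0) (nx0 : x0 != 0) (cx0 : x0 * c x0 = 1) (px0 : \prod_(j < p) autX th j x0 = 1).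
Hypotheses (A1 : q%:R ^+ e * x0 \in Aint) (A2 : q%:R ^+ e / x0 \in Aint).
Hypothesis ntors : forall n, (0 < n)%N -> x0 ^+ n != 1.
Hypotheses (pl1 : prime l1) (pl2 : prime l2) (nl : l1 <> l2).

Lemma descent_complete (n : nat) : exists x1 x2 u r v s1 s2 : algC,
  [/\ condr be q D x1 /\ condr be q D x2, x1 * c x1 = 1 /\ \prod_(j < p) autX th j x1 = 1,
    x2 * c x2 = 1 /\ \prod_(j < p) autX th j x2 = 1,
    [/\ condr be q D u, condr be q D r, condr be q D v, condr be q D s1 & condr be q D s2] &
    [/\ x1 ^+ h - 1 = shift_prod gam m mu n%:R * u, x2 ^+ h - 1 = (x1 ^+ h - 1) * (n%:R + (x1 ^+ h - 1) * r) &
        (x1 ^+ h - 1) * v = (1 - l1%:R * s1) * (1 - l2%:R * s2)]].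
Proof.
have [z z0 zE] := shift_prod_int m mu n Ag ig.
have zc0 : z%:~R != 0 :> algC by rewrite intr_eq0.
have Dc0 : D%:R != 0 :> algC by rewrite pnatr_eq0 -lt0n.
have qc0 j : q%:R ^+ j != 0 :> algC by rewrite expf_neq0 // pnatr_eq0 -lt0n.
have qe0 : (0 < q ^ e)%N by rewrite expn_gt0 q0.
have mz0 : (0 < D * `|z|)%N by rewrite muln_gt0 D0 absz_gt0.
have A1' := A1; have A2' := A2; rewrite -natrX in A1' A2'.
(* A power [x1] of [x0] is 1 modulo [D * z], up to powers of [q]: the factor [z], the value of the
   shift product, gives the quotient [u], and [D] makes it representable by a form. *)
have [N [j [N0 AN]]] := pow_cong1 mz0 qe0 bx0 nx0 A1' A2'.
set x1 := x0 ^+ N in AN.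
have bx1 : fld be x1 by apply: fldX.
pose G := (x1 - 1) / z%:~R.
have WG : condr be q D G.
  have -> : G = D%:R * (G / D%:R) by rewrite mulrC divfK.
  apply: (condr_mulD D (j := (e * j)%N)).
    by apply: fldM; [apply: fldM; [apply: fldB => //; apply: fld1 | apply/fldV/fld_int] | apply/fldV/fld_nat].
  have -> : q%:R ^+ (e * j) * (G / D%:R) = (sgz z)%:~R * ((q ^ e)%:R ^+ j * ((x1 - 1) / (D * `|z|)%:R)).
    have a0 : `|z|%:R != 0 :> algC by rewrite pnatr_eq0 absz_eq0.
    by rewrite /G abs_sgn // natrX exprM natrM; field; rewrite a0 Dc0.
  by rewrite rpredM ?rpred_int.
have W1 : condr be q D x1.
  have -> : x1 = G * z%:~R + 1 by rewrite /G divfK // subrK.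
  by apply: condr_D; [apply: condr_M => //; apply: condr_int | apply: (condr_nat _ _ _ 1)].
pose X1 := x1 ^+ h; have WX1 : condr be q D X1 by apply: condr_X.
have X1n : X1 - 1 != 0 by rewrite subr_eq0 /X1 -exprM; apply: ntors; rewrite muln_gt0 N0.
have upow k : (x0 ^+ k) * c (x0 ^+ k) = 1 /\ \prod_(i < p) autX th i (x0 ^+ k) = 1.
  rewrite rmorphXn -exprMn cx0 expr1n; split=> //.
  have -> : \prod_(i < p) autX th i (x0 ^+ k) = (\prod_(i < p) autX th i x0) ^+ k.
    by rewrite -prodrXl; apply: eq_bigr => i _; rewrite rmorphXn.
  by rewrite px0 expr1n.
have [J AJ] := condr_Aint (condr_B WX1 (condr_nat _ _ _ 1)).
have bX : fld be (X1 - 1) := condr_fld q0 (condr_B WX1 (condr_nat _ _ _ 1)).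
have bqX : fld be (q%:R ^+ J * (X1 - 1)) by apply: fldM => //; apply/fldX/fld_nat.
(* The norm provides an integer multiple of [X1 - 1], to which [split_coprime] applies. *)
have [y' [Ay' by' fE]] := fnorm_dvd AJ bqX.
have /intrP[n0 nE] := fnorm_int AJ bqX.
have n00 : n0 != 0.
  by rewrite -(intr_eq0 algC) -nE fnorm_eq0 mulf_neq0.
have m0 : (0 < D * `|n0|)%N by rewrite muln_gt0 D0 absz_gt0.
have [k [s1 [s2 kE]]] := split_coprime m0 pl1 pl2 nl.
exists x1, (x1 ^+ n), (G * \sum_(i < h) x1 ^+ i), (\sum_(i < n) \sum_(j < i) X1 ^+ j).
exists (D%:R * (q%:R ^+ J * y') * (sgz n0 * k)%:~R), s1%:~R, s2%:~R; split.
- by split=> //; apply: condr_X.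
- exact: upow.
- by rewrite /x1 -exprM; apply: upow.
- split; last exact: condr_int.
  + by apply: condr_M => //; apply: condr_sum => i; apply: condr_X.
  + by apply: (condr_sum n (F := fun i => \sum_(j0 < i) X1 ^+ j0)) => i; apply: (condr_sum i (F := fun i => X1 ^+ i)) => i'; apply: condr_X.
  + apply: condr_M; last exact: condr_int.
    apply: (condr_mulD D (j := 0%N)); first by apply: fldM => //; apply/fldX/fld_nat.
    by rewrite expr0 mul1r rpredM ?rpredX ?rpred_nat.
  + exact: condr_int.
split.
- by rewrite zE mulrA [_ * G]mulrC /G divfK // subrX1.
- have -> : (x1 ^+ n) ^+ h = X1 ^+ n by rewrite /X1 exprAC.
  rewrite -/X1.
  suff :  X1 ^+ n = 1 + n%:R * (X1 - 1) + (X1 - 1) ^+ 2 * \sum_(i < n) \sum_(j < i) X1 ^+ j by move=> ->; ring.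
  clear zE; elim: n => [|i IH]; first by rewrite big_ord0 expr0; ring.
  rewrite big_ord_recr exprS IH /=.
  have sE : (X1 - 1) * \sum_(j < i) X1 ^+ j = X1 ^+ i - 1 by exact: esym (subrX1 _ _).
  set S := \sum_(j < i) _ in sE *; set T := \sum_(i0 < i) _ in IH *.
  have e1 : 1 + i%:R * (X1 - 1) + (X1 - 1) ^+ 2 * T = 1 + (X1 - 1) * S by rewrite sE -IH; ring.
  have -> : 1 + i.+1%:R * (X1 - 1) + (X1 - 1) ^+ 2 * (T + S) =
    (1 + i%:R * (X1 - 1) + (X1 - 1) ^+ 2 * T) + (X1 - 1) + (X1 - 1) ^+ 2 * S by rewrite -natr1; ring.
  rewrite e1; ring.
have cE (a b : int) : a = b -> a%:~R = b%:~R :> algC by move->.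
have := cE _ _ kE; rewrite !rmorphM !rmorphB !rmorphM /= => <-.
have e2 : (X1 - 1) * (q%:R ^+ J * y') = n0%:~R by rewrite -nE fE; ring.
have -> : (X1 - 1) * (D%:R * (q%:R ^+ J * y') * ((sgz n0)%:~R * k%:~R)) =
   (X1 - 1) * (q%:R ^+ J * y') * (sgz n0)%:~R * D%:R * k%:~R by ring.
rewrite e2 -!pmulrn.
have -> : `|n0|%:R = (sgz n0)%:~R * n0%:~R :> algC by rewrite -rmorphM /= -abszEsg.
ring.
Qed.
End Compl.

Section Unit.
Variables (gam lamh : algC) (p : nat).
Hypotheses (pp : prime p) (acong : deg gam = p) (ng : normal gam).
Variables (eps sq be : algC) (th c : aut) (QQ : algC -> Prop) (q : nat) (k : int).
Hypotheses (sqE : sq ^+ 2 = eps) (Ab : be \in Aint) (bg : fld be gam) (bs : fld be sq).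
Hypotheses (thg : th gam <> gam) (cgam : c gam = gam) (cs : c sq = - sq).
Hypotheses (th_stable : fld be (th be)) (c_stable : fld be (c be)).
Hypotheses (comm : th (c be) = c (th be)) (thp : autX th p be = be) (c2 : c (c be) = be).
Hypotheses (pq : prime q) (pQ : prm QQ) (Qq : QQ q%:R).
Hypotheses (Qg : QQ (gam - k%:~R)) (Qe : mloc QQ ((eps - 1) / 4)).
Hypothesis Qsep : forall u v : aut, u gam <> v gam -> ~ QQ (u gam - v gam).

(** Such a [w] would either negate [sq], impossible where [eps] is 1 modulo [4 QQ], or move [gam] to
    another conjugate with the same residue [k]. *)
Lemma not_dec (w : aut) : fld be (w be) -> w sq = - sq \/ w gam <> gam -> ~ dec be QQ w.
Proof.
move=> nw [ws|wg] d; first exact: (eps1_sq sqE bs pQ Qe nw d ws).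
have := (d _ (fldB bg (@fld_int be k))).1 Qg; rewrite /pim rmorphB rmorph_int => h.
have := prmB pQ Qg h.
have -> : gam - k%:~R - (autV w gam - k%:~R) = gam - autV w gam by ring.
apply: (Qsep (u := idfun) (v := autV w)) => /= e; apply: wg.
by rewrite {1}e autKV.
Qed.

(** [x0] is [z / th z] with [z = pi / c pi], where [QQ] induces the only prime of [fld be] dividing
    [pi]. The two norm conditions follow from the relations between [th] and [c]. The three other
    conjugates of [pi] involved are outside [QQ], so [QQ] divides [x0] and no power of [x0] is 1. *)
Lemma unit_ex : exists x0 e, [/\ fld be x0 /\ x0 != 0, x0 * c x0 = 1, \prod_(j < p) autX th j x0 = 1,
  q%:R ^+ e * x0 \in Aint /\ q%:R ^+ e / x0 \in Aint & forall n, (0 < n)%N -> x0 ^+ n != 1].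
Proof.
have [pi [Api bpi Qpi pisame]] := prime_power_generator Ab pq pQ Qq.
have nV (w : aut) : fld be (w be) -> (w sq = - sq \/ w gam <> gam) -> ~ QQ (w pi).
  move=> nw h; rewrite -pimV => hQ.
  have s := pisame _ (prm_pim (autV w) pQ) hQ.
  apply: (not_dec (w := autV w)); [exact: nrm_V | | exact/sameon_sym].
  case: h => h; [left | right].
    by apply: (fmorph_inj w); rewrite autKV rmorphN h opprK.
  by move=> e; apply: h; rewrite -{1}e autKV.
have nthc : fld be (autM th c be) by exact: (nrm_fld th_stable c_stable).
have h1 : ~ QQ (c pi) by apply: nV => //; left.
have h2 : ~ QQ (th pi) by apply: nV => //; right.
have h3 : ~ QQ (th (c pi)) by apply: (nV (autM th c)) => //; right; rewrite autME cgam.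
have pi0 : pi != 0 by apply/eqP => e; apply: h1; rewrite e rmorph0; apply: prm0.
have nz (w : aut) : w pi != 0 by rewrite fmorph_eq0.
have n1 := nz c; have n2 := nz th; have n3 := nz (autM th c); rewrite autME in n3.
have [K AK] : exists K, q%:R ^+ K / pi \in Aint.
  have [y [Ay by_ yE]] := fnorm_dvd Api bpi.
  have /intrP[z zE] := fnorm_int Api bpi.
  have z0 : z != 0 by rewrite -(intr_eq0 algC) -zE fnorm_eq0.
  have az0 : (0 < `|z|)%N by rewrite absz_gt0.
  have [K KE] := prm_nil pQ az0 Qq.
  exists K; apply: Aint_loc => M pM; case: (boolp.EM (M pi)) => [Mpi|nM]; last first.
    by apply: locM => //; [apply/locX/loc_nat | apply: loc_unit; [exact: loc_Aint | move/(mloc_Aint pM Api)]].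
  have s := pisame _ pM Mpi.
  have bK : fld be (q%:R ^+ K / pi) by apply: fldM; [apply/fldX/fld_nat | apply: fldV].
  apply/(sameon_loc pM pQ s bK).1.
  have -> : q%:R ^+ K / pi = q%:R ^+ K / `|z|%:R * ((sgz z)%:~R * y).
    have zc0 : z%:~R != 0 :> algC by rewrite intr_eq0.
    have y0 : y != 0 by apply: contra zc0 => /eqP y0; rewrite -zE yE y0 mulr0.
    have -> : pi^-1 = y * z%:~R^-1 by rewrite -zE yE invfM mulrCA mulfV // mulr1.
    by rewrite abs_sgn //; ring.
  by apply: locM => //; [apply/mloc_loc/KE | apply: loc_Aint; rewrite ?rpredM ?rpred_int].
have Ac (w : aut) : q%:R ^+ K / w pi \in Aint.
  by have := Aint_aut w; rewrite -(Aint_aut w) rmorphM fmorphV rmorphXn rmorph_nat in AK.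
pose z := pi / c pi.
pose x0 := z / th z.
have x0E : x0 = pi * th (c pi) / (c pi * th pi).
  by rewrite /x0 /z rmorphM fmorphV; field; rewrite n1 n2 n3.
have bz : fld be z by apply: fldM => //; apply/fldV/nrm_fld.
have z0 : z != 0 by rewrite mulf_neq0 ?invr_neq0.
exists x0, (K + K)%N; split.
- split; first by apply: fldM => //; apply/fldV/nrm_fld.
  by rewrite mulf_neq0 ?invr_neq0 ?fmorph_eq0.
- have cc : c (c pi) = pi by apply: (fldE (u := autM c c) (v := idfun) bpi c2).
  have ct : c (th pi) = th (c pi) by apply/esym/(fldE (u := autM th c) (v := autM c th) bpi comm).
  have ctc : c (th (c pi)) = th pi.
    by have := fldE (u := autM th c) (v := autM c th) (nrm_fld c_stable bpi) comm; rewrite !autME cc => <-.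
  rewrite x0E rmorphM fmorphV !rmorphM cc ct ctc; field; rewrite n1 n2 n3 pi0 //.
- have tz : \prod_(j < p) autX th j (th z^-1 / z^-1) = 1.
    rewrite telescope_aut ?invr_neq0 // (fldE (u := autX th p) (v := idfun) (fldV bz) thp) /= divff //.
    exact: invr_neq0.
  by rewrite -[RHS]tz; apply: eq_bigr => j _; congr (autX _ _ _); rewrite fmorphV invrK mulrC.
- rewrite x0E exprD; split.
    have -> : q%:R ^+ K * q%:R ^+ K * (pi * th (c pi) / (c pi * th pi)) =
      (q%:R ^+ K / c pi) * (q%:R ^+ K / th pi) * (pi * th (c pi)) by rewrite invfM; ring.
    by apply: rpredM; apply: rpredM; rewrite ?Ac ?Aint_aut.
  have -> : q%:R ^+ K * q%:R ^+ K / (pi * th (c pi) / (c pi * th pi)) =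
      (q%:R ^+ K / pi) * (q%:R ^+ K / th (c pi)) * (c pi * th pi) by rewrite invf_div invfM; ring.
  by apply: rpredM; apply: rpredM; rewrite ?(Ac (autM th c)) ?Aint_aut.
have mx : mloc QQ x0.
  have lu y : y \in Aint -> ~ QQ y -> loc QQ y^-1.
    by move=> Ay ny; apply: loc_unit => //; [exact: loc_Aint | move/(mloc_Aint pQ Ay)].
  rewrite x0E invfM -!mulrA; apply: mlocMr => //; first exact: mloc_M.
  by apply: locM => //; [apply: loc_Aint | apply: locM => //; apply: lu]; rewrite ?Aint_aut.
move=> n n0; apply/eqP => e; apply: (mloc1 pQ); rewrite -e -(prednK n0) exprS.
by apply: mlocMr => //; apply/locX/mloc_loc.
Qed.
End Unit.

(** * One descent *)

Lemma dec_comm a M (u w : aut) : fld a (u a) -> fld a (w a) -> u (w a) = w (u a) -> dec a M w -> dec a (pim u M) w.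
Proof.
move=> nu nw uw d x ax; rewrite {1}/pim (d _ (nrm_fldV nu ax)) /pim.
suff -> : autV w (autV u x) = autV u (autV w x) by [].
have ax' := nrm_fldV nu (nrm_fldV nw ax).
apply: (fmorph_inj w); rewrite autKV; apply: (fmorph_inj u); rewrite autKV.
have := fldE (u := autM u w) (v := autM w u) ax' uw; rewrite !autME => ->.
by rewrite !autKV.
Qed.

Lemma autX_comm1 (u : aut) k x : u (autX u k x) = autX u k (u x).
Proof. by rewrite !autXE -iterS -iterSr. Qed.

(** The group generated by [sig] is abelian, so all primes above one prime of [fld phi] have the
    same decomposition group. *)
Lemma dec_same lam phi (sig : aut) l M M' : (0 < l)%N -> fld lam (sig lam) -> autX sig l lam = lam ->
  (forall x, fld phi x <-> fld lam x /\ sig x = x) -> prm M -> prm M' -> sameon phi M M' ->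
  dec lam M sig -> dec lam M' sig.
Proof.
move=> l0 ns sl phiE pM pM' s d; have [v [vp sv]] := prm_trans lam pM pM' s.
have [j vj] := conj_cyc l0 ns sl phiE vp.
have nv : fld lam (v lam) by rewrite vj; apply: nrm_X.
have d' : dec lam (pim v M) sig.
  apply: dec_comm => //; rewrite vj autX_comm1; exact: (fldE (u := v) (v := autX sig j) ns vj).
move=> x lx; refine (iff_trans (sv x lx) (iff_trans (d' x lx) _)).
exact: iff_sym (sv (autV sig x) (nrm_fldV ns lx)).
Qed.

Lemma pim_pim (u v : aut) M : pim u (pim v M) = pim (autM u v) M.
Proof.
apply: boolp.funext => x; rewrite /pim; congr (M _); apply: (fmorph_inj (autM u v)).
by rewrite autKV autME !autKV.
Qed.
Lemma pim_id M : pim idfun M = M.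
Proof. by apply: boolp.funext => x; rewrite /pim; congr (M _); exact: (autVK idfun x). Qed.

(** A large multiple of [4 * b * eta] keeps the congruences at the primes above [b] and gives [eps]
    the signs of [eta]. *)
Lemma eps_shift lam (sig : aut) eta eps0 b : fld lam eps0 -> sig eps0 = eps0 -> fld lam eta -> (0 < b)%N ->
  (forall g : aut, ((forall x, fld lam x -> g x \is Num.real) /\ g eta < 0) \/
    ((forall x, fld lam x -> (g x)^* = g (sig x)) /\ 0 < g eta)) ->
  exists N : nat, let eps := eps0 + (4 * b * N)%:R * eta in forall g : aut,
   ((forall x, fld lam x -> g x \is Num.real) /\ g eps < 0) \/
    ((forall x, fld lam x -> (g x)^* = g (sig x)) /\ 0 < g eps).
Proof.
move=> le se leta b0 arch.
have [N NE] := bounds (fun i : 'I_(deg lam) => emb i (eps0 / eta)).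
have eta0 : eta != 0.
  by apply/eqP => e; case: (arch idfun) => -[_]; rewrite e /= ltxx.
exists N.+1 => /= g; set eps := _ + _.
have lq : fld lam (eps0 / eta) by apply: fldM => //; apply: fldV.
have gE : g eps = g eta * (g (eps0 / eta) + (4 * b * N.+1)%:R).
  have h : g eta != 0 by rewrite fmorph_eq0.
  by rewrite rmorphD rmorphM rmorph_nat fmorph_div; field.
have bd : `|g (eps0 / eta)| < (4 * b * N.+1)%:R.
  have [i iE] := emb_surj lam g; rewrite (fldE lq iE); apply: le_lt_trans (NE i) _.
  by rewrite ltr_nat; apply: leq_pmull; rewrite muln_gt0 b0.
have pos : g eps0 \is Num.real -> g eta \is Num.real -> 0 < g (eps0 / eta) + (4 * b * N.+1)%:R.
  move=> r1 r2; have r : g (eps0 / eta) \is Num.real by rewrite fmorph_div rpredM ?rpredV.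
  by move: bd; rewrite real_ltr_norml // => /andP[h _]; rewrite -ltrBlDr sub0r.
case: (arch g) => [[r h]|[r h]]; [left | right]; split=> //; rewrite gE.
  by rewrite nmulr_rlt0 //; apply: pos; apply: r.
rewrite mulr_gt0 //; apply: pos; last exact: gtr0_real.
by apply/CrealP; rewrite r // se.
Qed.

Section StepF.
Variables (gam om lamh : algC) (p : nat).
Hypotheses (pp : prime p) (op : odd p) (Ag : gam \in Aint) (acong : deg gam = p) (ng : normal gam).
Hypotheses (rg : forall u : aut, u gam \is Num.real).
Hypotheses (nl : normal lamh) (lom : fld lamh om).
Hypothesis EXP : forall u : aut, exists e, [/\ (0 < e)%N, ~~ (p %| e)%N & autX u e lamh = lamh].
Variables (XG : subsetA -> Prop) (sx : seq subsetA) (w : algC) (bs : nat).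
Hypotheses (wo : fld w om) (wg : fld w gam).
Hypothesis XGs : forall P, XG P -> ~ List.In P sx -> not_split (fld om) (fld w) P.
Hypothesis (sb : forall b, (bs %| b)%N -> forall P, XG P -> List.In P sx -> P b%:R).
Variables (lam phi eta : algC) (sig : aut) (l : nat).
Hypotheses (lh : fld lamh lam) (Al : lam \in Aint) (ns : fld lam (sig lam)) (pl : prime l) (sl : autX sig l lam = lam).
Hypothesis sigm : sig lam <> lam.
Hypothesis phiE : forall x, fld phi x <-> fld lam x /\ sig x = x.
Hypotheses (Aeta : eta \in Aint) (feta : fld phi eta).
Hypothesis arch : forall g : aut, ((forall x, fld lam x -> g x \is Num.real) /\ g eta < 0) \/
    ((forall x, fld lam x -> (g x)^* = g (sig x)) /\ 0 < g eta).

(** [sig] is lifted to [s1] on the field generated by [lam] and [gam], with [s1 gam = gam]; as [gam]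
    lies in the fixed field of [s1], [decomp_prime] gives it an integer residue. *)
Lemma descent_prime y0 : exists q QQ (k : int), [/\ prime q, (y0 < q)%N, prm QQ, QQ q%:R &
  dec lam QQ sig /\ QQ (gam - k%:~R)].
Proof.
have [a2 [b1 b2 b3 b4 b5]] := primitive_element_aut [:: lam; gam].
have [th0 [t1 t2]] := ex_moving_aut pp acong ng EXP.
have [j jE] := T_gen pp acong ng sig t2.
have fixX k x : fld lam x -> autX th0 k x = x by move=> lx; apply/autX_fix/(fld_trans lh lx).
pose s1 := autM (autX th0 (p.-1 * j)) sig.
have s1lam : s1 lam = sig lam by rewrite /s1 autME fixX.
have s1gam : s1 gam = gam.
  rewrite /s1 autME jE -autX_add -mulSnr prednK ?prime_gt0 // mulnC autX_mul.
  by apply: autX_fix; apply: T_pow pp acong ng th0.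
have al : fld a2 lam by apply: b1; rewrite !inE eqxx.
have ag : fld a2 gam by apply: b1; rewrite !inE eqxx orbT.
have na2 : fld a2 (s1 a2).
  apply: (b4 (fun x => fld a2 (s1 x))).
    split.
    - by rewrite rmorph0; apply: fld0.
    - by rewrite rmorph1; apply: fld1.
    - by move=> x y; rewrite rmorphB; apply: fldB.
    - by move=> x y; rewrite rmorphM; apply: fldM.
    - by move=> x; rewrite fmorphV; apply: fldV.
  move=> x; rewrite !inE => /orP[] /eqP -> //; last by rewrite s1gam.
  by rewrite s1lam; apply: fld_trans al ns.
have Xlam k : autX s1 k lam = autX sig k lam.
  by elim: k => //= k ->; apply: (fldE (u := s1) (v := sig) (nrm_X k ns) s1lam).
have sl2 : autX s1 l a2 = a2.
  apply: (b2 (autX s1 l) idfun) => x; rewrite !inE => /orP[] /eqP -> /=; first by rewrite Xlam.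
  exact: autX_fix.
have [a1 [[a1f a1s] a1E]] : exists b, (fld a2 b /\ s1 b = b) /\ forall x, fld a2 x /\ s1 x = x <-> fld b x.
  apply: (subfield_fld (F := fun x => fld a2 x /\ s1 x = x) (a := a2)); last by move=> x [].
  split.
  - by split; [apply: fld0 | apply: rmorph0].
  - by split; [apply: fld1 | apply: rmorph1].
  - by move=> x y [hx ex] [hy ey]; split; [apply: fldB | rewrite rmorphB ex ey].
  - by move=> x y [hx ex] [hy ey]; split; [apply: fldM | rewrite rmorphM ex ey].
  - by move=> x [hx ex]; split; [apply: fldV | rewrite fmorphV ex].
have [d d0 Ad] := Aint_denom a1.
have dn0 : d%:R != 0 :> algC by rewrite pnatr_eq0 -lt0n.
have A2 : a2 \in Aint by apply: b5 => x; rewrite !inE => /orP[] /eqP ->.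
have a1E' x : fld (d%:R * a1) x <-> fld a2 x /\ s1 x = x.
  rewrite a1E; split=> h; apply: fld_trans h.
    by apply: fldM; [apply: fld_nat | apply: fld_id].
  rewrite -[X in fld _ X](mulKf dn0 a1); apply: fldM; [apply/fldV/fld_nat | exact: fld_id].
have [|q [QQ [k [pq yq pQ Qq [d2 Qg]]]]] := decomp_prime A2 Ad na2 pl sl2 a1E' (g := gam) y0 _ Ag; first exact/a1E'.
exists q, QQ, k; split=> //; split=> //.
apply: dec_ext (dec_sub al d2) => //; by rewrite s1lam.
Qed.

(** Otherwise [sq] lies in [fld lam]. It cannot be real when [eps < 0], and when conjugation acts as
    [sig] with [eps > 0], [sq] is fixed by [sig], so [eps] is a square in [fld phi]. *)
Lemma ex_moving_sqrt eps sq : fld phi eps -> sq ^+ 2 = eps ->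
  (forall g : aut, ((forall x, fld lam x -> g x \is Num.real) /\ g eps < 0) \/
    ((forall x, fld lam x -> (g x)^* = g (sig x)) /\ 0 < g eps)) ->
  (forall n, fld phi n -> eps * n ^+ 2 != 1) ->
  exists u : aut, [/\ u lam = lam, u gam = gam & u sq <> sq].
Proof.
move=> feps sqE ar nsq; apply: boolp.contrapT => no.
have [th0 [t1 t2]] := ex_moving_aut pp acong ng EXP.
have [le se] := (phiE eps).1 feps.
have fixth x : fld lam x -> th0 x = x by move=> lx; apply: (fld_trans lh lx).
pose th := autM th0 th0.
have thl : th lam = lam by rewrite /th autME !fixth //; apply: fld_id.
have thsq : th sq = sq by apply: sq_pm2; apply: (sq_pm sqE); apply: fixth.
have thg : th gam <> gam.
  apply: (@T_move_pow gam p pp acong ng th0 2) => //.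
  by rewrite dvdn_prime2 //; apply: contraL op => /eqP ->.
have lsq : fld lam sq.
  move=> v vl; have [j jE] := T_gen pp acong ng v thg.
  have : (autM (autV (autX th j)) v) sq = sq.
    apply: boolp.contrapT => h; apply: no; exists (autM (autV (autX th j)) v); split=> //.
      by rewrite autME vl; apply: (fmorph_inj (autX th j)); rewrite autKV; apply/esym/autX_fix.
    by rewrite autME jE autVK.
  by rewrite autME => /(congr1 (autX th j)); rewrite autKV => ->; apply: autX_fix.
have sq0 : sq != 0.
  by apply/eqP => e; move: (nsq 0 (@fld0 _)) (ar idfun); rewrite -sqE e expr0n /= ltxx => _ [[]|[]].
case: (ar idfun) => -[/= r h]; rewrite -sqE in h.
  have := sqr_lt0_conj h; have /CrealP -> := r sq lsq.
  move/eqP; rewrite -subr_eq0 opprK -mulr2n mulrn_eq0 /= => e; by rewrite e in sq0.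
have := sqr_gt0_conj h; rewrite (r _ lsq) => ss.
have := nsq sq^-1 (fldV ((phiE sq).2 (conj lsq ss))).
by rewrite -sqE -exprMn mulfV // expr1n eqxx.
Qed.

(** A prime outside [b] where [gam] has an integer residue is not inert: an automorphism [th] fixing
    it would give another conjugate of [gam] the same residue. *)
Lemma good_prime b (Good : (algC -> Prop) -> Prop) y0 : (0 < b)%N ->
  (forall M, prm M -> ~ M b%:R -> inert gam lamh M \/ Good M) ->
  (forall M, prm M -> ~ M b%:R -> forall u v : aut, u gam <> v gam -> ~ M (u gam - v gam)) ->
  exists l1, [/\ prime l1, (y0 < l1)%N & exists M, [/\ prm M, Good M & M l1%:R]].
Proof.
move=> b0 ig sep; have [l1 [M [r [pl1 yl pM Ml Mr]]]] := deg1_prime (b + y0) Ag.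
have nb : ~ M b%:R.
  by move/(prm_natE pM b pl1 Ml) => /(dvdn_leq b0); rewrite leqNgt (leq_ltn_trans (leq_addr y0 b)).
exists l1; split=> //; first exact: leq_ltn_trans (leq_addl b y0) yl.
exists M; split=> //; case: (ig M pM nb) => // i; case: (i gam ng) => th [_ thg d].
have := (d _ (fldB (@fld_id gam) (@fld_nat gam r))).1 Mr; rewrite /pim rmorphB rmorph_nat => h.
have := prmB pM Mr h.
have -> : gam - r%:R - (autV th gam - r%:R) = gam - autV th gam by ring.
case/(sep M pM nb idfun (autV th)) => /= e; apply: thg; by rewrite {1}e autKV.
Qed.

Lemma descent_step : exists2 b1 : nat, (0 < b1)%N & forall b, (0 < b)%N -> (b1 %| b)%N -> (bs %| b)%N ->
  forall A0, dio (OFW (fld om) (NN om XG b)) A0 -> (forall n : nat, A0 n%:R) -> (forall x, A0 x -> fld lam x) ->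
  exists A1, [/\ dio (OFW (fld om) (NN om XG b)) A1, forall n : nat, A1 n%:R & forall t, A1 t -> A0 t /\ sig t = t].
Proof.
have [Dg Dg0 sepg] := sep_aut Ag; have [Dl Dl0 sepl] := sep_aut Al.
have [q [QQ [k [pq yq pQ Qq [dQ Qg]]]]] := descent_prime Dg.
have [q2 [M2 [r [pq2 yq2 pM2 Mq2 Mr2]]]] := deg1_prime Dl Al.
have nbig M q' D : prime q' -> prm M -> M q'%:R -> (0 < D)%N -> (D < q')%N -> ~ M D%:R.
  move=> pq' pM Mq D0 Dq /(prm_natE pM D pq' Mq) /(dvdn_leq D0); by rewrite leqNgt Dq.
have nd2 : ~ dec lam M2 sig.
  move=> d; have := (d _ (fldB (@fld_id lam) (@fld_nat lam r))).1 Mr2; rewrite /pim rmorphB rmorph_nat => h.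
  have := prmB pM2 Mr2 h.
  have -> : lam - r%:R - (autV sig lam - r%:R) = lam - autV sig lam by ring.
  case/(sepl M2 pM2 (nbig _ _ _ pq2 pM2 Mq2 Dl0 yq2) idfun (autV sig)) => /= e; apply: sigm.
  by rewrite {1}e autKV.
(* At [q] there is a prime fixed by [sig], from which the non-torsion [x0] is built; at [q2] one
   that is not, which keeps [eps] from being a square in [fld phi]; outside [Dg] the conjugates of
   [gam] stay distinct. *)
exists (q * q2 * Dg)%N; first by rewrite !muln_gt0 Dg0 !prime_gt0.
move=> b b0 b1b bsb A0 dA NA Alam.
have qb : (q %| b)%N by apply: dvdn_trans b1b; rewrite -mulnA dvdn_mulr.
have q2b : (q2 %| b)%N by apply: dvdn_trans b1b; rewrite mulnAC dvdn_mull.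
have Dgb : (Dg %| b)%N by apply: dvdn_trans b1b; rewrite dvdn_mull.
have inb M n : prm M -> M n%:R -> (n %| b)%N -> M b%:R.
  by move=> pM Mn /dvdnP[x ->]; rewrite natrM; apply: (prmZ pM) => //; apply: rpred_nat.
have Sc : forall M M', prm M -> prm M' -> sameon phi M M' -> dec lam M sig -> dec lam M' sig.
  by move=> M M'; apply: dec_same (prime_gt0 pl) ns sl phiE.
have [eps0 [Ae0 fe0 re0]] := rule_ex Sc b0.
have [le0 se0] := (phiE _).1 fe0; have [leta seta] := (phiE _).1 feta.
have [N ar] := eps_shift le0 se0 leta b0 arch.
set eps := _ + _ in ar; rewrite /= in ar.
have Aeps : eps \in Aint by rewrite rpredD ?rpredM ?rpred_nat.
have feps : fld phi eps by apply: fldD => //; apply: fldM => //; apply: fld_nat.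
have re M : prm M -> M b%:R -> rule phi (fun M => dec lam M sig) M eps.
  move=> pM Mb; apply: (rule_shift pM Ae0 Aeps) (re0 M pM Mb).
  have -> : (eps0 - eps) / 4 = b%:R * (- (N%:R * eta)) by rewrite /eps !natrM; field.
  by apply: mlocMr => //; [apply: mloc_M | apply: loc_Aint; rewrite ?rpredN ?rpredM ?rpred_nat].
pose sq := sqrtC eps; have sqE : sq ^+ 2 = eps by apply: sqrtCK.
have csq : exists u : aut, [/\ u lam = lam, u gam = gam & u sq <> sq].
  apply: (ex_moving_sqrt feps sqE ar) => n fn; apply/eqP => e.
  have [_ /(_ nd2)[_ /(_ n fn)]] := re M2 pM2 (inb _ _ pM2 Mq2 q2b).
  by rewrite e subrr mul0r; apply; apply: mloc0.
have [be [th [c [s [[bl bg bsq bgen] [bA bstab] [thl thg ths] [cl cgam cs] [sl1 sgam ss]]]]]] :=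
  step_auts pp op Ag acong ng EXP lh ns phiE Aeps feps sqE csq.
have Ab := bA Al.
pose Good M := forall g : aut, ~ NN om XG b (trace om (pim g M)).
have GoodP (g : aut) M : Good M -> Good (pim g M) by move=> h g'; rewrite pim_pim.
have ig M : prm M -> ~ M b%:R -> inert gam lamh M \/ Good M.
  exact: (inert_or pp acong ng nl lom EXP wo wg XGs (sb bsb)).
have sepT M : prm M -> ~ M b%:R -> forall u v : aut, u gam <> v gam -> ~ M (u gam - v gam).
  by move=> pM nb; apply: sepg => // h; apply/nb/(inb _ _ pM h).
have decb M : prm M -> M b%:R -> [\/ dec be M th, dec be M c | dec be M s].
  move=> pM Mb; exact: (rule_dec pp op acong ng EXP lh ns pl sl sigm phiE Aeps feps sqE bl bg bsq bgen bstab
    thl thg ths cl cgam cs sl1 sgam ss pM (re M pM Mb)).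
have [h h0 hU] := U_fix pp op acong ng rg lh ns pl sl phiE feps sqE bl bg bsq bgen bstab thl thg ths cl cgam cs
  sl1 sgam ss ar GoodP ig decb.
have [l1 [pl1 _ g1]] := good_prime 0 b0 ig sepT.
have [l2 [pl2 l12 g2]] := good_prime l1 b0 ig sepT.
have nel : l1 <> l2 by move=> e; move: l12; rewrite e ltnn.
have [I [Ms [pMs covMs]]] := fin_primes be b0.
have [C CE] := bounds (fun i : 'I_(deg gam) => emb i gam).
pose m := ((#|I| + deg be) * 2 * p).+1.
(* [mu] is 1 modulo [b] and beats the size bounds of [descent_sound]. *)
pose mu := (8 * (m`! ^ p) ^ 2 * C.+1 * b).+1.
have mu_big : exists C : nat, (forall (g : aut) z, z \in conjs gam -> `|g z| <= C%:R) /\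
  (8 * (m`! ^ p) ^ 2 * C.+1 < mu)%N.
  exists C; split=> [g z zr|]; last by rewrite ltnS leq_pmulr.
  have /conj_aut[u <-] : root (minCpoly gam) z by rewrite -mem_conjs.
  by have [i iE] := emb_surj gam (autM g u); rewrite -autME iE.
have bmu : (b %| mu.-1)%N by rewrite dvdn_mull.
have nth' := th_stable phiE feps sqE bl bsq bstab thl; have nc' := c_stable phiE feps sqE bl bsq bstab cl.
have Qe : mloc QQ ((eps - 1) / 4).
  by have [/(_ dQ)] := re QQ pQ (inb _ _ pQ Qq qb).
have Qsep : forall u v : aut, u gam <> v gam -> ~ QQ (u gam - v gam).
  by apply: (sepg QQ pQ); exact: (nbig _ _ _ pq pQ Qq Dg0 yq).
have [x0 [e [[bx0 nx0] cx0 px0 [A1 A2] nt]]] := unit_ex sqE Ab bg bsq thg cgam cs nth' nc'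
  (comm_th_c ng bgen thl ths cl cgam cs) (th_pow pp acong ng bgen thl ths) (c_invol bgen cl cgam cs) pq pQ Qq Qg Qe Qsep.
have [D D0 DE] := int_coord be.
refine (@descent_encode _ _ gam be lam th c sig p h m mu l1 l2 D q Good dA NA Alam
  (@R_nat om XG b) (@R_M om XG b) (prime_gt0 pq) (R_natV om XG qb) _ bl Ab thl cl DE _ _).
- move=> x M Rx pM g; apply: (R_loc pM _ Rx); have := g idfun; by rewrite pim_id.
- move=> t x1 x2 u r' v s1 s2 lt Rt U1 U2 Ru Rr Rs1 Rs2 e1 e2 e3.
  exact: (descent_sound pp op Ag acong ng lh ns phiE feps sqE bl bg bsq bgen bstab thl thg ths sl1 GoodP ig sepT pMs covMs
    bmu _ _ mu_big lt Rt U1 U2 hU Ru Rr Rs1 Rs2 e1 e2 e3 g1 g2).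
- exact: (descent_complete (e := e) m mu Ag (T_irr pp acong) (prime_gt0 pq) D0 h0 bx0 nx0 cx0 px0 A1 A2 nt pl1 pl2 nel).
Qed.
End StepF.

(** * The chain of descents *)

Lemma Aint_gen a : exists2 a', a' \in Aint & forall x, fld a' x <-> fld a x.
Proof.
have [d d0 Ad] := Aint_denom a; have dn0 : d%:R != 0 :> algC by rewrite pnatr_eq0 -lt0n.
exists (d%:R * a) => // x; split=> h; apply: fld_trans h.
  by apply: fldM; [apply: fld_nat | apply: fld_id].
by rewrite -[X in fld _ X](mulKf dn0 a); apply: fldM; [apply/fldV/fld_nat | exact: fld_id].
Qed.

Lemma fixed_gen a (u : aut) : exists b, forall x, fld b x <-> fld a x /\ u x = x.
Proof.
have [||b [_ bE]] := @subfield_fld (fun x => fld a x /\ u x = x) a; last 1 first.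
- by exists b => x; apply: iff_sym.
- split.
  + by split; [apply: fld0 | apply: rmorph0].
  + by split; [apply: fld1 | apply: rmorph1].
  + by move=> x y [hx ex] [hy ey]; split; [apply: fldB | rewrite rmorphB ex ey].
  + by move=> x y [hx ex] [hy ey]; split; [apply: fldM | rewrite rmorphM ex ey].
  + by move=> x [hx ex]; split; [apply: fldV | rewrite fmorphV ex].
by move=> x [].
Qed.

Lemma autX_conj (u g : aut) n x : autX (autM (autV g) (autM u g)) n x = autV g (autX u n (g x)).
Proof. by elim: n => [|n IH] /=; rewrite ?autVK // IH autKV. Qed.

(** The elements of prime order generate a nontrivial normal subgroup, so they cannot all fix [k]. *)
Lemma prime_order_moves k lam : (forall g : aut, fld lam (g k)) -> normal lam ->
  (forall u v : aut, (forall g : aut, u (g k) = v (g k)) -> u lam = v lam) -> (exists u : aut, u k <> k) ->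
  exists (sig : aut) l, [/\ prime l, autX sig l lam = lam & sig k <> k].
Proof.
move=> lk nl lE [u uk]; have [o [o0 _ oE]] := free_order u nl.
have o1 : (1 < o)%N.
  rewrite ltn_neqAle o0 andbT; apply/eqP => o1; apply: uk; have h : u lam = lam by apply/(oE 1%N); rewrite -o1.
  exact: (lk idfun u h).
pose l := pdiv o; have pl : prime l by apply: pdiv_prime.
have lo : (l %| o)%N by apply: pdiv_dvd.
pose v := autX u (o %/ l).
have vl : autX v l lam = lam by rewrite /v -autX_mul mulnC divnK //; apply/oE.
have [g gk] : exists g : aut, v (g k) <> g k.
  apply: boolp.contrapT => no; have vlam : v lam = lam.
    by apply: (lE v idfun) => g /=; apply: boolp.contrapT => h; apply: no; exists g.
  have q0 : (0 < o %/ l)%N by rewrite divn_gt0 ?prime_gt0 // dvdn_leq.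
  by move/oE: vlam => /(dvdn_leq q0); rewrite leqNgt ltn_Pdiv // prime_gt1.
exists (autM (autV g) (autM v g)), l; split=> //.
  by rewrite autX_conj (fldE (u := autX v l) (v := idfun) (nl g) vl) /= autVK.
by rewrite !autME => e; apply: gk; rewrite -{2}e autKV.
Qed.

Section Chain.
Variables (gam om lamh : algC) (p : nat).
Hypotheses (pp : prime p) (op : odd p) (Ag : gam \in Aint) (acong : deg gam = p) (ng : normal gam).
Hypotheses (rg : forall u : aut, u gam \is Num.real).
Hypotheses (nl : normal lamh) (lom : fld lamh om).
Hypothesis EXP : forall u : aut, exists e, [/\ (0 < e)%N, ~~ (p %| e)%N & autX u e lamh = lamh].
Variables (XG : subsetA -> Prop) (sx : seq subsetA) (w : algC) (bs : nat).
Hypotheses (wo : fld w om) (wg : fld w gam).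
Hypothesis XGs : forall P, XG P -> ~ List.In P sx -> not_split (fld om) (fld w) P.
Hypothesis (sb : forall b, (bs %| b)%N -> forall P, XG P -> List.In P sx -> P b%:R).

(** The number [b1] is found before [b], so a single [b], hence a single ring, can serve all
    descents of the chain. *)
Definition descends (F F' : subsetA) := exists2 b1 : nat, (0 < b1)%N & forall b, (0 < b)%N -> (b1 %| b)%N -> (bs %| b)%N ->
  forall A0, dio (OFW (fld om) (NN om XG b)) A0 -> (forall n : nat, A0 n%:R) -> (forall x, A0 x -> F x) ->
  exists A1, [/\ dio (OFW (fld om) (NN om XG b)) A1, forall n : nat, A1 n%:R & forall t, A1 t -> F' t].

Lemma descends_trans F F' F'' : descends F F' -> descends F' F'' -> descends F F''.
Proof.
case=> b1 b10 h1 [b2 b20 h2]; exists (b1 * b2)%N; first by rewrite muln_gt0 b10.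
move=> b b0 hb bsb A dA NA AF; have [||||||A1 [d1 n1 f1]] := h1 b _ _ _ A => //; first exact: dvdn_trans (dvdn_mulr _ _) hb.
by apply: h2 d1 n1 f1 => //; apply: dvdn_trans (dvdn_mull _ _) hb.
Qed.

Lemma descends_real k : (forall (u : aut) x, fld k x -> u x \is Num.real) -> fld lamh k -> descends (fld k) QQ.
Proof.
have [n] := ubnP (deg k); elim: n k => // n IH k0 ltn rk0 lk0.
have [k Ak kE] := Aint_gen k0.
have rk (u : aut) x : fld k x -> u x \is Num.real by move/kE; apply: rk0.
have lk : fld lamh k by apply: fld_trans lk0 ((kE _).1 (@fld_id k)).
case: (boolp.EM (exists u : aut, u k <> k)) => [mv|nmv]; last first.
  have fk (u : aut) : u k = k by apply: boolp.contrapT => h; apply: nmv; exists u.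
  exists 1%N => // b _ _ _ A dA NA Ak0; exists A; split=> // t /Ak0/kE kt; apply: fixQ => u; exact: kt.
have [lam [nlam lamk lamE lammin lamA]] := normal_closure k.
have lkg (g : aut) : fld lam (g k) by apply: fld_trans (nlam g) _; apply: fld_aut.
have [sig [l [pl sl sk]]] := prime_order_moves lkg nlam lamE mv.
have sm : sig lam <> lam by move=> e; apply: sk; apply: lamk.
have [phi phiE] := fixed_gen lam sig.
have rl (g : aut) x : fld lam x -> g x \is Num.real.
  move=> lx; apply/CrealP; apply: (fldE (u := autM Num.conj g) (v := g) lx).
  by apply: lamE => g'; apply/CrealP/(rk (autM g g'))/fld_id.
have lamhl : fld lamh lam by apply: lammin => g; apply: fld_trans (nl g) _; apply: fld_aut.
have st := descent_step pp op Ag acong ng rg nl lom EXP wo wg XGs sb (phi := phi) (eta := -1)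
  lamhl (lamA Ak) (nlam sig) pl sl sm phiE.
have [|||b1 b10 b1E] := st.
- by rewrite rpredN rpred1.
- by apply: fldN; apply: fld1.
- by move=> g; left; split=> [x|]; [exact: rl | rewrite rmorphN rmorph1 ltrN10].
have [k1 k1E] := fixed_gen k sig.
have [kk1 sk1] := (k1E k1).1 (@fld_id k1).
have d2 : descends (fld k1) QQ.
  apply: IH => [|u x h|]; last exact: fld_trans lk kk1.
    have ck : deg k = deg k0.
      by apply/eqP; rewrite eqn_leq !deg_mono //; [apply/kE/fld_id | apply/kE/fld_id].
    rewrite -ltnS (leq_trans _ ltn) // ltnS -ck ltn_neqAle deg_mono // andbT.
    by apply/eqP => e; apply: sk; apply: (deg_eq kk1 e).
  by apply: rk; apply: fld_trans kk1 h.
apply: descends_trans d2; exists b1 => // b b0 h1 h2 A dA NA Ak0.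
have [|A1 [d1 n1 f1]] := b1E b b0 h1 h2 A dA NA; first by move=> x /Ak0/kE; apply: fld_trans.
by exists A1; split=> // t /f1[/Ak0/kE kt e]; apply/k1E.
Qed.

(** Here [sig] is the nontrivial automorphism of [fld om] over [fld k] and [eta = - v ^ 2]: where
    [v ^ 2 > 0] the larger field is real and [eta < 0]; where [v ^ 2 < 0] conjugation acts as [sig]
    and [eta > 0]. *)
Lemma descends_quad k : om \in Aint -> (forall x, fld k x -> fld om x) -> dimOver (fld k) (fld om) 2 ->
  (forall (u : aut) x, fld k x -> u x \is Num.real) -> descends (fld om) (fld k).
Proof.
move=> Ao ko dim rk.
have [v0 [ov0 nkv0 kv0 span0]] := quad_ext (is_subfield_fld k) (is_subfield_fld om) ko dim.
have [d d0 Av] := Aint_denom v0; have dn0 : d%:R != 0 :> algC by rewrite pnatr_eq0 -lt0n.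
set v := d%:R * v0 in Av.
have v0E : v0 = d%:R^-1 * v by rewrite mulKf.
have ov : fld om v by apply: fldM => //; apply: fld_nat.
have nkv : ~ fld k v by move=> h; apply: nkv0; rewrite v0E; apply: fldM => //; apply/fldV/fld_nat.
have kv : fld k (v ^+ 2) by rewrite exprMn; apply: fldM => //; apply/fldX/fld_nat.
have span x : fld om x -> exists a c, [/\ fld k a, fld k c & x = a + c * v].
  case/span0 => a [c [ka kc ->]]; exists a, (c * d%:R^-1); split=> //; last by rewrite -mulrA -v0E.
  by apply: fldM => //; apply/fldV/fld_nat.
clearbody v; have [sig [sk sv]] : exists u : aut, u k = k /\ u v <> v.
  apply: boolp.contrapT => no; apply: nkv => u uk; apply: boolp.contrapT => h; by apply: no; exists u.
have sv' : sig v = - v.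
  have : (sig v) ^+ 2 = v ^+ 2 by rewrite -rmorphXn; apply: kv.
  by move/eqP; rewrite eqf_sqr => /orP[] /eqP.
have sE a c : fld k a -> fld k c -> sig (a + c * v) = a - c * v.
  by move=> ka kc; rewrite rmorphD rmorphM sv' (ka _ sk) (kc _ sk) mulrN.
have v0' : v != 0 by apply/eqP => e; apply: sv; rewrite e rmorph0.
have [a [c [ka kc oE]]] := span om (@fld_id om).
have ns : fld om (sig om).
  by rewrite [X in sig X]oE sE //; apply: fldB; [apply: ko | apply: fldM => //; apply: ko].
have sl : autX sig 2 om = om by rewrite /= oE sE // rmorphB rmorphM sv' (ka _ sk) (kc _ sk) mulrN opprK.
have sm : sig om <> om by move=> e; apply: sv; apply: ov.
have kE x : fld k x <-> fld om x /\ sig x = x.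
  split=> [kx|[/span[a' [c' [ka' kc' ->]]]]]; first by split; [apply: ko | apply: kx].
  rewrite sE // => /(addrI a')/eqP; rewrite -subr_eq0 -opprD oppr_eq0 -mulr2n mulrn_eq0 /= mulf_eq0 (negbTE v0') orbF.
  by move=> /eqP ->; rewrite mul0r addr0.
have st := descent_step pp op Ag acong ng rg nl lom EXP wo wg XGs sb (eta := - v ^+ 2) lom Ao ns (isT : prime 2) sl sm kE.
have [|||b1 b10 b1E] := st.
- by rewrite rpredN rpredX.
- exact: fldN.
- move=> g; have rgv := rk g _ kv; rewrite rmorphN rmorphXn oppr_lt0 oppr_gt0.
  have gv0 : g v != 0 by rewrite fmorph_eq0.
  rewrite rmorphXn in rgv.
  have /orP[h|h] : (0 < (g v) ^+ 2) || ((g v) ^+ 2 < 0).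
    by rewrite orbC -real_neqr_lt ?real0 // expf_neq0.
    left; split=> // x /span[a' [c' [ka' kc' ->]]]; rewrite rmorphD rmorphM.
    by apply: rpredD; [|apply: rpredM]; try exact: rk; apply/CrealP/sqr_gt0_conj.
  right; split=> // x /span[a' [c' [ka' kc' ->]]]; rewrite sE // rmorphB [g (_ + _)]rmorphD !rmorphM rmorphD rmorphM /=.
  have cj y : fld k y -> (g y)^* = g y by move=> ky; apply/CrealP/rk.
  by rewrite (cj a') // (cj c') // (sqr_lt0_conj h) mulrN.
exists b1 => // b b0 h1 h2 A dA NA Ak0.
have [A1 [d1 n1 f1]] := b1E b b0 h1 h2 A dA NA Ak0.
by exists A1; split=> // t /f1[/Ak0 kt e]; apply/kE.
Qed.
End Chain.

Lemma exceptional_nat (om : algC) (XG : subsetA -> Prop) (s : seq subsetA) : (forall P, XG P -> prime_of (fld om) P) ->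
  exists2 bs : nat, (0 < bs)%N & forall b, (bs %| b)%N -> forall P, XG P -> List.In P s -> P b%:R.
Proof.
move=> XGp; elim: s => [|Q s [bs bs0 IH]]; first by exists 1%N.
case: (boolp.EM (XG Q)) => [XQ|nX]; last first.
  by exists bs => // b hb P XP [e|]; [case: nX; rewrite e | apply: IH].
have [n n0 Qn] := prime_has_nat (XGp Q XQ); exists (n * bs)%N; first by rewrite muln_gt0 n0.
move=> b hb P XP [<-|]; last by apply: IH => //; apply: dvdn_trans hb; apply: dvdn_mull.
have /dvdnP[k ->] : (n %| b)%N by apply: dvdn_trans hb; apply: dvdn_mulr.
have [[_ _ _ PZ] _] := XGp Q XQ; rewrite natrM; apply: PZ => //.
by split; [apply: fld_nat | apply: rpred_nat].
Qed.

(** A rational element of [R] is a difference of naturals over a natural denominator, and by Bezout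
    the inverse of that denominator lies in [R]. The set [A] supplies the naturals; its other
    members are rational too, so quotients remain rational. *)
Lemma rat_dio om XG b A : dio (OFW (fld om) (NN om XG b)) A -> (forall n : nat, A n%:R) -> (forall t, A t -> t \in Crat) ->
  dio (OFW (fld om) (NN om XG b)) (fun t => OFW (fld om) (NN om XG b) t /\ t \in Crat).
Proof.
move=> dA NA AQ; set R := OFW _ _ in dA *.
pose Fs : seq ((nat -> algC) -> algC) := [:: (fun w => w 0%N * w 3%N - (w 1%N - w 2%N)); (fun w => w 3%N * w 4%N - 1)].
have pf F : List.In F Fs -> pfun F.
  case=> [<-|[<-|//]]; first by apply: pf_sub; [apply: pf_mul; apply: pf_var | apply: pf_sub; apply: pf_var].
  by apply: pf_sub; [apply: pf_mul; apply: pf_var | apply: pf_cst].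
apply: dio_ext (dio_sys 1 3 dA pf) => t; split=> [[e [Re e0 Ae eq]]|[Rt /CratP[r tE]]].
  rewrite -e0; split=> //.
  have /eqP e2 := eq _ (or_intror (or_introl erefl)); have /eqP e1 := eq _ (or_introl erefl).
  rewrite subr_eq0 in e2; rewrite subr_eq0 in e1.
  have n3 : e 3%N != 0 by apply/eqP => z; move: e2; rewrite z mul0r eq_sym oner_eq0.
  rewrite -(mulfK n3 (e 0%N)) (eqP e1).
  by rewrite rpredM ?rpredV ?rpredB //; apply: AQ; [apply: (Ae 0%N) | apply: (Ae 1%N) | apply: (Ae 2%N)].
have [u [v uv]] := Bezoutz (numq r) (denq r).
have g1 : gcdz (numq r) (denq r) = 1.
  by rewrite /gcdz; have := coprime_num_den r; rewrite /coprime => /eqP ->.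
have d0 : (denq r)%:~R != 0 :> algC by rewrite intr_eq0 denq_neq0.
have tE' : t * (denq r)%:~R = (numq r)%:~R by rewrite tE /ratr divfK.
have Rint (z : int) : R z%:~R by apply: R_int; [apply: fld_int | apply: rpred_int].
have Rd : R (denq r)%:~R^-1.
  have -> : (denq r)%:~R^-1 = u%:~R * t - (- v)%:~R :> algC.
    apply: (mulIf d0); rewrite mulVf // mulrBl -mulrA tE' rmorphN mulNr opprK -!rmorphM -rmorphD /=.
    by rewrite uv g1.
  exact: R_B (R_M (Rint u) Rt) (Rint (- v)).
have [dn dE] : exists dn : nat, (denq r)%:~R = dn%:R :> algC.
  by exists `|denq r|%N; rewrite -{1}(absz_denq r).
have [n1 [n2 nE]] : exists n1 n2 : nat, (numq r)%:~R = n1%:R - n2%:R :> algC.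
  by case: (numq r) => n; [exists n, 0%N; rewrite subr0 | exists 0%N, n.+1; rewrite sub0r NegzE rmorphN].
exists (fun i => nth 0 [:: t; n1%:R; n2%:R; dn%:R; (denq r)%:~R^-1] i); split=> //.
- by case=> [|[|[|[|[|i]]]]] //=; rewrite ?nth_nil; try exact: R_nat; apply: (R_nat om XG b 0).
- by case=> [|[|[|]]] //= _; apply: NA.
move=> F [<-|[<-|//]] /=; first by rewrite -dE tE' nE subrr.
by rewrite -dE mulfV // subrr.
Qed.

Theorem theorem8p3 (K G T : subsetA) (p : nat) (XG : subsetA -> Prop) :
  number_field K -> totally_real K ->
  number_field G -> (forall x, K x -> G x) -> dimOver K G 2 ->
  number_field T -> totally_real T -> cyclic_over_Q T ->
  prime p -> odd p -> dimOver QQ T p ->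
  (exists d, dimOver QQ (galois_closure K) d /\ ~~ (p %| d)%N) ->
  (forall P, XG P -> prime_of G P) ->
  (exists s : seq subsetA, forall P, XG P -> ~ List.In P s ->
       not_split G (compositum G (compositum K T)) P) ->
  exists NG : subsetA -> Prop,
    [/\ (forall P, NG P -> prime_of G P),
        (forall P, XG P -> NG P),
        finite_diff NG XG &
        diophantine_over (OFW G NG) (fun x => x \in Crat)].
Proof.
move=> nfK rK nfG KG dKG nfT rT [nT _] pp op dT gc XGp [sx XGs].
have genE F : number_field F -> exists2 a, a \in Aint & F = fld a.
  case/number_field_fld => a [_ aE]; have [a' Aa' a'E] := Aint_gen a; exists a' => //.
  by apply: boolp.funext => x; apply: boolp.propext; rewrite aE a'E.
have [om Ao GE] := genE G nfG; have [k Ak KE] := genE K nfK; have [gam Ag TE] := genE T nfT.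
subst G K T.
have acong : deg gam = p by apply/esym/(@dim_deg (fld gam) gam).
have ng : normal gam by move=> u; apply: nT; apply: fld_id.
have rg (u : aut) : u gam \is Num.real by apply: rT; apply: fld_id.
have [lamh [nl lo EXP]] := ext_exponent_prime_to (is_subfield_fld k) KG dKG gc pp op.
have lom : fld lamh om := lo idfun.
have [w [w1 _ _ w4 _]] := primitive_element_aut [:: om; gam].
have wo : fld w om by apply: w1; rewrite !inE eqxx.
have wg : fld w gam by apply: w1; rewrite !inE eqxx orbT.
have wE : compositum (fld om) (compositum (fld k) (fld gam)) = fld w.
  apply: boolp.funext => x; apply: boolp.propext; split=> [|wx F sF hF].
    apply=> [|y [oy|]]; [exact: is_subfield_fld | exact: fld_trans wo oy |].
    apply=> [|z [kz|gz]]; [exact: is_subfield_fld | exact: fld_trans wo (KG _ kz) | exact: fld_trans wg gz].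
  apply: (fld_min sF _ wx); apply: w4 => // y; rewrite !inE => /orP[] /eqP ->; apply: hF; first by left; apply: fld_id.
  by right=> F' sF' hF'; apply: hF'; right; apply: fld_id.
rewrite wE in XGs.
have [bs bs0 sb] := exceptional_nat sx XGp.
have lk : fld lamh k by apply: fld_trans lom (KG _ (@fld_id k)).
have dq := descends_quad pp op Ag acong ng rg nl lom EXP wo wg XGs sb Ao KG dKG rK.
have dr := descends_real pp op Ag acong ng rg nl lom EXP wo wg XGs sb rK lk.
have [b1 b10 bE] := descends_trans dq dr.
pose b := (b1 * bs)%N; have b0 : (0 < b)%N by rewrite muln_gt0 b10.
pose R := OFW (fld om) (NN om XG b).
have h1 : (b1 %| b)%N by apply: dvdn_mulr.
have h2 : (bs %| b)%N by apply: dvdn_mull.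
(* The chain of descents starts from [R] itself. *)
have [||A [dA NA AQ]] := bE b b0 h1 h2 R (dio_self R); [exact: R_nat | by move=> x [] |].
exists (NN om XG b); split.
- exact: NN_prime.
- by left.
- have [s sE] := prime_ext om b0; exists s => P [//|[pP Pb]] _; exact: sE.
have [||n [f [Rf fE]]] := diophantine_over_dio (R := R) (om := om) _ _ (rat_dio dA NA AQ); [by move=> x [] | by move=> x; apply: R_int |].
exists n, f; split=> // t Rt; rewrite -(fE t Rt); by split=> [tQ|[]//]; split.
Qed.
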